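(* Let $M=\begin{pmatrix}a&b\\c&d\end{pmatrix}\in\mathrm{SL}_2(\mathbb Z)$ with $c>0$ and let $\tau\in\mathbb H$. Then for $j\in\{0,1,2\}$, \[u_j\!\left(\tfrac{a\tau+b}{c\tau+d}\right)=(c\tau+d)\sum_{\ell=0}^2\Psi_M(j,\ell)\,\mathcal I_{\ell,-\frac dc}(\tau),\] where \[\mathcal I_{\ell,-\frac dc}(\tau)=\frac1{\pi i}\sum^*_{n\in\mathbb Z+\beta_\ell}d_\ell(n)e^{-\frac{2\pi idn}{c}}\,\mathrm{PV}\!\int_0^\infty\frac{e^{2\pi i(\tau+\frac dc)t}}{t-n}dt.\]
   Context: $q=e^{2\pi i\tau}$, $Q(\mathbf n)=12n_1^2-2n_2^2$, $B(\mathbf n,\mathbf m)=24n_1m_1-4n_2m_2$. Sets: $\mathcal S_0^+=\{(\tfrac7{24},0),(\tfrac{17}{24},0),(\tfrac{11}{24},\tfrac12),(\tfrac{13}{24},\tfrac12)\}$, $\mathcal S_0^-=\{(\tfrac1{24},0),(\tfrac{23}{24},0),(\tfrac5{24},\tfrac12),(\tfrac{19}{24},\tfrac12)\}$, $\mathcal S_1^+=\{(\tfrac{11}{24},0),(\tfrac{13}{24},0),(\tfrac7{24},\tfrac12),(\tfrac{17}{24},\tfrac12)\}$, $\mathcal S_1^-=\{(\tfrac5{24},0),(\tfrac{19}{24},0),(\tfrac1{24},\tfrac12),(\tfrac{23}{24},\tfrac12)\}$, $\mathcal S_2^+=\{(\tfrac5{12},\tfrac14),(\tfrac7{12},\tfrac14),(\tfrac5{12},\tfrac34),(\tfrac7{12},\tfrac34)\}$,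 $\mathcal S_2^-=\{(\tfrac1{12},\tfrac14),(\tfrac{11}{12},\tfrac14),(\tfrac1{12},\tfrac34),(\tfrac{11}{12},\tfrac34)\}$; $\beta_0=\tfrac1{48},\beta_1=\tfrac{25}{48},\beta_2=\tfrac{23}{24}$. For $\boldsymbol\mu\in\mathcal S_j^\pm$, $n\in\mathbb Z+\beta_j$: $a_{\boldsymbol\mu}(n)=\tfrac12\sum_{\mathbf m\in\mathbb Z^2+\boldsymbol\mu,Q(\mathbf m)=n}(1+\operatorname{sgn}(2m_1+m_2)\operatorname{sgn}(2m_1-m_2))$ for $n>0$ and $a_{\boldsymbol\mu}(n)=\tfrac12\sum_{\mathbf m\in\mathbb Z^2+\boldsymbol\mu,Q(\mathbf m)=n}(1-\operatorname{sgn}(3m_1+m_2)\operatorname{sgn}(3m_1-m_2))$ for $n<0$; $d_j(n)=\tfrac12(\sum_{\mathcal S_j^+}a_{\boldsymbol\mu}(n)-\sum_{\mathcal S_j^-}a_{\boldsymbol\mu}(n))$; $u_j(\tau)=\sum_{n\in\mathbb Z+\beta_j,n>0}d_j(n)q^n$. Multiplier: for $c\ne0$ and $24\mu_1,4\mu_2,24\nu_1,4\nu_2\in\mathbb Z$, $\psi_M(\boldsymbol\mu,\boldsymbol\nu)=\frac{1}{4\sqrt6|c|}\sum_{\mathbf m\in\mathbb Z^2/c\mathbb Z^2}e^{\frac{2\pi i}{c}(aQ(\mathbf m+\boldsymbol\mu)-B(\mathbf m+\boldsymbol\mu,\boldsymbol\nu)+dQ(\boldsymbol\nu))}$, and $\Psi_M(j,\ell)=\sum_{\boldsymbol\mu\in\mathcal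 S_j^+}\psi_M(\boldsymbol\mu,\boldsymbol\nu)-\sum_{\boldsymbol\mu\in\mathcal S_j^-}\psi_M(\boldsymbol\mu,\boldsymbol\nu)$ with $\boldsymbol\nu\in\mathcal S_\ell^+$. $\sum^*_{n\in S}=\lim_{X\to\infty}\sum_{n\in S,|n|\le X}$; $\mathrm{PV}$ is the principal value at $t=n$. *)

(* Defs.v *)
From HB Require Import structures.
From mathcomp Require Import all_boot all_order all_algebra.
From mathcomp Require Import all_classical all_reals all_analysis.
From mathcomp Require Import complex.

Set Implicit Arguments.
Unset Strict Implicit.
Unset Printing Implicit Defensive.

Import Order.TTheory GRing.Theory Num.Theory.
Import numFieldNormedType.Exports.

Local Open Scope classical_set_scope.
Local Open Scope ring_scope.
Local Open Scope complex_scope.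

Section ComplexAnalysis.
Variable R : realType.
(* The regular module [R[i]^o] carries the topology of the norm of [R[i]]. *)
Local Notation C := (R[i]^o).

Definition cexp (z : C) : C :=
  (expR (complex.Re z))%:C * (cos (complex.Im z) +i* sin (complex.Im z)).

Definition e2pi (z : C) : C := cexp ((2 * pi)%:C * 'i%C * z).

Definition cintegrable (D : set R) (f : R -> C) : Prop :=
  (@lebesgue_measure R).-integrable D (fun t => (complex.Re (f t))%:E) /\
  (@lebesgue_measure R).-integrable D (fun t => (complex.Im (f t))%:E).

Definition cintegral (D : set R) (f : R -> C) : C :=
  Rintegral (@lebesgue_measure R) D (fun t => complex.Re (f t)) +i*
  Rintegral (@lebesgue_measure R) D (fun t => complex.Im (f t)).

(* [0, oo) with the open interval (n - eps, n + eps) removed; it is all of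
   [0, oo) when n < 0 and eps is small. *)
Definition pv_domain (n eps : R) : set R :=
  [set t | 0 <= t /\ eps <= `|t - n|].

Definition pv_int (f : R -> C) (n : R) : C :=
  lim (cintegral (pv_domain n eps) f @[eps --> 0^'+]).

Definition pv_exists (f : R -> C) (n : R) : Prop :=
  (forall eps, 0 < eps -> cintegrable (pv_domain n eps) f) /\
  cvg (cintegral (pv_domain n eps) f @[eps --> 0^'+]).

Definition trunc_sum (S : set R) (f : R -> C) (X : R) : C :=
  \sum_(n \in S `&` [set n | `|n| <= X]) f n.

Definition star_sum (S : set R) (f : R -> C) : C :=
  lim (trunc_sum S f X @[X --> +oo%R]).

Definition star_summable (S : set R) (f : R -> C) : Prop :=
  cvg (trunc_sum S f X @[X --> +oo%R]).

End ComplexAnalysis.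

Section Coefficients.
Variable R : realType.
Local Notation C := (R[i]^o).

Definition Q (n : R * R) : R := 12 * n.1 ^+ 2 - 2 * n.2 ^+ 2.

Definition B (n m : R * R) : R := 24 * n.1 * m.1 - 4 * n.2 * m.2.

Definition Splus (j : 'I_3) : seq (R * R) :=
  match val j with
  | 0%N => [:: (7 / 24, 0); (17 / 24, 0); (11 / 24, 1 / 2); (13 / 24, 1 / 2)]
  | 1%N => [:: (11 / 24, 0); (13 / 24, 0); (7 / 24, 1 / 2); (17 / 24, 1 / 2)]
  | _ => [:: (5 / 12, 1 / 4); (7 / 12, 1 / 4); (5 / 12, 3 / 4); (7 / 12, 3 / 4)]
  end.

Definition Sminus (j : 'I_3) : seq (R * R) :=
  match val j with
  | 0%N => [:: (1 / 24, 0); (23 / 24, 0); (5 / 24, 1 / 2); (19 / 24, 1 / 2)]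
  | 1%N => [:: (5 / 24, 0); (19 / 24, 0); (1 / 24, 1 / 2); (23 / 24, 1 / 2)]
  | _ => [:: (1 / 12, 1 / 4); (11 / 12, 1 / 4); (1 / 12, 3 / 4); (11 / 12, 3 / 4)]
  end.

Definition beta (j : 'I_3) : R :=
  match val j with
  | 0%N => 1 / 48
  | 1%N => 25 / 48
  | _ => 23 / 24
  end.

Definition Zcoset (b : R) : set R := [set k%:~R + b | k in [set: int]].

Definition Z2coset (mu : R * R) : set (R * R) :=
  [set m | Zcoset mu.1 m.1 /\ Zcoset mu.2 m.2].

(* Q is indefinite, so Q(m) = n may have infinitely many solutions, but only
   finitely many have a nonzero summand: 4 m1^2 <= n for those with n > 0, and
   6 m1^2 <= - n for those with n < 0.  The value n = 0 is never used, because
   0 does not belong to Z + beta_j. *)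
Definition a_mu (mu : R * R) (n : R) : R :=
  if 0 < n then
    2^-1 * \sum_(m \in Z2coset mu `&` [set m | Q m = n])
      (1 + Num.sg (2 * m.1 + m.2) * Num.sg (2 * m.1 - m.2))
  else
    2^-1 * \sum_(m \in Z2coset mu `&` [set m | Q m = n])
      (1 - Num.sg (3 * m.1 + m.2) * Num.sg (3 * m.1 - m.2)).

Definition dcoef (j : 'I_3) (n : R) : R :=
  2^-1 * (\sum_(mu <- Splus j) a_mu mu n - \sum_(mu <- Sminus j) a_mu mu n).

Definition pos_index (j : 'I_3) : set R := Zcoset (beta j) `&` [set n | 0 < n].

Definition u_term (j : 'I_3) (tau : C) (n : R) : C :=
  (dcoef j n)%:C * e2pi (n%:C * tau).

Definition u (j : 'I_3) (tau : C) : C :=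
  star_sum (pos_index j) (u_term j tau).

(* The summand depends only on the class of (k1, k2) modulo c, so the
   representatives 0 <= k1, k2 < |c| are used. *)
Definition psi (M : 'M[int]_2) (mu nu : R * R) : C :=
  let a : R := (M 0 0)%:~R in
  let c : R := (M 1 0)%:~R in
  let d : R := (M 1 1)%:~R in
  ((4 * Num.sqrt 6 * `|c|)^-1)%:C *
  \sum_(k1 < absz (M 1 0)) \sum_(k2 < absz (M 1 0))
    let m : R * R := (k1%:R + mu.1, k2%:R + mu.2) in
    e2pi ((c^-1 * (a * Q m - B m nu + d * Q nu))%:C).

(* Psi_M(j, l) is [Psi M j nu] for any nu in S_l^+. *)
Definition Psi (M : 'M[int]_2) (j : 'I_3) (nu : R * R) : C :=
  \sum_(mu <- Splus j) psi M mu nu - \sum_(mu <- Sminus j) psi M mu nu.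

Definition I_kernel (x : R) (tau : C) (n t : R) : C :=
  e2pi ((tau - x%:C) * t%:C) / (t - n)%:C.

Definition I_term (l : 'I_3) (x : R) (tau : C) (n : R) : C :=
  (dcoef l n)%:C * e2pi ((x * n)%:C) * pv_int (I_kernel x tau n) n.

Definition calI (l : 'I_3) (x : R) (tau : C) : C :=
  (pi%:C * 'i%C)^-1 * star_sum (Zcoset (beta l)) (I_term l x tau).

(* Since [lim] is total, convergence of u and calI is stated separately. *)
Definition u_converges (j : 'I_3) (tau : C) : Prop :=
  star_summable (pos_index j) (u_term j tau).

Definition calI_converges (l : 'I_3) (x : R) (tau : C) : Prop :=
  (forall n, Zcoset (beta l) n -> pv_exists (I_kernel x tau n) n) /\
  star_summable (Zcoset (beta l)) (I_term l x tau).

End Coefficients.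

(* Main.v *)
From HB Require Import structures.
Require Import Defs.
From mathcomp Require Import finmap.
From mathcomp Require Import all_boot all_order all_algebra.
From mathcomp Require Import all_classical all_reals all_analysis.
From mathcomp Require Import measurable_realfun complex ring lra zify.

Set Implicit Arguments.
Unset Strict Implicit.
Unset Printing Implicit Defensive.

Import Order.TTheory GRing.Theory Num.Theory.
Import numFieldNormedType.Exports.

Local Open Scope classical_set_scope.
Local Open Scope ring_scope.

(* Write points of the cosets as m = (X/24, Y/4) with integers X, Y, so that Q(m) = (X^2 - 6 Y^2)/48, and let
   f_l be the sign function of S_l^+ and S_l^-. The weights defining a_mu sum to 1 over each orbit of the
   automorph eps (X, Y) = (5X + 12Y, 2X + 5Y); hence a sum weighted by [om] over the lattice is a sum over
   orbits, and integrating a theta series of the majorant p_t^2 + r_t^2 (p_t^2 - r_t^2 = Q) over a period of t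
   unfolds to integrals over the whole hyperbola.

   Apply the two-dimensional theta inversion, obtained from Polya's proof of the one-dimensional one, to
   exp(- kap ((p - c q/2)^2 + r^2)) summed over residue classes, multiply by E(q) = |q| exp(- l q^2) and
   integrate in q, where l = pi i / (2 (tau + d/c)). As kap tends to infinity the left side tends to
   the sum of f_j e(a n/c) exp(- 2 pi i n / (c^2 (tau + d/c))), which is u_j(M tau). On the right, E is replaced
   by its cosine transform, a derivative of Dawson's function, and the coefficients by Gauss sums, which are
   combinations of f_l e(- d n/c) with coefficients Psi_M(j, l): both sides have the same symmetries, among
   them X -> u X with u^2 = 1 modulo 48 c and u = 7 modulo 24, which changes the sign of every f_l.

   The limit on the right is only conditionally convergent. The same sign change makes the coefficients sum to
   zero along each row X mod 48 c, so summation by parts along rows gives bounds that are uniform in the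
   regularisation and that hold as well for the truncation |n| <= T; the two limits therefore agree. Finally
   the integral of Delta(n cosh^2 t) (or of Delta(|n| sinh^2 t) for n < 0) is the principal value integral:
   both satisfy h' = - sigma h - 1/n, and they are matched at infinity and across n = 0. *)

(** The choice [E q = |q| exp (- l q^2)] is forced by the limit on the left. As the Gaussian
    sharpens, the q-integral and the integral along the hyperbola p^2 - r^2 = n > 0 together produce
    a multiple of [E (2 sqrt n / c) / sqrt n]. The factor |q| cancels the root, and l = pi^2 / s
    with s = - 2 pi i (tau + d/c) turns the exponent into that of the transformed point. For n < 0
    one has r^2 >= |n| on the hyperbola, so these terms die and only positive n survive. The
    obstacle on the right is a dual kernel of size only 1/|n|, against a number of lattice points
    with |n| <= T in the cone that grows like T. Absolute bounds fail, so each estimate carries a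
    nonincreasing majorant controlling variation as well as size. Such a pair survives
    multiplication by any nonincreasing nonnegative weight; the Gaussian damping and the sharp
    cut-off are both of this kind. Complex kernels enter through real parts with a free complex
    factor u, so that real integration theory suffices; u = 1 and u = -i recover real and imaginary
    part. *)

HB.structure Definition PCount := {T of Countable T & isPointed T}.
HB.instance Definition _ := isPointed.Build int 0.
HB.instance Definition _ (A B : PCount.type) :=
  isPointed.Build (A * B)%type (point, point).

(** A copy of the type, so that the discrete sigma-algebra cannot clash with another structure on
    it. Every function on it is measurable, and sums are integrals against counting measure, to
    which the convergence theorems of integration apply. *)
Definition disc (T : Type) : Type := T.
HB.instance Definition _ (T : PCount.type) := Countable.on (disc T).
HB.instance Definition _ (T : PCount.type) := isPointed.Build (disc T) (@point T).
HB.instance Definition _ (T : PCount.type) :=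
  @isMeasurable.Build default_measure_display
  (disc T) discrete_measurable discrete_measurable0
  discrete_measurableC discrete_measurableU.

Lemma mem_pmap_unpickle (T : countType) n (x : T) :
  (pickle x < n)%N -> x \in pmap (@unpickle T) (iota 0 n).
Proof.
move=> xn; rewrite mem_pmap; apply/mapP; exists (pickle x).
  by rewrite mem_iota.
by rewrite pickleK.
Qed.

Lemma sigma_finite_counting_disc (R : realType) (T : PCount.type) :
  sigma_finite [set: disc T] (@counting (disc T) R).
Proof.
exists (fun n => [set x : disc T | (pickle (x : T) <= n)%N]).
  by apply/seteqP; split=> // x _; exists (pickle (x : T)) => //=.
move=> k; split => //.
have fk : finite_set [set x : disc T | (pickle (x : T) <= k)%N].
  apply: (@sub_finite_set T _
    [set x : T | x \in pmap (@unpickle T) (iota 0 k.+1)]); last exact: finite_seq.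
  by move=> x /= xk; have := @mem_pmap_unpickle T k.+1 x xk; apply.
by rewrite /counting/= asboolT// ltry.
Qed.
HB.instance Definition _ (R : realType) (T : PCount.type) :=
  @isSigmaFinite.Build _ (disc T) R (@counting (disc T) R)
    (sigma_finite_counting_disc R T).

Lemma measurable_disc (T : PCount.type) (A : set (disc T)) : measurable A.
Proof. by []. Qed.

Lemma measurable_fun_disc (T : PCount.type) d (U : sigmaRingType d)
  (D : set (disc T)) (f : disc T -> U) : measurable_fun D f.
Proof. by move=> _ Y _; exact: measurable_disc. Qed.

(** * Absolutely convergent sums over countable types *)

Section tsum.
Variable R : realType.
Implicit Types T U : PCount.type.

Definition tsum T (f : T -> R) : R :=
  (\int[@counting (disc T) R]_(x in [set: disc T]) f x)%R.

Definition tsummable T (f : T -> R) : Prop :=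
  (@counting (disc T) R).-integrable [set: disc T] (fun x => (f x)%:E).

Lemma eq_tsum T (f g : T -> R) : f =1 g -> tsum f = tsum g.
Proof. by move=> fg; apply: eq_Rintegral => x _; exact: fg. Qed.

Lemma tsummable_le T (f g : T -> R) :
  (forall x, `|f x| <= g x) -> tsummable g -> tsummable f.
Proof.
move=> fg sg; apply: le_integrable sg => //.
by move=> x _ /=; rewrite !lee_fin; exact: le_trans (fg x) (ler_norm _).
Qed.

Lemma eq_tsummable T (f g : T -> R) : f =1 g -> tsummable f -> tsummable g.
Proof. by move=> /funext ->. Qed.

Lemma tsummable_norm T (f : T -> R) : tsummable f -> tsummable (fun x => `|f x|).
Proof. by move=> sf; exact: (@integrable_abse _ _ _ _ _ _ sf). Qed.

Lemma tsummableD T (f g : T -> R) :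
  tsummable f -> tsummable g -> tsummable (fun x => f x + g x).
Proof.
move=> sf sg; have := integrableD (measurable_disc _) sf sg.
by apply: eq_integrable.
Qed.

Lemma tsumD T (f g : T -> R) : tsummable f -> tsummable g ->
  tsum (fun x => f x + g x) = tsum f + tsum g.
Proof. by move=> sf sg; rewrite /tsum RintegralD. Qed.

Lemma tsummableZ T (f : T -> R) a : tsummable f -> tsummable (fun x => a * f x).
Proof.
move=> sf; have := integrableZl (measurable_disc _) a sf.
by apply: eq_integrable.
Qed.

Lemma tsumZ T (f : T -> R) a : tsummable f -> tsum (fun x => a * f x) = a * tsum f.
Proof. by move=> sf; rewrite /tsum RintegralZl. Qed.

Lemma le_tsum T (f g : T -> R) : tsummable f -> tsummable g ->
  (forall x, f x <= g x) -> tsum f <= tsum g.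
Proof. by move=> sf sg fg; apply: le_Rintegral. Qed.

Lemma tsum_ge0 T (f : T -> R) : (forall x, 0 <= f x) -> 0 <= tsum f.
Proof. by move=> f0; apply: Rintegral_ge0. Qed.

Lemma norm_tsum_le T (f : T -> R) : tsummable f ->
  `|tsum f| <= tsum (fun x => `|f x|).
Proof. by move=> sf; apply: le_normr_Rintegral. Qed.

Lemma tsummable0 T : tsummable (fun _ : T => 0).
Proof. exact: integrable0. Qed.

Lemma tsum0 T : tsum (fun _ : T => 0) = 0.
Proof. by rewrite /tsum Rintegral_cst// mul0r. Qed.

Lemma tsum_delta T (y : T) a :
  tsummable (fun x => a * (x == y)%:R) /\ tsum (fun x => a * (x == y)%:R) = a.
Proof.
have E : (fun x : T => (x == y)%:R : R) = (\1_([set (y : disc T)])).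
  apply/funext => x; rewrite indicE /=; congr ((nat_of_bool _)%:R : R).
  by apply/idP/idP => [/eqP ->|/set_mem /= ->]; rewrite ?mem_set.
have c1 : @counting (disc T) R [set (y : disc T)] = 1%E.
  by rewrite /counting asboolT// fset_set1 cardfs1.
have s1 : tsummable (fun x => (x == y)%:R : R).
  rewrite /tsummable; under eq_fun do rewrite -[(_ == _)%:R]/((fun x : T => (x == y)%:R) _) E.
  apply/integrableP; split; first exact: measurable_fun_disc.
  rewrite (eq_integral (fun x => (\1_([set (y : disc T)]) x)%:E)); last first.
    by move=> x _; rewrite gee0_abs// lee_fin.
  by rewrite integral_indic//= setIT c1 ltry.
split; first exact: tsummableZ.
rewrite tsumZ// E /tsum /Rintegral.
by rewrite integral_indic//= setIT c1 mulr1.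
Qed.

Lemma tsummable_sum T I (r : seq I) (P : pred I) (F : I -> T -> R) :
  (forall i, P i -> tsummable (F i)) ->
  tsummable (fun x => \sum_(i <- r | P i) F i x).
Proof.
move=> sF; elim: r => [|i r ih].
  by apply: eq_tsummable (tsummable0 T) => x; rewrite big_nil.
have [Pi|nPi] := boolP (P i).
  apply: eq_tsummable (tsummableD (sF i Pi) ih) => x.
  by rewrite big_cons Pi.
by apply: eq_tsummable ih => x; rewrite big_cons (negbTE nPi).
Qed.

Lemma tsum_sum T I (r : seq I) (P : pred I) (F : I -> T -> R) :
  (forall i, P i -> tsummable (F i)) ->
  tsum (fun x => \sum_(i <- r | P i) F i x) = \sum_(i <- r | P i) tsum (F i).
Proof.
move=> sF; elim: r => [|i r ih].
  by rewrite big_nil -[RHS](tsum0 T); apply: eq_tsum => x; rewrite big_nil.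
rewrite big_cons; case: ifPn => Pi; rewrite -ih.
  rewrite -tsumD//; [|exact: sF|exact: tsummable_sum].
  by apply: eq_tsum => x; rewrite big_cons Pi.
by apply: eq_tsum => x; rewrite big_cons (negbTE Pi).
Qed.

Lemma tsum_seq T (s : seq T) (f : T -> R) : uniq s ->
  (forall x, x \notin s -> f x = 0) ->
  tsummable f /\ tsum f = \sum_(x <- s) f x.
Proof.
move=> us f0.
have E : f =1 fun x => \sum_(y <- s) f y * (x == y)%:R.
  move=> x; have [xs|xs] := boolP (x \in s).
    rewrite (bigD1_seq x)//= eqxx mulr1 big1 ?addr0// => i ix.
    by rewrite eq_sym (negbTE ix) mulr0.
  rewrite f0// big_seq big1// => i si; case: eqP => [xi|_]; last by rewrite mulr0.
  by rewrite xi si in xs.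
split.
  apply: eq_tsummable (fun x => esym (E x)) _.
  by apply: tsummable_sum => i _; exact: (tsum_delta i (f i)).1.
rewrite (eq_tsum E) tsum_sum => [|i _]; last exact: (tsum_delta i (f i)).1.
by apply: eq_bigr => i _; exact: (tsum_delta i (f i)).2.
Qed.

Lemma tannery T (f_ : nat -> T -> R) (f g : T -> R) : tsummable g ->
  (forall n x, `|f_ n x| <= g x) ->
  (forall x, f_ n x @[n --> \oo] --> f x) ->
  tsummable f /\ tsum (f_ n) @[n --> \oo] --> tsum f.
Proof.
move=> sg fg fcvg.
have [] := @dominated_convergence _ (disc T) R (@counting (disc T) R) setT
  (measurable_disc _) (fun n x => (f_ n x)%:E) (fun x => (f x)%:E)
  (fun x => (g x)%:E).
- by move=> n; exact: measurable_fun_disc.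
- exact: measurable_fun_disc.
- by apply: aeW => x _; apply: cvg_EFin; [exact: nearW|exact: fcvg].
- exact: sg.
- by apply: aeW => x n _; rewrite lee_fin.
move=> sf _ cv; split => //.
apply: fine_cvg; rewrite fineK//; exact: integrable_fin_num.
Qed.

Lemma tsummable_bounded T (f : T -> R) (M : R) :
  (forall s, uniq s -> \sum_(x <- s) `|f x| <= M) -> tsummable f.
Proof.
move=> fM; apply/integrableP; split; first exact: measurable_fun_disc.
(* The elements of code below n form finite sets exhausting the type; monotone convergence along
   them computes the integral of |f|. *)
pose s n : seq T := undup (pmap (@unpickle T) (iota 0 n)).
pose g n (x : disc T) := (`|f x| * ((x : T) \in s n)%:R)%:E.
have cv := @cvg_monotone_convergence _ (disc T) R (@counting (disc T) R) setT
  (measurable_disc _) g (fun n => measurable_fun_disc _).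
have gE x : lim (g n x @[n --> \oo]) = `|f x|%:E.
  apply/cvg_lim => //; apply: cvg_near_cst; near=> n.
  rewrite /g; suff -> : (x : T) \in s n by rewrite mulr1.
  rewrite mem_undup; apply: mem_pmap_unpickle; near: n; exact: nbhs_infty_gt.
have := cv _ _; rewrite (eq_integral (fun x : disc T => `|(f x)%:E|%E)) => [{}cv|x _]; last first.
  by rewrite gE.
have {}cv : (\int[@counting (disc T) R]_x g n x)%E @[n --> \oo] -->
   (\int[@counting (disc T) R]_x `|(f x)%:E|)%E.
  apply: cv => [n x _|x _ m n mn]; first by rewrite lee_fin mulr_ge0.
  rewrite lee_fin ler_wpM2l// ler_nat; have [|//] := boolP ((x : T) \in s m).
  rewrite !mem_undup !mem_pmap => /mapP[i im xi].
  suff -> : Some (x : T) \in [seq unpickle i | i <- iota 0 n] by [].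
  apply/mapP; exists i => //; move: im; rewrite !mem_iota !add0n.
  by move=> /leq_trans; exact.
suff : (\int[@counting (disc T) R]_x `|(f x)%:E| <= M%:E)%E.
  by move=> /le_lt_trans; apply; rewrite ltry.
rewrite -(cvg_lim _ cv)//; apply: lime_le; first by apply/cvg_ex; eexists; exact: cv.
apply: nearW => n.
have gn0 x : x \notin s n -> `|f x| * (x \in s n)%:R = 0.
  by move=> /negbTE ->; rewrite mulr0.
have [sg tg] := @tsum_seq T (s n) (fun x => `|f x| * (x \in s n)%:R) (undup_uniq _)
  gn0.
rewrite -[X in (X <= _)%E]fineK; last exact: (integrable_fin_num _ sg).
rewrite lee_fin; move: tg; rewrite /tsum /Rintegral /g => ->.
apply: le_trans (fM (s n) (undup_uniq _)); rewrite big_seq [leRHS]big_seq.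
by apply: ler_sum => x xs; rewrite xs mulr1.
Unshelve. all: by end_near. Qed.

End tsum.

(** * Exhaustion by finite sets, Fubini, exchange of sum and integral *)

Section tsum_exhaustion.
Variable R : realType.
Implicit Types T U : PCount.type.

Definition exhaust T (n : nat) : seq T := undup (pmap (@unpickle T) (iota 0 n)).

Lemma exhaust_uniq T n : uniq (exhaust T n).
Proof. exact: undup_uniq. Qed.

Lemma mem_exhaust T (x : T) : \forall n \near \oo, x \in exhaust T n.
Proof.
near=> n; rewrite mem_undup; apply: mem_pmap_unpickle.
by near: n; exact: nbhs_infty_gt.
Unshelve. all: by end_near. Qed.

(** The freedom in the exhausting lists is the point: reindexing and Fubini follow by comparing two
    exhaustions of the same sum. *)
Lemma tsum_approx T (s : nat -> seq T) (f : T -> R) :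
  tsummable f -> (forall n, uniq (s n)) ->
  (forall x, \forall n \near \oo, x \in s n) ->
  \sum_(x <- s n) f x @[n --> \oo] --> tsum f.
Proof.
move=> sf us ms.
have -> : (fun n => \sum_(x <- s n) f x) =
          (fun n => tsum (fun x => f x * (x \in s n)%:R)).
  apply/funext => n.
  have [_ ->] := @tsum_seq R T (s n) (fun x => f x * (x \in s n)%:R) (us n)
    (fun x (xs : x \notin s n) => etrans (congr1 (fun b : bool => f x * b%:R) (negbTE xs)) (mulr0 _)).
  by rewrite big_seq [RHS]big_seq; apply: eq_bigr => x ->; rewrite mulr1.
apply: (@tannery R T (fun n x => f x * (x \in s n)%:R) f (fun x => `|f x|) (tsummable_norm sf) _ _).2.
- by move=> n x; case: (x \in s n); rewrite ?mulr1 ?mulr0 ?normr0.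
- move=> x; apply: cvg_near_cst; have := ms x; apply: filterS => n ->.
  by rewrite mulr1.
Qed.

Lemma sum_le_tsum T (s : seq T) (f : T -> R) : uniq s -> tsummable f ->
  (forall x, 0 <= f x) -> \sum_(x <- s) f x <= tsum f.
Proof.
move=> us sf f0.
have e : forall x, x \notin s -> f x * (x \in s)%:R = 0.
  by move=> x /negbTE ->; rewrite mulr0.
have [sg tg] := @tsum_seq R T s (fun x => f x * (x \in s)%:R) us e.
rewrite (_ : \sum_(x <- s) f x = tsum (fun x => f x * (x \in s)%:R)); last first.
  by rewrite tg big_seq [RHS]big_seq; apply: eq_bigr => x ->; rewrite mulr1.
by apply: le_tsum => // x; case: (x \in s); rewrite ?mulr1 ?mulr0.
Qed.

Lemma sum_subset_le T (s t : seq T) (f : T -> R) : uniq s -> uniq t ->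
  {subset s <= t} -> (forall x, 0 <= f x) ->
  \sum_(x <- s) f x <= \sum_(x <- t) f x.
Proof.
move=> us ut st f0.
have e x : x \notin t -> f x * (x \in t)%:R = 0.
  by move=> /negbTE ->; rewrite mulr0.
have [sg tg] := @tsum_seq R T t (fun x => f x * (x \in t)%:R) ut e.
rewrite [leRHS](_ : _ = tsum (fun x => f x * (x \in t)%:R)); last first.
  by rewrite tg big_seq [RHS]big_seq; apply: eq_bigr => x ->; rewrite mulr1.
apply: le_trans (sum_le_tsum us sg _); last by move=> x; rewrite mulr_ge0.
by rewrite big_seq [leRHS]big_seq; apply: ler_sum => x /st ->; rewrite mulr1.
Qed.

Lemma tsummable_reindex T U (e : T -> U) (f : U -> R) : injective e ->
  tsummable f -> tsummable (f \o e).
Proof.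
move=> inje sf; apply: (@tsummable_bounded _ _ _ (tsum (fun x => `|f x|))) => s us.
rewrite -(big_map e xpredT (fun y => `|f y|)); apply: sum_le_tsum => //.
  by rewrite map_inj_uniq.
exact: tsummable_norm.
Qed.

Lemma tsum_reindex T U (e : T -> U) (f : U -> R) : bijective e ->
  tsummable f -> tsum (f \o e) = tsum f.
Proof.
move=> [e' ee' e'e] sf; have inje : injective e := can_inj ee'.
have c1 := @tsum_approx T (exhaust T) (f \o e) (tsummable_reindex inje sf)
  (exhaust_uniq T) (@mem_exhaust T).
have c2 : \sum_(x <- exhaust T n) (f \o e) x @[n --> \oo] --> tsum f.
  have := @tsum_approx U (fun n => map e (exhaust T n)) f sf.
  under eq_fun do rewrite big_map; apply.
    by move=> n; rewrite map_inj_uniq// exhaust_uniq.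
  move=> x; have := mem_exhaust (e' x); apply: filterS => n xn.
  by rewrite -[x]e'e map_f.
exact: (cvg_unique _ c1 c2).
Qed.

Lemma tsummable_pair T U (f : T * U -> R) :
  (forall x, tsummable (fun y => f (x, y))) ->
  tsummable (fun x => tsum (fun y => `|f (x, y)|)) -> tsummable f.
Proof.
move=> sf1 sf2.
apply: (@tsummable_bounded _ _ _ (tsum (fun x => tsum (fun y => `|f (x, y)|)))).
move=> s us; set s1 := undup (map fst s); set s2 := undup (map snd s).
have : \sum_(x <- s) `|f x| <= \sum_(z <- [seq (x, y) | x <- s1, y <- s2]) `|f z|.
  have u12 : uniq [seq (x, y) | x <- s1, y <- s2].
    by apply: allpairs_uniq; rewrite ?undup_uniq// => -[? ?] [? ?] _ _ [-> ->].
  apply: sum_subset_le => // -[x y] xys.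
  apply/allpairsP; exists (x, y) => /=; split => //.
    by rewrite mem_undup; apply/mapP; exists (x, y).
  by rewrite mem_undup; apply/mapP; exists (x, y).
move=> /le_trans; apply; rewrite big_allpairs.
apply: (@le_trans _ _ (\sum_(x <- s1) tsum (fun y => `|f (x, y)|))).
  apply: ler_sum => x _; apply: sum_le_tsum; rewrite ?undup_uniq//.
  exact: tsummable_norm.
apply: sum_le_tsum; rewrite ?undup_uniq// => x.
exact: tsum_ge0.
Qed.

Lemma tsummable_pairl T U (f : T * U -> R) x : tsummable f ->
  tsummable (fun y => f (x, y)).
Proof.
by move=> sf; apply: (@tsummable_reindex _ _ (fun y : U => (x, y)) f) => // y y' [].
Qed.

Lemma tsummable_outer T U (f : T * U -> R) : tsummable f ->
  tsummable (fun x => tsum (fun y => `|f (x, y)|)).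
Proof.
move=> sf; apply: (@tsummable_bounded _ _ _ (tsum (fun z => `|f z|))) => s us.
under eq_bigr do rewrite ger0_norm ?tsum_ge0//.
rewrite -tsum_sum => [|x _]; last exact/tsummable_norm/tsummable_pairl.
have c := @tsum_approx U (exhaust U) _ (tsummable_sum s (fun (i : T) (_ : true) => tsummable_norm (tsummable_pairl i sf)))
  (exhaust_uniq U) (@mem_exhaust U).
rewrite -(cvg_lim _ c)//; apply: limr_le; first by apply/cvg_ex; eexists; exact: c.
apply: nearW => n; rewrite exchange_big /=.
have -> : \sum_(j <- s) \sum_(i <- exhaust U n) `|f (j, i)| =
   \sum_(i <- [seq (x, y) | x <- s, y <- exhaust U n]) `|f i|.
  by rewrite big_allpairs.
apply: sum_le_tsum => //; last exact: tsummable_norm.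
by apply: allpairs_uniq; rewrite ?exhaust_uniq// => -[? ?] [? ?] _ _ [-> ->].
Qed.

Lemma tsum_pair T U (f : T * U -> R) : tsummable f ->
  tsummable (fun x => tsum (fun y => f (x, y))) /\
  tsum f = tsum (fun x => tsum (fun y => f (x, y))).
Proof.
move=> sf; have so := tsummable_outer sf.
have sx x := tsummable_pairl x sf.
have s1 : tsummable (fun x => tsum (fun y => f (x, y))).
  by apply: tsummable_le so => x; exact: norm_tsum_le.
split => //.
pose F n x := \sum_(y <- exhaust U n) f (x, y) * (x \in exhaust T n)%:R.
have c1 : \sum_(x <- exhaust T n) \sum_(y <- exhaust U n) f (x, y) @[n --> \oo] --> tsum f.
  have := @tsum_approx (T * U)%type (fun n => [seq (x, y) | x <- exhaust T n, y <- exhaust U n]) f sf.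
  under eq_fun do rewrite big_allpairs; apply.
    move=> n; apply: allpairs_uniq; rewrite ?exhaust_uniq//.
    by move=> -[? ?] [? ?] _ _ [-> ->].
  move=> [x y]; near=> n; apply/allpairsP; exists (x, y); split => //=.
    by near: n; exact: mem_exhaust.
  by near: n; exact: mem_exhaust.
have c2 : tsum (F n) @[n --> \oo] --> tsum (fun x => tsum (fun y => f (x, y))).
  apply: (@tannery _ _ F _ _ so _ _).2 => [n x|x].
    rewrite /F -mulr_suml normrM.
    apply: (@le_trans _ _ (`|\sum_(y <- exhaust U n) f (x, y)| * 1)).
      by apply: ler_wpM2l => //; case: (_ \in _); rewrite ?normr1 ?normr0.
    rewrite mulr1; apply: le_trans (ler_norm_sum _ _ _) _.
    by apply: sum_le_tsum; rewrite ?exhaust_uniq//; exact: tsummable_norm.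
  have := @tsum_approx U (exhaust U) _ (sx x) (exhaust_uniq U) (@mem_exhaust U).
  apply: cvg_trans; apply: near_eq_cvg; near=> n.
  have xn : x \in exhaust T n by near: n; exact: mem_exhaust.
  by rewrite /F xn; under [RHS]eq_bigr do rewrite mulr1.
suff E : (fun n => \sum_(x <- exhaust T n) \sum_(y <- exhaust U n) f (x, y)) = (fun n => tsum (F n)).
  by rewrite E in c1; exact: (cvg_unique _ c1 c2).
apply/funext => n.
have e x : x \notin exhaust T n -> F n x = 0.
  by move=> /negbTE xs; rewrite /F big1// => y _; rewrite xs mulr0.
have [_ ->] := @tsum_seq R T (exhaust T n) (F n) (exhaust_uniq T n) e.
rewrite big_seq [RHS]big_seq; apply: eq_bigr => x xs; rewrite /F.
by apply: eq_bigr => y _; rewrite xs mulr1.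
Unshelve. all: by end_near. Qed.

Lemma tsum_swap T U (f : T -> U -> R) : tsummable (fun z => f z.1 z.2) ->
  tsum (fun x => tsum (fun y => f x y)) = tsum (fun y => tsum (fun x => f x y)).
Proof.
move=> sf.
have [_ <-] := tsum_pair sf.
have b : bijective (fun z : U * T => (z.2, z.1)) by exists (fun z => (z.2, z.1)) => -[].
have sf' := tsummable_reindex (bij_inj b) sf.
by rewrite -(tsum_reindex b sf) (tsum_pair sf').2.
Qed.

Lemma tsummable_prod T U (f : T -> R) (g : U -> R) : tsummable f -> tsummable g ->
  tsummable (fun z : T * U => f z.1 * g z.2).
Proof.
move=> sf sg; apply: tsummable_pair => /= [x|]; first exact: tsummableZ.
apply: (@eq_tsummable _ _ (fun x => tsum (fun y => `|g y|) * `|f x|)).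
  move=> x; rewrite mulrC -tsumZ; last exact: tsummable_norm.
  by apply: eq_tsum => y; rewrite normrM.
exact/tsummableZ/tsummable_norm.
Qed.

(** Dominated convergence along finite partial sums: one integrable [g] bounds the sum of absolute
    values, hence all partial sums at once. *)
Lemma tsum_Rintegral T d (Y : measurableType d) (mu : {measure set Y -> \bar R})
  (D : set Y) (f : T -> Y -> R) (g : Y -> R) : measurable D ->
  mu.-integrable D (EFin \o g) ->
  (forall x, mu.-integrable D (EFin \o f x)) ->
  (forall y, D y -> tsummable (fun x => f x y)) ->
  (forall y, D y -> tsum (fun x => `|f x y|) <= g y) ->
  [/\ tsummable (fun x => (\int[mu]_(y in D) f x y)%R),
   mu.-integrable D (EFin \o fun y => tsum (fun x => f x y)) &
  (\int[mu]_(y in D) tsum (fun x => f x y))%R =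
  tsum (fun x => (\int[mu]_(y in D) f x y)%R)].
Proof.
move=> mD ig if_ sf sg.
have mf x : measurable_fun D (f x).
  by have /integrableP[/measurable_EFinP] := if_ x.
have isum (s : seq T) : mu.-integrable D (EFin \o fun y => \sum_(x <- s) f x y).
  have := @integrable_sum _ _ _ mu D mD T s xpredT (fun x => EFin \o f x) (fun x _ => if_ x).
  by apply: eq_integrable => // y _ /=; rewrite sumEFin.
have S1 : tsummable (fun x => (\int[mu]_(y in D) f x y)%R).
  apply: (@tsummable_bounded _ _ _ (\int[mu]_(y in D) g y)%R) => s us.
  apply: (@le_trans _ _ (\sum_(x <- s) \int[mu]_(y in D) `|f x y|)%R).
    by apply: ler_sum => x _; apply: le_normr_Rintegral.
  have ifn x : mu.-integrable D (EFin \o fun y => `|f x y|).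
    exact: (@integrable_abse _ _ _ _ _ _ (if_ x)).
  have -> : (\sum_(x <- s) \int[mu]_(y in D) `|f x y| =
    \int[mu]_(y in D) (\sum_(x <- s) `|f x y|))%R.
    elim: s {us} => [|x s ih].
      rewrite big_nil (@eq_Rintegral _ _ _ _ _ (fun=> 0)) ?Rintegral_cst ?mul0r//.
      by move=> y _; rewrite big_nil.
    rewrite big_cons ih -RintegralD//; last first.
      have := @integrable_sum _ _ _ mu D mD T s xpredT (fun x => EFin \o (fun y => `|f x y|)) (fun x _ => ifn x).
      by apply: eq_integrable => // y _ /=; rewrite sumEFin.
    by apply: eq_Rintegral => y _; rewrite big_cons.
  apply: le_Rintegral => //.
    have := @integrable_sum _ _ _ mu D mD T s xpredT (fun x => EFin \o (fun y => `|f x y|)) (fun x _ => ifn x).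
    by apply: eq_integrable => // y _ /=; rewrite sumEFin.
  move=> y Dy; apply: le_trans (sg y Dy); apply: sum_le_tsum => //.
  exact/tsummable_norm/sf.
have cy y : D y -> \sum_(x <- exhaust T n) f x y @[n --> \oo] --> tsum (fun x => f x y).
  by move=> Dy; apply: tsum_approx; [exact: sf|exact: exhaust_uniq|exact: mem_exhaust].
have mt : measurable_fun D (fun y => tsum (fun x => f x y)).
  apply: (@measurable_fun_cvg _ _ _ _ (fun n y => \sum_(x <- exhaust T n) f x y)) => //.
  by move=> n; have /integrableP[/measurable_EFinP] := isum (exhaust T n).
have [] := @dominated_convergence _ Y R mu D mD
  (fun n y => (\sum_(x <- exhaust T n) f x y)%:E) (fun y => (tsum (fun x => f x y))%:E)
  (fun y => (g y)%:E).
- by move=> n; have /integrableP[] := isum (exhaust T n).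
- exact/measurable_EFinP.
- by apply: aeW => y Dy; apply: cvg_EFin; [exact: nearW|exact: cy].
- exact: ig.
- apply: aeW => y n Dy; rewrite lee_fin; apply: le_trans (ler_norm_sum _ _ _) _.
  apply: le_trans (sg y Dy); apply: sum_le_tsum => //; first exact: exhaust_uniq.
  exact/tsummable_norm/sf.
move=> it _ cv; split => //.
have c1 : (\int[mu]_(y in D) \sum_(x <- exhaust T n) f x y)%R @[n --> \oo] -->
   (\int[mu]_(y in D) tsum (fun x => f x y))%R.
  by apply: fine_cvg; rewrite fineK//; exact: integrable_fin_num.
have c2 := @tsum_approx T (exhaust T) _ S1 (exhaust_uniq T) (@mem_exhaust T).
suff E : (fun n => (\int[mu]_(y in D) \sum_(x <- exhaust T n) f x y)%R) = (fun n => \sum_(x <- exhaust T n) (\int[mu]_(y in D) f x y)%R).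
  by rewrite E in c1; exact: (cvg_unique _ c1 c2).
apply/funext => n; elim: (exhaust T n) => [|x s ih].
  rewrite big_nil (@eq_Rintegral _ _ _ _ _ (fun=> 0)) ?Rintegral_cst ?mul0r//.
  by move=> y _; rewrite big_nil.
rewrite big_cons -ih -RintegralD//.
by apply: eq_Rintegral => y _; rewrite big_cons.
Qed.

End tsum_exhaustion.

(** * Trigonometric, exponential and Gaussian inequalities *)

Section elementary.
Variable R : realType.
Implicit Types x y u : R.

Lemma cosD2pi_int x (k : int) : cos (x + 2 * pi * k%:~R) = cos x.
Proof.
have P n y : cos (y + 2 * pi * n%:R) = cos y.
  have := periodicn (@cosD2pi R) n y.
  by rewrite (_ : pi *+ 2 *+ n = 2 * pi * n%:R) //; ring.
case: k => n; first exact: P.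
rewrite NegzE mulrNz mulrN -(P n.+1 (x - 2 * pi * n.+1%:~R)).
by congr cos; rewrite subrK.
Qed.

Lemma sinD2pi_int x (k : int) : sin (x + 2 * pi * k%:~R) = sin x.
Proof. by rewrite -!cosBpihalf addrAC cosD2pi_int. Qed.

Lemma sinpi_sqr x (k : int) : sin (x + pi * k%:~R) ^+ 2 = sin x ^+ 2.
Proof.
have E z : sin z ^+ 2 = (1 - cos (z + z)) / 2.
  by rewrite cosD -!expr2 cos2sin2; field.
rewrite !E (_ : x + pi * k%:~R + _ = x + x + 2 * pi * k%:~R); last by ring.
by rewrite cosD2pi_int.
Qed.

Lemma onem_le_expR u : 1 - u <= expR (- u).
Proof. by have := expR_ge1Dx (- u). Qed.

Lemma expR_le_onem u : u < 1 -> expR (- (u / (1 - u))) <= 1 - u.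
Proof.
move=> u1; have v0 : 0 < 1 - u by rewrite subr_gt0.
rewrite expRN -[leRHS]invrK lef_pV2 ?posrE ?expR_gt0 ?invr_gt0//.
have := expR_ge1Dx (u / (1 - u)); apply: le_trans.
by rewrite le_eqVlt; apply/orP; left; apply/eqP; field; rewrite gt_eqF.
Qed.

Lemma expRN_le_inv u : 0 <= u -> expR (- u) <= (1 + u)^-1.
Proof.
move=> u0; rewrite expRN lef_pV2 ?posrE ?expR_gt0 ?ltr_pwDl//.
exact: expR_ge1Dx.
Qed.

(** The difference of the two sides is half of [(x + 2 y) ^+ 2]. *)
Lemma sqr_shift_ge x y : x ^+ 2 / 2 - y ^+ 2 <= (x + y) ^+ 2.
Proof. by have := sqr_ge0 (x + 2 * y); nra. Qed.

(** The range goes beyond pi/2 because the window of Polya's sum, once displaced by [th], reaches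
    arguments up to 3 pi/4. From pi/4 on the double angle formula is used, below it the mean value
    theorem with cos >= 1/2. *)
Lemma sqr_sin_ge x : `|x| <= 3 / 4 * pi -> x ^+ 2 / 64 <= sin x ^+ 2.
Proof.
have pi4 : (pi : R) < 4 by have := @pihalf_lt2 R; lra.
have pi0 := @pi_gt0 R.
wlog x0 : x / 0 <= x.
  move=> W; have [/W//|x0 h] := leP 0 x.
  by have := W (- x); rewrite sinN !sqrrN normrN; apply => //; rewrite oppr_ge0 ltW.
rewrite ger0_norm// => xb.
have E : sin x ^+ 2 = (1 - cos (x + x)) / 2.
  by rewrite cosD -!expr2 cos2sin2; field.
have [x4|x4] := leP (pi / 4) x.
  have : 0 <= cos (x + x - pi) by apply: cos_ge0_pihalf; lra.
  rewrite cosB cospi sinpi mulr0 addr0 mulrN1 => h.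
  have x3 : x <= 3 by lra.
  have : x ^+ 2 <= 9 by nra.
  by lra.
have cge (z : R) : 0 <= z -> z <= pi / 4 -> 1 / 2 <= cos z.
  move=> z0 z4; have h1 : 0 <= cos z by apply: cos_ge0_pihalf; lra.
  have h2 : 0 <= cos (z + z) by apply: cos_ge0_pihalf; lra.
  have h3 : cos z ^+ 2 = (1 + cos (z + z)) / 2 by rewrite cosD -!expr2 sin2cos2; field.
  nra.
have [->|xn0] := eqVneq x 0; first by rewrite sin0 !expr0n /= mul0r.
have xp : 0 < x by rewrite lt_neqAle eq_sym xn0.
have [c] := @MVT R (@sin R) (@cos R) 0 x xp (fun z _ => is_derive_sin z)
  (continuous_subspaceT (@continuous_sin R)).
rewrite in_itv/= => /andP[c0 cx]; rewrite sin0 !subr0 => ->.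
have := cge c (ltW c0) (ltW (lt_trans cx x4)); move: (cos c) => w hw.
have w2 : 1 / 4 <= w ^+ 2 by nra.
rewrite exprMn; have := ler_wpM2r (sqr_ge0 x) w2; have := sqr_ge0 x; lra.
Qed.

Lemma tsummable_inv_sqr : tsummable (fun k : int => (1 + (k%:~R : R) ^+ 2)^-1).
Proof.
have P (n : nat) : (1 + n%:R ^+ 2)^-1 <= 4 * (n.+1%:R^-1 - n.+2%:R^-1) :> R.
  have n0 : (0 : R) <= n%:R by [].
  rewrite -(natr1 n.+1) -(natr1 n).
  have -> : (n%:R + 1)^-1 - (n%:R + 1 + 1)^-1 = ((n%:R + 1) * (n%:R + 1 + 1))^-1 :> R.
    by field; rewrite !gt_eqF ?ltr_wpDl//.
  rewrite -[leLHS]mul1r ler_pdivrMr ?ltr_pwDl ?sqr_ge0// mulrAC ler_pdivlMr; last by rewrite mulr_gt0// ltr_wpDl.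
  nra.
apply: (@tsummable_bounded _ _ _ 8) => s us.
pose B := (\max_(k <- s) `|k|%N).+1.
pose t : seq int := [seq Posz n | n <- iota 0 B] ++ [seq Negz n | n <- iota 0 B].
have ut : uniq t.
  rewrite cat_uniq !map_inj_uniq ?iota_uniq ?andbT; try by move=> ? ? [].
  by apply/hasPn => k /mapP[n _ ->]; apply/mapP => -[].
apply: (@le_trans _ _ (\sum_(k <- t) `|(1 + (k%:~R : R) ^+ 2)^-1|)).
  apply: sum_subset_le => // k ks.
  have kB : (`|k| < B)%N.
    by rewrite ltnS; exact: (@leq_bigmax_seq _ s xpredT (fun k : int => `|k|%N) k ks isT).
  rewrite mem_cat; case: k kB {ks} => n nB.
    by rewrite map_f// mem_iota.
  by rewrite [X in _ || X]map_f ?orbT// mem_iota/= add0n; lia.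
have tel (n : nat) : \sum_(k <- iota 0 n) (4 * (k.+1%:R^-1 - k.+2%:R^-1)) <= 4 :> R.
  have -> : iota 0 n = index_iota 0 n by rewrite /index_iota subn0.
  rewrite -mulr_sumr.
  have -> : \sum_(0 <= i < n) (i.+1%:R^-1 - i.+2%:R^-1) = 1 - n.+1%:R^-1 :> R.
    have := @telescope_sumr R 0 n (fun i => - i.+1%:R^-1) (leq0n n).
    by under eq_bigr do rewrite opprK addrC; move=> ->; rewrite opprK addrC invr1.
  have : 0 <= n.+1%:R^-1 :> R by rewrite invr_ge0.
  by move: (n.+1%:R^-1 : R) => z; lra.
rewrite big_cat !big_map (_ : 8 = 4 + 4 :> R); last by ring.
apply: lerD; apply: le_trans (tel B); apply: ler_sum => n _.
  by rewrite ger0_norm ?invr_ge0 ?addr_ge0 ?sqr_ge0//; exact: P.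
rewrite ger0_norm ?invr_ge0 ?addr_ge0 ?sqr_ge0//.
apply: le_trans (P n); rewrite NegzE mulrNz sqrrN lef_pV2 ?posrE ?ltr_pwDl ?sqr_ge0//.
by rewrite lerD2l lerXn2r ?nnegrE// ler_nat.
Qed.

(** Uniform in the shift [b], so that one summable majorant serves a family of Gaussians whose
    centres move in a bounded set. *)
Lemma gauss_le_inv_sqr (c a : R) : 0 < c ->
  exists2 M, 0 <= M & forall (x b : R), `|b| <= a ->
    expR (- (c * (x + b) ^+ 2)) <= M * (1 + x ^+ 2)^-1.
Proof.
move=> c0; exists (expR (c * a ^+ 2) * (1 + 2 / c)).
  by rewrite mulr_ge0 ?expR_ge0// addr_ge0// divr_ge0// ltW.
move=> x b ba.
have ba2 : b ^+ 2 <= a ^+ 2.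
  by rewrite -real_normK ?num_real// lerXn2r ?nnegrE//; exact: le_trans ba.
apply: (@le_trans _ _ (expR (c * a ^+ 2) * expR (- (c * (x ^+ 2 / 2))))).
  rewrite -expRD ler_expR; have := sqr_shift_ge x b; nra.
rewrite -[leRHS]mulrA; apply: ler_wpM2l; first exact: expR_ge0.
have h : 0 <= c * (x ^+ 2 / 2) by apply: mulr_ge0; [exact: ltW|exact: divr_ge0 (sqr_ge0 x) _].
apply: le_trans (expRN_le_inv h) _.
have x20 := sqr_ge0 x.
rewrite ler_pdivlMr; last by rewrite ltr_pwDl.
rewrite mulrC ler_pdivrMr; last by rewrite ltr_pwDl.
have : (1 + 2 / c) * (1 + c * (x ^+ 2 / 2)) = 1 + x ^+ 2 + 2 / c + c * (x ^+ 2 / 2).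
  by field; rewrite gt_eqF.
have : 0 <= 2 / c by rewrite divr_ge0// ltW.
by move=> h1 ->; lra.
Qed.

Lemma tsummable_gauss (c b : R) : 0 < c ->
  tsummable (fun k : int => expR (- (c * (k%:~R + b) ^+ 2))).
Proof.
move=> c0; have [M M0 h] := gauss_le_inv_sqr `|b| c0.
apply: tsummable_le (tsummableZ M tsummable_inv_sqr) => k.
by rewrite ger0_norm ?expR_ge0//; exact: h.
Qed.

(** The real part of e^(ie) times the binomial expansion of (e^(ix) + e^(-ix))^M. *)
Lemma expr_cos_sum (M : nat) x (e : R) :
  (2 * cos x) ^+ M * cos e =
  \sum_(l < M.+1) 'C(M, l)%:R * cos ((2 * l%:R - M%:R) * x + e).
Proof.
elim: M e => [|M IH] e.
  by rewrite expr0 mul1r big_ord_recl big_ord0 addr0 bin0 mul1r mulr0 subr0 mul0r add0r.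
have -> : (2 * cos x) ^+ M.+1 * cos e =
  (2 * cos x) ^+ M * cos (e + x) + (2 * cos x) ^+ M * cos (e - x).
  by rewrite exprS cosD cosB; ring.
rewrite !IH big_ord_recr/= [X in _ + X]big_ord_recl/= [RHS]big_ord_recl big_ord_recr/=.
rewrite !bin0 !binn.
have E1 : (2 * 0 - M%:R) * x + (e - x) = (2 * 0 - M.+1%:R) * x + e by rewrite -natr1; ring.
have E2 : (2 * M%:R - M%:R) * x + (e + x) = (2 * M.+1%:R - M.+1%:R) * x + e by rewrite -natr1; ring.
rewrite E1 E2.
have -> : \sum_(i < M) 'C(M.+1, bump 0 i)%:R * cos ((2 * (bump 0 i)%:R - M.+1%:R) * x + e) =
  \sum_(i < M) 'C(M, i)%:R * cos ((2 * i%:R - M%:R) * x + (e + x)) +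
  \sum_(i < M) 'C(M, bump 0 i)%:R * cos ((2 * (bump 0 i)%:R - M%:R) * x + (e - x)).
  rewrite -big_split/=; apply: eq_bigr => i _; rewrite /bump /= add1n binS natrD mulrDl addrC.
  by congr (_ * cos _ + _ * cos _); rewrite -!natr1; ring.
by ring.
Qed.

(** Orthogonality of additive characters with a phase. When N does not divide l, the half-step sine
    is nonzero, and multiplying by it makes the sum telescope. *)
Lemma sum_cos_residues (N : nat) (l : int) (th e : R) : (0 < N)%N ->
  \sum_(j < N) cos (2 * pi * l%:~R * (j%:R + th) / N%:R + e) =
  if (N%:Z %| l)%Z then N%:R * cos (2 * pi * l%:~R * th / N%:R + e) else 0.
Proof.
move=> N0; have Nn0 : N%:R != 0 :> R by rewrite pnatr_eq0 -lt0n.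
have [|nd] := boolP (N%:Z %| l)%Z.
  move=> /dvdzP[q ->].
  rewrite (eq_bigr (fun=> cos (2 * pi * (q * N)%:~R * th / N%:R + e))).
    by rewrite sumr_const card_ord -[LHS]mulr_natl.
  move=> j _; rewrite -[RHS](cosD2pi_int _ (q * j%:Z)); congr cos.
  by rewrite !intrM -!pmulrn; field.
pose d : R := 2 * pi * l%:~R / N%:R; pose b := d * th + e.
have -> : \sum_(j < N) cos (2 * pi * l%:~R * (j%:R + th) / N%:R + e) =
  \sum_(0 <= j < N) cos (d * j%:R + b).
  by rewrite big_mkord; apply: eq_bigr => j _; congr cos; rewrite /b /d; field.
have sd : sin (d / 2) != 0.
  have E : d / 2 = pi * (l %% N)%Z%:~R / N%:R + pi * (l %/ N)%Z%:~R.
    by rewrite /d {1}(divz_eq l N) intrD intrM -!pmulrn; field.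
  suff : sin (d / 2) ^+ 2 != 0 by rewrite expf_eq0.
  rewrite E sinpi_sqr expf_eq0/=.
  have r0 : (0 : int) <= (l %% N)%Z by rewrite modz_ge0// -lt0n.
  have rN : (l %% N)%Z < N by rewrite ltz_pmod.
  have rn0 : (l %% N)%Z != 0 by apply: contra nd => /eqP h; apply/dvdz_mod0P.
  rewrite gt_eqF//; apply: sin_gt0_pi; apply/andP; split.
    by rewrite divr_gt0 ?ltr0n// mulr_gt0 ?pi_gt0// ltr0z lt_neqAle eq_sym rn0.
  rewrite ltr_pdivrMr ?ltr0n// ltr_pM2l ?pi_gt0//.
  by rewrite pmulrn ltr_int.
apply: (mulfI sd); rewrite mulr0 mulr_sumr.
have T : \sum_(0 <= j < N) sin (d / 2) * cos (d * j%:R + b) =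
  \sum_(0 <= j < N) ((fun j : nat => sin (d * j%:R - d / 2 + b) / 2) j.+1 - (fun j : nat => sin (d * j%:R - d / 2 + b) / 2) j).
  apply: eq_bigr => j _.
  rewrite (_ : d * j.+1%:R - d / 2 + b = (d * j%:R + b) + d / 2); last by rewrite -natr1; field.
  rewrite (_ : d * j%:R - d / 2 + b = (d * j%:R + b) - d / 2); last by ring.
  by rewrite sinD sinB; field.
rewrite T telescope_sumr//.
rewrite (_ : d * N%:R - d / 2 + b = (d * 0%:R - d / 2 + b) + 2 * pi * l%:~R).
  by rewrite sinD2pi_int subrr.
by rewrite /d; field.
Qed.

End elementary.

(** * Polya's finite identity and the asymptotics of binomial ratios *)

Section polya.
Variable R : realType.
Implicit Types (th al et s t : R).

Lemma norm_sin_sub_le (z : R) : `|sin z - z| <= z ^+ 2.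
Proof.
wlog z0 : z / 0 < z.
  move=> W; have [/W//|z0|<-] := ltgtP 0 z; last by rewrite sin0 subr0 normr0 sqr_ge0.
  have := W (- z); rewrite sinN sqrrN -opprD normrN; apply.
  by rewrite oppr_gt0.
have c1 (y : R) : 0 < y -> 1 - cos y <= y.
  move=> y0; have [c] := @MVT R (@cos R) (fun x => - sin x) 0 y y0
    (fun z _ => is_derive_cos z) (continuous_subspaceT (@continuous_cos R)).
  rewrite in_itv/= => /andP[c0 cy]; rewrite cos0 subr0 => h.
  have := ler_wpM2r (ltW y0) (sin_le1 c); lra.
have D (x : R) : x \in `]0, z[ -> is_derive x 1 (fun x => sin x - x) (cos x - 1).
  by move=> _; apply: is_deriveB.
have [|c] := MVT z0 D.
  by apply: continuous_subspaceT => x; apply: cvgB; [exact: continuous_sin|exact: cvg_id].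
rewrite in_itv/= => /andP[c0 cz]; rewrite sin0 !subr0 => ->.
rewrite normrM (ger0_norm (ltW z0)) expr2; apply: ler_wpM2r; first exact: ltW.
rewrite ler0_norm ?subr_le0 ?cos_le1// opprB; exact: le_trans (c1 c c0) (ltW cz).
Qed.

Lemma cvg_sin_mul (x : R) (N : nat -> R) : (forall n, 0 < N n) ->
  (N n)^-1 @[n --> \oo] --> (0 : R) -> N n * sin (x / N n) @[n --> \oo] --> x.
Proof.
move=> N0 iN.
have h : x ^+ 2 * (N n)^-1 @[n --> \oo] --> (0 : R).
  by rewrite -[X in _ --> X](mulr0 (x ^+ 2)); apply: cvgMr.
apply/cvgrPdist_le => e e0; move/cvgr0Pnorm_le : h => /(_ e e0); apply: filterS => n.
move=> h; have {}h := le_trans (ler_norm _) h; apply: le_trans h.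
have Nn := lt0r_neq0 (N0 n).
rewrite distrC (_ : _ - _ = N n * (sin (x / N n) - x / N n)); last by field.
rewrite normrM gtr0_norm//.
have -> : x ^+ 2 / N n = N n * (x / N n) ^+ 2 by field.
by rewrite ler_pM2l// norm_sin_sub_le.
Qed.

(** The coefficient of exp(2 i l x) in (2 cos x)^(2m); it is 0 for |l| > m by the convention on
    binomials. *)
Definition binZ (m : nat) (l : int) : R := 'C(2 * m, m + `|l|)%:R.

Lemma sum_bin_delta (m : nat) (z : int) :
  \sum_(l < (2 * m).+1) 'C(2 * m, l)%:R * (z == l%:Z - m%:Z)%:R = binZ m z :> R.
Proof.
have [zm|zm] := leqP `|z|%N m; last first.
  rewrite /binZ bin_small; last by lia.
  rewrite big1// => l _; case: eqP => [zl|]; last by rewrite mulr0.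
  by exfalso; have := ltn_ord l; lia.
pose l0 : nat := absz (m%:Z + z)%R.
have l0m : (l0 < (2 * m).+1)%N by rewrite /l0; lia.
rewrite (bigD1 (Ordinal l0m))//= big1 => [|l ll0]; last first.
  case: eqP => [zl|]; last by rewrite mulr0.
  by case/negP: ll0; apply/eqP/val_inj => /=; rewrite /l0; lia.
rewrite addr0 (_ : z == _) ?mulr1; last by apply/eqP; rewrite /l0; lia.
rewrite /binZ; congr (_%:R); case: z @l0 zm {l0m} => n /= nm.
  by congr 'C(_, _); lia.
by rewrite -bin_sub; [congr 'C(_, _)|]; lia.
Qed.

(** Expanding the power of the cosine and summing over j keeps the frequencies divisible by N, by
    orthogonality. The extra frequency r displaces the binomial and becomes the shift [al] in the
    limit. *)
Lemma polya_finite (N m : nat) (r : int) th et : (0 < N)%N ->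
  tsummable (fun k : int => binZ m (k * N - r) * cos (2 * pi * k%:~R * th + et)) /\
  \sum_(j < N) cos (pi * (j%:R + th) / N%:R) ^+ (2 * m) *
     cos (2 * pi * r%:~R * (j%:R + th) / N%:R + et) =
  N%:R / 4 ^+ m *
  tsum (fun k : int => binZ m (k * N - r) * cos (2 * pi * k%:~R * th + et)).
Proof.
move=> N0; have Nn0 : N%:R != 0 :> R by rewrite pnatr_eq0 -lt0n.
pose q (l : nat) : int := l%:Z - m%:Z + r.
pose F (l : nat) (k : int) : R := 'C(2 * m, l)%:R * cos (2 * pi * k%:~R * th + et) *
  (k * N%:Z == q l)%:R.
have FE l : tsummable (F l) /\ tsum (F l) = 'C(2 * m, l)%:R *
   (if (N%:Z %| q l)%Z then cos (2 * pi * (q l)%:~R * th / N%:R + et) else 0).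
  have [/dvdzP[k0 qk0]|nd] := boolP (N%:Z %| q l)%Z; last first.
    have -> : F l = fun=> 0.
      apply/funext => k; rewrite /F; case: eqP => [E|]; last by rewrite mulr0.
      by case/negP: nd; apply/dvdzP; exists k.
    by rewrite mulr0 tsum0; split=> //; exact: tsummable0.
  have -> : F l = fun k => ('C(2 * m, l)%:R * cos (2 * pi * k0%:~R * th + et)) * (k == k0)%:R.
    apply/funext => k; rewrite /F qk0 (inj_eq (mulIf _)); last by rewrite -lt0n in N0 *; lia.
    by case: eqP => [->|]; rewrite ?mulr0.
  have [h1 ->] := tsum_delta k0 ('C(2 * m, l)%:R * cos (2 * pi * k0%:~R * th + et)).
  split=> //; congr (_ * cos (_ + _)); rewrite qk0 intrM -pmulrn; by field.
have E (k : int) : binZ m (k * N - r) * cos (2 * pi * k%:~R * th + et) = \sum_(l < (2 * m).+1) F l k.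
  rewrite -sum_bin_delta mulr_suml; apply: eq_bigr => l _; rewrite /F mulrAC.
  by congr (_ * _%:R); rewrite /q subr_eq.
split.
  apply: eq_tsummable (fun k => esym (E k)) _.
  by apply: tsummable_sum => l _; exact: (FE l).1.
rewrite (eq_tsum E) tsum_sum => [|l _]; last exact: (FE l).1.
have f4 : (4 ^+ m : R) != 0 by rewrite expf_neq0.
apply: (mulfI f4); rewrite [RHS]mulrA [4 ^+ m * (_ / _)]mulrC divfK// !mulr_sumr.
under eq_bigr => j _.
  rewrite mulrA (_ : 4 ^+ m = 2 ^+ (2 * m) :> R); last by rewrite exprM -[2 ^+ 2]natrX.
  rewrite -exprMn expr_cos_sum.
  over.
rewrite exchange_big/=; apply: eq_bigr => l _.
rewrite (FE l).2 mulrCA -mulr_sumr; congr (_ * _).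
have := sum_cos_residues (q l) th et N0.
rewrite (fun_if (fun x => N%:R * x)) mulr0 => <-.
apply: eq_bigr => j _; congr cos; rewrite /q intrD intrB -!pmulrn natrM; by field.
Qed.

(** The binomial coefficient at distance l from the centre, relative to the central one. In later
    sections [rho] is a notation for sqrt 6 instead. *)
Definition rho (m l : nat) : R := 'C(2 * m, m + l)%:R / 'C(2 * m, m)%:R.

Lemma bin2m_gt0 m : 0 < 'C(2 * m, m)%:R :> R.
Proof. by rewrite ltr0n bin_gt0; lia. Qed.

Lemma rho0 m : rho m 0 = 1.
Proof. by rewrite /rho addn0 divff// gt_eqF// bin2m_gt0. Qed.

Lemma rho_ge0 m l : 0 <= rho m l.
Proof. by rewrite /rho divr_ge0. Qed.

Lemma rhoS m l : (l < m)%N -> rho m l.+1 = rho m l * (1 - (2 * l + 1)%:R / (m + l + 1)%:R).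
Proof.
move=> lm; rewrite /rho.
have /(congr1 (fun n : nat => n%:R : R)) := mul_bin_left (2 * m) (m + l).
rewrite !natrM (_ : (2 * m - (m + l))%N = (m - l)%N); last by lia.
rewrite -addnS natrB; last by lia.
have h : ((m + l.+1)%:R : R) != 0 by rewrite pnatr_eq0; lia.
have h2 := bin2m_gt0 m.
move=> E; have -> : 'C(2 * m, m + l.+1)%:R = (m%:R - l%:R) * 'C(2 * m, m + l)%:R / (m + l.+1)%:R :> R.
  by rewrite -E mulrAC divff// mul1r.
have e1 : (2 * l + 1)%:R = 2 * l%:R + 1 :> R by rewrite natrD natrM.
have e2 : (m + l + 1)%:R = m%:R + l%:R + 1 :> R by rewrite !natrD.
have e3 : (m + l.+1)%:R = m%:R + l%:R + 1 :> R by rewrite natrD -natr1 addrA.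
move: h; rewrite e1 e2 e3 => h.
field; rewrite h/= gt_eqF//.
Qed.

(** The ratio is a product of factors 1 - (2 i + 1)/(m + i + 1) for i < l; each is at most exp(- (2
    i + 1)/D), and the odd numbers sum to l^2. *)
Lemma rho_le m L (D : R) l : (l <= L)%N -> (L <= m)%N -> 0 < D -> (m + L)%:R <= D ->
  rho m l <= expR (- (l%:R ^+ 2 / D)).
Proof.
move=> lL Lm D0 mD; elim: l lL => [|l ih] lL.
  by rewrite rho0 expr0n mul0r oppr0 expR0.
rewrite rhoS; last by lia.
have -> : expR (- (l.+1%:R ^+ 2 / D)) = expR (- (l%:R ^+ 2 / D)) * expR (- ((2 * l + 1)%:R / D)).
  by rewrite -expRD; congr expR; rewrite -natr1 natrD natrM; field; rewrite gt_eqF.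
apply: ler_pM; [exact: rho_ge0| |by apply: ih; lia|].
  by rewrite subr_ge0 ler_pdivrMr ?ltr0n ?addn1// mul1r ler_nat; lia.
apply: le_trans (onem_le_expR _) _; rewrite ler_expR lerN2 ler_pM2l ?ltr0n; last by lia.
rewrite lef_pV2 ?posrE ?ltr0n//; last by lia.
by apply: le_trans mD; rewrite ler_nat; lia.
Qed.

(** The same product with 1 - v >= exp(- v/(1 - v)); for v = (2 i + 1)/(m + i + 1) the exponent is
    (2 i + 1)/(m - i). *)
Lemma rho_ge m L (D : R) l : (l <= L)%N -> (L <= m)%N -> 0 < D -> D <= (m - L + 1)%:R ->
  expR (- (l%:R ^+ 2 / D)) <= rho m l.
Proof.
move=> lL Lm D0 mD; elim: l lL => [|l ih] lL.
  by rewrite rho0 expr0n mul0r oppr0 expR0.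
rewrite rhoS; last by lia.
have -> : expR (- (l.+1%:R ^+ 2 / D)) = expR (- (l%:R ^+ 2 / D)) * expR (- ((2 * l + 1)%:R / D)).
  by rewrite -expRD; congr expR; rewrite -natr1 natrD natrM; field; rewrite gt_eqF.
apply: ler_pM; rewrite ?expR_ge0//; first by apply: ih; lia.
have u1 : (2 * l + 1)%:R / (m + l + 1)%:R < 1 :> R.
  by rewrite ltr_pdivrMr ?ltr0n ?addn1// mul1r ltr_nat; lia.
apply: le_trans (expR_le_onem u1); rewrite ler_expR lerN2.
have -> : (2 * l + 1)%:R / (m + l + 1)%:R / (1 - (2 * l + 1)%:R / (m + l + 1)%:R) =
  (2 * l + 1)%:R / (m - l)%:R :> R.
  have h : ((m + l + 1)%:R : R) != 0 by rewrite pnatr_eq0; lia.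
  have h2 : ((m - l)%:R : R) != 0 by rewrite pnatr_eq0; lia.
  move: h h2; rewrite natrB; last by lia.
  have e1 : (2 * l + 1)%:R = 2 * l%:R + 1 :> R by rewrite natrD natrM.
  have e2 : (m + l + 1)%:R = m%:R + l%:R + 1 :> R by rewrite !natrD.
  by rewrite e1 e2 => h h2; field; rewrite h2 h.
rewrite ler_pM2l ?ltr0n; last by lia.
rewrite lef_pV2 ?posrE ?ltr0n//; last by lia.
by apply: le_trans mD _; rewrite ler_nat; lia.
Qed.

(** Wallis' sequence k (C(2k, k)/4^k)^2 at k = m + 1. It increases, while the same expression with k
    + 1/2 decreases, hence it converges; no value of the limit is needed until theta inversion
    itself determines it. *)
Definition wallis (m : nat) : R := m.+1%:R * ('C(2 * m.+1, m.+1)%:R / 4 ^+ m.+1) ^+ 2.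

Lemma cvg_wallis : cvg (wallis m @[m --> \oo]).
Proof.
pose a (m : nat) : R := 'C(2 * m, m)%:R / 4 ^+ m.
have aS m : a m.+1 = a m * ((2 * m + 1)%:R / (2 * m + 2)%:R).
  rewrite /a.
  have /(congr1 (fun n : nat => n%:R : R)) := mul_bin_diag (2 * m).+2 m.
  have /(congr1 (fun n : nat => n%:R : R)) := mul_bin_down (2 * m).+1 m.
  rewrite /= (_ : ((2 * m).+1 - m = m.+1)%N); last by lia.
  rewrite (_ : (2 * m.+1 = (2 * m).+2)%N); last by lia.
  rewrite !natrM => E1 E2.
  have h : (m.+1%:R : R) != 0 by rewrite pnatr_eq0.
  have -> : 'C((2 * m).+2, m.+1)%:R = (2 * m).+2%:R * ((2 * m).+1%:R * 'C(2 * m, m)%:R / m.+1%:R) / m.+1%:R :> R.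
    by rewrite E1 [m.+1%:R * 'C(_.+1, _)%:R]mulrC mulfK// E2 mulrAC divff// mul1r.
  have e1 : (2 * m + 1)%:R = 2 * m%:R + 1 :> R by rewrite natrD natrM.
  have e2 : (2 * m + 2)%:R = 2 * m%:R + 2 :> R by rewrite natrD natrM.
  have e3 : (2 * m).+1%:R = 2 * m%:R + 1 :> R by rewrite -natr1 natrM.
  have e4 : (2 * m).+2%:R = 2 * m%:R + 2 :> R by rewrite -!natr1 natrM; ring.
  rewrite exprS e1 e2 e3 e4; move: h; rewrite -natr1 => h.
  have h2 : 2 * m%:R + 2 != 0 :> R by rewrite gt_eqF// ltr_wpDl// mulr_ge0.
  by field; rewrite h2 expf_neq0.
have a0 m : 0 < a m by rewrite divr_gt0 ?bin2m_gt0// exprn_gt0.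
apply: nondecreasing_is_cvgn.
  apply/nondecreasing_seqP => m; rewrite /wallis -!/(a _) (aS m.+1); have := a0 m.+1; move: (a m.+1) => am am0.
  rewrite [leRHS](_ : _ = (m.+2%:R * ((2 * m.+1 + 1)%:R / (2 * m.+1 + 2)%:R) ^+ 2) * am ^+ 2); last first.
    by move: (_ / _) (m.+2%:R) => x y; ring.
  rewrite ler_pM2r ?exprn_gt0//.
  rewrite expr_div_n mulrA ler_pdivlMr ?exprn_gt0 ?ltr0n ?addn2//.
  by rewrite -!natrX -!natrM ler_nat; nia.
exists ((a 1) ^+ 2 * 2) => _ [m _ <-].
apply: (@le_trans _ _ ((m.+1%:R + 1 / 2) * a m.+1 ^+ 2)).
  by rewrite /wallis -/(a _) ler_wpM2r ?sqr_ge0// lerDl.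
elim: m => [|m ih]; first by have := sqr_ge0 (a 1%N); move: (a 1%N ^+ 2) => z; lra.
apply: le_trans ih; rewrite (aS m.+1) exprMn.
have h2 : 0 < (2 * m.+1 + 2)%:R ^+ 2 :> R by rewrite exprn_gt0// ltr0n; lia.
rewrite mulrCA [leRHS]mulrC; apply: ler_wpM2l; first exact: sqr_ge0.
rewrite expr_div_n mulrA ler_pdivrMr//.
have e1 : (2 * m.+1 + 1)%:R = 2 * m%:R + 3 :> R by rewrite natrD natrM -natr1; ring.
have e2 : (2 * m.+1 + 2)%:R = 2 * m%:R + 4 :> R by rewrite natrD natrM -natr1; ring.
rewrite e1 e2 -(natr1 m.+1) -(natr1 m); have : 0 <= m%:R :> R by [].
by move: (m%:R : R) => z; nra.
Qed.

End polya.

(** * Limit of Polya's identity in the Gaussian scaling *)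

Section polya_limit.
Variable R : realType.
Variables (s th al et : R).
Hypothesis s0 : 0 < s.

(** The scaling m ~ s N^2, r ~ al N makes both the powers of the cosine and the binomial ratios
    Gaussian. [n0] ensures |th| <= H/2, and m is a successor because [wallis] is indexed by the
    predecessor. *)
Let n0 : nat := (Num.truncn (2 * `|th|)).+1.
Let H (n : nat) : nat := (n + n0)%N.
Let N (n : nat) : nat := (2 * H n)%N.
Let m' (n : nat) : nat := Num.truncn (s * (N n)%:R ^+ 2).
Let m (n : nat) : nat := (m' n).+1.
Let r (n : nat) : int := Num.floor (al * (N n)%:R).

Let N_gt0 n : (0 < N n)%N.
Proof. by rewrite /N /H /n0; lia. Qed.

Let NR_gt0 n : 0 < (N n)%:R :> R.
Proof. by rewrite ltr0n N_gt0. Qed.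

Let NR_neq0 n : (N n)%:R != 0 :> R.
Proof. by rewrite gt_eqF. Qed.

Let n_le_N n : (n <= N n)%N.
Proof. by rewrite /N /H /n0; lia. Qed.

Let cvg_iN : ((N n)%:R)^-1 @[n --> \oo] --> (0 : R).
Proof.
apply: (@squeeze_cvgr _ _ _ _ (fun=> 0) (fun n => n.+1%:R^-1 *+ 2)).
- near=> n; rewrite invr_ge0 ler0n/=.
  have n1 : (0 < n)%N by near: n; exact: nbhs_infty_gt.
  rewrite -[leRHS]mulr_natl ler_pdivlMr ?ltr0n// mulrC ler_pdivrMr//.
  by rewrite -natrM ler_nat; have := n_le_N n; lia.
- exact: cvg_cst.
- rewrite -[X in _ --> X](mul0rn _ 2); apply: cvgMn; exact: cvg_harmonic.
Unshelve. all: by end_near. Qed.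

Let cvg_iN2 : ((N n)%:R ^+ 2)^-1 @[n --> \oo] --> (0 : R).
Proof.
have E : (fun n => ((N n)%:R ^+ 2)^-1 : R) = (fun n => (N n)%:R^-1 * (N n)%:R^-1).
  by apply/funext => n; rewrite expr2 invfM.
by rewrite E -[X in _ --> X](mulr0 0); apply: cvgM; exact: cvg_iN.
Qed.

Let m_bounds n : s * (N n)%:R ^+ 2 <= (m n)%:R <= s * (N n)%:R ^+ 2 + 1.
Proof.
have h : 0 <= s * (N n)%:R ^+ 2 by rewrite mulr_ge0 ?(ltW s0)// exprn_ge0.
have /andP[h1 h2] := truncn_itv h.
rewrite /m /m'; apply/andP; split; first exact: ltW.
by rewrite -natr1 lerD2r.
Qed.

Let cvg_mN2 : (m n)%:R / (N n)%:R ^+ 2 @[n --> \oo] --> s.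
Proof.
apply: (@squeeze_cvgr _ _ _ _ (fun=> s) (fun n => s + ((N n)%:R ^+ 2)^-1)).
- apply: nearW => n; have /andP[h1 h2] := m_bounds n.
  have N2 : 0 < (N n)%:R ^+ 2 :> R by rewrite exprn_gt0.
  rewrite ler_pdivlMr// h1/= ler_pdivrMr// mulrDl mulVf ?gt_eqF//.
- exact: cvg_cst.
- by rewrite -[X in _ --> X]addr0; apply: cvgD; [exact: cvg_cst|exact: cvg_iN2].
Qed.

Let r_bounds n : al - (N n)%:R^-1 <= (r n)%:~R / (N n)%:R <= al.
Proof.
have h1 : (r n)%:~R <= al * (N n)%:R by exact: ge_floor.
have h2 : al * (N n)%:R < (r n + 1)%:~R by exact: lt_succ_floor.
rewrite ler_pdivlMr// ler_pdivrMr// h1 andbT mulrBl mulVf//.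
by move: h2; rewrite intrD; lra.
Qed.

Let cvg_rN : (r n)%:~R / (N n)%:R @[n --> \oo] --> al.
Proof.
apply: (@squeeze_cvgr _ _ _ _ (fun n => al - (N n)%:R^-1) (fun=> al)).
- by apply: nearW => n; exact: r_bounds.
- by rewrite -[X in _ --> X]subr0; apply: cvgB; [exact: cvg_cst|exact: cvg_iN].
- exact: cvg_cst.
Qed.

(** The power is (1 - sin^2)^m, squeezed between exponentials by the bounds on 1 - u; m sin^2 tends
    to pi^2 s x^2. *)
Let cvg_cosX (x : R) :
  cos (pi * x / (N n)%:R) ^+ (2 * m n) @[n --> \oo] --> expR (- (pi ^+ 2 * s * x ^+ 2)).
Proof.
pose u n : R := sin (pi * x / (N n)%:R) ^+ 2.
have cvgX2 : ((N n)%:R * sin (pi * x / (N n)%:R)) ^+ 2 @[n --> \oo] --> (pi * x) ^+ 2.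
  have h : (N n)%:R * sin (pi * x / (N n)%:R) @[n --> \oo] --> pi * x.
    by apply: (cvg_sin_mul (N := fun n => (N n)%:R)) => // n; exact: NR_gt0.
  by rewrite expr2; under eq_fun do rewrite expr2; exact: cvgM.
have uE n : cos (pi * x / (N n)%:R) ^+ (2 * m n) = (1 - u n) ^+ m n.
  by rewrite exprM cos2sin2.
have mu : (m n)%:R * u n @[n --> \oo] --> pi ^+ 2 * s * x ^+ 2.
  have E n : (m n)%:R * u n = ((m n)%:R / (N n)%:R ^+ 2) * ((N n)%:R * sin (pi * x / (N n)%:R)) ^+ 2.
    by rewrite /u exprMn; field.
  under eq_fun do rewrite E.
  rewrite (_ : pi ^+ 2 * s * x ^+ 2 = s * (pi * x) ^+ 2); last by ring.
  by apply: cvgM => //; exact: cvgX2.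
have u_cvg : u n @[n --> \oo] --> (0 : R).
  have E n : u n = (N n)%:R ^- 2 * ((N n)%:R * sin (pi * x / (N n)%:R)) ^+ 2.
    by rewrite /u exprMn; field.
  under eq_fun do rewrite E.
  rewrite (_ : 0 = 0 * (pi * x) ^+ 2); last by rewrite mul0r.
  by apply: cvgM => //; exact: cvgX2.
have u0 n : 0 <= u n by exact: sqr_ge0.
under eq_fun do rewrite uE.
apply: (@squeeze_cvgr _ _ _ _ (fun n => expR (- ((m n)%:R * u n / (1 - u n)))) (fun n => expR (- ((m n)%:R * u n)))).
- near=> n.
  have u1 : u n < 1.
    by near: n; apply: (cvgr_lt _ u_cvg); rewrite ltr01.
  have h1 := expR_le_onem u1; have h2 := onem_le_expR (u n).
  have v0 : 0 <= 1 - u n by rewrite subr_ge0 ltW.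
  rewrite (_ : - ((m n)%:R * u n / (1 - u n)) = (m n)%:R * - (u n / (1 - u n))); last by rewrite mulrN -mulrA.
  rewrite -[- ((m n)%:R * u n)]mulrN !expRM_natl.
  by rewrite !lerXn2r ?nnegrE ?expR_ge0.
- apply: continuous_cvg; first exact: continuous_expR.
  apply: cvgN; rewrite -[X in _ --> X]mulr1; apply: cvgM => //.
  rewrite -[X in _ --> X]invr1; apply: cvgV; rewrite ?oner_eq0//.
  by rewrite -[X in _ --> X]subr0; apply: cvgB => //; exact: cvg_cst.
- by apply: continuous_cvg; [exact: continuous_expR|exact: cvgN].
Unshelve. all: by end_near. Qed.

Let F n (z : R) : R := cos (pi * (z + th) / (N n)%:R) ^+ (2 * m n) *
  cos (2 * pi * (r n)%:~R * (z + th) / (N n)%:R + et).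

Let G (z : R) : R := expR (- (pi ^+ 2 * s * (z + th) ^+ 2)) * cos (2 * pi * al * (z + th) + et).

Let win n (z : int) : bool := (- (H n)%:Z <= z) && (z < (H n)%:Z).

Let cvg_F (z : R) : F n z @[n --> \oo] --> G z.
Proof.
apply: cvgM; first exact: cvg_cosX.
apply: continuous_cvg; first exact: continuous_cos.
apply: cvgD; last exact: cvg_cst.
have E n : 2 * pi * (r n)%:~R * (z + th) / (N n)%:R = ((r n)%:~R / (N n)%:R) * (2 * pi * (z + th)).
  by field.
under eq_fun do rewrite E.
by rewrite (_ : 2 * pi * al * _ = al * (2 * pi * (z + th))); [apply: cvgMl|ring].
Qed.

Let th_le n : `|th| <= (H n)%:R / 2.
Proof.
have := @truncnS_gt R (2 * `|th|); rewrite -/n0 => h.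
have : n0%:R <= (H n)%:R :> R by rewrite ler_nat /H leq_addl.
by move: h; move: (`|th|) ((H n)%:R : R) (n0%:R : R) => a b c; lra.
Qed.

(** The majorant is independent of n: inside the window the argument is at most 3 pi/4 in absolute
    value, where sin^2 is bounded below by a quadratic, and m >= s N^2 cancels N^2. *)
Let F_le n (z : int) : `|F n z%:~R * (win n z)%:R| <= expR (- (pi ^+ 2 * s / 64 * (z%:~R + th) ^+ 2)).
Proof.
have [/andP[z1 z2]|_] := boolP (win n z); last by rewrite mulr0 normr0 expR_ge0.
rewrite mulr1 /F normrM -[leRHS]mulr1; apply: ler_pM => //; last exact: cos_max.
set x := z%:~R + th.
have xb : `|x| <= 3 / 2 * (H n)%:R.
  apply: le_trans (ler_normD _ _) _.
  have h1 : `|z%:~R| <= (H n)%:R :> R.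
    by rewrite ler_norml -[_%:R]/((Posz (H n))%:~R) -mulrNz !ler_int z1/= ltW.
  by have := th_le n; move: h1; move: (`|z%:~R|) (`|th|) ((H n)%:R : R) => a b c; lra.
have yb : `|pi * x / (N n)%:R| <= 3 / 4 * pi.
  rewrite !normrM normfV (gtr0_norm (NR_gt0 n)) (gtr0_norm (pi_gt0 R)) ler_pdivrMr//.
  rewrite (_ : 3 / 4 * pi * (N n)%:R = pi * (3 / 2 * (H n)%:R)); last by rewrite /N natrM; field.
  by rewrite ler_pM2l ?pi_gt0.
rewrite exprM cos2sin2 ger0_norm; last by rewrite exprn_ge0// subr_ge0 sin2cos2 lerBlDr lerDl sqr_ge0.
have v0 : 0 <= 1 - sin (pi * x / (N n)%:R) ^+ 2 by rewrite subr_ge0 sin2cos2 lerBlDr lerDl sqr_ge0.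
apply: (@le_trans _ _ (expR (- (sin (pi * x / (N n)%:R) ^+ 2)) ^+ m n)).
  by rewrite lerXn2r ?nnegrE ?expR_ge0// onem_le_expR.
rewrite -expRM_natl ler_expR mulrN lerN2.
have h1 := sqr_sin_ge yb; have /andP[h2 _] := m_bounds n.
apply: (@le_trans _ _ (s * (N n)%:R ^+ 2 * ((pi * x / (N n)%:R) ^+ 2 / 64))).
  by rewrite le_eqVlt; apply/orP; left; apply/eqP; field.
apply: ler_pM => //; first by rewrite mulr_ge0 ?(ltW s0)// exprn_ge0.
by rewrite divr_ge0// sqr_ge0.
Qed.

Let cvg_lhs : \sum_(j < N n) F n (j%:R - (H n)%:R) @[n --> \oo] -->
  tsum (fun z : int => G z%:~R).
Proof.
have E n : \sum_(j < N n) F n (j%:R - (H n)%:R) = tsum (fun z : int => F n z%:~R * (win n z)%:R).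
  pose sq : seq int := [seq (j%:Z - (H n)%:Z) | j <- iota 0 (N n)].
  have [||_ ->] := @tsum_seq R int sq (fun z : int => F n z%:~R * (win n z)%:R).
  - by rewrite map_inj_uniq ?iota_uniq// => a b; lia.
  - move=> z zs; suff /negbTE -> : ~~ win n z by rewrite mulr0.
    apply: contra zs => /andP[z1 z2]; apply/mapP; exists (absz (z + (H n)%:Z)%R); last by lia.
    by rewrite mem_iota /N; lia.
  rewrite big_map -(big_mkord xpredT (fun j => F n (j%:R - (H n)%:R))) /index_iota subn0.
  rewrite big_seq [RHS]big_seq; apply: eq_bigr => j; rewrite mem_iota => jN.
  rewrite (_ : win n _) ?mulr1; last by rewrite /win; move: jN; rewrite /N; lia.
  by rewrite intrB.
under eq_fun do rewrite E.
have c0 : 0 < pi ^+ 2 * s / 64 by rewrite divr_gt0// mulr_gt0// exprn_gt0// pi_gt0.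
apply: (@tannery _ _ (fun n z => F n z%:~R * (win n z)%:R) _ _ (tsummable_gauss th c0) F_le _).2 => z.
rewrite -[X in _ --> X]mulr1; apply: cvgM; first exact: cvg_F.
apply: cvg_near_cst; near=> n.
suff -> : win n z by [].
have zn : (absz z < n)%N by near: n; exact: nbhs_infty_gt.
by rewrite /win /H; lia.
Unshelve. all: by end_near. Qed.

Let rz n (k : int) : nat := absz (k * (N n)%:Z - r n)%R.

Let rzE n (k : int) : ((rz n k)%:R : R) = `|k%:~R - (r n)%:~R / (N n)%:R| * (N n)%:R.
Proof.
rewrite /rz -[LHS]/((Posz _)%:~R) abszE intr_norm intrB intrM -pmulrn.
rewrite -[X in _ = _ * X](gtr0_norm (NR_gt0 n)) -normrM mulrBl divfK//.
Qed.

(** With l = |k N - r| the bounds hold for D = m + l and D = m - l. After division by N^2 both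
    denominators tend to s, since l is O(N) and m is of order N^2. *)
Let cvg_rho (k : int) : rho R (m n) (rz n k) @[n --> \oo] --> expR (- ((k%:~R - al) ^+ 2 / s)).
Proof.
pose v n : R := `|k%:~R - (r n)%:~R / (N n)%:R|.
have cv : v n @[n --> \oo] --> `|k%:~R - al|.
  by apply: cvg_norm; apply: cvgB => //; exact: cvg_cst.
have lo : v n ^+ 2 / ((m n)%:R / (N n)%:R ^+ 2 - v n / (N n)%:R) @[n --> \oo] --> (k%:~R - al) ^+ 2 / s.
  rewrite -(real_normK (num_real (k%:~R - al))).
  apply: cvgM; first by rewrite expr2; under eq_fun do rewrite expr2; exact: cvgM.
  apply: cvgV; first by rewrite gt_eqF.
  rewrite -[X in _ --> X]subr0 -(mulr0 `|k%:~R - al|); apply: cvgB => //.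
  exact: cvgM.
have up : v n ^+ 2 / ((m n)%:R / (N n)%:R ^+ 2 + v n / (N n)%:R) @[n --> \oo] --> (k%:~R - al) ^+ 2 / s.
  rewrite -(real_normK (num_real (k%:~R - al))).
  apply: cvgM; first by rewrite expr2; under eq_fun do rewrite expr2; exact: cvgM.
  apply: cvgV; first by rewrite gt_eqF.
  rewrite -[X in _ --> X]addr0 -(mulr0 `|k%:~R - al|); apply: cvgD => //.
  exact: cvgM.
apply: (@squeeze_cvgr _ _ _ _
  (fun n => expR (- (v n ^+ 2 / ((m n)%:R / (N n)%:R ^+ 2 - v n / (N n)%:R))))
  (fun n => expR (- (v n ^+ 2 / ((m n)%:R / (N n)%:R ^+ 2 + v n / (N n)%:R))))); first last.
- by apply: continuous_cvg; [exact: continuous_expR|exact: cvgN].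
- by apply: continuous_cvg; [exact: continuous_expR|exact: cvgN].
near=> n.
have pos : 0 < (m n)%:R / (N n)%:R ^+ 2 - v n / (N n)%:R.
  near: n; apply: (@cvgr_gt _ _ _ _ _ s) => //.
  rewrite -[X in _ --> X]subr0 -(mulr0 `|k%:~R - al|); apply: cvgB => //.
  exact: cvgM.
have N2 : 0 < (N n)%:R ^+ 2 :> R by rewrite exprn_gt0.
have E1 : (N n)%:R ^+ 2 * ((m n)%:R / (N n)%:R ^+ 2 - v n / (N n)%:R) = (m n)%:R - (rz n k)%:R.
  by rewrite rzE -/(v n); field.
have E2 : (N n)%:R ^+ 2 * ((m n)%:R / (N n)%:R ^+ 2 + v n / (N n)%:R) = (m n)%:R + (rz n k)%:R.
  by rewrite rzE -/(v n); field.
have lm : (rz n k < m n)%N.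
  by rewrite -(ltr_nat R) -subr_gt0 -E1 mulr_gt0.
have E3 : forall D, D != 0 -> v n ^+ 2 / D = (rz n k)%:R ^+ 2 / ((N n)%:R ^+ 2 * D).
  move=> D D0; rewrite rzE -/(v n); have := NR_neq0 n.
  by move: (N n)%:R => NN NN0; field; rewrite D0 NN0.
have m0 : 0 < (m n)%:R :> R by rewrite ltr0n.
have pos2 : 0 < (m n)%:R / (N n)%:R ^+ 2 + v n / (N n)%:R.
  by apply: ltr_wpDr; [exact: divr_ge0 (normr_ge0 _) (ler0n _ _)|exact: divr_gt0].
rewrite !E3 ?gt_eqF// E1 E2; apply/andP; split.
  apply: (@rho_ge R (m n) (rz n k)) => //; first exact: ltnW.
    by rewrite subr_gt0 ltr_nat.
  rewrite natrD natrB; last exact: ltnW.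
  by rewrite lerDl.
apply: (@rho_le R (m n) (rz n k)) => //; first exact: ltnW.
  by rewrite ltr_pwDl.
by rewrite natrD.
Unshelve. all: by end_near. Qed.

Let cvg_rhs : tsum (fun k : int => rho R (m n) (rz n k) * cos (2 * pi * k%:~R * th + et)) @[n --> \oo] -->
  tsum (fun k : int => expR (- ((k%:~R - al) ^+ 2 / s)) * cos (2 * pi * k%:~R * th + et)).
Proof.
have c0 : 0 < (2 * (s + 1))^-1 by rewrite invr_gt0 mulr_gt0// addr_gt0.
have [M M0 hM] := gauss_le_inv_sqr (`|al| + 1) c0.
apply: (@tannery _ _ (fun n k => rho R (m n) (rz n k) * cos (2 * pi * k%:~R * th + et)) _ _ (tsummableZ M (tsummable_inv_sqr R)) _ _).2 => [n k|k]; last first.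
  by apply: cvgM; [exact: cvg_rho|exact: cvg_cst].
rewrite normrM (ger0_norm (rho_ge0 _ _ _)).
have b1 : `|- ((r n)%:~R / (N n)%:R)| <= `|al| + 1.
  have /andP[h1 h2] := r_bounds n.
  have h3 : (N n)%:R^-1 <= 1 :> R by rewrite invf_le1// ler1n.
  have := ler_norm al; have := ler_norm (- al); rewrite !normrN ler_norml.
  by move: h1 h2 h3; set a := (_ / _); set b := (_ ^-1); lra.
apply: le_trans (hM k%:~R _ b1).
rewrite -[leRHS]mulr1; apply: ler_pM => //; [exact: rho_ge0| |exact: cos_max].
have [lm|lm] := leqP (rz n k) (m n); last first.
  by rewrite /rho bin_small ?mul0r ?expR_ge0//; lia.
have m0 : 0 < (m n)%:R :> R by rewrite ltr0n.
(* For l <= m the upper bound holds with D = 2 m, and m <= (s + 1) N^2 makes it a Gaussian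
   independent of n; for l > m the ratio vanishes. *)
apply: (@le_trans _ _ (expR (- ((rz n k)%:R ^+ 2 / (2 * (m n)%:R))))).
  apply: (@rho_le R (m n) (rz n k)) => //; first by rewrite mulr_gt0.
  by rewrite -natrM ler_nat; lia.
rewrite ler_expR lerN2 rzE exprMn real_normK ?num_real//.
rewrite [leLHS]mulrC -[leRHS]mulrA; apply: ler_wpM2l; first exact: sqr_ge0.
rewrite ler_pdivlMr ?mulr_gt0// mulrC ler_pdivrMr ?mulr_gt0 ?addr_gt0//.
have /andP[_ h2] := m_bounds n.
have : 1 <= (N n)%:R ^+ 2 :> R by rewrite exprn_ege1// ler1n.
by move: h2; move: ((m n)%:R : R) ((N n)%:R ^+ 2 : R) => a b; nra.
Qed.

Let C n : R := (N n)%:R * ('C(2 * m n, m n)%:R / 4 ^+ m n).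

(** The prefactor is the square root of the Wallis sequence divided by m/N^2. *)
Let cvg_C : C n @[n --> \oo] --> Num.sqrt (limn (@wallis R) / s).
Proof.
have CE n : C n = Num.sqrt (@wallis R (m' n) / ((m n)%:R / (N n)%:R ^+ 2)).
  have C0 : 0 <= C n by rewrite /C mulr_ge0// divr_ge0// exprn_ge0.
  rewrite -[LHS]ger0_norm// -sqrtr_sqr; congr Num.sqrt.
  have m0 : (m n)%:R != 0 :> R by rewrite pnatr_eq0.
  rewrite /wallis -/(m n) /C exprMn; have := NR_neq0 n.
  move: ('C(_, _)%:R / _) ((N n)%:R : R) m0 => x y; move: ((m n)%:R : R) => z z0 y0.
  by field; rewrite z0 y0.
under eq_fun do rewrite CE.
apply: continuous_cvg; first exact: sqrt_continuous.
apply: cvgM; last by apply: cvgV => //; rewrite gt_eqF.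
have cm : m' n @[n --> \oo] --> \oo.
  apply/cvgnyPge => A; near=> n.
  have : A%:R + 1 <= s * n%:R ^+ 2.
    near: n; exists (Num.truncn ((A%:R + 1) / s)).+1 => // k /= kn.
    have h : (A%:R + 1) / s < k%:R.
      by apply: lt_le_trans (truncnS_gt _) _; rewrite ler_nat.
    move: h; rewrite ltr_pdivrMr// => /ltW/le_trans; apply.
    by rewrite mulrC ler_pM2l// -natrX ler_nat; nia.
  move=> h; rewrite -ltnS -/(m n) -(ltr_nat R).
  have /andP[h2 _] := m_bounds n; apply: lt_le_trans h2.
  have : s * n%:R ^+ 2 <= s * (N n)%:R ^+ 2.
    by rewrite ler_pM2l// lerXn2r ?nnegrE// ler_nat n_le_N.
  by move: h; move: (A%:R : R) (s * _) (s * _) => a b c; lra.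
by apply: cvg_comp cm _; exact: cvg_wallis.
Unshelve. all: by end_near. Qed.

Lemma polya_theta : tsum (fun z : int => G z%:~R) =
  Num.sqrt (limn (@wallis R) / s) *
  tsum (fun k : int => expR (- ((k%:~R - al) ^+ 2 / s)) * cos (2 * pi * k%:~R * th + et)).
Proof.
have c1 := cvgM cvg_C cvg_rhs.
suff E : (fun n => \sum_(j < N n) F n (j%:R - (H n)%:R)) = (fun n => C n * tsum (fun k : int => rho R (m n) (rz n k) * cos (2 * pi * k%:~R * th + et))).
  by have := cvg_lhs; rewrite E => c2; exact: (cvg_unique _ c2 (c1 _)).
apply/funext => n.
have [_ /=] := @polya_finite R (N n) (m n) (r n) (th - (H n)%:R) et (N_gt0 n).
rewrite (eq_bigr (fun j : 'I_(N n) => F n (j%:R - (H n)%:R))) => [->|j _]; last first.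
  by rewrite /F addrA [_ + th - _]addrAC.
rewrite /C -!mulrA; congr (_ * _); rewrite mulrCA; congr (_ * _).
have sr : tsummable (fun k : int => rho R (m n) (rz n k) * cos (2 * pi * k%:~R * th + et)).
  have := (@polya_finite R (N n) (m n) (r n) th et (N_gt0 n)).1.
  move/(tsummableZ ('C(2 * m n, m n)%:R^-1)); apply: eq_tsummable => k.
  by rewrite /rho /binZ mulrA [_^-1 * _]mulrC.
rewrite -tsumZ//; apply: eq_tsum => k.
rewrite mulrA; congr (_ * _).
  by rewrite /rho /binZ mulrCA divff ?mulr1// gt_eqF// bin2m_gt0.
rewrite -[RHS](cosD2pi_int _ (- (k * (H n)%:Z))); congr cos.
by rewrite mulrNz intrM -pmulrn; ring.
Qed.

End polya_limit.

(** At s = 1/pi and zero shift both sides of the limit identity are the same positive theta value,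
    so the unknown constant is forced to be 1. *)
Lemma lim_wallis (R : realType) : limn (@wallis R) = pi^-1.
Proof.
have pi0 := @pi_gt0 R.
have := @polya_theta R pi^-1 0 0 0; rewrite invr_gt0 pi0 => /(_ isT).
pose th0 := tsum (fun k : int => expR (- (pi * (k%:~R : R) ^+ 2))).
have e1 : tsum (fun z : int => expR (- (pi ^+ 2 * pi^-1 * (z%:~R + 0) ^+ 2)) * cos (2 * pi * 0 * (z%:~R + 0) + 0)) = th0.
  apply: eq_tsum => k; rewrite !addr0 mulr0 mul0r cos0 mulr1; congr (expR (- _)).
  by have := lt0r_neq0 pi0; move: (pi : R) => p pn0; field.
have e2 : tsum (fun k : int => expR (- ((k%:~R - 0) ^+ 2 / pi^-1)) * cos (2 * pi * k%:~R * 0 + 0)) = th0.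
  by apply: eq_tsum => k; rewrite !subr0 mulr0 addr0 cos0 mulr1 invrK mulrC.
rewrite e1 e2 invrK.
have th0_gt0 : 0 < th0.
  have su : tsummable (fun k : int => expR (- (pi * (k%:~R : R) ^+ 2))).
    by have := tsummable_gauss 0 pi0; apply: eq_tsummable => k; rewrite addr0.
  have : \sum_(x <- [:: (0 : int)]) expR (- (pi * (x%:~R : R) ^+ 2)) <= th0.
    by apply: sum_le_tsum => // x; exact: expR_ge0.
  by rewrite big_seq1; apply: lt_le_trans; exact: expR_gt0.
move=> E; have {}E : Num.sqrt (limn (@wallis R) * pi) = 1.
  by apply: (mulIf (lt0r_neq0 th0_gt0)); rewrite mul1r.
have p0 : 0 <= limn (@wallis R) * pi.
  apply: mulr_ge0; last exact: ltW.
  apply: limr_ge; first exact: cvg_wallis.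
  by apply: nearW => n; rewrite /wallis mulr_ge0 ?sqr_ge0.
have : limn (@wallis R) * pi = 1 by rewrite -[LHS]sqr_sqrtr// E expr1n.
by move=> h; rewrite -[RHS]mul1r -h mulfK// gt_eqF.
Qed.

(** The free phase [et] replaces complex exponentials: et = 0 and et = - pi/2 give the cosine and
    the sine form. *)
Lemma theta_inversion (R : realType) (t al th et : R) : 0 < t ->
  tsum (fun k : int => expR (- (pi * t * (k%:~R + al) ^+ 2)) * cos (2 * pi * th * (k%:~R + al) + et)) =
  (Num.sqrt t)^-1 *
  tsum (fun k : int => expR (- (pi * (k%:~R - th) ^+ 2 / t)) * cos (2 * pi * k%:~R * al + et)).
Proof.
move=> t0; have pi0 := @pi_gt0 R.
have s0 : 0 < t / pi by rewrite divr_gt0.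
have := polya_theta al th et s0; rewrite lim_wallis.
have pn0 := lt0r_neq0 pi0; have tn0 := lt0r_neq0 t0.
rewrite (_ : pi^-1 / (t / pi) = t^-1); last by move: (pi : R) pn0 => p pn0; field; rewrite tn0 pn0.
rewrite sqrtrV; last exact: ltW.
rewrite (_ : tsum _ = tsum (fun k : int => expR (- (pi * t * (k%:~R + al) ^+ 2)) * cos (2 * pi * th * (k%:~R + al) + et))); last first.
  by apply: eq_tsum => k; congr (expR (- _) * _); move: (pi : R) pn0 => p pn0; field.
move=> ->; congr (_ * _); apply: eq_tsum => k; congr (expR (- _) * _).
by move: (pi : R) pn0 => p pn0; field; rewrite tn0 pn0.
Qed.

(** * Injective reindexing and splitting into residue classes *)

Section reindex.
Variable R : realType.
Implicit Types T U : PCount.type.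

Lemma tsum_reindex_inj T U (e : T -> U) (f : U -> R) : injective e ->
  tsummable f -> (forall y, f y != 0 -> exists x, y = e x) ->
  tsum (f \o e) = tsum f.
Proof.
move=> inje sf fe.
have c1 := @tsum_approx R T (exhaust T) (f \o e) (tsummable_reindex inje sf)
  (exhaust_uniq T) (@mem_exhaust T).
have us n : uniq (map e (exhaust T n)) by rewrite map_inj_uniq// exhaust_uniq.
have E : (fun n => \sum_(x <- exhaust T n) (f \o e) x) =
         (fun n => tsum (fun y => f y * (y \in map e (exhaust T n))%:R)).
  apply/funext => n.
  have h y : y \notin map e (exhaust T n) -> f y * (y \in map e (exhaust T n))%:R = 0.
    by move=> /negbTE ->; rewrite mulr0.
  have [_ ->] := @tsum_seq R U _ (fun y => f y * (y \in map e (exhaust T n))%:R) (us n) h.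
  rewrite -(big_map e xpredT f) big_seq [RHS]big_seq.
  by apply: eq_bigr => y ->; rewrite mulr1.
have c2 : tsum (fun y => f y * (y \in map e (exhaust T n))%:R) @[n --> \oo] --> tsum f.
  apply: (@tannery R U (fun n y => f y * (y \in map e (exhaust T n))%:R) f (fun y => `|f y|) (tsummable_norm sf) _ _).2.
    by move=> n y; case: (_ \in _); rewrite ?mulr1 ?mulr0 ?normr0.
  move=> y; have [->|/fe[x ->]] := eqVneq (f y) 0.
    by under eq_fun do rewrite mul0r; exact: cvg_cst.
  apply: cvg_near_cst; have := mem_exhaust x; apply: filterS => n xn.
  by rewrite map_f// mulr1.
by rewrite E in c1; exact: (cvg_unique _ c1 c2).
Qed.

Lemma tsum_residues2 (N1 N2 : nat) (f : int * int -> R) : (0 < N1)%N -> (0 < N2)%N ->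
  tsummable f ->
  tsum f = \sum_(i < N1) \sum_(j < N2)
    tsum (fun y : int * int => f (i%:Z + N1%:Z * y.1, j%:Z + N2%:Z * y.2)).
Proof.
move=> N10 N20 sf.
pose g (i : 'I_N1) (j : 'I_N2) (x : int * int) : R :=
  f x * ((x.1 %% N1)%Z == i%:Z)%:R * ((x.2 %% N2)%Z == j%:Z)%:R.
have sg i j : tsummable (g i j).
  apply: tsummable_le (tsummable_norm sf) => x; rewrite /g.
  by do 2 case: (_ == _); rewrite ?mulr0 ?mulr1 ?normr0.
have fE x : f x = \sum_(i < N1) \sum_(j < N2) g i j x.
  have p1 : (`|(x.1 %% N1)%Z| < N1)%N.
    by have := ltz_pmod x.1 (_ : 0 < N1%:Z); have := modz_ge0 x.1 (_ : N1%:Z != 0); lia.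
  have p2 : (`|(x.2 %% N2)%Z| < N2)%N.
    by have := ltz_pmod x.2 (_ : 0 < N2%:Z); have := modz_ge0 x.2 (_ : N2%:Z != 0); lia.
  have e1 : ((`|(x.1 %% N1)%Z|%N)%:Z = (x.1 %% N1)%Z)%R by rewrite gez0_abs// modz_ge0//; lia.
  have e2 : ((`|(x.2 %% N2)%Z|%N)%:Z = (x.2 %% N2)%Z)%R by rewrite gez0_abs// modz_ge0//; lia.
  rewrite (bigD1 (Ordinal p1))//= [X in _ + X]big1 ?addr0; last first.
    move=> i ni; rewrite big1// => j _; rewrite /g (_ : _ == _ = false) ?mulr0 ?mul0r//.
    apply/eqP => h; case/eqP: ni; apply: val_inj => /=; lia.
  rewrite (bigD1 (Ordinal p2))//= [X in _ + X]big1 ?addr0; last first.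
    move=> j nj; rewrite /g; case: (eqVneq (x.2 %% N2)%Z) => [h|_]; last by rewrite mulr0.
    by case/eqP: nj; apply: val_inj => /=; lia.
  by rewrite /g /= e1 e2 !eqxx !mulr1.
rewrite (eq_tsum fE) tsum_sum => [|i _]; last by apply: tsummable_sum => j _.
apply: eq_bigr => i _; rewrite tsum_sum => [|j _]; last exact: sg.
apply: eq_bigr => j _.
pose e (y : int * int) : int * int := (i%:Z + N1%:Z * y.1, j%:Z + N2%:Z * y.2).
rewrite -(@tsum_reindex_inj _ _ e (g i j))//.
- apply: eq_tsum => y; rewrite /g /e /=.
  by rewrite !(addrC _%:Z) !(mulrC _%:Z) !modzMDl !modz_small ?eqxx ?mulr1//;
     have := ltn_ord i; have := ltn_ord j; lia.
- by move=> [y1 y2] [z1 z2] [h1 h2]; congr pair; nia.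
- move=> [x1 x2]; rewrite /g /=.
  case: ((x1 %% N1)%Z =P i%:Z) => [h1|_]; last by rewrite mulr0 mul0r eqxx.
  case: ((x2 %% N2)%Z =P j%:Z) => [h2|_]; last by rewrite mulr0 eqxx.
  move=> _; exists ((x1 %/ N1)%Z, (x2 %/ N2)%Z); rewrite /e /=.
  by rewrite -h1 -h2 {1}(divz_eq x1 N1) {1}(divz_eq x2 N2); congr pair; ring.
Qed.

End reindex.

(** * Theta inversion for a binary positive form *)

Section theta2.
Variable R : realType.

(** Determinant over trace is a lower bound for the least eigenvalue. With m this quotient, (A -
    m)(C - m) - B^2 = m^2, so the difference of the two forms is nonnegative. *)
Lemma quad_form_ge (A B C x y : R) : 0 < A -> 0 < A * C - B ^+ 2 ->
  (A * C - B ^+ 2) / (A + C) * (x ^+ 2 + y ^+ 2) <= A * x ^+ 2 + 2 * B * x * y + C * y ^+ 2.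
Proof.
move=> A0 D0.
have C0 : 0 < C by nra.
have S0 : 0 < A + C by rewrite addr_gt0.
set m := (_ / _).
have mE : m * (A + C) = A * C - B ^+ 2 by rewrite /m divfK// gt_eqF.
have m0 : 0 < m by rewrite divr_gt0.
have Am : 0 < A - m by have := sqr_ge0 B; nra.
rewrite -subr_ge0 -(pmulr_rge0 _ Am).
have K : (A - m) * (C - m) - B ^+ 2 = m ^+ 2.
  have : (A - m) * (C - m) = A * C - m * (A + C) + m ^+ 2 by ring.
  by rewrite mE => ->; ring.
have -> : (A - m) * (A * x ^+ 2 + 2 * B * x * y + C * y ^+ 2 - m * (x ^+ 2 + y ^+ 2)) =
  ((A - m) * x + B * y) ^+ 2 + ((A - m) * (C - m) - B ^+ 2) * y ^+ 2 by ring.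
by rewrite K; apply: addr_ge0; [|apply: mulr_ge0]; exact: sqr_ge0.
Qed.

Lemma tsummable_gauss2 (A B C a1 a2 : R) : 0 < A -> 0 < A * C - B ^+ 2 ->
  tsummable (fun z : int * int => expR (- (A * (z.1%:~R + a1) ^+ 2 +
    2 * B * (z.1%:~R + a1) * (z.2%:~R + a2) + C * (z.2%:~R + a2) ^+ 2))).
Proof.
move=> A0 D0; have C0 : 0 < C by nra.
have m0 : 0 < (A * C - B ^+ 2) / (A + C) by rewrite divr_gt0// addr_gt0.
have := tsummable_prod (tsummable_gauss a1 m0) (tsummable_gauss a2 m0).
apply: tsummable_le => z; rewrite ger0_norm ?expR_ge0// -expRD ler_expR.
have := quad_form_ge (z.1%:~R + a1) (z.2%:~R + a2) A0 D0.
by set m := (_ / _); lra.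
Qed.

Lemma theta2_inversion (A B C a1 a2 : R) : 0 < A -> 0 < A * C - B ^+ 2 ->
  tsum (fun z : int * int => expR (- (pi * (A * (z.1%:~R + a1) ^+ 2 +
    2 * B * (z.1%:~R + a1) * (z.2%:~R + a2) + C * (z.2%:~R + a2) ^+ 2)))) =
  (Num.sqrt (A * C - B ^+ 2))^-1 *
  tsum (fun z : int * int => expR (- (pi * (C * z.1%:~R ^+ 2 -
    2 * B * z.1%:~R * z.2%:~R + A * z.2%:~R ^+ 2) / (A * C - B ^+ 2))) *
    cos (2 * pi * (z.1%:~R * a1 + z.2%:~R * a2))).
Proof.
move=> A0 D0; have C0 : 0 < C by nra.
have pi0 := @pi_gt0 R.
set D := A * C - B ^+ 2 in D0 *.
have Cn0 : C != 0 by rewrite gt_eqF.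
have Dn0 : D != 0 by rewrite gt_eqF.
have piA : 0 < pi * A by rewrite mulr_gt0.
have piD : 0 < (pi * A) * (pi * C) - (pi * B) ^+ 2.
  by rewrite (_ : _ - _ = pi ^+ 2 * D) ?mulr_gt0 ?exprn_gt0//; rewrite /D; ring.
have s1 := tsummable_gauss2 a1 a2 piA piD.
rewrite (eq_tsum (g := fun z : int * int => expR (- (pi * A * (z.1%:~R + a1) ^+ 2 +
    2 * (pi * B) * (z.1%:~R + a1) * (z.2%:~R + a2) + pi * C * (z.2%:~R + a2) ^+ 2)))); last first.
  by move=> z; congr (expR (- _)); ring.
rewrite (tsum_pair s1).2 /=.
(* For fixed z1 the square in z2 is completed: the offset moves by B/C times z1 + a1, and D/C
   remains as coefficient of the square of z1 + a1. *)
have E1 (z1 : int) : tsum (fun y : int => expR (- (pi * A * (z1%:~R + a1) ^+ 2 +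
    2 * (pi * B) * (z1%:~R + a1) * (y%:~R + a2) + pi * C * (y%:~R + a2) ^+ 2))) =
  tsum (fun k : int => (Num.sqrt C)^-1 * (expR (- (pi * (D / C) * (z1%:~R + a1) ^+ 2)) *
      expR (- (pi * k%:~R ^+ 2 / C)) * cos (2 * pi * (k%:~R * B / C) * (z1%:~R + a1) + 2 * pi * k%:~R * a2))).
  have := theta_inversion (a2 + B / C * (z1%:~R + a1)) 0 0 C0.
  set w := z1%:~R + a1 => T.
  have sw : tsummable (fun k : int => expR (- (pi * k%:~R ^+ 2 / C)) * cos (2 * pi * (k%:~R * B / C) * w + 2 * pi * k%:~R * a2)).
    have c0 : 0 < pi / C by rewrite divr_gt0.
    apply: tsummable_le (tsummable_gauss 0 c0) => k.
    rewrite normrM ger0_norm ?expR_ge0// addr0 -[leRHS]mulr1 ler_pM ?expR_ge0 ?cos_max//.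
    by rewrite [pi / C * _]mulrAC.
  transitivity (expR (- (pi * (D / C) * w ^+ 2)) * ((Num.sqrt C)^-1 * tsum (fun k : int => expR (- (pi * k%:~R ^+ 2 / C)) * cos (2 * pi * (k%:~R * B / C) * w + 2 * pi * k%:~R * a2)))).
    have -> : tsum (fun k : int => expR (- (pi * k%:~R ^+ 2 / C)) * cos (2 * pi * (k%:~R * B / C) * w + 2 * pi * k%:~R * a2)) =
      tsum (fun k : int => expR (- (pi * (k%:~R - 0) ^+ 2 / C)) * cos (2 * pi * k%:~R * (a2 + B / C * w) + 0)).
      by apply: eq_tsum => k; rewrite subr0 addr0; congr (_ * cos _); field.
    rewrite -T -tsumZ; last first.
      have c0 : 0 < pi * C by rewrite mulr_gt0.
      have := tsummable_gauss (a2 + B / C * w) c0; apply: eq_tsummable => k.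
      by rewrite mulr0 mul0r add0r cos0 mulr1.
    apply: eq_tsum => k; rewrite mulr0 mul0r add0r cos0 mulr1 -expRD; congr expR.
    by rewrite /D; field.
  rewrite mulrCA -tsumZ// -tsumZ; last exact: tsummableZ.
  by apply: eq_tsum => k; rewrite -!mulrA.
rewrite (eq_tsum E1).
have c1 : 0 < pi / C by rewrite divr_gt0.
have c2 : 0 < pi * (D / C) by rewrite mulr_gt0// divr_gt0.
rewrite tsum_swap; last first.
  have := tsummableZ (Num.sqrt C)^-1 (tsummable_prod (tsummable_gauss a1 c2) (tsummable_gauss 0 c1)).
  apply: tsummable_le => z; rewrite normrM ger0_norm ?invr_ge0 ?sqrtr_ge0//.
  rewrite ler_wpM2l ?invr_ge0 ?sqrtr_ge0// normrM (ger0_norm (mulr_ge0 (expR_ge0 _) (expR_ge0 _))).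
  rewrite addr0 -[leRHS]mulr1 ler_pM ?mulr_ge0 ?expR_ge0 ?cos_max//.
  by rewrite [pi / C * _]mulrAC.
(* After the exchange of sums the z1-sum is again of theta type, with frequency k B/C and a phase
   from the first inversion. *)
have E2 (k : int) : tsum (fun z1 : int => (Num.sqrt C)^-1 * (expR (- (pi * (D / C) * (z1%:~R + a1) ^+ 2)) *
      expR (- (pi * k%:~R ^+ 2 / C)) * cos (2 * pi * (k%:~R * B / C) * (z1%:~R + a1) + 2 * pi * k%:~R * a2))) =
  tsum (fun j : int => (Num.sqrt D)^-1 * (expR (- (pi * (C * j%:~R ^+ 2 - 2 * B * j%:~R * k%:~R + A * k%:~R ^+ 2) / D)) *
    cos (2 * pi * (j%:~R * a1 + k%:~R * a2)))).
  have DC0 : 0 < D / C by rewrite divr_gt0.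
  have := theta_inversion a1 (k%:~R * B / C) (2 * pi * k%:~R * a2) DC0.
  set th := k%:~R * B / C; set et := 2 * pi * k%:~R * a2 => T.
  have sj : tsummable (fun j : int => expR (- (pi * (j%:~R - th) ^+ 2 / (D / C))) * cos (2 * pi * j%:~R * a1 + et)).
    have c0 : 0 < pi / (D / C) by rewrite divr_gt0.
    apply: tsummable_le (tsummable_gauss (- th) c0) => j.
    rewrite normrM ger0_norm ?expR_ge0// -[leRHS]mulr1 ler_pM ?expR_ge0 ?cos_max//.
    by rewrite [pi / (D / C) * _]mulrAC.
  have sz : tsummable (fun z1 : int => expR (- (pi * (D / C) * (z1%:~R + a1) ^+ 2)) * cos (2 * pi * th * (z1%:~R + a1) + et)).
    apply: tsummable_le (tsummable_gauss a1 c2) => j.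
    by rewrite normrM ger0_norm ?expR_ge0// -[leRHS]mulr1 ler_pM ?expR_ge0 ?cos_max.
  transitivity (((Num.sqrt C)^-1 * expR (- (pi * k%:~R ^+ 2 / C))) * ((Num.sqrt (D / C))^-1 * tsum (fun j : int => expR (- (pi * (j%:~R - th) ^+ 2 / (D / C))) * cos (2 * pi * j%:~R * a1 + et)))).
    rewrite -T -tsumZ//; apply: eq_tsum => z1; ring.
  rewrite mulrA -tsumZ//.
  apply: eq_tsum => j.
  rewrite sqrtrM ?(ltW D0)// sqrtrV ?(ltW C0)// invfM invrK.
  have sC : Num.sqrt C != 0 by rewrite gt_eqF// sqrtr_gt0.
  have sD : Num.sqrt D != 0 by rewrite gt_eqF// sqrtr_gt0.
  rewrite [X in X * _](_ : _ = (Num.sqrt D)^-1 * expR (- (pi * k%:~R ^+ 2 / C))); last by field; rewrite sC sD.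
  rewrite -[LHS]mulrA; congr (_ * _); rewrite mulrA -expRD; congr (expR _ * cos _).
    rewrite /th; move: Dn0; rewrite /D => Dn0; field; by rewrite Cn0 Dn0.
  by rewrite /et; ring.
rewrite (eq_tsum E2) tsum_swap; last first.
  have B2 : 0 < pi / D * C by rewrite mulr_gt0// divr_gt0.
  have D2 : 0 < (pi / D * C) * (pi / D * A) - (- (pi / D * B)) ^+ 2.
    have -> : (pi / D * C) * (pi / D * A) - (- (pi / D * B)) ^+ 2 = (pi / D) ^+ 2 * (A * C - B ^+ 2) by ring.
    by rewrite mulr_gt0// exprn_gt0// divr_gt0.
  have b : bijective (fun z : int * int => (z.2, z.1)) by exists (fun z => (z.2, z.1)) => -[].
  have := tsummableZ (Num.sqrt D)^-1 (tsummable_reindex (bij_inj b) (tsummable_gauss2 0 0 B2 D2)).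
  apply: tsummable_le => z /=; rewrite normrM ger0_norm ?invr_ge0 ?sqrtr_ge0//.
  rewrite ler_wpM2l ?invr_ge0 ?sqrtr_ge0// normrM ger0_norm ?expR_ge0//.
  rewrite -[leRHS]mulr1 ler_pM ?expR_ge0 ?cos_max// ler_expR !addr0 le_eqVlt; apply/orP; left; apply/eqP.
  by field.
have B2 : 0 < pi / D * C by rewrite mulr_gt0// divr_gt0.
have D2 : 0 < (pi / D * C) * (pi / D * A) - (- (pi / D * B)) ^+ 2.
  have -> : (pi / D * C) * (pi / D * A) - (- (pi / D * B)) ^+ 2 = (pi / D) ^+ 2 * (A * C - B ^+ 2) by ring.
    by rewrite mulr_gt0// exprn_gt0// divr_gt0.
have sf : tsummable (fun z : int * int => expR (- (pi * (C * z.1%:~R ^+ 2 -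
    2 * B * z.1%:~R * z.2%:~R + A * z.2%:~R ^+ 2) / D)) *
    cos (2 * pi * (z.1%:~R * a1 + z.2%:~R * a2))).
  have := tsummable_gauss2 0 0 B2 D2.
  apply: tsummable_le => z /=; rewrite normrM ger0_norm ?expR_ge0//.
  rewrite -[leRHS]mulr1 ler_pM ?expR_ge0 ?cos_max// ler_expR !addr0 le_eqVlt; apply/orP; left; apply/eqP.
  by field.
by rewrite -tsumZ// (tsum_pair (tsummableZ _ sf)).2.
Qed.

End theta2.

(** * Syntax-directed derivatives and continuity *)

Section calculus.
Context {R : realType}.
Implicit Types (f g : R -> R) (x : R).

Lemma dE f x (a b : R) : is_derive x 1 f a -> a = b -> is_derive x 1 f b.
Proof. by move=> h <-. Qed.
Lemma dcst (a x : R) : is_derive x 1 (fun _ : R => a) 0.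
Proof. exact: is_derive_cst. Qed.
Lemma did x : is_derive x 1 (fun t : R => t) 1.
Proof. exact: is_derive_id. Qed.
Lemma dD f g x (a b : R) : is_derive x 1 f a -> is_derive x 1 g b ->
  is_derive x 1 (fun t => f t + g t) (a + b).
Proof. by move=> hf hg; exact: is_deriveD. Qed.
Lemma dN f x (a : R) : is_derive x 1 f a -> is_derive x 1 (fun t => - f t) (- a).
Proof. by move=> hf; exact: is_deriveN. Qed.
Lemma dM f g x (a b : R) : is_derive x 1 f a -> is_derive x 1 g b ->
  is_derive x 1 (fun t => f t * g t) (a * g x + f x * b).
Proof.
move=> hf hg; apply: (dE (is_deriveM hf hg)).
by rewrite /GRing.scale/= addrC [g x * _]mulrC.
Qed.
Lemma dX f n x (a : R) : is_derive x 1 f a ->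
  is_derive x 1 (fun t => f t ^+ n) (n%:R * f x ^+ n.-1 * a).
Proof.
move=> hf; elim: n => [|n ih]; first by rewrite !mul0r; exact: dcst.
under eq_fun do rewrite exprS.
apply: (dE (dM hf ih)); case: n {ih} => [|n]; first by rewrite /= !mulr1 !mul0r mulr0 addr0 mul1r.
by rewrite /= [f x ^+ n.+1]exprS -(natr1 n.+1); ring.
Qed.
Lemma dcomp f g x (a b : R) : is_derive x 1 f a -> is_derive (f x) 1 g b ->
  is_derive x 1 (fun t => g (f t)) (a * b).
Proof. by move=> hf hg; apply: (dE (is_derive1_comp _ _)); rewrite mulrC. Qed.
Lemma dexp f x (a : R) : is_derive x 1 f a -> is_derive x 1 (fun t => expR (f t)) (a * expR (f x)).
Proof. by move=> hf; exact: (dcomp hf). Qed.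
Lemma dcos f x (a : R) : is_derive x 1 f a -> is_derive x 1 (fun t => cos (f t)) (a * - sin (f x)).
Proof. by move=> hf; exact: (dcomp hf). Qed.
Lemma dsin f x (a : R) : is_derive x 1 f a -> is_derive x 1 (fun t => sin (f t)) (a * cos (f x)).
Proof. by move=> hf; exact: (dcomp hf). Qed.

Lemma derive_continuous_at f x (a : R) : is_derive x 1 f a -> {for x, continuous f}.
Proof. by move=> [hf _]; exact/differentiable_continuous/derivable1_diffP. Qed.

Lemma derive_continuous f (f' : R -> R) : (forall x, is_derive x 1 f (f' x)) -> continuous f.
Proof. by move=> h x; exact: derive_continuous_at (h x). Qed.

Lemma cc_cst (a : R) : continuous (fun _ : R => a).
Proof. by move=> x; exact: cvg_cst. Qed.
Lemma cc_id : continuous (fun x : R => x).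
Proof. by move=> x; exact: cvg_id. Qed.
Lemma cc_D f g : continuous f -> continuous g -> continuous (fun x => f x + g x).
Proof. by move=> hf hg x; apply: cvgD; [exact: hf|exact: hg]. Qed.
Lemma cc_N f : continuous f -> continuous (fun x => - f x).
Proof. by move=> hf x; apply: cvgN; exact: hf. Qed.
Lemma cc_M f g : continuous f -> continuous g -> continuous (fun x => f x * g x).
Proof. by move=> hf hg x; apply: cvgM; [exact: hf|exact: hg]. Qed.
Lemma cc_X f n : continuous f -> continuous (fun x => f x ^+ n).
Proof.
move=> hf; elim: n => [|n ih]; first exact: cc_cst.
by under eq_fun do rewrite exprS; exact: cc_M.
Qed.
Lemma cc_comp f g : continuous f -> continuous g -> continuous (fun x => g (f x)).
Proof. by move=> hf hg x; apply: continuous_comp; [exact: hf|exact: hg]. Qed.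
Lemma cc_norm f : continuous f -> continuous (fun x => `|f x|).
Proof. by move=> hf x; apply: cvg_norm; exact: hf. Qed.
Lemma cc_exp f : continuous f -> continuous (fun x => expR (f x)).
Proof. by move=> hf; apply: cc_comp => //; exact: continuous_expR. Qed.
Lemma cc_cos f : continuous f -> continuous (fun x => cos (f x)).
Proof. by move=> hf; apply: cc_comp => //; exact: continuous_cos. Qed.
Lemma cc_sin f : continuous f -> continuous (fun x => sin (f x)).
Proof. by move=> hf; apply: cc_comp => //; exact: continuous_sin. Qed.
Lemma cc_inv f : continuous f -> (forall x, f x != 0) -> continuous (fun x => (f x)^-1).
Proof. by move=> hf f0 x; apply: cvgV => //; exact: hf. Qed.

End calculus.

(** Builds the derivative as an existential variable by following the syntax of the function;
    [dring] then compares it with the expected one. [ctac] is the analogue for continuity. *)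
Ltac dtac := first [ exact: dcst | exact: did
  | eapply dD; [dtac|dtac] | eapply dN; dtac | eapply dM; [dtac|dtac]
  | eapply dX; dtac | eapply dexp; dtac | eapply dcos; dtac | eapply dsin; dtac | eassumption ].
Ltac dring := eapply dE; [dtac|cbv beta; first [ring | rewrite /=; ring]].
Create HintDb cont.
Ltac ctac := cbv beta; lazymatch goal with
  | |- continuous (fun _ => ?c) => exact: cc_cst
  | |- continuous (fun x => x) => exact: cc_id
  | |- continuous (fun x => GRing.add (@?f x) (@?g x)) => apply: (@cc_D _ f g); ctac
  | |- continuous (fun x => GRing.opp (@?f x)) => apply: (@cc_N _ f); ctac
  | |- continuous (fun x => GRing.mul (@?f x) (@?g x)) => apply: (@cc_M _ f g); ctac
  | |- continuous (fun x => GRing.exp (@?f x) ?n) => apply: (@cc_X _ f n); ctac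
  | |- continuous (fun x => Num.norm (@?f x)) => apply: (@cc_norm _ f); ctac
  | |- continuous (fun x => expR (@?f x)) => apply: (@cc_exp _ f); ctac
  | |- continuous (fun x => cos (@?f x)) => apply: (@cc_cos _ f); ctac
  | |- continuous (fun x => sin (@?f x)) => apply: (@cc_sin _ f); ctac
  | |- continuous (fun x => ?h (@?f x)) =>
      first [ solve [auto with cont] | apply: (@cc_comp _ f h); [ctac | solve [auto with cont]] ]
  | _ => solve [auto with cont]
  end.

(** * Real integrals: fundamental theorem, substitution, parameters *)

Section integrals.
Context {R : realType}.
Notation mu := (@lebesgue_measure R).
Implicit Types (f g : R -> R) (D : set (measurableTypeR R)).

Definition Int D f : R := (\int[mu]_(x in D) f x)%R.
Definition intg D f : Prop := mu.-integrable D (EFin \o f).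

Lemma intg_meas D f : intg D f -> measurable_fun D f.
Proof. by move=> /integrableP[/measurable_EFinP]. Qed.

Lemma intg_le D f g : measurable D -> measurable_fun D f -> intg D g ->
  (forall x, D x -> `|f x| <= g x) -> intg D f.
Proof.
move=> mD mf ig fg; apply: le_integrable ig => //; first exact/measurable_EFinP.
by move=> x Dx /=; rewrite lee_fin (le_trans (fg x Dx))// ler_norm.
Qed.

Lemma cont_meas D f : measurable D -> continuous f -> measurable_fun D f.
Proof.
by move=> mD cf; apply: measurable_funTS; exact: continuous_measurable_fun.
Qed.

Lemma intg_itv f a b : continuous f -> intg `[a, b] f.
Proof.
move=> cf; apply: continuous_compact_integrable; first exact: segment_compact.
exact: continuous_subspaceT.
Qed.

Lemma intgS D D' f : measurable D -> measurable D' -> D' `<=` D -> intg D f -> intg D' f.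
Proof. by move=> mD mD' sD; exact: integrableS. Qed.

Lemma eq_Int D f g : (forall x, D x -> f x = g x) -> Int D f = Int D g.
Proof. by move=> fg; apply: eq_Rintegral => x /set_mem; exact: fg. Qed.

Lemma eq_intg D f g : measurable D -> (forall x, D x -> f x = g x) -> intg D f -> intg D g.
Proof. by move=> mD fg; apply: eq_integrable => // x /set_mem Dx /=; rewrite fg. Qed.

Lemma intgD D f g : measurable D -> intg D f -> intg D g -> intg D (fun x => f x + g x).
Proof. by move=> mD hf hg; have := integrableD mD hf hg; apply: eq_integrable. Qed.

Lemma intgZ D f a : measurable D -> intg D f -> intg D (fun x => a * f x).
Proof. by move=> mD hf; have := integrableZl mD a hf; apply: eq_integrable. Qed.

Lemma intgN D f : measurable D -> intg D f -> intg D (fun x => - f x).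
Proof.
by move=> mD hf; apply: eq_intg (intgZ (-1) mD hf) => // x _; rewrite mulN1r.
Qed.

Lemma intgB D f g : measurable D -> intg D f -> intg D g -> intg D (fun x => f x - g x).
Proof. by move=> mD hf hg; apply: intgD => //; exact: intgN. Qed.

Lemma intg_norm D f : measurable D -> intg D f -> intg D (fun x => `|f x|).
Proof. by move=> mD hf; exact: (@integrable_abse _ _ _ _ _ _ hf). Qed.

Lemma IntD D f g : measurable D -> intg D f -> intg D g ->
  Int D (fun x => f x + g x) = Int D f + Int D g.
Proof. by move=> mD hf hg; exact: RintegralD. Qed.

Lemma IntZ D f a : measurable D -> intg D f -> Int D (fun x => a * f x) = a * Int D f.
Proof. by move=> mD hf; exact: RintegralZl. Qed.

Lemma IntN D f : measurable D -> intg D f -> Int D (fun x => - f x) = - Int D f.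
Proof.
by move=> mD hf; rewrite -mulN1r -IntZ//; apply: eq_Int => x _; rewrite mulN1r.
Qed.

Lemma IntB D f g : measurable D -> intg D f -> intg D g ->
  Int D (fun x => f x - g x) = Int D f - Int D g.
Proof. by move=> mD hf hg; exact: RintegralB. Qed.

Lemma le_Int D f g : measurable D -> intg D f -> intg D g ->
  (forall x, D x -> f x <= g x) -> Int D f <= Int D g.
Proof. by move=> mD hf hg fg; exact: le_Rintegral. Qed.

Lemma Int_ge0 D f : (forall x, D x -> 0 <= f x) -> 0 <= Int D f.
Proof. by move=> f0; exact: Rintegral_ge0. Qed.

Lemma norm_Int_le D f : measurable D -> intg D f -> `|Int D f| <= Int D (fun x => `|f x|).
Proof. by move=> mD hf; exact: le_normr_Rintegral. Qed.

Lemma norm_Int_le2 D f g : measurable D -> measurable_fun D f -> intg D g ->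
  (forall x, D x -> `|f x| <= g x) -> `|Int D f| <= Int D g.
Proof.
move=> mD mf ig fg; have hf := intg_le mD mf ig fg.
by apply: le_trans (norm_Int_le mD hf) _; apply: le_Int => //; exact: intg_norm.
Qed.

Lemma dct D (f_ : nat -> R -> R) f g : measurable D ->
  (forall n, measurable_fun D (f_ n)) -> intg D g ->
  (forall n x, D x -> `|f_ n x| <= g x) ->
  (forall x, D x -> f_ n x @[n --> \oo] --> f x) ->
  intg D f /\ Int D (f_ n) @[n --> \oo] --> Int D f.
Proof.
move=> mD mf ig fg cf.
have mf' : measurable_fun D f.
  by apply: (@measurable_fun_cvg _ _ _ _ f_) => // x; exact: cf.
have [] := @dominated_convergence _ (measurableTypeR R) R mu D mD (fun n y => (f_ n y)%:E) (fun y => (f y)%:E)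
  (fun y => (g y)%:E).
- by move=> n; exact/measurable_EFinP.
- exact/measurable_EFinP.
- by apply: aeW => y Dy; apply: cvg_EFin; [exact: nearW|exact: cf].
- exact: ig.
- by apply: aeW => y n Dy; rewrite lee_fin; exact: fg.
move=> it _ cv; split => //.
by apply: fine_cvg; rewrite fineK//; exact: integrable_fin_num.
Qed.

Lemma Int_exhaust D (D_ : nat -> set (measurableTypeR R)) f : measurable D -> (forall n, measurable (D_ n)) ->
  (forall n, D_ n `<=` D) -> (forall x, D x -> \forall n \near \oo, D_ n x) ->
  intg D f -> Int (D_ n) f @[n --> \oo] --> Int D f.
Proof.
move=> mD mD_ sD near_ hf.
have E n : Int (D_ n) f = Int D (fun x => f x * \1_(D_ n) x).
  rewrite /Int Rintegral_mkcond [RHS]Rintegral_mkcond; apply: eq_Rintegral => x _.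
  rewrite /patch; case: ifPn => [/set_mem Dx|nDx].
    by rewrite ifT ?indicE ?mem_set ?mulr1//; exact: sD Dx.
  by case: ifPn => // _; rewrite indicE (negPf nDx) mulr0.
under eq_cvg do rewrite E.
apply: (dct mD _ (intg_norm mD hf) _ _).2.
- move=> n; apply: measurable_funM; first exact: intg_meas.
  exact: measurable_indic.
- move=> n x Dx; rewrite normrM -[leRHS]mulr1 ler_wpM2l//.
  by rewrite indicE; case: (_ \in _); rewrite ?normr1 ?normr0 ?ler01.
- move=> x Dx; apply: cvg_near_cst.
  by near=> n; rewrite indicE mem_set ?mulr1//; near: n; exact: near_.
Unshelve. all: by end_near. Qed.

Lemma near_itv_nat (x : R) : \forall n \near \oo, `[- n%:R, n%:R]%classic x.
Proof.
near=> n; rewrite /= in_itv/= -ler_norml; near: n; exact: nbhs_infty_ger.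
Unshelve. all: by end_near. Qed.

Lemma opp_nat_le (n : nat) : - n%:R <= n%:R :> R.
Proof. by rewrite -subr_ge0 opprK addr_ge0. Qed.

Lemma IntT_lim f : intg setT f -> Int `[- n%:R, n%:R] f @[n --> \oo] --> Int setT f.
Proof.
by move=> hf; apply: Int_exhaust => // x _; exact: near_itv_nat.
Qed.

Lemma Int_FTC f (F : R -> R) a b : a <= b -> continuous f -> (forall x : R, is_derive x 1 F (f x)) ->
  Int `[a, b] f = F b - F a.
Proof.
rewrite le_eqVlt => /predU1P[<- _ _|ab cf dF].
  by rewrite subrr set_itv1 /Int Rintegral_set1.
rewrite /Int /Rintegral (@continuous_FTC2 _ f F)//.
- exact: continuous_subspaceT.
- split.
  + by move=> x _; have [] := dF x.
  + by apply: cvg_at_right_filter; exact: (derive_continuous dF).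
  + by apply: cvg_at_left_filter; exact: (derive_continuous dF).
- by move=> x _; rewrite derive1E; have [_ ->] := dF x.
Qed.

Lemma Int_cat f (a b c : R) : a <= b -> b <= c -> intg `[a, c] f ->
  Int `[a, c] f = Int `[a, b] f + Int `[b, c] f.
Proof.
move=> ab bc hf.
have i1 : intg `[a, b] f by apply: intgS hf => //; apply: subset_itvl; rewrite bnd_simp.
have i2 : intg `]b, c] f by apply: intgS hf => //; apply: subset_itvr; rewrite bnd_simp.
have <- : Int `]b, c] f = Int `[b, c] f.
  by rewrite /Int Rintegral_itv_obnd_cbnd//; have := intg_meas i2.
rewrite /Int.
rewrite -Rintegral_setU//; first by rewrite -itv_bndbnd_setU// bnd_simp.
  by rewrite -itv_bndbnd_setU// bnd_simp.
by apply: lt_disjoint => x y; rewrite !in_itv/= => /andP[_ xb] /andP[by_ _]; exact: le_lt_trans xb by_.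
Qed.

Lemma Int_affine_itv f (a b h k : R) : a <= b -> 0 < h -> continuous f ->
  Int `[a, b] (fun t => h * f (h * t + k)) = Int `[h * a + k, h * b + k] f.
Proof.
move=> ab h0 cf; rewrite /Int /Rintegral.
have dF (x : R) : is_derive x 1 (fun t => h * t + k) h.
  dring.
have F' : derive1 (fun t : R => h * t + k) = cst h.
  by apply/funext => x; rewrite derive1E; have [_ ->] := dF x.
rewrite (@integration_by_substitution_increasing _ (fun t => h * t + k) f a b ab).
- by congr fine; apply: eq_integral => x _ /=; rewrite !fctE F' mulrC.
- by move=> x y _ _ xy; rewrite ltrD2r ltr_pM2l.
- by rewrite F' => x _; exact: cvg_cst.
- by rewrite F'; exact: is_cvg_cst.
- by rewrite F'; exact: is_cvg_cst.
- split.
  + by move=> x _; have [] := dF x.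
  + by apply: cvg_at_right_filter; exact: (derive_continuous dF).
  + by apply: cvg_at_left_filter; exact: (derive_continuous dF).
- exact: continuous_subspaceT.
Qed.

Lemma Int_opp_itv f (a b : R) : a <= b -> continuous f ->
  Int `[a, b] (fun t => f (- t)) = Int `[- b, - a] f.
Proof.
move=> ab cf; rewrite /Int /Rintegral integration_by_substitution_oppr//.
exact: continuous_subspaceT.
Qed.

Lemma intgT_bounded f M : continuous f -> (forall n : nat, Int `[- n%:R, n%:R] (fun x => `|f x|) <= M) ->
  intg setT f.
Proof.
move=> cf bd; apply/integrableP; split.
  by apply/measurable_EFinP; exact: continuous_measurable_fun.
have mf : measurable_fun setT (fun x => (`|f x|)%:E).
  by apply/measurable_EFinP; apply: measurableT_comp => //; exact: continuous_measurable_fun.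
have U : \bigcup_n `[- n%:R, n%:R]%classic = [set: R].
  apply/seteqP; split => // x _; have [n _ h] := near_itv_nat x.
  by exists n => //; exact: (h n (leqnn n)).
apply: (@le_lt_trans _ _ M%:E); last exact: ltry.
have cv : (\int[mu]_(x in `[(- n%:R)%R, n%:R%R]%classic) (`|f x|)%:E)%E @[n --> \oo] -->
    (\int[mu]_(x in setT) (`|f x|)%:E)%E.
  rewrite -U; apply: ge0_nondecreasing_set_cvg_integral => //.
  - move=> n m nm; apply/subsetPset; apply: subset_itv; rewrite bnd_simp ?lerN2 ler_nat//.
  - by move=> n; apply: measurable_funTS.
rewrite -(cvg_lim _ cv)//; apply: lime_le; first by apply/cvg_ex; eexists; exact: cv.
apply: nearW => n; have := bd n; rewrite /Int /Rintegral -lee_fin fineK//.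
by apply: integrable_fin_num => //; apply: intg_itv; exact: cc_norm.
Qed.

Lemma cvg_Int_affine f (h k : R) : 0 < h -> intg setT f ->
  Int `[h * (- n%:R) + k, h * n%:R + k] f @[n --> \oo] --> Int setT f.
Proof.
move=> h0 hf; apply: Int_exhaust => // x _.
near=> n; rewrite /= in_itv/=.
have : (`|x - k| / h <= n%:R) by near: n; exact: nbhs_infty_ger.
by rewrite ler_pdivrMr// ler_norml => /andP[h1 h2]; apply/andP; split; lra.
Unshelve. all: by end_near. Qed.

Lemma intg_affine f (h k : R) : 0 < h -> continuous f -> intg setT f ->
  intg setT (fun t => f (h * t + k)).
Proof.
move=> h0 cf hf.
apply: (@intgT_bounded _ (h^-1 * Int setT (fun x => `|f x|))).
  by apply: cc_comp => //; ctac.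
move=> n; rewrite ler_pdivlMl// -IntZ//; last by apply: intg_itv; apply: cc_norm; apply: cc_comp => //; ctac.
rewrite (Int_affine_itv (f := fun x => `|f x|) k (opp_nat_le n) h0 (cc_norm cf)).
rewrite /Int Rintegral_mkcond; apply: le_Int => //.
- by have := @intg_itv (fun x => `|f x|) (h * - n%:R + k) (h * n%:R + k) (cc_norm cf); rewrite /intg integrable_mkcond//= => H; apply: eq_integrable H => // x _ /=; rewrite /patch; case: ifP.
- exact: intg_norm.
- by move=> x _; rewrite patchE; case: ifP => _; [exact: lexx|exact: normr_ge0].
Qed.

Lemma Int_affine f (h k : R) : 0 < h -> continuous f -> intg setT f ->
  Int setT (fun t => f (h * t + k)) = h^-1 * Int setT f.
Proof.
move=> h0 cf hf.
have c1 := IntT_lim (intg_affine k h0 cf hf).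
have c2 : Int `[- n%:R, n%:R] (fun t => f (h * t + k)) @[n --> \oo] --> h^-1 * Int setT f.
  have := cvg_Int_affine k h0 hf => /(cvgM (cvg_cst h^-1)); apply: cvg_trans; apply: near_eq_cvg.
  apply: nearW => n /=; rewrite -(Int_affine_itv k (opp_nat_le n) h0 cf).
  rewrite IntZ ?mulKf ?gt_eqF//; apply: intg_itv; apply: cc_comp => //; ctac.
by rewrite -(cvg_lim _ c1)// -(cvg_lim _ c2).
Qed.

Lemma Int_odd f : continuous f -> intg setT f -> (forall x, f (- x) = - f x) -> Int setT f = 0.
Proof.
move=> cf hf odf; have c1 := IntT_lim hf.
rewrite -(cvg_lim _ c1)//; apply/cvg_lim => //; apply: cvg_near_cst; apply: nearW => n.
have E := @Int_opp_itv f (- n%:R) n%:R (opp_nat_le n) cf.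
have : Int `[- n%:R, n%:R] f = - Int `[- n%:R, n%:R] f.
  rewrite opprK in E; rewrite -{1}E -IntN//; last exact: intg_itv.
  by apply: eq_Int => x _; exact: odf.
by move=> h; lra.
Qed.

Lemma Int_itv_le (a b M : R) f : a <= b -> continuous f -> (forall x, a <= x <= b -> `|f x| <= M) ->
  `|Int `[a, b] f| <= M * (b - a).
Proof.
move=> ab cf fM.
have h : `|Int `[a, b] f| <= Int `[a, b] (fun _ => M).
  apply: norm_Int_le2 => //; [exact: cont_meas|exact/intg_itv/cc_cst].
apply: le_trans h _.
have -> : Int `[a, b] (fun _ => M) = M * b - M * a.
  apply: (@Int_FTC (fun _ => M) (fun x => M * x)) => //; first exact: cc_cst.
  by move=> x; dring.
by rewrite mulrBr.
Qed.

Lemma seq_continuous (F : R -> R) : (forall (x : R) (u_ : nat -> R), u_ n @[n --> \oo] --> x -> F (u_ n) @[n --> \oo] --> F x) ->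
  continuous F.
Proof. by move=> h x; apply/(@cvg_nbhsP _ R^o) => u_ hu; exact: h. Qed.

Lemma cont_seq (F : R -> R) (x : R) (u_ : nat -> R) : {for x, continuous F} -> u_ n @[n --> \oo] --> x -> F (u_ n) @[n --> \oo] --> F x.
Proof. by move=> cF cu; apply: continuous_cvg. Qed.

Lemma cont_param D (f : R -> R -> R) g : measurable D -> (forall x, measurable_fun D (f x)) ->
  intg D g -> (forall x y, D y -> `|f x y| <= g y) ->
  (forall y, D y -> continuous (fun x => f x y)) -> continuous (fun x => Int D (f x)).
Proof.
move=> mD mf ig fg cf; apply: seq_continuous => x u_ cu.
apply: (dct mD _ ig _ _).2 => //.
- by move=> n y Dy; exact: fg.
- by move=> y Dy; apply: (cont_seq (F := fun x => f x y)) => //; exact: cf.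
Qed.

Lemma derive_param D (f f' : R -> R -> R) g (u v a : R) : measurable D -> u < a < v ->
  (forall x, u < x < v -> intg D (f x)) ->
  intg D g -> (forall x y, u < x < v -> D y -> is_derive x 1 (fun x => f x y) (f' x y)) ->
  (forall x y, u < x < v -> D y -> `|f' x y| <= g y) ->
  is_derive a 1 (fun x => Int D (f x)) (Int D (f' a)).
Proof.
move=> mD ua intf ig df bf'.
have d1 x y : u < x < v -> D y -> partial1of2 f x y = f' x y.
  by move=> xu Dy; rewrite partial1of2E; have [_ ->] := df x y xu Dy.
have Ia : `]u, v[%classic a by rewrite /= in_itv.
have intf' x : `]u, v[%classic x -> mu.-integrable D (EFin \o f x).
  by rewrite /= in_itv; exact: intf.
have derf1 x y : `]u, v[%classic x -> D y -> derivable (f ^~ y) x 1.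
  by rewrite /= in_itv => xu Dy; have [] := df x y xu Dy.
have Gub x y : `]u, v[%classic x -> D y -> `|partial1of2 f x y| <= `|g y|.
  rewrite /= in_itv => xu Dy; rewrite d1//; apply: le_trans (bf' _ _ xu Dy) _; exact: ler_norm.
have G0 y : 0 <= `|g y| by [].
split; first exact: (derivable_under_integral mD Ia intf' derf1 G0 (intg_norm mD ig) Gub).
rewrite -derive1E (differentiation_under_integral mD Ia intf' derf1 G0 (intg_norm mD ig) Gub).
by apply: eq_Rintegral => y /set_mem Dy; rewrite d1.
Qed.

End integrals.

(** * Hyperbolic functions *)

Section hyperbolic.
Context {R : realType}.
Definition ch (t : R) : R := (expR t + expR (- t)) / 2.
Definition sh (t : R) : R := (expR t - expR (- t)) / 2.

Lemma expRNM (t : R) : expR t * expR (- t) = 1.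
Proof. by rewrite -expRD subrr expR0. Qed.

Lemma ch2_sh2 (t : R) : ch t ^+ 2 = 1 + sh t ^+ 2.
Proof.
have e := expRNM t; rewrite /ch /sh; apply/eqP; rewrite -subr_eq0; apply/eqP.
rewrite (_ : _ - _ = expR t * expR (- t) - 1); first by rewrite e subrr.
by field.
Qed.

Lemma ch_gt0 t : 0 < ch t.
Proof. by rewrite /ch divr_gt0// addr_gt0// expR_gt0. Qed.

Lemma ch0 : ch 0 = 1. Proof. by rewrite /ch oppr0 expR0; lra. Qed.
Lemma sh0 : sh 0 = 0. Proof. by rewrite /sh oppr0 expR0; lra. Qed.
Lemma chN t : ch (- t) = ch t. Proof. by rewrite /ch opprK addrC. Qed.
Lemma shN t : sh (- t) = - sh t. Proof. by rewrite /sh opprK -mulNr opprB. Qed.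

Lemma d_ch (t : R) : is_derive t 1 ch (sh t).
Proof. by rewrite /ch /sh; dring. Qed.
Lemma d_sh (t : R) : is_derive t 1 sh (ch t).
Proof. by rewrite /ch /sh; dring. Qed.
Lemma cc_ch : continuous ch. Proof. exact: derive_continuous d_ch. Qed.
Lemma cc_sh : continuous sh. Proof. exact: derive_continuous d_sh. Qed.
Hint Resolve cc_ch cc_sh : cont.

Lemma chD s t : ch (s + t) = ch s * ch t + sh s * sh t.
Proof. by rewrite /ch /sh opprD !expRD; field. Qed.
Lemma shD s t : sh (s + t) = sh s * ch t + ch s * sh t.
Proof. by rewrite /ch /sh opprD !expRD; field. Qed.

Lemma sh_ge t : 0 <= t -> t <= sh t.
Proof.
move=> t0; rewrite -subr_ge0.
have [->|tn0] := eqVneq t 0; first by rewrite sh0 subrr.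
have tp : 0 < t by rewrite lt_neqAle eq_sym tn0.
have E : Int `[0, t] (fun x => ch x - 1) = sh t - t - (sh 0 - 0).
  apply: (Int_FTC t0 _ (F := fun x => sh x - x)); first by ctac.
  by move=> x; eapply dE; [eapply dD; [exact: d_sh|dtac]|by []].
rewrite (_ : sh t - t = sh t - t - (sh 0 - 0)); last by rewrite sh0 subrr subr0.
rewrite -E; apply: Int_ge0 => x _; rewrite subr_ge0 -(@ler_pXn2r _ 2)// ?nnegrE ?(ltW (ch_gt0 _))//.
by rewrite ch2_sh2 expr1n lerDl sqr_ge0.
Qed.

Lemma sh2_ge t : t ^+ 2 <= sh t ^+ 2.
Proof.
have [t0|t0] := leP 0 t; first by rewrite ler_pXn2r ?nnegrE ?sh_ge// (le_trans t0)// sh_ge.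
have h : 0 <= - t by rewrite oppr_ge0 ltW.
by rewrite -(sqrrN t) -(sqrrN (sh t)) -shN ler_pXn2r ?nnegrE ?sh_ge// (le_trans h)// sh_ge.
Qed.

Lemma ch_ge1 t : 1 <= ch t.
Proof.
rewrite -(@ler_pXn2r _ 2)// ?nnegrE ?(ltW (ch_gt0 _))//.
by rewrite ch2_sh2 expr1n lerDl sqr_ge0.
Qed.

End hyperbolic.
#[global] Hint Resolve cc_ch cc_sh : cont.

(** * The theta kernel of the majorant and its inversion *)

Section theta_kernel.
Context {R : realType}.
Implicit Types (b : int * int -> R) (E : R -> R).
Local Notation rho := (Num.sqrt 6 : R).
Local Notation kk := (Num.sqrt 48 : R).

Lemma rho2 : rho ^+ 2 = 6. Proof. by rewrite sqr_sqrtr. Qed.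
Lemma kk2 : kk ^+ 2 = 48. Proof. by rewrite sqr_sqrtr. Qed.
Lemma rho_gt0 : 0 < rho. Proof. by rewrite sqrtr_gt0. Qed.
Lemma kk_gt0 : 0 < kk. Proof. by rewrite sqrtr_gt0. Qed.

(** [pp] and [rr] are the Lorentz boost by t of (X, sqrt 6 Y)/sqrt 48, so pp^2 - rr^2 = [nn] for
    every t; [nn] is Q in the coordinates X = 24 m1, Y = 4 m2. *)
Definition pp (t X Y : R) : R := (X * ch t + rho * Y * sh t) / kk.
Definition rr (t X Y : R) : R := (X * sh t + rho * Y * ch t) / kk.
Definition nn (X Y : R) : R := (X ^+ 2 - 6 * Y ^+ 2) / 48.

Lemma pp_rr_sum t X Y : pp t X Y ^+ 2 + rr t X Y ^+ 2 =
  (X ^+ 2 * (ch t ^+ 2 + sh t ^+ 2) + 2 * rho * X * Y * (2 * ch t * sh t) + 6 * Y ^+ 2 * (ch t ^+ 2 + sh t ^+ 2)) / 48.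
Proof.
rewrite /pp /rr; move: (ch t) (sh t) => C S; rewrite !exprMn !exprVn kk2 -mulrDl; congr (_ / _).
by have := rho2; move: rho => p p2; ring: p2.
Qed.

(** A boost by t has least eigenvalue exp(- 2|t|) on squares; the remainder is sinh(2|t|) times the
    square of X + sqrt 6 Y or X - sqrt 6 Y, according to the sign of t. *)
Lemma pp_rr_sum_ge t X Y : expR (- (2 * `|t|)) * (X ^+ 2 + 6 * Y ^+ 2) / 48 <= pp t X Y ^+ 2 + rr t X Y ^+ 2.
Proof.
rewrite pp_rr_sum ler_pM2r ?invr_gt0//.
have e := expRNM t.
have h (s : R) : 0 <= s -> expR (- (2 * s)) * (X ^+ 2 + 6 * Y ^+ 2) <= expR (- (2 * s)) * (X ^+ 2 + 6 * Y ^+ 2) + (expR s ^+ 2 - expR (- s) ^+ 2) / 2 * (X - rho * Y) ^+ 2.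
  move=> s0; rewrite lerDl mulr_ge0 ?sqr_ge0// divr_ge0// subr_ge0 ler_pXn2r ?nnegrE ?expR_ge0// ler_expR; lra.
have h' (s : R) : 0 <= s -> expR (- (2 * s)) * (X ^+ 2 + 6 * Y ^+ 2) <= expR (- (2 * s)) * (X ^+ 2 + 6 * Y ^+ 2) + (expR s ^+ 2 - expR (- s) ^+ 2) / 2 * (X + rho * Y) ^+ 2.
  move=> s0; rewrite lerDl mulr_ge0 ?sqr_ge0// divr_ge0// subr_ge0 ler_pXn2r ?nnegrE ?expR_ge0// ler_expR; lra.
have E2 (s : R) : expR (- (2 * s)) = expR (- s) ^+ 2 by rewrite -expRM_natl; congr expR; lra.
have [t0|t0] := leP 0 t.
  rewrite ger0_norm//; apply: le_trans (h' _ t0) _; rewrite E2 le_eqVlt; apply/orP; left; apply/eqP.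
  by have := rho2; rewrite /ch /sh; move: rho (expR t) (expR (- t)) => p a b p2; field: p2.
rewrite ltr0_norm//; apply: le_trans (h _ _) _; first by lra.
rewrite E2 opprK le_eqVlt; apply/orP; left; apply/eqP.
by have := rho2; rewrite /ch /sh; move: rho (expR t) (expR (- t)) => p a b p2; field: p2.
Qed.

Lemma cc_pp X Y : continuous (fun t => pp t X Y).
Proof. by rewrite /pp; ctac. Qed.
Lemma cc_rr X Y : continuous (fun t => rr t X Y).
Proof. by rewrite /rr; ctac. Qed.

Definition Kth (c kap t q X Y : R) : R :=
  expR (- (kap * ((pp t X Y - c * q / 2) ^+ 2 + rr t X Y ^+ 2))).

(** Two-dimensional inversion on one residue class modulo (24 c, 4 c). The displacement c q/2 of the
    Gaussian is absorbed into the lattice offset and reappears as the phase 2 pi q p on the dual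
    side. *)
Lemma class_theta (c kap t q X0 Y0 : R) : 0 < c -> 0 < kap ->
  tsummable (fun y : int * int => Kth c kap t q (X0 + 24 * c * y.1%:~R) (Y0 + 4 * c * y.2%:~R)) /\
  tsum (fun y : int * int => Kth c kap t q (X0 + 24 * c * y.1%:~R) (Y0 + 4 * c * y.2%:~R)) =
  pi / (2 * rho * kap * c ^+ 2) *
  tsum (fun v : int * int => expR (- (4 * pi ^+ 2 / (kap * c ^+ 2) * (pp t v.1%:~R v.2%:~R ^+ 2 + rr t v.1%:~R v.2%:~R ^+ 2))) *
    cos (2 * pi * (v.1%:~R * X0 / (24 * c) - v.2%:~R * Y0 / (4 * c)) - 2 * pi * q * pp t v.1%:~R v.2%:~R)).
Proof.
move=> c0 k0; have p0 := pi_gt0 R; have r2 := rho2; have r0 := rho_gt0; have q2 := kk2; have q0 := kk_gt0.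
have C2 := ch2_sh2 t.
pose c2 := ch t ^+ 2 + sh t ^+ 2; pose s2 := 2 * ch t * sh t.
have c20 : 0 < c2 by rewrite /c2 C2; have := sqr_ge0 (sh t); lra.
have cs : c2 ^+ 2 - s2 ^+ 2 = 1 by rewrite /c2 /s2; move: C2; move: (ch t) (sh t) => x y C2; ring: C2.
pose A := 12 * kap * c ^+ 2 * c2 / pi; pose B := 2 * rho * kap * c ^+ 2 * s2 / pi.
pose C := 2 * kap * c ^+ 2 * c2 / pi.
(* (u1, u2) is the point with [pp] equal to c q/2 and [rr] equal to 0. *)
pose u1 := kk * (c * q / 2) * ch t; pose u2 := - (kk * (c * q / 2) * sh t / rho).
pose a1 := (X0 - u1) / (24 * c); pose a2 := (Y0 - u2) / (4 * c).
have pn : pi != 0 :> R by rewrite gt_eqF.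
have cn : c != 0 by rewrite gt_eqF.
have kn : kap != 0 by rewrite gt_eqF.
have rn : rho != 0 by rewrite gt_eqF.
have qn : kk != 0 by rewrite gt_eqF.
have A0 : 0 < A by rewrite /A divr_gt0// !mulr_gt0// exprn_gt0.
(* The determinant does not depend on t, because boosts preserve area: c2^2 - s2^2 = 1. *)
have D : A * C - B ^+ 2 = 24 * kap ^+ 2 * c ^+ 4 / pi ^+ 2.
  rewrite (_ : _ - _ = 24 * kap ^+ 2 * c ^+ 4 / pi ^+ 2 * (c2 ^+ 2 - s2 ^+ 2)); first by rewrite cs mulr1.
  by rewrite /A /B /C; move: (pi : R) pn r2; move: rho => rh p pn r2; field: r2.
have D0 : 0 < A * C - B ^+ 2 by rewrite D divr_gt0// ?exprn_gt0// !mulr_gt0// exprn_gt0.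
have E1 (y : int * int) : Kth c kap t q (X0 + 24 * c * y.1%:~R) (Y0 + 4 * c * y.2%:~R) =
   expR (- (pi * (A * (y.1%:~R + a1) ^+ 2 + 2 * B * (y.1%:~R + a1) * (y.2%:~R + a2) + C * (y.2%:~R + a2) ^+ 2))).
  rewrite /Kth; congr (expR (- _)).
  have e1 : pp t (X0 + 24 * c * y.1%:~R) (Y0 + 4 * c * y.2%:~R) - c * q / 2 =
     pp t (24 * c * (y.1%:~R + a1)) (4 * c * (y.2%:~R + a2)).
    rewrite /pp /a1 /a2 /u1 /u2; move: C2 rn qn; move: rho kk (ch t) (sh t) (y.1%:~R) (y.2%:~R) => rh k x z y1 y2 C2 rn qn.
    by field: C2; rewrite cn rn qn.
  have e2 : rr t (X0 + 24 * c * y.1%:~R) (Y0 + 4 * c * y.2%:~R) =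
     rr t (24 * c * (y.1%:~R + a1)) (4 * c * (y.2%:~R + a2)).
    rewrite /rr /a1 /a2 /u1 /u2; move: C2 rn qn; move: rho kk (ch t) (sh t) (y.1%:~R) (y.2%:~R) => rh k x z y1 y2 C2 rn qn.
    by field: C2; rewrite cn rn qn.
  rewrite e1 e2 pp_rr_sum -/c2 -/s2 /A /B /C; move: (pi : R) pn (y.1%:~R + a1) (y.2%:~R + a2) => p pn z1 z2.
  by field.
split.
  apply: (@eq_tsummable _ _ (fun y : int * int => expR (- (pi * A * (y.1%:~R + a1) ^+ 2 + 2 * (pi * B) * (y.1%:~R + a1) * (y.2%:~R + a2) + pi * C * (y.2%:~R + a2) ^+ 2)))).
    by move=> y; rewrite E1; congr (expR (- _)); ring.
  apply: tsummable_gauss2; first by rewrite mulr_gt0.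
  by rewrite (_ : _ - _ = pi ^+ 2 * (A * C - B ^+ 2)); [rewrite mulr_gt0// exprn_gt0|ring].
rewrite (eq_tsum E1) theta2_inversion//.
congr (_ * _).
  rewrite D; have -> : 24 * kap ^+ 2 * c ^+ 4 / pi ^+ 2 = (2 * rho * kap * c ^+ 2 / pi) ^+ 2.
    by move: r2 (pi : R) pn; move: rho => rh r2 p pn; field: r2.
  rewrite sqrtr_sqr ger0_norm; last by rewrite divr_ge0 ?(ltW p0)// !mulr_ge0 ?(ltW k0) ?(ltW r0) ?exprn_ge0 ?(ltW c0).
  by rewrite invf_div.
(* The dual variable is reflected in its second coordinate, because the pairing B is X X'/24 - Y
   Y'/4. *)
have bij : bijective (fun v : int * int => (v.1, - v.2)) by exists (fun v : int * int => (v.1, - v.2)) => -[x y] /=; rewrite opprK.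
rewrite -(tsum_reindex bij); last first.
  have B2 : 0 < pi / (A * C - B ^+ 2) * C by rewrite mulr_gt0 ?divr_gt0// /C !mulr_gt0 ?exprn_gt0 ?invr_gt0.
  have D2 : 0 < (pi / (A * C - B ^+ 2) * C) * (pi / (A * C - B ^+ 2) * A) - (- (pi / (A * C - B ^+ 2) * B)) ^+ 2.
    set d := pi / _; rewrite (_ : _ - _ = d ^+ 2 * (A * C - B ^+ 2)); last ring.
    by rewrite mulr_gt0// exprn_gt0// divr_gt0.
  have := tsummable_gauss2 0 0 B2 D2.
  apply: tsummable_le => z /=; rewrite normrM ger0_norm ?expR_ge0//.
  rewrite -[leRHS]mulr1 ler_pM ?expR_ge0 ?cos_max// ler_expR !addr0 le_eqVlt; apply/orP; left; apply/eqP.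
  by set d := A * C - B ^+ 2; move: d^-1 => d'; ring.
apply: eq_tsum => v /=; rewrite rmorphN /=; congr (expR (- _) * cos _).
  rewrite D pp_rr_sum -/c2 -/s2 /A /B /C; move: (pi : R) pn r2 (v.1%:~R) (v.2%:~R); move: rho => rh p pn r2 z1 z2.
  by field: r2; rewrite pn cn kn.
rewrite /a1 /a2 /u1 /u2 /pp; move: r2 q2 rn qn (pi : R) (v.1%:~R) (v.2%:~R); move: rho kk (ch t) (sh t) => rh k x y r2 q2 rn qn p z1 z2.
by field: r2 q2; rewrite ?rn ?cn ?qn.
Qed.

Lemma dual_gauss_summable (d m : R) : 0 < d ->
  tsummable (fun v : int * int => expR (- (d * (expR (- (2 * m)) * (v.1%:~R ^+ 2 + 6 * v.2%:~R ^+ 2) / 48)))).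
Proof.
move=> d0; set s := d * expR (- (2 * m)) / 48.
have s0 : 0 < s by rewrite /s divr_gt0// mulr_gt0// expR_gt0.
have D0 : 0 < s * (6 * s) - 0 ^+ 2 by rewrite expr0n /= subr0; apply: mulr_gt0 => //; apply: mulr_gt0.
have := tsummable_gauss2 0 0 s0 D0; apply: eq_tsummable => v.
by congr (expR (- _)); rewrite /s; ring.
Qed.

Lemma dual_gauss_le (d m t X Y : R) : 0 < d -> `|t| <= m ->
  expR (- (d * (pp t X Y ^+ 2 + rr t X Y ^+ 2))) <=
  expR (- (d * (expR (- (2 * m)) * (X ^+ 2 + 6 * Y ^+ 2) / 48))).
Proof.
move=> d0 tm; rewrite ler_expR lerN2 ler_pM2l//.
apply: le_trans (pp_rr_sum_ge _ _ _).
rewrite ler_pM2r ?invr_gt0//; apply: ler_wpM2r; last by rewrite ler_expR; lra.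
by rewrite addr_ge0 ?sqr_ge0// mulr_ge0// sqr_ge0.
Qed.

Definition dualbound (d m : R) : R :=
  tsum (fun v : int * int => expR (- (d * (expR (- (2 * m)) * (v.1%:~R ^+ 2 + 6 * v.2%:~R ^+ 2) / 48)))).

Lemma dual_summable (d m t : R) (g : int * int -> R) (M : R) : 0 < d -> `|t| <= m ->
  (forall v, `|g v| <= M) ->
  tsummable (fun v : int * int => g v * expR (- (d * (pp t v.1%:~R v.2%:~R ^+ 2 + rr t v.1%:~R v.2%:~R ^+ 2)))) /\
  tsum (fun v : int * int => `|g v * expR (- (d * (pp t v.1%:~R v.2%:~R ^+ 2 + rr t v.1%:~R v.2%:~R ^+ 2)))|) <= M * dualbound d m.
Proof.
move=> d0 tm gM; have s0 := dual_gauss_summable m d0.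
have le v : `|g v * expR (- (d * (pp t v.1%:~R v.2%:~R ^+ 2 + rr t v.1%:~R v.2%:~R ^+ 2)))| <=
   M * expR (- (d * (expR (- (2 * m)) * (v.1%:~R ^+ 2 + 6 * v.2%:~R ^+ 2) / 48))).
  by rewrite normrM (ger0_norm (expR_ge0 _)) ler_pM ?expR_ge0// dual_gauss_le.
have S := tsummable_le le (tsummableZ M s0).
split=> //; rewrite /dualbound -tsumZ//; apply: le_tsum => //; first exact: tsummable_norm.
exact: tsummableZ.
Qed.

Definition periodic (N1 N2 : int) b := forall x y : int * int, b (x.1 + N1 * y.1, x.2 + N2 * y.2) = b x.

Variables (c : nat) (kap : R).
Hypotheses (c0 : (0 < c)%N) (k0 : 0 < kap).
Let cR0 : 0 < c%:R :> R. Proof. by rewrite ltr0n. Qed.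

Local Notation del := (4 * pi ^+ 2 / (kap * c%:R ^+ 2)).
Local Notation cst0 := (pi / (2 * rho * kap * c%:R ^+ 2)).

Lemma del_gt0 : 0 < del.
Proof. by rewrite divr_gt0 ?mulr_gt0 ?exprn_gt0// pi_gt0. Qed.

Lemma cst0_gt0 : 0 < cst0.
Proof. by rewrite divr_gt0 ?mulr_gt0 ?exprn_gt0// ?pi_gt0// rho_gt0. Qed.

Definition ang (i j : nat) (v : int * int) : R :=
  2 * pi * (v.1%:~R * i%:R / (24 * c%:R) - v.2%:~R * j%:R / (4 * c%:R)).

(** The cosine part of the finite Fourier transform of b; the sine part disappears after integration
    against an even function of q. *)
Definition Gh b (v : int * int) : R :=
  \sum_(i < 24 * c) \sum_(j < 4 * c) b (i%:Z, j%:Z) * cos (ang i j v).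

Lemma Kth_summable (t q : R) : tsummable (fun x : int * int => Kth c%:R kap t q x.1%:~R x.2%:~R).
Proof.
have C2 := ch2_sh2 t.
pose c2 := ch t ^+ 2 + sh t ^+ 2; pose s2 := 2 * ch t * sh t.
have c20 : 0 < c2 by rewrite /c2 C2; have := sqr_ge0 (sh t); lra.
have cs : c2 ^+ 2 - s2 ^+ 2 = 1 by rewrite /c2 /s2; move: C2; move: (ch t) (sh t) => x y C2; ring: C2.
pose A := kap * c2 / 48; pose B := rho * kap * s2 / 48.
pose C := 6 * kap * c2 / 48.
pose u1 := kk * (c%:R * q / 2) * ch t; pose u2 := - (kk * (c%:R * q / 2) * sh t / rho).
have rn : rho != 0 by rewrite gt_eqF// rho_gt0.
have qn : kk != 0 by rewrite gt_eqF// kk_gt0.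
have A0 : 0 < A by rewrite /A divr_gt0// mulr_gt0.
have D0 : 0 < A * C - B ^+ 2.
  rewrite (_ : _ - _ = 6 * (kap / 48) ^+ 2 * (c2 ^+ 2 - s2 ^+ 2)); first by rewrite cs !mulr_gt0 ?exprn_gt0 ?divr_gt0.
  by rewrite /A /B /C; have := rho2; move: rho => rh r2; field: r2.
have := tsummable_gauss2 (- u1) (- u2) A0 D0; apply: eq_tsummable => y.
rewrite /Kth; congr (expR (- _)).
have e1 : pp t y.1%:~R y.2%:~R - c%:R * q / 2 = pp t (y.1%:~R - u1) (y.2%:~R - u2).
  rewrite /pp /u1 /u2; move: C2 rn qn; move: rho kk (ch t) (sh t) (y.1%:~R) (y.2%:~R) => rh k x z y1 y2 C2 rn qn.
  by field: C2; rewrite rn qn.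
have e2 : rr t y.1%:~R y.2%:~R = rr t (y.1%:~R - u1) (y.2%:~R - u2).
  rewrite /rr /u1 /u2; move: C2 rn qn; move: rho kk (ch t) (sh t) (y.1%:~R) (y.2%:~R) => rh k x z y1 y2 C2 rn qn.
  by field: C2; rewrite rn qn.
rewrite e1 e2 pp_rr_sum -/c2 -/s2 /A /B /C; move: (y.1%:~R - u1) (y.2%:~R - u2) => z1 z2.
by field.
Qed.

Lemma bsummable b M (f : int * int -> R) : (forall x, `|b x| <= M) -> tsummable f -> tsummable (fun x => b x * f x).
Proof.
move=> bM sf; apply: tsummable_le (tsummableZ M (tsummable_norm sf)) => x.
by rewrite normrM ler_wpM2r.
Qed.

Lemma theta_sum b M (t q : R) : periodic (24 * c)%N (4 * c)%N b -> (forall x, `|b x| <= M) ->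
  tsum (fun x : int * int => b x * Kth c%:R kap t q x.1%:~R x.2%:~R) =
  cst0 * tsum (fun v : int * int => (\sum_(i < 24 * c) \sum_(j < 4 * c) b (i%:Z, j%:Z) *
     cos (ang i j v - 2 * pi * q * pp t v.1%:~R v.2%:~R)) *
    expR (- (del * (pp t v.1%:~R v.2%:~R ^+ 2 + rr t v.1%:~R v.2%:~R ^+ 2)))).
Proof.
move=> pb bM.
rewrite (tsum_residues2 (N1 := (24 * c)%N) (N2 := (4 * c)%N)) ?muln_gt0//; last first.
  exact: bsummable bM (Kth_summable t q).
have S i j : tsummable (fun v : int * int => cos (ang i j v - 2 * pi * q * pp t v.1%:~R v.2%:~R) *
    expR (- (del * (pp t v.1%:~R v.2%:~R ^+ 2 + rr t v.1%:~R v.2%:~R ^+ 2)))).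
  by apply: (dual_summable del_gt0 (lexx _) (M := 1) _).1 => v; exact: cos_max.
transitivity (\sum_(i < 24 * c) \sum_(j < 4 * c) tsum (fun v : int * int => cst0 * (b (i%:Z, j%:Z) * (cos (ang i j v - 2 * pi * q * pp t v.1%:~R v.2%:~R) *
    expR (- (del * (pp t v.1%:~R v.2%:~R ^+ 2 + rr t v.1%:~R v.2%:~R ^+ 2))))))).
  apply: eq_bigr => i _; apply: eq_bigr => j _.
  have [s1 e1] := class_theta t q i%:R j%:R cR0 k0.
  transitivity (b (i%:Z, j%:Z) * tsum (fun y : int * int => Kth c%:R kap t q (i%:R + 24 * c%:R * y.1%:~R) (j%:R + 4 * c%:R * y.2%:~R))).
    rewrite -tsumZ//; apply: eq_tsum => y; rewrite (pb (i%:Z, j%:Z) y) /=.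
    have e1' : ((i%:Z + (24 * c)%N%:Z * y.1)%:~R : R) = i%:R + 24 * c%:R * y.1%:~R.
      by rewrite intrD intrM -!pmulrn natrM.
    have e2' : ((j%:Z + (4 * c)%N%:Z * y.2)%:~R : R) = j%:R + 4 * c%:R * y.2%:~R.
      by rewrite intrD intrM -!pmulrn natrM.
    by rewrite e1' e2'.
  rewrite tsumZ; last exact/tsummableZ/S.
  rewrite tsumZ; last exact: S.
  by rewrite e1 mulrCA; congr (_ * (_ * _)); apply: eq_tsum => v; rewrite mulrC /ang.
have -> : (fun v : int * int => (\sum_(i < 24 * c) \sum_(j < 4 * c) b (i%:Z, j%:Z) *
     cos (ang i j v - 2 * pi * q * pp t v.1%:~R v.2%:~R)) *
    expR (- (del * (pp t v.1%:~R v.2%:~R ^+ 2 + rr t v.1%:~R v.2%:~R ^+ 2)))) =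
  (fun v : int * int => \sum_(i < 24 * c) \sum_(j < 4 * c) b (i%:Z, j%:Z) *
     (cos (ang i j v - 2 * pi * q * pp t v.1%:~R v.2%:~R) *
    expR (- (del * (pp t v.1%:~R v.2%:~R ^+ 2 + rr t v.1%:~R v.2%:~R ^+ 2))))).
  apply/funext => v; rewrite mulr_suml; apply: eq_bigr => i _; rewrite mulr_suml.
  by apply: eq_bigr => j _; rewrite mulrA.
rewrite tsum_sum; last by move=> i _; apply: tsummable_sum => j _; exact/tsummableZ/S.
rewrite mulr_sumr; apply: eq_bigr => i _.
rewrite tsum_sum; last by move=> j _; exact/tsummableZ/S.
rewrite mulr_sumr; apply: eq_bigr => j _.
by rewrite (tsumZ _ (tsummableZ (b (i%:Z, j%:Z)) (S i j))).
Qed.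

End theta_kernel.

(** * Smearing the kernel by an even function of q *)

Section theta_transform.
Context {R : realType}.
Local Notation rho := (Num.sqrt 6 : R).
Variables (c : nat) (kap : R) (E : R -> R).
Hypotheses (c0 : (0 < c)%N) (k0 : 0 < kap).
Hypotheses (cE : continuous E) (iE : intg setT E) (eE : forall q, E (- q) = E q).
Let cR0 : 0 < c%:R :> R. Proof. by rewrite ltr0n. Qed.
Implicit Types (b : int * int -> R).

Local Notation del := (4 * pi ^+ 2 / (kap * c%:R ^+ 2)).
Local Notation cst0 := (pi / (2 * rho * kap * c%:R ^+ 2)).

Definition Ehat (p : R) : R := Int setT (fun q => E q * cos (2 * pi * q * p)).
Definition KE (t X Y : R) : R := Int setT (fun q => E q * Kth c%:R kap t q X Y).
Definition DE (t X Y : R) : R := Ehat (pp t X Y) * expR (- (del * (pp t X Y ^+ 2 + rr t X Y ^+ 2))).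
Definition normE : R := Int setT (fun q => `|E q|).

Lemma E_cos_bound (p q : R) : `|E q * cos (2 * pi * q * p)| <= `|E q|.
Proof. by rewrite normrM -[leRHS]mulr1 ler_wpM2l// cos_max. Qed.

Lemma Kth_le1 (t q X Y : R) : Kth c%:R kap t q X Y <= 1.
Proof.
by rewrite /Kth -expR0 ler_expR oppr_le0 mulr_ge0 ?(ltW k0)// addr_ge0// sqr_ge0.
Qed.

Lemma E_Kth_bound (t q X Y : R) : `|E q * Kth c%:R kap t q X Y| <= `|E q|.
Proof.
by rewrite normrM -[leRHS]mulr1 ler_wpM2l// ger0_norm ?expR_ge0// Kth_le1.
Qed.

Lemma cc_Ehat : continuous Ehat.
Proof.
apply: (@cont_param _ setT (fun p q => E q * cos (2 * pi * q * p)) (fun q => `|E q|)) => //.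
- by move=> p; apply: cont_meas => //; ctac.
- exact: intg_norm.
- by move=> p q _; exact: E_cos_bound.
- by move=> q _; ctac.
Qed.

Lemma cc_Kth_q t X Y : continuous (fun q => Kth c%:R kap t q X Y).
Proof. by rewrite /Kth; ctac. Qed.

Lemma cc_KE X Y : continuous (fun t => KE t X Y).
Proof.
have ? := @cc_pp R X Y; have ? := @cc_rr R X Y.
apply: (@cont_param _ setT (fun t q => E q * Kth c%:R kap t q X Y) (fun q => `|E q|)) => //.
- by move=> p; apply: cont_meas => //; apply: cc_M => //; exact: cc_Kth_q.
- exact: intg_norm.
- by move=> p q _; exact: E_Kth_bound.
- by move=> q _; rewrite /Kth; ctac.
Qed.

Lemma cc_DE X Y : continuous (fun t => DE t X Y).
Proof.
have h1 := @cc_pp R X Y; have ? := @cc_rr R X Y; have h := cc_comp h1 cc_Ehat.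
by rewrite /DE; ctac.
Qed.

Lemma Ehat_le p : `|Ehat p| <= normE.
Proof.
apply: norm_Int_le2 => //; last by move=> q _; exact: E_cos_bound.
- by apply: cont_meas => //; ctac.
- exact: intg_norm.
Qed.

(** Inversion with b = 1: on the dual side q occurs only inside a cosine, which gives a bound
    uniform in q and in |t| <= m. *)
Lemma tsum_Kth_le (m t q : R) : `|t| <= m ->
  tsum (fun x : int * int => Kth c%:R kap t q x.1%:~R x.2%:~R) <=
  cst0 * ((24 * c * (4 * c))%:R * dualbound del m).
Proof.
move=> tm.
have := @theta_sum R c kap c0 k0 (fun=> 1) 1 t q (fun _ _ => erefl) (fun _ => _).
move=> /(_ _)/wrap[]; first by rewrite normr1.
under eq_tsum do rewrite mul1r.
move=> ->; rewrite ler_wpM2l ?(ltW (cst0_gt0 c0 k0))//.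
have B v : `|\sum_(i < 24 * c) \sum_(j < 4 * c) (1 : R) * cos ((ang c i j v : R) - 2 * pi * q * pp t v.1%:~R v.2%:~R)| <= (24 * c * (4 * c))%:R.
  apply: le_trans (ler_norm_sum _ _ _) _.
  apply: (@le_trans _ _ (\sum_(i < 24 * c) \sum_(j < 4 * c) (1 : R))); last first.
    by rewrite !big_const_ord !iter_addr_0 -mulrnA mulnC.
  apply: ler_sum => i _; apply: le_trans (ler_norm_sum _ _ _) _.
  by apply: ler_sum => j _; rewrite mul1r cos_max.
have [S1 S2] := dual_summable (del_gt0 c0 k0) tm B.
apply: le_trans (ler_norm _) _; apply: le_trans S2; exact: norm_tsum_le.
Qed.

Definition CT (m : R) : R := cst0 * ((24 * c * (4 * c))%:R * dualbound del m) * normE.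

Lemma sum_KE (m t : R) : `|t| <= m ->
  tsummable (fun x : int * int => KE t x.1%:~R x.2%:~R) /\
  tsum (fun x : int * int => `|KE t x.1%:~R x.2%:~R|) <= CT m.
Proof.
move=> tm.
have cK (x : int * int) : continuous (fun q => `|E q * Kth c%:R kap t q x.1%:~R x.2%:~R|).
  by apply: cc_norm; apply: cc_M => //; exact: cc_Kth_q.
have iK (x : int * int) : intg setT (fun q => `|E q * Kth c%:R kap t q x.1%:~R x.2%:~R|).
  apply: (intg_le _ _ (intg_norm _ iE)) => //; first exact: cont_meas.
  by move=> q _; rewrite normr_id E_Kth_bound.
have sK q : tsummable (fun x : int * int => `|E q * Kth c%:R kap t q x.1%:~R x.2%:~R|).
  exact/tsummable_norm/tsummableZ/Kth_summable.
pose Bd := cst0 * ((24 * c * (4 * c))%:R * dualbound del m).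
have bK q : tsum (fun x : int * int => `| `|E q * Kth c%:R kap t q x.1%:~R x.2%:~R| |) <= Bd * `|E q|.
  under eq_tsum do rewrite normr_id normrM.
  rewrite tsumZ; last exact/tsummable_norm/Kth_summable.
  rewrite mulrC ler_wpM2r//; under eq_tsum do rewrite ger0_norm ?expR_ge0//.
  exact: tsum_Kth_le.
have [S1 S2 S3] := @tsum_Rintegral R _ _ _ (@lebesgue_measure R) setT _ (fun q => Bd * `|E q|) measurableT (intgZ Bd (D := setT) measurableT (intg_norm measurableT iE)) iK (fun q _ => sK q) (fun q _ => bK q).
have le1 (x : int * int) : `|KE t x.1%:~R x.2%:~R| <= Int setT (fun q => `|E q * Kth c%:R kap t q x.1%:~R x.2%:~R|).
  apply: norm_Int_le => //; apply: (intg_le _ _ (intg_norm _ iE)) => //; last by move=> q _; exact: E_Kth_bound.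
  by apply: cont_meas => //; apply: cc_M => //; exact: cc_Kth_q.
have S := tsummable_le le1 S1; split => //.
apply: le_trans (le_tsum (tsummable_norm S) S1 le1) _.
rewrite /Int -S3 /CT -/Bd /normE -IntZ//; last exact: intg_norm.
apply: le_Int => //; first exact: intgZ (intg_norm _ _).
by move=> q _; have := bK q; under eq_tsum do rewrite normr_id.
Qed.

Lemma Gh_le b (M : R) v : (forall x, `|b x| <= M) -> `|Gh c b v| <= M * (24 * c * (4 * c))%:R.
Proof.
move=> bM; apply: le_trans (ler_norm_sum _ _ _) _.
apply: (@le_trans _ _ (\sum_(i < 24 * c) \sum_(j < 4 * c) M)); last first.
  by rewrite !big_const_ord !iter_addr_0 -mulrnA mulnC mulr_natr.
apply: ler_sum => i _; apply: le_trans (ler_norm_sum _ _ _) _.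
apply: ler_sum => j _; rewrite normrM -[leRHS]mulr1 ler_pM ?cos_max//.
Qed.

Lemma theta_E b (M : R) (t : R) : periodic (24 * c)%N (4 * c)%N b -> (forall x, `|b x| <= M) ->
  tsum (fun x : int * int => b x * KE t x.1%:~R x.2%:~R) =
  cst0 * tsum (fun v : int * int => Gh c b v * DE t v.1%:~R v.2%:~R).
Proof.
move=> pb bM; have M0 : 0 <= M := le_trans (normr_ge0 _) (bM (0, 0)).
have tm : `|t| <= `|t| by [].
have iK (x : int * int) : intg setT (fun q => b x * (E q * Kth c%:R kap t q x.1%:~R x.2%:~R)).
  apply: intgZ => //; apply: (intg_le _ _ (intg_norm _ iE)) => //; last by move=> q _; exact: E_Kth_bound.
  by apply: cont_meas => //; apply: cc_M => //; exact: cc_Kth_q.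
have sK q : tsummable (fun x : int * int => b x * (E q * Kth c%:R kap t q x.1%:~R x.2%:~R)).
  apply: bsummable bM _; exact/tsummableZ/Kth_summable.
pose Bd := M * (cst0 * ((24 * c * (4 * c))%:R * dualbound del `|t|)).
have bK q : tsum (fun x : int * int => `|b x * (E q * Kth c%:R kap t q x.1%:~R x.2%:~R)|) <= Bd * `|E q|.
  apply: (@le_trans _ _ (tsum (fun x : int * int => M * `|E q| * Kth c%:R kap t q x.1%:~R x.2%:~R))).
    apply: le_tsum; [exact: tsummable_norm|exact/tsummableZ/Kth_summable|].
    move=> x; rewrite normrM normrM mulrA (ger0_norm (expR_ge0 _)).
    by rewrite ler_wpM2r ?expR_ge0// ler_wpM2r.
  rewrite tsumZ; last exact: Kth_summable.
  by rewrite /Bd mulrAC ler_wpM2r// ler_wpM2l//; exact: tsum_Kth_le.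
have [S1 S2 S3] := @tsum_Rintegral R _ _ _ (@lebesgue_measure R) setT _ (fun q => Bd * `|E q|) measurableT (intgZ Bd (D := setT) measurableT (intg_norm measurableT iE)) iK (fun q _ => sK q) (fun q _ => bK q).
pose Gs v := \sum_(i < 24 * c) \sum_(j < 4 * c) b (i%:Z, j%:Z) * sin (ang c i j v).
pose ex (v : int * int) : R := expR (- (del * (pp t v.1%:~R v.2%:~R ^+ 2 + rr t v.1%:~R v.2%:~R ^+ 2))).
pose F (v : int * int) q := (Gh c b v * cos (2 * pi * q * pp t v.1%:~R v.2%:~R) + Gs v * sin (2 * pi * q * pp t v.1%:~R v.2%:~R)).
have FE v q : \sum_(i < 24 * c) \sum_(j < 4 * c) b (i%:Z, j%:Z) *
     cos ((ang c i j v : R) - 2 * pi * q * pp t v.1%:~R v.2%:~R) = F v q.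
  rewrite /F /Gh /Gs !mulr_suml -big_split; apply: eq_bigr => i _.
  rewrite !mulr_suml -big_split; apply: eq_bigr => j _.
  by rewrite cosB /=; ring.
have FB v q : `|F v q| <= M * (24 * c * (4 * c))%:R.
  rewrite -FE; apply: le_trans (ler_norm_sum _ _ _) _.
  apply: (@le_trans _ _ (\sum_(i < 24 * c) \sum_(j < 4 * c) M)); last first.
    by rewrite !big_const_ord !iter_addr_0 -mulrnA mulnC mulr_natr.
  apply: ler_sum => i _; apply: le_trans (ler_norm_sum _ _ _) _.
  apply: ler_sum => j _; rewrite normrM -[leRHS]mulr1 ler_pM ?cos_max//.
have d0 := del_gt0 c0 k0.
have iV (v : int * int) : intg setT (fun q => E q * (F v q * ex v)).
  apply: (intg_le _ _ (intgZ (M * (24 * c * (4 * c))%:R * ex v) _ (intg_norm _ iE))) => //.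
    by apply: cont_meas => //; rewrite /F; ctac.
  move=> q _; rewrite !normrM mulrC ler_wpM2r// (ger0_norm (expR_ge0 _)) ler_wpM2r ?expR_ge0//.
have sV q : tsummable (fun v : int * int => E q * (F v q * ex v)) /\
   tsum (fun v : int * int => `|E q * (F v q * ex v)|) <= (M * (24 * c * (4 * c))%:R * dualbound del `|t|) * `|E q|.
  have [T1 T2] := dual_summable d0 tm (fun v => FB v q).
  split; first exact: tsummableZ.
  under eq_tsum do rewrite normrM.
  rewrite tsumZ; last exact: tsummable_norm T1.
  by rewrite mulrC; apply: ler_wpM2r.
have [V1 V2 V3] := @tsum_Rintegral R _ _ _ (@lebesgue_measure R) setT _ (fun q => _ * `|E q|) measurableT (intgZ (M * (24 * c * (4 * c))%:R * dualbound del `|t|) (D := setT) measurableT (intg_norm measurableT iE)) iV (fun q _ => (sV q).1) (fun q _ => (sV q).2).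
transitivity (tsum (fun x : int * int => Int setT (fun q => b x * (E q * Kth c%:R kap t q x.1%:~R x.2%:~R)))).
  apply: eq_tsum => x; rewrite IntZ//.
  apply: (intg_le _ _ (intg_norm _ iE)) => //; last by move=> q _; exact: E_Kth_bound.
  by apply: cont_meas => //; apply: cc_M => //; exact: cc_Kth_q.
rewrite /Int -S3.
transitivity (Int setT (fun q => cst0 * tsum (fun v : int * int => E q * (F v q * ex v)))).
  apply: eq_Int => q _.
  have := theta_sum c0 k0 t q pb bM; under [in X in _ = X -> _]eq_tsum do rewrite FE -/(ex _).
  move=> TS; rewrite tsumZ; last exact: (dual_summable d0 tm (fun v => FB v q)).1.
  rewrite mulrCA -TS -tsumZ; last by apply: bsummable bM _; exact: Kth_summable.
  by apply: eq_tsum => x; rewrite mulrCA.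
rewrite IntZ//; congr (_ * _).
rewrite [LHS]V3; apply: eq_tsum => v.
have iC : intg setT (fun q => E q * cos (2 * pi * q * pp t v.1%:~R v.2%:~R)).
  apply: (intg_le _ _ (intg_norm _ iE)) => //; last by move=> q _; exact: E_cos_bound.
  by apply: cont_meas => //; ctac.
have cS : continuous (fun q => E q * sin (2 * pi * q * pp t v.1%:~R v.2%:~R)) by ctac.
have iS : intg setT (fun q => E q * sin (2 * pi * q * pp t v.1%:~R v.2%:~R)).
  apply: (intg_le _ _ (intg_norm _ iE)) => //; first exact: cont_meas.
  by move=> q _; rewrite normrM -[leRHS]mulr1 ler_wpM2l// sin_max.
transitivity (Int setT (fun q => Gh c b v * ex v * (E q * cos (2 * pi * q * pp t v.1%:~R v.2%:~R)) + Gs v * ex v * (E q * sin (2 * pi * q * pp t v.1%:~R v.2%:~R)))).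
  by apply: eq_Int => q _; rewrite /F; ring.
rewrite IntD//; [|exact: intgZ|exact: intgZ].
(* The term with [Gs] is the integral of an odd function of q, hence zero. *)
rewrite !IntZ// [X in _ + _ * X]Int_odd//; last first.
  by move=> q; rewrite eE -mulrN -sinN; congr (_ * sin _); ring.
by rewrite mulr0 addr0 /DE /Ehat -/(ex v); ring.
Qed.

Lemma sum_DE (m t : R) : `|t| <= m ->
  tsummable (fun v : int * int => DE t v.1%:~R v.2%:~R) /\
  tsum (fun v : int * int => `|DE t v.1%:~R v.2%:~R|) <= normE * dualbound del m.
Proof. by move=> tm; apply: dual_summable (del_gt0 c0 k0) tm _ => v; exact: Ehat_le. Qed.

Lemma tsum_Int_itv (f : int * int -> R -> R) (P CC : R) : 0 <= P -> (forall x, continuous (f x)) ->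
  (forall t, `|t| <= P -> tsummable (fun x => f x t) /\ tsum (fun x => `|f x t|) <= CC) ->
  tsummable (fun x => Int `[0, P] (f x)) /\ tsummable (fun x => Int `[0, P] (fun t => `|f x t|)) /\
  tsum (fun x => Int `[0, P] (f x)) = Int `[0, P] (fun t => tsum (fun x => f x t)).
Proof.
move=> P0 cf sf.
have itv t : `[0, P]%classic t -> `|t| <= P by rewrite /= in_itv /= => /andP[t0 tP]; rewrite ger0_norm.
have iC : (@lebesgue_measure R).-integrable `[0, P] (EFin \o (fun _ : R => CC)).
  exact/intg_itv/cc_cst.
have mI : measurable (`[0, P]%classic : set (measurableTypeR R)) by [].
have [S1 S2 S3] := @tsum_Rintegral R _ _ _ (@lebesgue_measure R) `[0, P] f (fun _ => CC) mI iC (fun x => intg_itv 0 P (cf x)) (fun t ht => (sf t (itv t ht)).1) (fun t ht => (sf t (itv t ht)).2).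
have sf' t : `[0, P]%classic t -> tsum (fun x => `| `|f x t| |) <= CC.
  by move=> /itv ht; under eq_tsum do rewrite normr_id; exact: (sf t ht).2.
have [S1' _ _] := @tsum_Rintegral R _ _ _ (@lebesgue_measure R) `[0, P] (fun x t => `|f x t|) (fun _ => CC) mI iC (fun x => intg_itv 0 P (cc_norm (cf x))) (fun t ht => tsummable_norm (sf t (itv t ht)).1) sf'.
by [].
Qed.

(** The bounds are uniform for |t| <= P, so both sides may be integrated term by term over a period
    of t. *)
Lemma theta_E_itv b (M : R) (P : R) : 0 <= P -> periodic (24 * c)%N (4 * c)%N b -> (forall x, `|b x| <= M) ->
  [/\ tsummable (fun x : int * int => Int `[0, P] (fun t => `|KE t x.1%:~R x.2%:~R|)),
      tsummable (fun x : int * int => Int `[0, P] (fun t => `|DE t x.1%:~R x.2%:~R|)) &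
  tsum (fun x : int * int => b x * Int `[0, P] (fun t => KE t x.1%:~R x.2%:~R)) =
  cst0 * tsum (fun v : int * int => Gh c b v * Int `[0, P] (fun t => DE t v.1%:~R v.2%:~R))].
Proof.
move=> P0 pb bM; have M0 : 0 <= M := le_trans (normr_ge0 _) (bM (0, 0)).
have K1 := tsum_Int_itv P0 (fun x : int * int => @cc_KE x.1%:~R x.2%:~R) (sum_KE (m := P)).
have D1 := tsum_Int_itv P0 (fun x : int * int => @cc_DE x.1%:~R x.2%:~R) (sum_DE (m := P)).
have bnd (g : int * int -> R) (f : int * int -> R -> R) (N CC : R) : (forall x, `|g x| <= N) ->
   (forall t, `|t| <= P -> tsummable (fun x => f x t) /\ tsum (fun x => `|f x t|) <= CC) ->
   (forall t, `|t| <= P -> tsummable (fun x => g x * f x t) /\ tsum (fun x => `|g x * f x t|) <= N * CC).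
  move=> gN sf t tP; have N0 : 0 <= N := le_trans (normr_ge0 _) (gN (0, 0)).
  have [s1 s2] := sf t tP; have s3 := bsummable gN s1; split => //.
  apply: le_trans (_ : _ <= N * tsum (fun x => `|f x t|)) _; last by rewrite ler_wpM2l.
  rewrite -tsumZ; last exact: tsummable_norm.
  apply: le_tsum; [exact: tsummable_norm|exact/tsummableZ/tsummable_norm|].
  by move=> x; rewrite normrM ler_wpM2r.
have [_ [_ K2]] := tsum_Int_itv P0 (fun x : int * int => cc_M (@cc_cst R (b x)) (@cc_KE x.1%:~R x.2%:~R)) (bnd _ _ _ _ bM (sum_KE (m := P))).
have [_ [_ D2]] := tsum_Int_itv P0 (fun x : int * int => cc_M (@cc_cst R (Gh c b x)) (@cc_DE x.1%:~R x.2%:~R)) (bnd _ _ _ _ (fun v => Gh_le v bM) (sum_DE (m := P))).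
split; [exact: K1.2.1|exact: D1.2.1|].
transitivity (tsum (fun x : int * int => Int `[0, P] (fun t => b x * KE t x.1%:~R x.2%:~R))).
  by apply: eq_tsum => x; rewrite IntZ//; exact/intg_itv/cc_KE.
rewrite K2.
transitivity (cst0 * tsum (fun x : int * int => Int `[0, P] (fun t => Gh c b x * DE t x.1%:~R x.2%:~R))); last first.
  by congr (_ * _); apply: eq_tsum => x; rewrite IntZ//; exact/intg_itv/cc_DE.
rewrite D2 -IntZ//; last first.
  have iC : (@lebesgue_measure R).-integrable `[0, P] (EFin \o (fun _ : R => M * (24 * c * (4 * c))%:R * (normE * dualbound del P))).
    exact/intg_itv/cc_cst.
  have mI : measurable (`[0, P]%classic : set (measurableTypeR R)) by [].
  have itv t : `[0, P]%classic t -> `|t| <= P by rewrite /= in_itv /= => /andP[t0 tP]; rewrite ger0_norm.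
  have B := bnd _ _ _ _ (fun v => Gh_le v bM) (sum_DE (m := P)).
  by have [] := @tsum_Rintegral R _ _ _ (@lebesgue_measure R) `[0, P] (fun (x : int * int) t => Gh c b x * DE t x.1%:~R x.2%:~R) _ mI iC (fun x => intg_itv 0 P (cc_M (@cc_cst R (Gh c b x)) (@cc_DE x.1%:~R x.2%:~R))) (fun t ht => (B t (itv t ht)).1) (fun t ht => (B t (itv t ht)).2).
by apply: eq_Int => t _; exact: theta_E.
Qed.

End theta_transform.

(** * The sign functions f_l and their symmetries *)

Section structure.

(* Signed residues: [fcl l] is the characteristic function of S_l^+ minus that of S_l^-, in the
   integer coordinates (X, Y) = (24 m1, 4 m2). *)
Definition fcl_nat (l X Y : nat) : int :=
  match l with
  | 0 => (((X, Y) \in [:: (7, 0); (17, 0); (11, 2); (13, 2)])%N : nat)%:Z -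
         (((X, Y) \in [:: (1, 0); (23, 0); (5, 2); (19, 2)])%N : nat)%:Z
  | 1 => (((X, Y) \in [:: (11, 0); (13, 0); (7, 2); (17, 2)])%N : nat)%:Z -
         (((X, Y) \in [:: (5, 0); (19, 0); (1, 2); (23, 2)])%N : nat)%:Z
  | _ => (((X, Y) \in [:: (10, 1); (14, 1); (10, 3); (14, 3)])%N : nat)%:Z -
         (((X, Y) \in [:: (2, 1); (22, 1); (2, 3); (22, 3)])%N : nat)%:Z
  end.

Definition fcl (l : nat) (x : int * int) : int :=
  fcl_nat l (absz (modz x.1 24)) (absz (modz x.2 4)).

(** Multiplication of X + Y sqrt 6 by the unit 5 + 2 sqrt 6. *)
Definition eps (x : int * int) : int * int := (5 * x.1 + 12 * x.2, 2 * x.1 + 5 * x.2).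

Lemma modz_nat (m : int) (N : nat) : (0 < N)%N ->
  exists2 i : nat, (i < N)%N & exists k : int, m = i%:Z + N%:Z * k.
Proof.
move=> N0; exists (absz (modz m N)); last first.
  by exists (divz m N); have := divz_eq m N; have := @modz_ge0 m N; lia.
by have := @ltz_pmod m N; have := @modz_ge0 m N; lia.
Qed.

Lemma fclD (l : nat) (x y : int * int) : fcl l (x.1 + 24 * y.1, x.2 + 4 * y.2) = fcl l x.
Proof. by rewrite /fcl /= (mulrC 24) (mulrC 4) ![_ + _ * _]addrC !modzMDl. Qed.

Lemma fclE (l i j : nat) : (i < 24)%N -> (j < 4)%N -> fcl l (i%:Z, j%:Z) = fcl_nat l i j.
Proof. by move=> hi hj; rewrite /fcl /= !modz_small//; lia. Qed.

Lemma fcl_case (P : (int * int) -> Prop) :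
  (forall x y, P x -> P (x.1 + 24 * y.1, x.2 + 4 * y.2)) ->
  (forall i j : nat, (i < 24)%N -> (j < 4)%N -> P (i%:Z, j%:Z)) -> forall x, P x.
Proof.
move=> HP Hij [x1 x2].
have [i hi [k1 ->]] := modz_nat x1 (isT : 0 < 24)%N.
have [j hj [k2 ->]] := modz_nat x2 (isT : 0 < 4)%N.
exact: (HP (i%:Z, j%:Z) (k1, k2) (Hij i j hi hj)).
Qed.

(** Reduces a symmetry of f_l to the 96 residues modulo (24, 4), which are then verified by
    computation. *)
Lemma fcl_check (g : int * int -> int * int) (s : int) (l : nat) :
  (forall x y, exists z : int * int, g (x.1 + 24 * y.1, x.2 + 4 * y.2) = ((g x).1 + 24 * z.1, (g x).2 + 4 * z.2)) ->
  all (fun i => all (fun j : nat => fcl l (g (i%:Z, j%:Z)) == s * fcl l (i%:Z, j%:Z)) (iota 0 4)) (iota 0 24) ->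
  forall x, fcl l (g x) = s * fcl l x.
Proof.
move=> hg chk; apply: fcl_case => [x y hx|i j hi hj].
  by have [z ->] := hg x y; rewrite !fclD.
apply/eqP; move/allP: chk => /(_ i); rewrite mem_iota => /(_ hi)/allP/(_ j).
by rewrite mem_iota; exact.
Qed.

Lemma fcl_eps l x : fcl l (eps x) = fcl l x.
Proof.
rewrite -[RHS]mul1r; apply: fcl_check => [[x1 x2] [y1 y2]|].
  by exists (5 * y1 + 2 * y2, 12 * y1 + 5 * y2); rewrite /eps /=; congr (_, _); ring.
by case: l => [|[|l]]; vm_compute.
Qed.

Lemma fcl_negX l x : fcl l (- x.1, x.2) = fcl l x.
Proof.
rewrite -[RHS]mul1r; apply: (@fcl_check (fun x => (- x.1, x.2))) => [[x1 x2] [y1 y2]|].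
  by exists (- y1, y2); rewrite /=; congr (_, _); ring.
by case: l => [|[|l]]; vm_compute.
Qed.

Lemma fcl_negY l x : fcl l (x.1, - x.2) = fcl l x.
Proof.
rewrite -[RHS]mul1r; apply: (@fcl_check (fun x => (x.1, - x.2))) => [[x1 x2] [y1 y2]|].
  by exists (y1, - y2); rewrite /=; congr (_, _); ring.
by case: l => [|[|l]]; vm_compute.
Qed.

Lemma fcl_seven l (u : int) x : u = 7 %[mod 24]%Z -> fcl l (u * x.1, x.2) = - fcl l x.
Proof.
move=> u7; rewrite -mulN1r.
have [k uk] : exists k, u = 7 + 24 * k.
  by exists (divz u 24); rewrite {1}(divz_eq u 24) u7; have -> : modz 7 24 = 7 by []; ring.
rewrite uk; transitivity (fcl l (7 * x.1, x.2)).
  have := fclD l (7 * x.1, x.2) (k * x.1, 0); rewrite /= mulr0 addr0 => <-.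
  by congr (fcl l (_, _)); ring.
move: x; apply: (@fcl_check (fun x => (7 * x.1, x.2))) => [[x1 x2] [y1 y2]|].
  by exists (7 * y1, y2); rewrite /=; congr (_, _); ring.
by case: l => [|[|l]]; vm_compute.
Qed.

Lemma fcl_row0 l (i j : int) : fcl l (24 * i, j) = 0.
Proof.
have := fclD l (0, j) (i, 0); rewrite /= mulr0 add0r addr0 => ->.
have [m hm [k ->]] := modz_nat j (isT : 0 < 4)%N.
have := fclD l (0, m%:Z) (0, k); rewrite /= mulr0 addr0 => ->.
by rewrite (@fclE l 0 m)//; case: l => [|[|l]]; case: m hm => [|[|[|[|m]]]].
Qed.

(** The generators on residues: 0 multiplies X by 7 and is the only one that reverses the sign; 1
    and 2 negate X and Y; 3 is [eps]. *)
Definition gact (g : nat) (p : nat * nat) : nat * nat :=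
  match g with
  | 0 => ((7 * p.1) %% 24, p.2)
  | 1 => ((24 - p.1) %% 24, p.2)
  | 2 => (p.1, (4 - p.2) %% 4)
  | _ => ((5 * p.1 + 12 * p.2) %% 24, (2 * p.1 + 5 * p.2) %% 4)
  end%N.

Definition gword (s : seq nat) (p : nat * nat) : nat * nat := foldl (fun p g => gact g p) p s.

Definition gsign (s : seq nat) : bool := odd (count_mem 0%N s).

Definition gwords : seq (seq nat) :=
  [:: [::]; [:: 0]; [:: 1]; [:: 2]; [:: 3]; [:: 0; 1]; [:: 0; 2]; [:: 0; 3]; [:: 1; 2]; [:: 1; 3];
      [:: 0; 1; 2]; [:: 0; 1; 3]]%N.

(** A certificate for one residue. Either two words of opposite sign carry it to the same residue,
    which forces an equivariant function to vanish there, or a word carries it to a base point (7,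
    0), (11, 0), (10, 1) with the sign recorded by f_l. *)
Definition gcheck (p : nat * nat) : bool :=
  (has (fun s => has (fun t => (gword s p == gword t p) && (gsign s != gsign t)) gwords) gwords &&
   [&& fcl_nat 0 p.1 p.2 == 0, fcl_nat 1 p.1 p.2 == 0 & fcl_nat 2 p.1 p.2 == 0]) ||
  has (fun s => let v : int := (-1) ^+ gsign s in
    [|| [&& gword s p == (7, 0)%N, fcl_nat 0 p.1 p.2 == v, fcl_nat 1 p.1 p.2 == 0 & fcl_nat 2 p.1 p.2 == 0],
        [&& gword s p == (11, 0)%N, fcl_nat 0 p.1 p.2 == 0, fcl_nat 1 p.1 p.2 == v & fcl_nat 2 p.1 p.2 == 0] |
        [&& gword s p == (10, 1)%N, fcl_nat 0 p.1 p.2 == 0, fcl_nat 1 p.1 p.2 == 0 & fcl_nat 2 p.1 p.2 == v]])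
    gwords.

Lemma gcheckP : all (fun i => all (fun j => gcheck (i, j)) (iota 0 4)) (iota 0 24).
Proof. by vm_compute. Qed.

Lemma fcl_basis (K : numFieldType) (W : int * int -> K) :
  (forall x y, W (x.1 + 24 * y.1, x.2 + 4 * y.2) = W x) ->
  (forall x, W (eps x) = W x) ->
  (forall x, W (- x.1, x.2) = W x) -> (forall x, W (x.1, - x.2) = W x) ->
  (forall x, W (7 * x.1, x.2) = - W x) ->
  forall x, W x = (fcl 0 x)%:~R * W (7, 0) + (fcl 1 x)%:~R * W (11, 0) + (fcl 2 x)%:~R * W (10, 1).
Proof.
move=> WD We Wa Wb Wu; apply: fcl_case => [x y|]; first by rewrite WD !fclD.
have red (a b : int) (i j : nat) : (exists k, a = i%:Z + 24 * k) -> (exists k, b = j%:Z + 4 * k) -> W (a, b) = W (i%:Z, j%:Z).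
  by move=> [k1 ->] [k2 ->]; exact: (WD (i%:Z, j%:Z) (k1, k2)).
pose w (i j : nat) := W (i%:Z, j%:Z).
have We' (i j : nat) : w i j = w ((5 * i + 12 * j) %% 24)%N ((2 * i + 5 * j) %% 4)%N.
  rewrite /w -We; apply: red.
    by exists ((5 * i + 12 * j) %/ 24)%N%:Z => /=; have := divn_eq (5 * i + 12 * j) 24; lia.
  by exists ((2 * i + 5 * j) %/ 4)%N%:Z => /=; have := divn_eq (2 * i + 5 * j) 4; lia.
have Wa' (i j : nat) : (i < 24)%N -> w i j = w ((24 - i) %% 24)%N j.
  move=> hi; rewrite /w -(Wa (i%:Z, j%:Z)); apply: red; last by exists 0; rewrite /= mulr0 addr0.
  by exists (((24 - i) %/ 24)%N%:Z - 1) => /=; have := divn_eq (24 - i) 24; lia.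
have Wb' (i j : nat) : (j < 4)%N -> w i j = w i ((4 - j) %% 4)%N.
  move=> hj; rewrite /w -(Wb (i%:Z, j%:Z)); apply: red; first by exists 0; rewrite /= mulr0 addr0.
  by exists (((4 - j) %/ 4)%N%:Z - 1) => /=; have := divn_eq (4 - j) 4; lia.
have Wu' (i j : nat) : w i j = - w ((7 * i) %% 24)%N j.
  apply: (canRL (@opprK _)); rewrite /w -(Wu (i%:Z, j%:Z)); apply: red; last by exists 0; rewrite /= mulr0 addr0.
  by exists ((7 * i) %/ 24)%N%:Z => /=; have := divn_eq (7 * i) 24; lia.
have neg0 (a : K) : a = - a -> a = 0.
  by move=> h; have : 2 * a == 0 by [rewrite mulr2n mulrDl mul1r {1}h addNr]; rewrite mulf_eq0 pnatr_eq0 => /eqP.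
have act1 g (p : nat * nat) : (p.1 < 24)%N -> (p.2 < 4)%N ->
  [/\ ((gact g p).1 < 24)%N, ((gact g p).2 < 4)%N & w p.1 p.2 = (-1) ^+ (g == 0%N) * w (gact g p).1 (gact g p).2].
  move=> h1 h2; case: g => [|[|[|g]]] /=; rewrite ?expr1 ?expr0 ?mulN1r ?mul1r; split; rewrite ?ltn_pmod//.
  - exact: Wa'.
  - exact: Wb'.
have actw s (p : nat * nat) : (p.1 < 24)%N -> (p.2 < 4)%N ->
  w p.1 p.2 = (-1) ^+ gsign s * w (gword s p).1 (gword s p).2.
  elim: s p => [|g s ih] p h1 h2; first by rewrite expr0 mul1r.
  have [h1' h2' ->] := act1 g p h1 h2; rewrite (ih (gact g p) h1' h2') mulrA; congr (_ * _).
  by rewrite /gsign /= oddD signr_addb; case: (g == 0%N).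
move=> i j hi hj; rewrite !fclE// -/(w i j) -/(w 7 0) -/(w 11 0) -/(w 10 1).
have /allP/(_ i) := gcheckP; rewrite mem_iota => /(_ hi)/allP/(_ j); rewrite mem_iota => /(_ hj).
case/orP => [/andP[/hasP[s _ /hasP[t _ /andP[/eqP st sg]]]]|/hasP[s _]] /=.
  move=> /and3P[/eqP-> /eqP-> /eqP->]; rewrite !mulr0z !mul0r !addr0.
  apply: neg0; rewrite {1}(actw s (i, j) hi hj) (actw t (i, j) hi hj) st -mulNr; congr (_ * _).
  by move: sg; case: (gsign s); case: (gsign t); rewrite //= ?expr1 ?expr0 ?opprK.
have := actw s (i, j) hi hj => /= ->.
have es : (((-1) ^+ gsign s : int)%:~R : K) = (-1) ^+ gsign s by rewrite rmorphXn /= rmorphN1.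
by case/or3P => /and4P[/eqP -> /eqP-> /eqP-> /eqP->]; rewrite es !mulr0z !mul0r ?addr0 ?add0r.
Qed.

(* u = -1 modulo the 2-part of 48 c and u = 1 modulo the odd part. *)
Lemma exists_square_root_one (c : nat) : (0 < c)%N ->
  exists2 u : nat, (u = 7 %[mod 24])%N & (u ^ 2 = 1 %[mod 48 * c])%N.
Proof.
move=> c0; pose N := (48 * c)%N; have N0 : (0 < N)%N by rewrite muln_gt0.
pose A := (N`_2)%N; pose Bp := (N`_(2^'))%N.
have NAB : N = (A * Bp)%N by rewrite /A /Bp partnC.
have cop : coprime A Bp by exact: coprime_partC.
pose u := chinese A Bp (A - 1)%N 1%N.
have A16 : (16 %| A)%N.
  have -> : 16%N = (2 ^ 4)%N by [].
  rewrite /A p_part; apply: dvdn_exp2l; rewrite -pfactor_dvdn// /N.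
  by rewrite -[(48 * c)%N]/((16 * 3) * c)%N -mulnA dvdn_mulr.
have A0 : (0 < A)%N by rewrite /A part_gt0.
have B3 : (3 %| Bp)%N.
  have h : (3 %| A * Bp)%N by rewrite -NAB /N -[48%N]/(3 * 16)%N -mulnA dvdn_mulr.
  move: h; rewrite Gauss_dvdr// /A p_part; rewrite coprimeXr//.
have uA : (u = A - 1 %[mod A])%N by rewrite chinese_modl.
have uB : (u = 1 %[mod Bp])%N by rewrite chinese_modr.
exists u.
  have u8 : (u = 7 %[mod 8])%N.
    have d8 : (8 %| A)%N by apply: dvdn_trans A16.
    rewrite -(modn_dvdm u d8) uA (modn_dvdm _ d8).
    have [k Ak] := dvdnP A16; rewrite Ak; case: k Ak => [|k] Ak; first by rewrite Ak in A0.
    have -> : (k.+1 * 16 - 1 = (k * 2 + 1) * 8 + 7)%N by clear; lia.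
    by rewrite modnMDl.
  have u3 : (u = 7 %[mod 3])%N by rewrite -(modn_dvdm u B3) uB (modn_dvdm _ B3).
  by apply/eqP; rewrite -[24%N]/(8 * 3)%N chinese_remainder// u8 u3 !eqxx.
rewrite -/N NAB; apply/eqP; rewrite chinese_remainder//; apply/andP; split; apply/eqP.
  rewrite -modnXm uA modnXm.
  have -> : ((A - 1) ^ 2 = (A - 2) * A + 1)%N.
    have [m ->] : exists m, A = m.+2 by exists (A - 2)%N; have := dvdn_leq A0 A16; clear; lia.
    by rewrite subn2 subn1 /= -mulnn !mulSn !mulnS; clear; lia.
  by rewrite modnMDl.
by rewrite -modnXm uB modnXm exp1n.
Qed.

End structure.

(** * Orbits of the automorph and the orbit weight *)

Section orbits.
Context {R : realType}.
Local Notation rho := (Num.sqrt 6 : R).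

Definition epsi (x : int * int) : int * int := (5 * x.1 - 12 * x.2, - 2 * x.1 + 5 * x.2).

Lemma epsK : cancel eps epsi.
Proof. by move=> [x y]; rewrite /eps /epsi /=; congr (_, _); ring. Qed.
Lemma epsiK : cancel epsi eps.
Proof. by move=> [x y]; rewrite /eps /epsi /=; congr (_, _); ring. Qed.

Definition epsz (k : int) (x : int * int) : int * int :=
  match k with Posz n => iter n eps x | Negz n => iter n.+1 epsi x end.

Lemma epszS k x : epsz (k + 1) x = eps (epsz k x).
Proof.
case: k => n; first by rewrite -PoszD addn1.
case: n => [|n]; first by rewrite /= epsiK.
by rewrite (_ : Negz n.+1 + 1 = Negz n) /=; [rewrite epsiK|lia].
Qed.

Lemma epszP k x : epsz (k - 1) x = epsi (epsz k x).
Proof. by rewrite -{2}(subrK 1 k) epszS epsK. Qed.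

Lemma int_ind1 (P : int -> Prop) : P 0 -> (forall k, P k -> P (k + 1)) -> (forall k, P k -> P (k - 1)) -> forall k, P k.
Proof.
move=> P0 PS PP; case=> n.
  by elim: n => // n ih; rewrite -addn1 PoszD; exact: PS.
elim: n => [|n ih]; first exact: (PP 0).
by rewrite (_ : Negz n.+1 = Negz n - 1); [exact: PP|lia].
Qed.

Lemma epszD k l x : epsz (k + l) x = epsz k (epsz l x).
Proof.
elim/int_ind1: k => [|k ih|k ih]; first by rewrite add0r.
  by rewrite addrAC !epszS ih.
by rewrite addrAC !epszP ih.
Qed.

Definition qf (x : int * int) : int := x.1 ^+ 2 - 6 * x.2 ^+ 2.

Lemma qf_eps x : qf (eps x) = qf x.
Proof. by rewrite /qf /eps /=; ring. Qed.
Lemma qf_epsi x : qf (epsi x) = qf x.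
Proof. by rewrite -[in RHS](epsiK x) qf_eps. Qed.
Lemma qf_epsz k x : qf (epsz k x) = qf x.
Proof.
by elim/int_ind1: k => // k ih; rewrite ?epszS ?epszP ?qf_eps ?qf_epsi.
Qed.

(** 6 is not a rational square: the power of 2 in X^2 is even, that in 6 Y^2 odd. *)
Lemma qf_eq0 x : qf x = 0 -> x = (0, 0).
Proof.
move=> h.
have h2 : (absz x.1 ^ 2 = 6 * absz x.2 ^ 2)%N.
  by have := congr1 absz (subr0_eq h); rewrite abszM !abszX.
have [y0|y0] := eqVneq (absz x.2) 0%N.
  move: h2; rewrite y0 muln0 => /eqP; rewrite expn_eq0 andbT => /eqP x0.
  by case: x {h} x0 y0 => a b /=; move=> /eqP; rewrite absz_eq0 => /eqP -> /eqP; rewrite absz_eq0 => /eqP ->.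
have : odd (logn 2 (absz x.1 ^ 2)) = odd (logn 2 (6 * absz x.2 ^ 2)) by rewrite h2.
rewrite lognX oddM /= lognM ?expn_gt0 ?lt0n ?y0// lognX oddD oddM /=.
by [].
Qed.

(* the value of the cone form at x; the weight compares its sign at x and at eps^-1 x *)
Definition vform (x : int * int) : int := if 0 < qf x then x.1 + 3 * x.2 else x.1 + 2 * x.2.

Definition om (x : int * int) : R :=
  (1 - Num.sg (vform x)%:~R * Num.sg (vform (epsi x))%:~R) / 2.

Lemma omE x : om x = if 0 < qf x
  then (1 + Num.sg ((x.1%:~R : R) + 3 * x.2%:~R) * Num.sg (x.1%:~R - 3 * x.2%:~R)) / 2
  else (1 - Num.sg ((x.1%:~R : R) + 2 * x.2%:~R) * Num.sg (x.1%:~R - 2 * x.2%:~R)) / 2.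
Proof.
rewrite /om /vform qf_epsi; case: ifP => _ /=.
  rewrite (_ : (5 * x.1 - 12 * x.2 + 3 * (- 2 * x.1 + 5 * x.2))%:~R = - (x.1%:~R - 3 * x.2%:~R) :> R).
    by rewrite sgrN mulrN opprK intrD intrM.
  by rewrite !(intrD, intrM, intrN, rmorphB, rmorphN) /=; ring.
rewrite (_ : (5 * x.1 - 12 * x.2 + 2 * (- 2 * x.1 + 5 * x.2))%:~R = x.1%:~R - 2 * x.2%:~R :> R).
  by rewrite intrD intrM.
by rewrite !(intrD, intrM, intrN, rmorphB, rmorphN) /=; ring.
Qed.

Lemma om_ge0 x : 0 <= om x.
Proof.
rewrite /om divr_ge0// subr_ge0; apply: le_trans (ler_norm _) _; rewrite normrM !normr_sg.
by case: (_ != 0); case: (_ != 0); rewrite ?mulr1 ?mulr0.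
Qed.

Lemma om_le1 x : om x <= 1.
Proof.
have : - 1 <= Num.sg (vform x)%:~R * Num.sg (vform (epsi x))%:~R :> R.
  by apply: lerNnormlW; rewrite normrM !normr_sg; case: (_ != 0); case: (_ != 0); rewrite ?mulr1 ?mulr0.
by rewrite /om => h; lra.
Qed.

Lemma tsum_telescope (t : int -> R) (K : nat) : (forall k, K%:Z <= k -> t k = 1 / 2) ->
  (forall k, k <= - K%:Z -> t k = - (1 / 2)) ->
  tsummable (fun k => t k - t (k - 1)) /\ tsum (fun k => t k - t (k - 1)) = 1.
Proof.
move=> tp tn; pose s := [seq i%:Z - K%:Z | i <- iota 0 (2 * K).+1].
have us : uniq s by rewrite map_inj_uniq ?iota_uniq// => i j; lia.
have ns k : k \notin s -> t k - t (k - 1) = 0.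
  move=> ks; have [h|h] := leP (K%:Z + 1) k; first by rewrite !tp ?subrr//; lia.
  have [h'|h'] := leP k (- K%:Z); first by rewrite !tn ?subrr//; lia.
  case/negP: ks; apply/mapP; exists (absz (k + K%:Z)%R); last by lia.
  by rewrite mem_iota; lia.
have [S1 S2] := @tsum_seq R _ s (fun k => t k - t (k - 1)) us ns.
split=> //; rewrite S2 big_map.
have tel m : \sum_(i <- iota 0 m) (t (i%:Z - K%:Z) - t (i%:Z - K%:Z - 1)) = t (m%:Z - K%:Z - 1) - t (- K%:Z - 1).
  elim: m => [|m ih]; first by rewrite big_nil sub0r subrr.
  rewrite -addn1 iotaD big_cat /= big_seq1 ih add0n (_ : (m + 1)%N%:Z - K%:Z - 1 = m%:Z - K%:Z); last lia.
  by lra.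
by rewrite tel tp ?tn; [lra|lia|lia].
Qed.

(** Checked case by case, including a = 0 and b = 0: an orbit that meets the wall contributes two
    halves, so the telescoping is exact there too. *)
Lemma sg_step (a b : int) : b < a -> (1 - Num.sg (a%:~R : R) * Num.sg b%:~R) / 2 = Num.sg (a%:~R : R) / 2 - Num.sg b%:~R / 2.
Proof.
move=> ba; have ba' : (b%:~R : R) < a%:~R by rewrite ltr_int.
have [a0|a0|a0] := ltgtP (a%:~R : R) 0; have [b0|b0|b0] := ltgtP (b%:~R : R) 0;
 rewrite ?a0 ?b0 ?(ltr0_sg a0) ?(ltr0_sg b0) ?(gtr0_sg a0) ?(gtr0_sg b0) ?sgr0; lra.
Qed.

(** A strictly increasing integer sequence grows by at least 1 at each step, so its sign is
    eventually constant in both directions, and the weights telescope from -1/2 to 1/2. *)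
Lemma om_sum_mono x (z : int) : (z == 1) || (z == -1) ->
  (forall k, z * vform (epsz (k - 1) x) < z * vform (epsz k x)) ->
  tsummable (fun k => om (epsz k x)) /\ tsum (fun k => om (epsz k x)) = 1.
Proof.
move=> z1 mono.
pose t k : R := Num.sg (z * vform (epsz k x))%:~R / 2.
have grow (n : nat) k : z * vform (epsz k x) + n%:Z <= z * vform (epsz (k + n%:Z) x).
  elim: n => [|n ih]; first by rewrite !addr0.
  by have := mono (k + n.+1%:Z); rewrite (_ : k + n.+1%:Z - 1 = k + n%:Z); lia.
pose K := (absz (z * vform (epsz 0 x))%R).+1.
have E k : om (epsz k x) = t k - t (k - 1).
  rewrite /t -sg_step ?mono// /om epszP; congr ((1 - _) / 2).
  by case/orP: z1 => /eqP ->; rewrite ?mul1r// !mulN1r !rmorphN /= !sgrN mulrNN.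
have h1 (k : int) : K%:Z <= k -> t k = 1 / 2.
  move=> kK; rewrite /t gtr0_sg// ltr0z.
  have := grow (absz k) 0; rewrite add0r (_ : (absz k)%:Z = k); last by lia.
  by move: kK; rewrite /K; lia.
have h2 (k : int) : k <= - K%:Z -> t k = - (1 / 2).
  move=> kK; rewrite /t ltr0_sg ?mulN1r; first by lra.
  rewrite ltrz0.
  have := grow (absz k) k; rewrite (_ : k + (absz k)%:Z = 0); last by lia.
  by move: kK; rewrite /K; lia.
have [S1 S2] := tsum_telescope h1 h2.
by split; [apply: eq_tsummable S1 => k; rewrite E|rewrite (eq_tsum E)].
Qed.

(** Cauchy-Schwarz in the forward light cone: |q b| < p a. Together with [cone_neg] it shows that
    [eps] and its inverse preserve each branch. *)
Lemma cone_pos (p q a b : int) : 0 < p -> 0 < a -> q ^+ 2 <= 6 * p ^+ 2 -> 6 * b ^+ 2 < a ^+ 2 ->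
  0 < p * a + q * b.
Proof.
move=> p0 a0 qp ba; have pa : 0 < p * a by rewrite mulr_gt0.
have h : `|q * b| < p * a.
  rewrite -(@ltr_pXn2r _ 2)// ?nnegrE ?(ltW pa)// real_normK ?num_real// !exprMn.
  apply: (@le_lt_trans _ _ (6 * p ^+ 2 * b ^+ 2)); first by rewrite ler_wpM2r ?sqr_ge0.
  by rewrite [6 * _]mulrC -mulrA ltr_pM2l// exprn_gt0.
by have := ler_norm (- (q * b)); rewrite normrN; lia.
Qed.

Lemma cone_neg (p q a b : int) : 0 < q -> 0 < b -> 6 * p ^+ 2 <= q ^+ 2 -> a ^+ 2 < 6 * b ^+ 2 ->
  0 < p * a + q * b.
Proof.
move=> q0 b0 qp ba; have qb : 0 < q * b by rewrite mulr_gt0.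
have h : `|p * a| < q * b.
  rewrite -(@ltr_pXn2r _ 2)// ?nnegrE ?(ltW qb)// real_normK ?num_real// !exprMn.
  apply: (@lt_le_trans _ _ (q ^+ 2 * b ^+ 2)) => //.
  have [->|pn0] := eqVneq p 0; first by rewrite expr0n mul0r mulr_gt0// exprn_gt0.
  apply: (@lt_le_trans _ _ (p ^+ 2 * (6 * b ^+ 2))).
    by rewrite ltr_pM2l// lt_neqAle eq_sym expf_eq0 /= pn0 sqr_ge0.
  by rewrite mulrA [_ * 6]mulrC ler_wpM2r ?sqr_ge0.
by have := ler_norm (- (p * a)); rewrite normrN; lia.
Qed.

(** From eps^-1 x to x, [vform] grows by 2 X when [qf] is positive and by 4 Y when it is negative.
    The sign z selects the branch on which this is positive, and the branch is preserved along the
    orbit. *)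
Lemma om_sum x : x != (0, 0) ->
  tsummable (fun k => om (epsz k x)) /\ tsum (fun k => om (epsz k x)) = 1.
Proof.
move=> x0; have [q0|q0] := boolP (0 < qf x).
  have [z z1 zx] : exists2 z : int, (z == 1) || (z == -1) & 0 < z * x.1.
    have [h|h|h] := ltgtP 0 x.1; [by exists 1; rewrite ?mul1r|by exists (-1); rewrite ?mulN1r ?oppr_gt0|].
    by move: q0; rewrite /qf -h expr0n sub0r oppr_gt0 => q0; have := sqr_ge0 x.2; lia.
  have z2 : z ^+ 2 = 1 by case/orP: z1 => /eqP ->.
  have pos k : 0 < z * (epsz k x).1.
    have q0k k' : 0 < qf (epsz k' x) by rewrite qf_epsz.
    have cone (a b p q : int) : 0 < p -> q ^+ 2 <= 6 * p ^+ 2 -> 0 < z * a -> 0 < qf (a, b) -> 0 < z * (p * a + q * b).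
      move=> p0 qp za qab; have := @cone_pos p q (z * a) (z * b) p0 za qp _.
      rewrite !exprMn z2 !mul1r mulrDr [p * _]mulrCA [q * _]mulrCA; apply.
      by move: qab; rewrite /qf /=; lia.
    elim/int_ind1: k => [//|k ih|k ih].
      by rewrite epszS /=; apply: cone => //; rewrite -surjective_pairing.
    rewrite epszP /= -mulNr; apply: cone => //; by rewrite -surjective_pairing.
  apply: (@om_sum_mono x z) => // k; rewrite epszP /vform qf_epsi qf_epsz q0 /=.
  by have := pos k; move: (epsz k x) => [a b] /=; move: z1 => /orP[]/eqP ->; lia.
have q0' : qf x < 0.
  by rewrite lt_neqAle leNgt q0 andbT; apply: contra x0 => /eqP/qf_eq0 ->.
have [z z1 zx] : exists2 z : int, (z == 1) || (z == -1) & 0 < z * x.2.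
  have [h|h|h] := ltgtP 0 x.2; [by exists 1; rewrite ?mul1r|by exists (-1); rewrite ?mulN1r ?oppr_gt0|].
  by move: q0'; rewrite /qf -h expr0n mulr0 subr0 => q0'; have := sqr_ge0 x.1; lia.
have z2 : z ^+ 2 = 1 by case/orP: z1 => /eqP ->.
have pos k : 0 < z * (epsz k x).2.
  have q0k k' : qf (epsz k' x) < 0 by rewrite qf_epsz.
  have cone (a b p q : int) : 0 < q -> 6 * p ^+ 2 <= q ^+ 2 -> 0 < z * b -> qf (a, b) < 0 -> 0 < z * (p * a + q * b).
    move=> p0 qp za qab; have := @cone_neg p q (z * a) (z * b) p0 za qp _.
    rewrite !exprMn z2 !mul1r mulrDr [p * _]mulrCA [q * _]mulrCA; apply.
    by move: qab; rewrite /qf /=; lia.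
  elim/int_ind1: k => [//|k ih|k ih].
    by rewrite epszS /=; apply: cone => //; rewrite -surjective_pairing.
  rewrite epszP /=; apply: cone => //; by rewrite -surjective_pairing.
apply: (@om_sum_mono x z) => // k; rewrite epszP /vform qf_epsi qf_epsz (negPf q0) /=.
by have := pos k; move: (epsz k x) => [a b] /=; move: z1 => /orP[]/eqP ->; lia.
Qed.

(** If the orbit were periodic, a positive weight would recur infinitely often, against the total
    weight 1. *)
Lemma epsz_inj x : x != (0, 0) -> injective (epsz^~ x).
Proof.
move=> x0; suff key k l : k < l -> epsz k x = epsz l x -> False.
  by move=> k l /= h; have [kl|kl|//] := ltgtP k l; [case: (key _ _ kl h)|case: (key _ _ kl (esym h))].
move=> kl h.
have fixk : epsz (l - k) x = x.
  by rewrite addrC epszD -h -epszD addNr.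
pose m := l - k.
have fixm j : epsz (j * m) x = x.
  elim/int_ind1: j => [|j ih|j ih]; first by rewrite mul0r.
    by rewrite mulrDl mul1r epszD fixk ih.
  rewrite mulrBl mul1r epszD -[in X in epsz _ X]fixk -epszD -epszD.
  by rewrite -/m subrK ih.
have [S1 S2] := om_sum x0.
have [k0 ok0] : exists k, 0 < om (epsz k x).
  apply: contrapT => nk; move: S2; rewrite (eq_tsum (g := fun=> 0)) ?tsum0; first by move=> /esym/eqP; rewrite oner_eq0.
  by move=> k'; apply/eqP; rewrite eq_le om_ge0 andbT leNgt; apply/negP => h'; apply: nk; exists k'.
have per (i : nat) : om (epsz (k0 + i%:Z * m) x) = om (epsz k0 x) by rewrite epszD fixm.
have [n hn] : exists n : nat, 1 < n%:R * om (epsz k0 x).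
  have := archi_boundP (x := (om (epsz k0 x))^-1); rewrite invr_ge0 om_ge0 => /(_ isT) h'.
  by eexists; rewrite -ltr_pdivrMr ?div1r; [exact: h'|exact: ok0].
pose s := [seq k0 + i%:Z * m | i <- iota 0 n].
have us : uniq s by rewrite map_inj_uniq ?iota_uniq// => i j; rewrite /m; nia.
have := sum_le_tsum us S1 (fun k => om_ge0 _); rewrite S2 big_map.
under eq_bigr do rewrite per; rewrite big_const_seq count_predT size_iota iter_addr_0 -mulr_natl.
by rewrite leNgt hn.
Qed.

End orbits.

(** * Unfolding an integral over a period of t *)

Section unfolding.
Context {R : realType}.
Local Notation rho := (Num.sqrt 6 : R).

(** The logarithm of the unit 5 + 2 sqrt 6: applying [eps] to the lattice point translates t by
    [PP]. *)
Definition PP : R := ln (5 + 2 * rho).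

Lemma expPP : expR PP = 5 + 2 * rho.
Proof. by rewrite lnK// posrE; have := @rho_gt0 R; lra. Qed.
Lemma expNPP : expR (- PP) = 5 - 2 * rho.
Proof.
have r2 := @rho2 R; have r0 := @rho_gt0 R.
rewrite expRN expPP; apply: (mulfI (x := 5 + 2 * rho)); first by rewrite gt_eqF//; lra.
rewrite divff; last by rewrite gt_eqF//; lra.
by move: r2; move: rho => p p2; ring: p2.
Qed.
Lemma chPP : ch PP = 5. Proof. by rewrite /ch expPP expNPP; lra. Qed.
Lemma shPP : sh PP = 2 * rho. Proof. by rewrite /sh expPP expNPP; lra. Qed.
Lemma PP_gt0 : 0 < PP.
Proof. by rewrite ln_gt0//; have := @rho_gt0 R; lra. Qed.

Lemma pp_eps t (x : int * int) : pp t (eps x).1%:~R (eps x).2%:~R = pp (t + PP) x.1%:~R x.2%:~R.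
Proof.
rewrite /pp chD shD chPP shPP /eps /= !intrD !intrM; congr (_ / _).
by have := @rho2 R; move: rho => p p2; ring: p2.
Qed.
Lemma rr_eps t (x : int * int) : rr t (eps x).1%:~R (eps x).2%:~R = rr (t + PP) x.1%:~R x.2%:~R.
Proof.
rewrite /rr chD shD chPP shPP /eps /= !intrD !intrM; congr (_ / _).
by have := @rho2 R; move: rho => p p2; ring: p2.
Qed.

Lemma Int_shift_sum (f : R -> R) (P : R) (n : nat) (a : R) : 0 <= P -> continuous f ->
  Int `[a, a + n%:R * P] f = \sum_(i < n) Int `[0, P] (fun t => f (t + (a + i%:R * P))).
Proof.
move=> P0 cf; elim: n => [|n ih]; first by rewrite big_ord0 mul0r addr0 set_itv1 /Int Rintegral_set1.
have nP : 0 <= n%:R * P by rewrite mulr_ge0.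
have e1 : a + n.+1%:R * P = (a + n%:R * P) + P by rewrite -(natr1 n) mulrDl mul1r addrA.
rewrite big_ord_recr /= -ih e1 (@Int_cat _ f a (a + n%:R * P)) ?lerDl//; last exact: intg_itv.
congr (_ + _); have := @Int_affine_itv _ f 0 P 1 (a + n%:R * P) P0 ltr01 cf.
rewrite mulr0 add0r mul1r [P + _]addrC => <-.
by apply: eq_Int => t _; rewrite !mul1r.
Qed.

Lemma Int_itv_sub (f : R -> R) (a b a' b' : R) : a' <= a -> a <= b -> b <= b' -> continuous f ->
  (forall t, 0 <= f t) -> Int `[a, b] f <= Int `[a', b'] f.
Proof.
move=> aa ab bb cf f0.
rewrite (@Int_cat _ f a' a b')//; [|exact: le_trans bb|exact: intg_itv].
rewrite (@Int_cat _ f a b b')//; last exact: intg_itv.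
have h1 : 0 <= Int `[a', a] f by apply: Int_ge0.
have h2 : 0 <= Int `[b, b'] f by apply: Int_ge0.
by lra.
Qed.

Variable Xi : R -> int * int -> R.
Hypotheses (cX : forall x, continuous (Xi^~ x)) (eX : forall t x, Xi t (eps x) = Xi (t + PP) x).
Hypothesis sX : tsummable (fun x => Int `[0, PP] (fun t => `|Xi t x|)).

Lemma Xi_epsz k t x : Xi t (epsz k x) = Xi (t + k%:~R * PP) x.
Proof.
elim/int_ind1: k t => [|k ih|k ih] t; first by rewrite mulr0z mul0r addr0.
  by rewrite epszS eX ih intrD mulrDl mul1r -addrA [PP + _]addrC.
have := ih (t - PP); rewrite -{1}(subrK 1 k) epszS eX subrK => ->.
by rewrite intrB mulrBl mul1r -addrA [- PP + _]addrC.
Qed.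

(** The translates of [0, PP] tile the line, so the integrals of the orbit of x over one period add
    up to the integral of x over the line. *)
Lemma unfold_line x : x != (0, 0) ->
  [/\ intg setT (Xi^~ x), tsummable (fun k => Int `[0, PP] (Xi^~ (epsz k x))) &
     tsum (fun k => Int `[0, PP] (Xi^~ (epsz k x))) = Int setT (Xi^~ x)].
Proof.
move=> x0; have P0 := ltW PP_gt0.
have S := tsummable_reindex (epsz_inj (R := R) x0) sX.
pose s n := [seq i%:Z - n%:Z | i <- iota 0 (n + n)].
have us n : uniq (s n) by rewrite map_inj_uniq ?iota_uniq// => i j; lia.
have win (g : R -> R) n : Int `[- (n%:R * PP), n%:R * PP] g = Int `[- (n%:R * PP), - (n%:R * PP) + (n + n)%:R * PP] g.
  by rewrite natrD mulrDl addKr.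
have sumE (g : R -> R) n : continuous g -> Int `[- (n%:R * PP), n%:R * PP] g =
    \sum_(k <- s n) Int `[0, PP] (fun t => g (t + k%:~R * PP)).
  move=> cg; rewrite win Int_shift_sum// big_map (_ : iota 0 (n + n) = index_iota 0 (n + n)) ?big_mkord; last by rewrite /index_iota subn0.
  apply: eq_bigr => i _; apply: eq_Int => t _; congr (g (_ + _)).
  by rewrite intrB mulrBl addrC -!pmulrn.
have iX : intg setT (Xi^~ x).
  apply: (@intgT_bounded _ _ (tsum (fun k => Int `[0, PP] (fun t => `|Xi t (epsz k x)|)))) => // n.
  have [m hm] : exists m : nat, n%:R <= m%:R * PP.
    have := archi_boundP (x := n%:R / PP); rewrite divr_ge0// => /(_ isT) h.
    by eexists; rewrite -ler_pdivrMr ?PP_gt0//; apply: ltW; exact: h.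
  apply: le_trans (_ : _ <= Int `[- (m%:R * PP), m%:R * PP] (fun t => `|Xi t x|)) _.
    by apply: Int_itv_sub => //; [rewrite lerN2|exact: opp_nat_le|exact: cc_norm].
  rewrite sumE; last exact: cc_norm.
  under eq_bigr do under eq_Int => t _ do rewrite -Xi_epsz.
  apply: sum_le_tsum => // k; exact: Int_ge0.
have Sk : tsummable (fun k => Int `[0, PP] (Xi^~ (epsz k x))).
  apply: tsummable_le S => k /=; apply: norm_Int_le => //; exact: intg_itv.
split => //.
have c1 : \sum_(k <- s n) Int `[0, PP] (Xi^~ (epsz k x)) @[n --> \oo] --> tsum (fun k => Int `[0, PP] (Xi^~ (epsz k x))).
  apply: tsum_approx => // k; near=> n; apply/mapP; exists (absz (k + n%:Z)%R); last first.
    have : (absz k <= n)%N by near: n; exact: nbhs_infty_ge.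
    by lia.
  rewrite mem_iota; have : (absz k < n)%N by near: n; exact: nbhs_infty_gt.
  by lia.
have c2 : Int `[- (n%:R * PP), n%:R * PP] (Xi^~ x) @[n --> \oo] --> Int setT (Xi^~ x).
  apply: Int_exhaust => // y _; near=> n; rewrite /= in_itv /= -ler_norml -ler_pdivrMr ?PP_gt0//.
  by near: n; exact: nbhs_infty_ger.
have E n : \sum_(k <- s n) Int `[0, PP] (Xi^~ (epsz k x)) = Int `[- (n%:R * PP), n%:R * PP] (Xi^~ x).
  by rewrite sumE//; apply: eq_bigr => k _; apply: eq_Int => t _; rewrite Xi_epsz.
by rewrite -(cvg_lim _ c1)// -(cvg_lim _ c2)//; under eq_fun do rewrite E.
Unshelve. all: by end_near. Qed.

(** One inserts the identity that the weights along each orbit sum to 1, and exchanges the sums; the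
    origin, which has no such orbit, is excluded by b (0, 0) = 0. *)
Lemma unfolding (b : int * int -> R) (M : R) : (forall x, `|b x| <= M) -> (forall x, b (eps x) = b x) ->
  b (0, 0) = 0 ->
  tsummable (fun x => om x * b x * Int setT (Xi^~ x)) /\
  tsum (fun x => b x * Int `[0, PP] (Xi^~ x)) = tsum (fun x => om x * b x * Int setT (Xi^~ x)).
Proof.
move=> bM be b0; pose I x := Int `[0, PP] (Xi^~ x).
have bez k x : b (epsz k x) = b x.
  elim/int_ind1: k => [//|k ih|k ih]; first by rewrite epszS be.
  by rewrite epszP -be epsiK.
have sI : tsummable I by apply: tsummable_le sX => x; apply: norm_Int_le => //; exact: intg_itv.
pose f (z : (int * int) * int) : R := om (epsz z.2 z.1) * (b z.1 * I z.1).
have f1 x : tsummable (fun k => f (x, k)) /\ tsum (fun k => f (x, k)) = b x * I x /\ tsum (fun k => `|f (x, k)|) = `|b x * I x|.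
  rewrite /f /=; have [->|x0] := eqVneq x (0, 0).
    rewrite b0 !mul0r normr0; under eq_fun do rewrite mulr0.
    split; first exact: tsummable0.
    by split; [|under eq_fun do rewrite mulr0 normr0]; exact: tsum0.
  have [S1 S2] := om_sum (R := R) x0.
  under eq_fun do rewrite mulrC; split; first exact: tsummableZ.
  split; first by rewrite tsumZ// S2 mulr1.
  under eq_fun do rewrite mulrC normrM (ger0_norm (om_ge0 _)).
  by rewrite tsumZ// S2 mulr1.
have sbI : tsummable (fun x => b x * I x) by exact: bsummable bM sI.
have sf : tsummable f.
  apply: tsummable_pair => [x|]; first exact: (f1 x).1.
  by apply: eq_tsummable (tsummable_norm sbI) => x; rewrite (f1 x).2.2.
(* The change of variables (x, k) to (eps^-k x, k) moves the power of [eps] from the weight to the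
   integral. *)
pose e (z : (int * int) * int) := (epsz (- z.2) z.1, z.2).
have be' : bijective e.
  by exists (fun z => (epsz z.2 z.1, z.2)) => -[x k]; rewrite /e /= -epszD ?subrr ?addNr.
have sfe := tsummable_reindex (bij_inj be') sf.
have E x k : (f \o e) (x, k) = om x * b x * I (epsz (- k) x).
  by rewrite /f /e /= -epszD subrr bez mulrA.
have tx x : tsum (fun k => (f \o e) (x, k)) = om x * b x * Int setT (Xi^~ x).
  have [->|x0] := eqVneq x (0, 0).
    rewrite (eq_tsum (g := fun=> 0)) ?tsum0 ?b0 ?mulr0 ?mul0r// => k.
    by rewrite E b0 mulr0 mul0r.
  have [iX Sk <-] := unfold_line x0.
  have bN : bijective (fun k : int => - k) by exists (fun k => - k) => k; rewrite opprK.
  rewrite -tsumZ// -(tsum_reindex bN (f := fun k => _ * _)); last exact: tsummableZ.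
  by apply: eq_tsum => k; rewrite E.
have [P1 P2] := tsum_pair sfe.
split; first by apply: eq_tsummable P1 => x; rewrite tx.
transitivity (tsum f).
  by rewrite (tsum_pair sf).2; apply: eq_tsum => x; rewrite (f1 x).2.1.
by rewrite -(tsum_reindex be' sf) P2; apply: eq_tsum => x; rewrite tx.
Qed.

End unfolding.

(** * Integrals along a hyperbola depend only on its norm *)

Section parametrization.
Context {R : realType}.
Local Notation rho := (Num.sqrt 6 : R).
Local Notation kk := (Num.sqrt 48 : R).

Lemma pp_exp (t X Y : R) : pp t X Y = ((X + rho * Y) / kk * expR t + (X - rho * Y) / kk * expR (- t)) / 2.
Proof. by rewrite /pp /ch /sh; field; rewrite gt_eqF// kk_gt0. Qed.

Lemma rr_exp (t X Y : R) : rr t X Y = ((X + rho * Y) / kk * expR t - (X - rho * Y) / kk * expR (- t)) / 2.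
Proof. by rewrite /rr /ch /sh; field; rewrite gt_eqF// kk_gt0. Qed.

(** In light-cone coordinates, whose product is [nn], a boost scales one by exp t and the other by
    exp(-t); t0 is the logarithm that balances them and s the branch. The form [1 * t + t0] matches
    the affine substitution lemma. *)
Lemma hyp_param_pos (X Y : R) : 0 < nn X Y -> exists t0 s : R, s ^+ 2 = 1 /\ forall t,
  pp t X Y = s * (Num.sqrt (nn X Y) * ch (1 * t + t0)) /\ rr t X Y = s * (Num.sqrt (nn X Y) * sh (1 * t + t0)).
Proof.
move=> n0; pose al := (X + rho * Y) / kk; pose be := (X - rho * Y) / kk.
have kn : kk != 0 by rewrite gt_eqF// kk_gt0.
have nE : nn X Y = al * be.
  rewrite /nn /al /be mulrACA -invfM -expr2 kk2; congr (_ / _).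
  by have := @rho2 R; move: rho => p p2; ring: p2.
have [s s2 sal] : exists2 s : R, s ^+ 2 = 1 & 0 < s * al.
  have [h|h|h] := ltgtP 0 al; [by exists 1; rewrite ?expr1n ?mul1r|by exists (-1); rewrite ?sqrrN ?expr1n// mulN1r oppr_gt0|].
  by move: n0; rewrite nE -h mul0r ltxx.
set r := Num.sqrt (nn X Y); have r0 : 0 < r by rewrite sqrtr_gt0.
have rn : r != 0 by rewrite gt_eqF.
have r2 : r ^+ 2 = al * be by rewrite sqr_sqrtr ?nE// -nE ltW.
exists (ln (s * al / r)), s; split => // t.
have e1 : expR (ln (s * al / r)) = s * al / r by rewrite lnK// posrE divr_gt0.
have aln : al != 0 by apply: contraTneq sal => ->; rewrite mulr0 ltxx.
have sn : s != 0 by apply: contraTneq sal => ->; rewrite mul0r ltxx.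
have hne : s * al / r != 0 by rewrite gt_eqF// divr_gt0.
have e2 : expR (- ln (s * al / r)) = s * be / r.
  rewrite expRN e1; apply: (mulfI (x := s * al / r)); first exact: hne.
  rewrite divff//.
  rewrite (_ : s * al / r * (s * be / r) = s ^+ 2 * (al * be) / r ^+ 2); last by field.
  by rewrite s2 mul1r -r2 divff// expf_neq0.
rewrite pp_exp rr_exp -/al -/be mul1r /ch /sh opprD !expRD e1 e2.
clear -rn s2; move: rn s2; move: (r : R) (al) (be) (expR t) (expR (- t)) => r' a b x y rn s2.
by split; field: s2.
Qed.

Lemma hyp_param_neg (X Y : R) : nn X Y < 0 -> exists t0 s : R, s ^+ 2 = 1 /\ forall t,
  pp t X Y = s * (Num.sqrt (- nn X Y) * sh (1 * t + t0)) /\ rr t X Y = s * (Num.sqrt (- nn X Y) * ch (1 * t + t0)).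
Proof.
move=> n0; pose al := (X + rho * Y) / kk; pose be := (X - rho * Y) / kk.
have kn : kk != 0 by rewrite gt_eqF// kk_gt0.
have nE : nn X Y = al * be.
  rewrite /nn /al /be mulrACA -invfM -expr2 kk2; congr (_ / _).
  by have := @rho2 R; move: rho => p p2; ring: p2.
have [s s2 sal] : exists2 s : R, s ^+ 2 = 1 & 0 < s * al.
  have [h|h|h] := ltgtP 0 al; [by exists 1; rewrite ?expr1n ?mul1r|by exists (-1); rewrite ?sqrrN ?expr1n// mulN1r oppr_gt0|].
  by move: n0; rewrite nE -h mul0r ltxx.
set r := Num.sqrt (- nn X Y); have r0 : 0 < r by rewrite sqrtr_gt0 oppr_gt0.
have rn : r != 0 by rewrite gt_eqF.
have r2 : r ^+ 2 = - (al * be) by rewrite sqr_sqrtr ?nE// -nE oppr_ge0 ltW.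
exists (ln (s * al / r)), s; split => // t.
have e1 : expR (ln (s * al / r)) = s * al / r by rewrite lnK// posrE divr_gt0.
have aln : al != 0 by apply: contraTneq sal => ->; rewrite mulr0 ltxx.
have sn : s != 0 by apply: contraTneq sal => ->; rewrite mul0r ltxx.
have hne : s * al / r != 0 by rewrite gt_eqF// divr_gt0.
have e2 : expR (- ln (s * al / r)) = - (s * be / r).
  rewrite expRN e1; apply: (mulfI (x := s * al / r)); first exact: hne.
  rewrite divff// mulrN.
  by rewrite mulrACA -invfM -expr2 mulrACA -expr2 s2 mul1r -mulNr -r2 divff// expf_neq0.
rewrite pp_exp rr_exp -/al -/be mul1r /ch /sh opprD !expRD e1 e2.
clear -rn s2; move: rn s2; move: (r : R) (al) (be) (expR t) (expR (- t)) => r' a b x y rn s2.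
by split; field: s2.
Qed.

(** The integral of Phi along one branch of p^2 - r^2 = n: the branch meets the p-axis for n > 0 and
    the r-axis for n < 0. *)
Definition lineI (Phi : R -> R -> R) (n : R) : R :=
  if 0 < n then Int setT (fun t => Phi (Num.sqrt n * ch t) (Num.sqrt n * sh t))
  else Int setT (fun t => Phi (Num.sqrt (- n) * sh t) (Num.sqrt (- n) * ch t)).

Lemma Int_shift (f : R -> R) (h k : R) : h = 1 -> continuous f -> intg setT (fun t => f (h * t + k)) ->
  intg setT f /\ Int setT (fun t => f (h * t + k)) = Int setT f.
Proof.
move=> -> cf iF.
have iF' : intg setT f.
  have cg : continuous (fun t : R => f (1 * t + k)) by apply: cc_comp => //; ctac.
  have := intg_affine (- k) ltr01 cg iF; apply: eq_intg => // x _.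
  by rewrite !mul1r subrK.
by split => //; rewrite Int_affine// invr1 mul1r.
Qed.

Lemma Int_line (Phi : R -> R -> R) (X Y : R) : nn X Y != 0 ->
  (forall p r, Phi (- p) (- r) = Phi p r) ->
  (forall n : R, continuous (fun t : R => Phi (n * ch t) (n * sh t))) ->
  (forall n : R, continuous (fun t : R => Phi (n * sh t) (n * ch t))) ->
  intg setT (fun t => Phi (pp t X Y) (rr t X Y)) ->
  Int setT (fun t => Phi (pp t X Y) (rr t X Y)) = lineI Phi (nn X Y).
Proof.
move=> n0 ev c1 c2 iP; rewrite /lineI.
have sE (s a b : R) : s ^+ 2 = 1 -> Phi (s * a) (s * b) = Phi a b.
  by move=> /eqP; rewrite sqrf_eq1 => /orP[]/eqP ->; rewrite ?mul1r// !mulN1r.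
case: ifPn => np.
  have [t0 [s [s2 H]]] := hyp_param_pos np.
  have E t : Phi (pp t X Y) (rr t X Y) = Phi (Num.sqrt (nn X Y) * ch (1 * t + t0)) (Num.sqrt (nn X Y) * sh (1 * t + t0)).
    by have [-> ->] := H t; rewrite sE.
  rewrite (eq_Int (fun t _ => E t)).
  apply: (Int_shift (f := fun t => Phi (Num.sqrt (nn X Y) * ch t) (Num.sqrt (nn X Y) * sh t)) erefl _ _).2 => //.
  by apply: eq_intg iP => // t _; rewrite E.
have nn0 : nn X Y < 0 by rewrite lt_neqAle n0 leNgt np.
have [t0 [s [s2 H]]] := hyp_param_neg nn0.
have E t : Phi (pp t X Y) (rr t X Y) = Phi (Num.sqrt (- nn X Y) * sh (1 * t + t0)) (Num.sqrt (- nn X Y) * ch (1 * t + t0)).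
  by have [-> ->] := H t; rewrite sE.
rewrite (eq_Int (fun t _ => E t)).
apply: (Int_shift (f := fun t => Phi (Num.sqrt (- nn X Y) * sh t) (Num.sqrt (- nn X Y) * ch t)) erefl _ _).2 => //.
by apply: eq_intg iP => // t _; rewrite E.
Qed.

End parametrization.

(** * Reflection and Gaussian integrals *)

Section reflection.
Context {R : realType}.
Lemma Int_opp_all (f : R -> R) : continuous f -> intg setT f -> Int setT (fun t => f (- t)) = Int setT f.
Proof.
move=> cf hf; have cg : continuous (fun t : R => f (- t)) by apply: (@cc_comp _ (fun t => - t) f) => //; ctac.
have E n : Int `[- n%:R, n%:R] (fun t => f (- t)) = Int `[- n%:R, n%:R] f.
  by rewrite (Int_opp_itv (opp_nat_le n) cf) opprK.
have ig : intg setT (fun t => f (- t)).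
  apply: (@intgT_bounded _ _ (Int setT (fun t => `|f t|))) => // n.
  rewrite (Int_opp_itv (f := fun t => `|f t|) (opp_nat_le n) (cc_norm cf)) opprK.
  rewrite /Int Rintegral_mkcond; apply: le_Int => //.
  - by have := @intg_itv _ (fun x => `|f x|) (- n%:R) n%:R (cc_norm cf); rewrite /intg integrable_mkcond//= => H; apply: eq_integrable H => // x _ /=; rewrite /patch; case: ifP.
  - exact: intg_norm.
  - by move=> x _; rewrite patchE; case: ifP => _; [exact: lexx|exact: normr_ge0].
have c1 := IntT_lim ig; have c2 := IntT_lim hf.
rewrite -(cvg_lim _ c2)//; symmetry; apply/cvg_lim => //.
by apply: cvg_trans c1; apply: near_eq_cvg; apply: nearW => n; exact: E.
Qed.
End reflection.

Section gauss.
Context {R : realType}.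

Lemma gauss_int (a : R) : 0 < a ->
  intg setT (fun s => expR (- (a * s ^+ 2))) /\ Int setT (fun s => expR (- (a * s ^+ 2))) = Num.sqrt (pi / a).
Proof.
move=> a0; have sa : 0 < Num.sqrt a by rewrite sqrtr_gt0.
have ig : intg setT (@gauss_fun R) := @integrableT_gauss R.
have E s : gauss_fun (Num.sqrt a * s + 0) = expR (- (a * s ^+ 2)).
  by rewrite /gauss_fun addr0 exprMn sqr_sqrtr ?ltW.
have cg := @continuous_gauss_fun R; split.
  by have := intg_affine 0 sa cg ig; apply: eq_intg => // s _; rewrite E.
have := Int_affine 0 sa cg ig; rewrite (eq_Int (fun s _ => E s)) => ->.
have -> : Int setT (@gauss_fun R) = Num.sqrt pi by rewrite /Int /Rintegral integralT_gauss.
by rewrite mulrC sqrtrM ?pi_ge0// sqrtrV ?ltW.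
Qed.

End gauss.

Ltac nonneg := repeat first [ assumption | apply: mulr_ge0 | apply: addr_ge0 | apply: divr_ge0
  | exact: sqr_ge0 | exact: sqrtr_ge0 | exact: expR_ge0 | exact: pi_ge0 | exact: ler0n | done ].

(** * The sharp Gaussian limit on the left *)

Section left_limit.
Context {R : realType}.
Variables (c : nat) (E : R -> R) (C0 : R).
Hypotheses (c0 : (0 < c)%N) (cE : continuous E) (eE : forall q, E (- q) = E q).
Hypothesis (bE : forall q, `|E q| <= C0 / (1 + q ^+ 2) ^+ 2).
Let cR0 : 0 < c%:R :> R. Proof. by rewrite ltr0n. Qed.
Let C00 : 0 <= C0. Proof. by have := bE 0; rewrite expr0n addr0 expr1n divr1; exact: le_trans. Qed.

Lemma E_bounded q : `|E q| <= C0.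
Proof.
apply: le_trans (bE q) _; rewrite ler_pdivrMr ?exprn_gt0//; last by have := sqr_ge0 q; lra.
by rewrite ler_peMr// exprn_ege1// lerDl sqr_ge0.
Qed.

Definition Lkern (kap p r : R) : R := Int setT (fun q => E q * expR (- (kap * ((p - c%:R * q / 2) ^+ 2 + r ^+ 2)))).

(** The inner integral after the substitution s = m (c q/2 - p), for kap = m^2; as m grows, E is
    evaluated at 2 p/c. *)
Definition Jin (m : nat) (p : R) : R :=
  Int setT (fun s => E (2 / (c%:R * m%:R) * s + 2 * p / c%:R) * expR (- s ^+ 2)).

Lemma cc_Ein (m : nat) (p : R) : continuous (fun s : R => E (2 / (c%:R * m%:R) * s + 2 * p / c%:R) * expR (- s ^+ 2)).
Proof.
apply: cc_M; last by ctac.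
by apply: (cc_comp (g := E)) => //; ctac.
Qed.

Lemma intg_gauss1 : intg setT (fun s : R => expR (- s ^+ 2)).
Proof. by have := (gauss_int (@ltr01 R)).1; apply: eq_intg => // s _; rewrite mul1r. Qed.
Lemma Int_gauss1 : Int setT (fun s : R => expR (- s ^+ 2)) = Num.sqrt pi.
Proof.
by have := (gauss_int (@ltr01 R)).2; rewrite divr1 => <-; apply: eq_Int => s _; rewrite mul1r.
Qed.

Lemma Jin_intg m p : intg setT (fun s => E (2 / (c%:R * m%:R) * s + 2 * p / c%:R) * expR (- s ^+ 2)).
Proof.
apply: (intg_le _ _ (intgZ C0 _ intg_gauss1)) => //; first by apply: cont_meas => //; exact: cc_Ein.
by move=> s _; rewrite normrM (ger0_norm (expR_ge0 _)) ler_wpM2r ?expR_ge0 ?E_bounded.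
Qed.

Lemma Jin_le m p : `|Jin m p| <= C0 * Num.sqrt pi.
Proof.
rewrite -Int_gauss1 -IntZ//; last exact: intg_gauss1.
apply: norm_Int_le2 => //; [by apply: cont_meas => //; exact: cc_Ein|exact: intgZ intg_gauss1|].
by move=> s _; rewrite normrM (ger0_norm (expR_ge0 _)) ler_wpM2r ?expR_ge0 ?E_bounded.
Qed.

Let cp : R := 2 + c%:R ^+ 2 / 2.

(** A Peetre-type inequality from p = c q/2 - s/m and m >= 1: decay of E in q becomes decay in n at
    the cost of powers of 1 + s^2, which the Gaussian absorbs. *)
Lemma peetre (m : nat) (p s n : R) : (0 < m)%N -> 0 <= n -> n <= p ^+ 2 ->
  1 + n <= cp * (1 + (2 / (c%:R * m%:R) * s + 2 * p / c%:R) ^+ 2) * (1 + s ^+ 2).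
Proof.
move=> m0 n0 np; set q := _ + 2 * p / c%:R.
have mR : 1 <= m%:R :> R by rewrite ler1n.
have mn : m%:R != 0 :> R by rewrite gt_eqF// (lt_le_trans ltr01).
have cn : c%:R != 0 :> R by rewrite gt_eqF.
have e : p = c%:R / 2 * q - s / m%:R by rewrite /q; field; rewrite cn mn.
have h1 : (s / m%:R) ^+ 2 <= s ^+ 2.
  rewrite exprMn exprVn ler_pdivrMr ?exprn_gt0 ?(lt_le_trans ltr01)//.
  by rewrite ler_peMr ?sqr_ge0// exprn_ege1.
have h2 : p ^+ 2 <= 2 * ((c%:R / 2 * q) ^+ 2 + (s / m%:R) ^+ 2).
  by rewrite e; have := sqr_ge0 (c%:R / 2 * q + s / m%:R); rewrite sqrrD sqrrB; lra.
have h3 : (c%:R / 2 * q) ^+ 2 = c%:R ^+ 2 / 4 * q ^+ 2 by rewrite exprMn; field.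
have hq := sqr_ge0 q; have hs := sqr_ge0 s; have hc := sqr_ge0 (c%:R : R).
rewrite h3 in h2; rewrite /cp; move: (c%:R ^+ 2) (q ^+ 2) (s ^+ 2) h1 h2 hq hs hc => C Q S h1 h2 hq hs hc.
have k1 := mulr_ge0 hc hq; have k2 := mulr_ge0 hq hs; have k3 := mulr_ge0 hc hs; have k4 := mulr_ge0 k1 hs.
by lra.
Qed.

Lemma cp_gt0 : 0 < cp.
Proof. by rewrite /cp; have := sqr_ge0 (c%:R : R); lra. Qed.

Lemma gauss_poly_le (s : R) : expR (- s ^+ 2) * (1 + s ^+ 2) ^+ 2 <= 16 * expR (- (2^-1 * s ^+ 2)).
Proof.
have h : 1 + s ^+ 2 <= 4 * expR (s ^+ 2 / 4).
  by have := expR_ge1Dx (s ^+ 2 / 4); have := sqr_ge0 s; lra.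
have h2 : (1 + s ^+ 2) ^+ 2 <= (4 * expR (s ^+ 2 / 4)) ^+ 2.
  by rewrite ler_pXn2r ?nnegrE// ?mulr_ge0 ?expR_ge0//; have := sqr_ge0 s; lra.
apply: le_trans (ler_wpM2l (expR_ge0 _) h2) _.
rewrite exprMn -expRM_natl mulrCA -expRD le_eqVlt; apply/orP; left; apply/eqP.
by congr (_ * expR _); [ring|field].
Qed.

Lemma Jin_decay (m : nat) (p n : R) : (0 < m)%N -> 0 <= n -> n <= p ^+ 2 ->
  `|Jin m p| <= C0 * cp ^+ 2 * 16 * Num.sqrt (2 * pi) / (1 + n) ^+ 2.
Proof.
move=> m0 n0 np; have h2 : 0 < 2^-1 :> R by rewrite invr_gt0.
have [g1 g2] := gauss_int h2.
have -> : Num.sqrt (2 * pi) = Num.sqrt (pi / 2^-1) :> R by rewrite invrK mulrC.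
rewrite -g2 [leRHS](_ : _ = C0 * cp ^+ 2 * 16 / (1 + n) ^+ 2 * Int setT (fun s => expR (- (2^-1 * s ^+ 2)))); last by rewrite mulrAC.
rewrite -IntZ//; apply: norm_Int_le2 => //; [by apply: cont_meas => //; exact: cc_Ein|exact: intgZ|].
move=> s _; rewrite normrM (ger0_norm (expR_ge0 _)).
have P := peetre s m0 n0 np; set q := _ + 2 * p / c%:R in P *.
have n1 : 0 < (1 + n) ^+ 2 by rewrite exprn_gt0//; lra.
have q1 : 0 < (1 + q ^+ 2) ^+ 2 by rewrite exprn_gt0//; have := sqr_ge0 q; lra.
have P2 : (1 + n) ^+ 2 <= cp ^+ 2 * (1 + q ^+ 2) ^+ 2 * (1 + s ^+ 2) ^+ 2.
  rewrite -!exprMn ler_pXn2r ?nnegrE//; first by lra.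
  by rewrite !mulr_ge0 ?(ltW cp_gt0)//; [have := sqr_ge0 q; lra|have := sqr_ge0 s; lra].
have E1 : `|E q| <= C0 * cp ^+ 2 / (1 + n) ^+ 2 * (1 + s ^+ 2) ^+ 2.
  apply: le_trans (bE q) _; rewrite ler_pdivrMr//.
  rewrite [leRHS](_ : _ = C0 * ((cp ^+ 2 * (1 + q ^+ 2) ^+ 2 * (1 + s ^+ 2) ^+ 2) / (1 + n) ^+ 2)); last first.
    by move: ((1 + n) ^+ 2)^-1 => z; ring.
  by rewrite -[leLHS]mulr1; apply: ler_wpM2l => //; rewrite ler_pdivlMr// mul1r.
apply: le_trans (ler_wpM2r (expR_ge0 _) E1) _.
rewrite [leLHS](_ : _ = C0 * cp ^+ 2 / (1 + n) ^+ 2 * (expR (- s ^+ 2) * (1 + s ^+ 2) ^+ 2)); last first.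
  by rewrite -[LHS]mulrA; congr (_ * _); exact: mulrC.
rewrite [leRHS](_ : _ = C0 * cp ^+ 2 / (1 + n) ^+ 2 * (16 * expR (- (2^-1 * s ^+ 2)))); last first.
  by move: ((1 + n) ^+ 2)^-1 => z; ring.
apply: ler_wpM2l; last exact: gauss_poly_le.
by rewrite divr_ge0 ?(ltW n1)// mulr_ge0// sqr_ge0.
Qed.

Lemma LkernE (m : nat) (p r : R) : (0 < m)%N ->
  m%:R * Lkern (m%:R ^+ 2) p r = 2 / c%:R * expR (- (m%:R ^+ 2 * r ^+ 2)) * Jin m p.
Proof.
move=> m0; have mR : 0 < m%:R :> R by rewrite ltr0n.
have mn : m%:R != 0 :> R by rewrite gt_eqF.
have cn : c%:R != 0 :> R by rewrite gt_eqF.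
have h0 : 0 < c%:R * m%:R / 2 :> R by rewrite divr_gt0// mulr_gt0.
have := Int_affine (- (m%:R * p)) h0 (@cc_Ein m p) (Jin_intg m p).
rewrite -/(Jin m p) => H.
rewrite [RHS](_ : _ = m%:R * (expR (- (m%:R ^+ 2 * r ^+ 2)) * ((c%:R * m%:R / 2)^-1 * Jin m p))); last first.
  by field; rewrite cn mn.
rewrite -H -IntZ//; last exact: intg_affine (@cc_Ein m p) (Jin_intg m p).
congr (_ * _); apply: eq_Int => q _.
rewrite [in RHS](_ : 2 / (c%:R * m%:R) * (c%:R * m%:R / 2 * q + - (m%:R * p)) + 2 * p / c%:R = q); last by field; rewrite cn mn.
rewrite mulrCA; congr (_ * _); rewrite -expRD; congr expR; by field.
Qed.

Lemma cc_Jin m : continuous (Jin m).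
Proof.
apply: (@cont_param _ setT (fun p s => E (2 / (c%:R * m%:R) * s + 2 * p / c%:R) * expR (- s ^+ 2)) (fun s => C0 * expR (- s ^+ 2))) => //.
- by move=> p; apply: cont_meas => //; exact: cc_Ein.
- exact: intgZ intg_gauss1.
- by move=> p s _; rewrite normrM (ger0_norm (expR_ge0 _)) ler_wpM2r ?expR_ge0 ?E_bounded.
- by move=> s _; apply: cc_M; [apply: (cc_comp (g := E)) => //; ctac|exact: cc_cst].
Qed.

(** The normalisation m^2 compensates the width 1/m of the Gaussian both in q and in t. *)
Definition LamP (m : nat) (n : R) : R := m%:R ^+ 2 * lineI (Lkern (m%:R ^+ 2)) n.

Lemma cc_fpos (m : nat) (n : R) : continuous (fun t : R => expR (- (m%:R ^+ 2 * (n * sh t ^+ 2))) * Jin m (Num.sqrt n * ch t)).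
Proof. by have ? := @cc_Jin m; ctac. Qed.

Lemma cc_fneg (m : nat) (n : R) : continuous (fun t : R => expR (- (m%:R ^+ 2 * (n * ch t ^+ 2))) * Jin m (Num.sqrt n * sh t)).
Proof. by have ? := @cc_Jin m; ctac. Qed.

Lemma sqr_sqrt_mul (n x : R) : 0 <= n -> (Num.sqrt n * x) ^+ 2 = n * x ^+ 2.
Proof. by move=> n0; rewrite exprMn sqr_sqrtr. Qed.

Lemma LamP_scale (m : nat) (f g : R -> R) : (0 < m)%N -> continuous f -> intg setT f ->
  (forall t, m%:R * g t = 2 / c%:R * f t) ->
  m%:R ^+ 2 * Int setT g = 2 / c%:R * Int setT (fun t => f (m%:R^-1 * t)).
Proof.
move=> m0 cf iF gf; have mR : 0 < m%:R :> R by rewrite ltr0n.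
have mn : m%:R != 0 :> R by rewrite gt_eqF.
have mV : 0 < m%:R^-1 :> R by rewrite invr_gt0.
have := Int_affine 0 mV cf iF; rewrite invrK => H.
have -> : Int setT (fun t => f (m%:R^-1 * t)) = m%:R * Int setT f.
  by rewrite -H; apply: eq_Int => t _; rewrite addr0.
have -> : Int setT g = m%:R^-1 * (2 / c%:R * Int setT f).
  rewrite -IntZ// -IntZ//; last exact: intgZ.
  by apply: eq_Int => t _; rewrite -gf mulKf.
by field; rewrite mn gt_eqF.
Qed.

Lemma gauss_dom (n t : R) : 0 <= n -> expR (- (n * sh t ^+ 2)) <= expR (- (n * t ^+ 2)).
Proof. by move=> n0; rewrite ler_expR lerN2 ler_wpM2l// sh2_ge. Qed.

Lemma gauss_dom_ch (n t : R) : 0 <= n -> expR (- (n * ch t ^+ 2)) <= expR (- n) * expR (- (n * t ^+ 2)).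
Proof.
move=> n0; rewrite -expRD ler_expR ch2_sh2.
by have := ler_wpM2l n0 (sh2_ge t); lra.
Qed.

Lemma intg_fpos (m : nat) (n : R) : (0 < m)%N -> 0 < n ->
  intg setT (fun t : R => expR (- (m%:R ^+ 2 * (n * sh t ^+ 2))) * Jin m (Num.sqrt n * ch t)).
Proof.
move=> m0 n0; have mn0 : 0 < m%:R ^+ 2 * n :> R by rewrite mulr_gt0// exprn_gt0// ltr0n.
have [g1 _] := gauss_int mn0.
apply: (intg_le _ _ (intgZ (C0 * Num.sqrt pi) _ g1)) => //; first by apply: cont_meas => //; exact: cc_fpos.
move=> t _; rewrite normrM (ger0_norm (expR_ge0 _)) mulrC; apply: ler_pM => //.
  exact: Jin_le.
by rewrite mulrA; apply: gauss_dom; exact: ltW.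
Qed.

Lemma intg_fneg (m : nat) (n : R) : (0 < m)%N -> 0 < n ->
  intg setT (fun t : R => expR (- (m%:R ^+ 2 * (n * ch t ^+ 2))) * Jin m (Num.sqrt n * sh t)).
Proof.
move=> m0 n0; have mn0 : 0 < m%:R ^+ 2 * n :> R by rewrite mulr_gt0// exprn_gt0// ltr0n.
have [g1 _] := gauss_int mn0.
apply: (intg_le _ _ (intgZ (C0 * Num.sqrt pi) _ g1)) => //; first by apply: cont_meas => //; exact: cc_fneg.
move=> t _; rewrite normrM (ger0_norm (expR_ge0 _)) mulrC; apply: ler_pM => //.
  exact: Jin_le.
rewrite mulrA; apply: le_trans (gauss_dom_ch _ (ltW mn0)) _.
by apply: ler_piMl; [exact: expR_ge0|rewrite -[leRHS]expR0 ler_expR oppr_le0 ltW].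
Qed.

Lemma LamP_pos (m : nat) (n : R) : (0 < m)%N -> 0 < n -> LamP m n =
  2 / c%:R * Int setT (fun t => expR (- (m%:R ^+ 2 * (n * sh (m%:R^-1 * t) ^+ 2))) * Jin m (Num.sqrt n * ch (m%:R^-1 * t))).
Proof.
move=> m0 n0; rewrite /LamP /lineI n0.
apply: (LamP_scale (f := fun t => expR (- (m%:R ^+ 2 * (n * sh t ^+ 2))) * Jin m (Num.sqrt n * ch t))) => //.
- exact: cc_fpos.
- exact: intg_fpos.
- by move=> t; rewrite LkernE// sqr_sqrt_mul ?(ltW n0)// -[LHS]mulrA.
Qed.

Lemma LamP_neg (m : nat) (n : R) : (0 < m)%N -> 0 < n -> LamP m (- n) =
  2 / c%:R * Int setT (fun t => expR (- (m%:R ^+ 2 * (n * ch (m%:R^-1 * t) ^+ 2))) * Jin m (Num.sqrt n * sh (m%:R^-1 * t))).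
Proof.
move=> m0 n0; rewrite /LamP /lineI oppr_gt0 ltNge (ltW n0) /= opprK.
apply: (LamP_scale (f := fun t => expR (- (m%:R ^+ 2 * (n * ch t ^+ 2))) * Jin m (Num.sqrt n * sh t))) => //.
- exact: cc_fneg.
- exact: intg_fneg.
- by move=> t; rewrite LkernE// sqr_sqrt_mul ?(ltW n0)// -[LHS]mulrA.
Qed.

Lemma scale_gauss_dom (m : nat) (n t : R) : (0 < m)%N -> 0 <= n ->
  expR (- (m%:R ^+ 2 * (n * sh (m%:R^-1 * t) ^+ 2))) <= expR (- (n * t ^+ 2)).
Proof.
move=> m0 n0; have mn : m%:R != 0 :> R by rewrite pnatr_eq0 -lt0n.
rewrite ler_expR lerN2 [leRHS]mulrCA; apply: ler_wpM2l => //.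
rewrite (_ : t ^+ 2 = m%:R ^+ 2 * (m%:R^-1 * t) ^+ 2); last by rewrite exprMn exprVn mulVKf// expf_neq0.
by apply: ler_wpM2l; [exact: sqr_ge0|exact: sh2_ge].
Qed.

(** The factor 48 comes from |n| >= 1/48 on nonzero lattice points; the 4 pays for [expN_le_sqr] in
    the bound for negative n. *)
Definition CL : R := 2 / c%:R * Num.sqrt (48 * pi) * (4 * (C0 * Num.sqrt pi) + C0 * cp ^+ 2 * 16 * Num.sqrt (2 * pi)).

Lemma sqrt_pi_div (n : R) : 48^-1 <= n -> Num.sqrt (pi / n) <= Num.sqrt (48 * pi).
Proof.
move=> n48; apply: ler_wsqrtr; rewrite mulrC; apply: ler_wpM2r; first exact: pi_ge0.
by rewrite -[leRHS]invrK lef_pV2// posrE ?invr_gt0//; lra.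
Qed.

Lemma LamP_pos_le (m : nat) (n : R) : (0 < m)%N -> 48^-1 <= n -> `|LamP m n| <= CL / (1 + n) ^+ 2.
Proof.
move=> m0 n48; have n0 : 0 < n by lra.
rewrite LamP_pos// normrM ger0_norm; last by rewrite divr_ge0.
have [g1 g2] := gauss_int n0.
have n1 : 0 < (1 + n) ^+ 2 by rewrite exprn_gt0//; lra.
set K := C0 * cp ^+ 2 * 16 * Num.sqrt (2 * pi).
have K0 : 0 <= K by rewrite /K; nonneg.
have B : `|Int setT (fun t => expR (- (m%:R ^+ 2 * (n * sh (m%:R^-1 * t) ^+ 2))) * Jin m (Num.sqrt n * ch (m%:R^-1 * t)))| <=
   K / (1 + n) ^+ 2 * Num.sqrt (pi / n).
  rewrite -g2 -IntZ//; apply: norm_Int_le2 => //; last 1 first.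
  - move=> t _; rewrite normrM (ger0_norm (expR_ge0 _)) mulrC; apply: ler_pM => //.
      apply: Jin_decay => //; first exact: ltW.
      by rewrite sqr_sqrt_mul ?(ltW n0)// ler_peMr ?(ltW n0)// exprn_ege1// ch_ge1.
    by apply: scale_gauss_dom => //; exact: ltW.
  - by apply: cont_meas => //; have ? := @cc_Jin m; ctac.
  - exact: intgZ.
apply: le_trans (ler_wpM2l _ B) _; first by rewrite divr_ge0.
rewrite /CL -/K [leRHS](_ : _ = 2 / c%:R * ((4 * (C0 * Num.sqrt pi) + K) / (1 + n) ^+ 2 * Num.sqrt (48 * pi))); last first.
  by move: ((1 + n) ^+ 2)^-1 (c%:R^-1) => z w; ring.
apply: ler_wpM2l; first by rewrite divr_ge0.
apply: ler_pM; rewrite ?sqrtr_ge0 ?sqrt_pi_div//; first by rewrite divr_ge0 ?(ltW n1).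
by rewrite ler_pM2r ?invr_gt0// lerDr; nonneg.
Qed.

Lemma expN_le_sqr (n : R) : 0 <= n -> expR (- n) <= 4 / (1 + n) ^+ 2.
Proof.
move=> n0; have h := expR_ge1Dx (n / 2).
have n1 : 0 < (1 + n) ^+ 2 by rewrite exprn_gt0//; lra.
rewrite expRN ler_pdivlMr// mulrC ler_pdivrMr ?expR_gt0//.
have -> : n = 2%:R * (n / 2) by lra.
rewrite expRM_natl; have h2 : (1 + n / 2) ^+ 2 <= expR (n / 2) ^+ 2.
  by rewrite ler_pXn2r ?nnegrE ?expR_ge0//; lra.
by apply: le_trans (_ : _ <= 4 * (1 + n / 2) ^+ 2) _; [nra|lra].
Qed.

(** Here r^2 = n ch^2 = n + n sh^2, so a factor exp(- m^2 n) comes out of the integral. It gives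
    both the limit 0 and a bound uniform in m. *)
Lemma LamP_neg_le (m : nat) (n : R) : (0 < m)%N -> 48^-1 <= n ->
  `|LamP m (- n)| <= CL * expR (- (m%:R ^+ 2 * n)) /\ `|LamP m (- n)| <= CL / (1 + n) ^+ 2.
Proof.
move=> m0 n48; have n0 : 0 < n by lra.
have mR : 1 <= m%:R ^+ 2 :> R by rewrite exprn_ege1// ler1n.
rewrite LamP_neg// normrM ger0_norm; last by rewrite divr_ge0.
have [g1 g2] := gauss_int n0.
have B : `|Int setT (fun t => expR (- (m%:R ^+ 2 * (n * ch (m%:R^-1 * t) ^+ 2))) * Jin m (Num.sqrt n * sh (m%:R^-1 * t)))| <=
   C0 * Num.sqrt pi * expR (- (m%:R ^+ 2 * n)) * Num.sqrt (pi / n).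
  rewrite -g2 -IntZ//; apply: norm_Int_le2 => //; last 1 first.
  - move=> t _; rewrite normrM (ger0_norm (expR_ge0 _)) mulrC -mulrA; apply: ler_pM => //.
      exact: Jin_le.
    rewrite ch2_sh2 (_ : - _ = - (m%:R ^+ 2 * n) - m%:R ^+ 2 * (n * sh (m%:R^-1 * t) ^+ 2)); last ring.
    by rewrite expRD ler_wpM2l ?expR_ge0//; apply: scale_gauss_dom => //; exact: ltW.
  - by apply: cont_meas => //; have ? := @cc_Jin m; ctac.
  - exact: intgZ.
have K0 : 0 <= C0 * cp ^+ 2 * 16 * Num.sqrt (2 * pi) by nonneg.
have K1 : 0 <= C0 * Num.sqrt pi by nonneg.
have c2 : 0 <= 2 / c%:R :> R by rewrite divr_ge0.
have B2 : 2 / c%:R * (C0 * Num.sqrt pi * expR (- (m%:R ^+ 2 * n)) * Num.sqrt (pi / n)) <= CL / 4 * expR (- (m%:R ^+ 2 * n)).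
  rewrite /CL; set K := _ * Num.sqrt (2 * pi) in K0 *; set K' := C0 * _ in K1 *.
  rewrite [leRHS](_ : _ = 2 / c%:R * ((K' + K / 4) * expR (- (m%:R ^+ 2 * n)) * Num.sqrt (48 * pi))); last first.
    by move: (c%:R^-1) => w; field.
  apply: ler_wpM2l => //; apply: ler_pM; rewrite ?sqrtr_ge0 ?sqrt_pi_div//; first by rewrite mulr_ge0 ?expR_ge0.
  by rewrite ler_wpM2r ?expR_ge0//; lra.
have CL0 : 0 <= CL by rewrite /CL; nonneg.
have B3 := le_trans (ler_wpM2l c2 B) B2; split.
  by apply: le_trans B3 _; rewrite ler_wpM2r ?expR_ge0//; lra.
apply: le_trans B3 _; rewrite [leRHS](_ : _ = CL / 4 * (4 / (1 + n) ^+ 2)); last by move: ((1 + n) ^+ 2)^-1 => z; field.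
apply: ler_wpM2l; first by rewrite divr_ge0.
apply: le_trans (expN_le_sqr (ltW n0)); by rewrite ler_expR lerN2 ler_peMl ?(ltW n0).
Qed.

Lemma sh_le (x : R) : 0 <= x -> sh x <= x * ch x.
Proof.
move=> x0; rewrite -subr_ge0.
have Ei : Int `[0, x] (fun t => t * sh t) = (x * ch x - sh x) - (0 * ch 0 - sh 0).
  apply: (Int_FTC x0 _ (F := fun t => t * ch t - sh t)); first by ctac.
  move=> t; eapply dE; [eapply dD; [eapply dM; [dtac|exact: d_ch]|eapply dN; exact: d_sh]|].
  by rewrite mul1r addrAC subrr add0r.
rewrite sh0 mul0r subr0 subr0 in Ei; rewrite -Ei; apply: Int_ge0 => t /=; rewrite in_itv /= => /andP[t0 _].
by rewrite mulr_ge0// (le_trans t0)// sh_ge.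
Qed.

Lemma sh2_le (x : R) : sh x ^+ 2 <= x ^+ 2 * ch x ^+ 2.
Proof.
rewrite -exprMn; have [x0|x0] := leP 0 x.
  rewrite ler_pXn2r ?nnegrE ?sh_le//; first exact: le_trans (sh_ge x0).
  by rewrite mulr_ge0// (ltW (ch_gt0 _)).
have h : 0 <= - x by rewrite oppr_ge0 ltW.
rewrite -(sqrrN (sh x)) -(sqrrN (x * ch x)) -shN -mulNr -(chN x) ler_pXn2r ?nnegrE ?sh_le//; first exact: le_trans (sh_ge h).
by rewrite mulr_ge0// (ltW (ch_gt0 _)).
Qed.

Lemma cvg_natV (t : R) : m.+1%:R^-1 * t @[m --> \oo] --> (0 : R).
Proof.
rewrite -(mul0r t); apply: cvgM; last exact: cvg_cst.
exact: cvg_harmonic.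
Qed.

Lemma cvg_ch (t : R) : ch (m.+1%:R^-1 * t) @[m --> \oo] --> (1 : R).
Proof. by have := @cont_seq R ch 0 (fun m : nat => m.+1%:R^-1 * t) (@cc_ch R 0) (cvg_natV t); rewrite ch0. Qed.

Lemma cvg_m_sh (t : R) : m.+1%:R ^+ 2 * sh (m.+1%:R^-1 * t) ^+ 2 @[m --> \oo] --> t ^+ 2.
Proof.
have e (m : nat) : t ^+ 2 = m.+1%:R ^+ 2 * (m.+1%:R^-1 * t) ^+ 2 by rewrite exprMn exprVn mulVKf// expf_neq0.
apply: (squeeze_cvgr (f := fun _ => t ^+ 2) (h := fun m : nat => t ^+ 2 * ch (m.+1%:R^-1 * t) ^+ 2)).
- apply: nearW => m; apply/andP; split.
    by rewrite (e m); apply: ler_wpM2l; [exact: sqr_ge0|exact: sh2_ge].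
  by rewrite [X in _ <= X * _](e m) -[leRHS]mulrA; apply: ler_wpM2l; [exact: sqr_ge0|exact: sh2_le].
- exact: cvg_cst.
- rewrite -[X in _ --> X]mulr1 -[in X in _ --> X](expr1n R 2); apply: cvgM; first exact: cvg_cst.
  by apply: (cvgM (cvg_ch t) (cvg_ch t)).
Qed.

(** Two Gaussian integrals remain in the limit: the one along the hyperbola gives sqrt (pi/n), the
    inner one sqrt pi times the value of E. *)
Lemma LamP_pos_cvg (n : R) : 0 < n ->
  LamP m.+1 n @[m --> \oo] --> 2 / c%:R * (pi / Num.sqrt n * E (2 * Num.sqrt n / c%:R)).
Proof.
move=> n0; under eq_cvg do rewrite LamP_pos//.
apply: cvgM; first exact: cvg_cst.
have [g1 g2] := gauss_int n0.
have -> : pi / Num.sqrt n * E (2 * Num.sqrt n / c%:R) = Int setT (fun t => Num.sqrt pi * E (2 * Num.sqrt n / c%:R) * expR (- (n * t ^+ 2))).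
  rewrite IntZ// g2 sqrtrM ?pi_ge0// sqrtrV ?(ltW n0)// mulrACA.
  by rewrite -expr2 sqr_sqrtr ?pi_ge0// [E _ * _]mulrC mulrA.
apply: (dct (g := fun t => C0 * Num.sqrt pi * expR (- (n * t ^+ 2))) _ _ _ _ _).2 => //.
- by move=> m; apply: cont_meas => //; have ? := @cc_Jin m.+1; ctac.
- exact: intgZ.
- move=> m t _; rewrite normrM (ger0_norm (expR_ge0 _)) mulrC; apply: ler_pM => //.
    exact: Jin_le.
  by apply: scale_gauss_dom => //; exact: ltW.
move=> t _; rewrite mulrC; apply: cvgM.
  apply: cont_seq; first exact: continuous_expR.
  apply: cvgN; under eq_cvg do rewrite mulrCA; apply: cvgM; first exact: cvg_cst.
  exact: cvg_m_sh.
have -> : Num.sqrt pi * E (2 * Num.sqrt n / c%:R) = Int setT (fun s => E (2 * Num.sqrt n / c%:R) * expR (- s ^+ 2)).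
  by rewrite IntZ ?Int_gauss1 ?[_ * E _]mulrC//; exact: intg_gauss1.
apply: (dct (g := fun s => C0 * expR (- s ^+ 2)) _ _ _ _ _).2 => //.
- by move=> m; apply: cont_meas => //; exact: cc_Ein.
- exact: intgZ intg_gauss1.
- by move=> m s _; rewrite normrM (ger0_norm (expR_ge0 _)) ler_wpM2r ?expR_ge0 ?E_bounded.
- move=> s _; apply: cvgM; last exact: cvg_cst.
  apply: cont_seq; first exact: cE.
  rewrite -[X in _ --> X]add0r; apply: cvgD.
    have := cvg_natV (2 / c%:R * s); apply: cvg_trans; apply: near_eq_cvg; apply: nearW => m /=.
    by rewrite invfM; ring.
  apply: cvgM; last exact: cvg_cst.
  apply: cvgM; first exact: cvg_cst.
  rewrite -[X in _ --> X]mulr1; apply: cvgM; [exact: cvg_cst|exact: cvg_ch].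
Qed.

Lemma LamP_neg_cvg (n : R) : 48^-1 <= n -> LamP m.+1 (- n) @[m --> \oo] --> (0 : R).
Proof.
move=> n48; have n0 : 0 < n by lra.
have CL0 : 0 <= CL.
  by rewrite /CL; nonneg.
apply/norm_cvg0P.
apply: (squeeze_cvgr (f := fun _ => 0) (h := fun m : nat => CL * (m.+1%:R^-1 * n^-1))).
- apply: nearW => m; rewrite normr_ge0 /=; apply: le_trans (LamP_neg_le (ltn0Sn m) n48).1 _.
  apply: ler_wpM2l => //; rewrite -invfM.
  have h := expRN_le_inv; rewrite expRN lef_pV2 ?posrE ?expR_gt0// ?mulr_gt0//.
  apply: le_trans (_ : _ <= m.+1%:R ^+ 2 * n) _; last by apply: le_trans (expR_ge1Dx _); rewrite lerDr.
  by rewrite ler_wpM2r ?(ltW n0)// expr2 ler_peMr// ler1n.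
- exact: cvg_cst.
- rewrite -(mulr0 CL); apply: cvgM; [exact: cvg_cst|exact: cvg_natV].
Qed.

End left_limit.

(** * The unfolded identity and its limit *)

Section core_limit.
Context {R : realType}.
Local Notation rho := (Num.sqrt 6 : R).
Local Notation nx x := (nn (x.1%:~R : R) x.2%:~R).

Lemma nnE (x : int * int) : nx x = (qf x)%:~R / 48.
Proof. by rewrite /nn /qf !(rmorphB, rmorphM, rmorphXn) /=. Qed.

Lemma nn_eps x : nx (eps x) = nx x.
Proof. by rewrite !nnE qf_eps. Qed.

Lemma nn_ge x : x != (0, 0) -> (48^-1 <= `|nx x|)%R.
Proof.
move=> x0; rewrite nnE normrM (ger0_norm (x := 48^-1))// -[leLHS]mul1r ler_pM2r// -intr_norm ler1z.
have : qf x != 0 by apply: contra x0 => /eqP/qf_eq0 ->.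
by lia.
Qed.

Lemma nn_neq0 x : x != (0, 0) -> nx x != 0.
Proof. by move=> /nn_ge h; rewrite -normr_gt0 (lt_le_trans _ h)// invr_gt0. Qed.

Lemma qf_nn x : (0 < nx x) = (0 < qf x).
Proof. by rewrite nnE pmulr_lgt0 ?invr_gt0// ltr0z. Qed.

(** The weight is nonzero only where X^2 >= 9 Y^2 or X^2 <= 4 Y^2, and there |n| is comparable to
    X^2 + Y^2. The constant 160 is attained on X^2 = 9 Y^2. *)
Lemma om_cone x : om x != 0 :> R -> ((x.1%:~R : R) ^+ 2 + x.2%:~R ^+ 2) / 160 <= `|nx x|.
Proof.
have sgM (a b : R) : Num.sg a * Num.sg b = Num.sg (a * b) by rewrite sgrM.
rewrite omE; case: ifPn => q0.
  rewrite -qf_nn in q0; rewrite (gtr0_norm q0) sgM /nn => h.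
  have : 0 <= ((x.1%:~R : R) + 3 * x.2%:~R) * (x.1%:~R - 3 * x.2%:~R).
    rewrite leNgt; apply/negP => h'; move: h; rewrite (ltr0_sg h') subrr mul0r eqxx.
    by [].
  by nra.
rewrite -qf_nn in q0; rewrite sgM => h.
have : ((x.1%:~R : R) + 2 * x.2%:~R) * (x.1%:~R - 2 * x.2%:~R) <= 0.
  rewrite leNgt; apply/negP => h'; move: h; rewrite (gtr0_sg h') subrr mul0r eqxx.
  by [].
by rewrite (ler0_norm (_ : nx x <= 0)); [rewrite /nn; nra|rewrite leNgt].
Qed.

Lemma tsummable_inv_sqr2 : tsummable (fun x : int * int => (1 + (x.1%:~R : R) ^+ 2)^-1 * (1 + x.2%:~R ^+ 2)^-1).
Proof. exact: (tsummable_prod (@tsummable_inv_sqr R) (@tsummable_inv_sqr R)). Qed.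

Lemma cone_le x : om x != 0 :> R -> (1 + `|nx x|) ^- 2 <= 160 ^+ 2 * ((1 + (x.1%:~R : R) ^+ 2)^-1 * (1 + x.2%:~R ^+ 2)^-1).
Proof.
move=> /om_cone h; have h1 := sqr_ge0 (x.1%:~R : R); have h2 := sqr_ge0 (x.2%:~R : R).
move: h h1 h2; move: (x.1%:~R ^+ 2) (x.2%:~R ^+ 2) `|nx x| => a b n h a0 b0.
rewrite -invfM -[160 ^+ 2]invrK -invfM lef_pV2 ?posrE.
- have p1 : (1 + a) / 160 <= 1 + n by lra.
  have p2 : (1 + b) / 160 <= 1 + n by lra.
  have := ler_pM _ _ p1 p2; rewrite -expr2 mulrACA.
  have -> : 160^-1 * 160^-1 = (160 ^+ 2)^-1 :> R by rewrite -invfM -expr2.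
  by move=> H; rewrite [leLHS]mulrC; apply: H; apply: divr_ge0; lra.
- by rewrite exprn_gt0//; lra.
- by rewrite mulr_gt0 ?invr_gt0// mulr_gt0//; lra.
Qed.

Variables (c : nat) (E : R -> R) (C0 : R).
Hypotheses (c0 : (0 < c)%N) (cE : continuous E) (eE : forall q, E (- q) = E q).
Hypothesis (bE : forall q, `|E q| <= C0 / (1 + q ^+ 2) ^+ 2).
Let cR0 : 0 < c%:R :> R. Proof. by rewrite ltr0n. Qed.
Let C00 : 0 <= C0. Proof. by have := bE 0; rewrite expr0n addr0 expr1n divr1; exact: le_trans. Qed.

Lemma iE : intg setT E.
Proof.
apply: (@intgT_bounded _ _ (pi * C0)) => // n.
have bE' q : `|E q| <= C0 * (1 + q ^+ 2)^-1.
  apply: le_trans (bE q) _; have q0 := sqr_ge0 q; apply: ler_wpM2l => //.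
  by rewrite lef_pV2 ?posrE ?exprn_gt0//; [rewrite expr2 ler_peMr//; lra| |]; lra.
have ci : continuous (fun q : R => C0 * (1 + q ^+ 2)^-1).
  apply: cc_M; first exact: cc_cst.
  by apply: cc_inv; [ctac|move=> q; rewrite gt_eqF//; have := sqr_ge0 q; lra].
apply: le_trans (_ : _ <= Int `[- n%:R, n%:R] (fun q => C0 * (1 + q ^+ 2)^-1)) _.
  apply: le_Int => //; [exact: intg_itv (cc_norm cE)|exact: intg_itv ci].
have -> : Int `[- n%:R, n%:R] (fun q => C0 * (1 + q ^+ 2)^-1) = C0 * atan n%:R - C0 * atan (- n%:R).
  have da (x : R) : is_derive x 1 (fun q => C0 * atan q) (C0 * (1 + x ^+ 2)^-1).
    by eapply dE; [eapply dM; [exact: dcst|exact: is_derive1_atan]|rewrite mul0r add0r].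
  exact: (Int_FTC (opp_nat_le n) ci da).
rewrite atanN mulrN opprK -mulrDr mulrC; apply: ler_wpM2r => //.
by have := atan_ltpi2 (n%:R : R); lra.
Qed.

(** The dual kernel as a function of the two coordinates; d = 4 pi^2/(m^2 c^2) is the Gaussian
    damping that tends to 0. *)
Definition Dk (d p r : R) : R := Ehat E p * expR (- (d * (p ^+ 2 + r ^+ 2))).
Definition kd (d n : R) : R := lineI (Dk d) n.
Definition Llim (n : R) : R := if 0 < n then 2 / c%:R * (pi / Num.sqrt n * E (2 * Num.sqrt n / c%:R)) else 0.

Variables (b : int * int -> R) (M : R).
Hypotheses (pb : periodic (24 * c)%N (4 * c)%N b) (bM : forall x, `|b x| <= M).
Hypotheses (be : forall x, b (eps x) = b x) (b0 : b (0, 0) = 0).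
Hypotheses (Ge : forall x, Gh c b (eps x) = Gh c b x :> R) (G0 : Gh c b (0, 0) = 0 :> R).

Lemma EhatN p : Ehat E (- p) = Ehat E p.
Proof. by apply: eq_Int => q _; rewrite mulrN cosN. Qed.

Lemma line_D (kap X Y : R) : nn X Y != 0 -> intg setT (fun t => DE c kap E t X Y) ->
  Int setT (fun t => DE c kap E t X Y) = kd (4 * pi ^+ 2 / (kap * c%:R ^+ 2)) (nn X Y).
Proof.
move=> n0 iX; have cH := cc_Ehat cE iE.
apply: (Int_line (Phi := Dk (4 * pi ^+ 2 / (kap * c%:R ^+ 2))) n0 _ _ _ iX).
- by move=> p r; rewrite /Dk EhatN !sqrrN.
- by move=> n; rewrite /Dk; ctac.
- by move=> n; rewrite /Dk; ctac.
Qed.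

Lemma Lkern_even (kap p r : R) : 0 < kap -> Lkern c E kap (- p) (- r) = Lkern c E kap p r.
Proof.
move=> k0; rewrite /Lkern; set f := fun q => E q * expR (- (kap * ((p - c%:R * q / 2) ^+ 2 + r ^+ 2))).
have cf : continuous f by rewrite /f; ctac.
have fb q : `|f q| <= `|E q|.
  rewrite /f normrM -[leRHS]mulr1; apply: ler_wpM2l; first exact: normr_ge0.
  rewrite ger0_norm; last exact: expR_ge0.
  rewrite -[leRHS]expR0 ler_expR oppr_le0; apply: mulr_ge0; first exact: ltW.
  by apply: addr_ge0; exact: sqr_ge0.
have iff : intg setT f.
  apply: (intg_le _ _ (intg_norm _ iE)) => //; first exact: cont_meas.
transitivity (Int setT (fun q => f (- q))); last exact: Int_opp_all.
apply: eq_Int => q _; rewrite /f eE.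
have e : (- p - c%:R * q / 2) ^+ 2 = (p - c%:R * - q / 2) ^+ 2 by ring.
by rewrite e sqrrN.
Qed.

Lemma line_K (m : nat) (X Y : R) : (0 < m)%N -> nn X Y != 0 ->
  intg setT (fun t => KE c (m%:R ^+ 2) E t X Y) ->
  m%:R ^+ 2 * Int setT (fun t => KE c (m%:R ^+ 2) E t X Y) = LamP c E m (nn X Y).
Proof.
move=> m0 n0 iX; rewrite /LamP; congr (_ * _).
have mR : 0 < m%:R :> R by rewrite ltr0n.
have k0 : 0 < m%:R ^+ 2 :> R by rewrite exprn_gt0.
have cJ : continuous (Jin c E m) by exact: cc_Jin.
have LkE p r : Lkern c E (m%:R ^+ 2) p r = m%:R^-1 * (2 / c%:R * expR (- (m%:R ^+ 2 * r ^+ 2)) * Jin c E m p).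
  by rewrite -(LkernE c0 cE bE p r m0) mulKf ?gt_eqF.
apply: (Int_line (Phi := Lkern c E (m%:R ^+ 2)) n0 _ _ _ iX).
- by move=> p r; exact: Lkern_even.
- move=> n; have -> : (fun t : R => Lkern c E (m%:R ^+ 2) (n * ch t) (n * sh t)) =
    (fun t : R => m%:R^-1 * (2 / c%:R * expR (- (m%:R ^+ 2 * (n * sh t) ^+ 2)) * Jin c E m (n * ch t))).
    by apply/funext => t; exact: LkE.
  by ctac.
- move=> n; have -> : (fun t : R => Lkern c E (m%:R ^+ 2) (n * sh t) (n * ch t)) =
    (fun t : R => m%:R^-1 * (2 / c%:R * expR (- (m%:R ^+ 2 * (n * ch t) ^+ 2)) * Jin c E m (n * sh t))).
    by apply/funext => t; exact: LkE.
  by ctac.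
Qed.

(** Both sides of the inverted theta series, integrated over a period, are unfolded; the prefactor
    loses its 1/kap to the m^2 in [LamP]. *)
Lemma core_identity (m : nat) : (0 < m)%N ->
  tsummable (fun x => om x * Gh c b x * kd (4 * pi ^+ 2 / (m%:R ^+ 2 * c%:R ^+ 2)) (nx x)) /\
  tsum (fun x => om x * b x * LamP c E m (nx x)) =
  pi / (2 * rho * c%:R ^+ 2) * tsum (fun x => om x * Gh c b x * kd (4 * pi ^+ 2 / (m%:R ^+ 2 * c%:R ^+ 2)) (nx x)).
Proof.
move=> m0; have mR : 0 < m%:R :> R by rewrite ltr0n.
have k0 : 0 < m%:R ^+ 2 :> R by rewrite exprn_gt0.
have iE' := iE.
have [S1 S2 S3] := theta_E_itv c0 k0 cE iE' eE (ltW (@PP_gt0 R)) pb bM.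
have cK := fun x : int * int => @cc_KE R c _ E k0 cE iE' x.1%:~R x.2%:~R.
have cD := fun x : int * int => @cc_DE R c (m%:R ^+ 2) E cE iE' x.1%:~R x.2%:~R.
have eK t x : KE c (m%:R ^+ 2) E t (eps x).1%:~R (eps x).2%:~R = KE c (m%:R ^+ 2) E (t + PP) x.1%:~R x.2%:~R.
  by apply: eq_Int => q _; rewrite /Kth pp_eps rr_eps.
have eD t x : DE c (m%:R ^+ 2) E t (eps x).1%:~R (eps x).2%:~R = DE c (m%:R ^+ 2) E (t + PP) x.1%:~R x.2%:~R.
  by rewrite /DE pp_eps rr_eps.
have [UK1 UK2] := unfolding cK eK S1 bM be b0.
have [UD1 UD2] := unfolding cD eD S2 (fun v => @Gh_le R c b M v bM) Ge G0.
have ED x : om x * Gh c b x * Int setT (fun t => DE c (m%:R ^+ 2) E t x.1%:~R x.2%:~R) =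
   om x * Gh c b x * kd (4 * pi ^+ 2 / (m%:R ^+ 2 * c%:R ^+ 2)) (nx x).
  have [->|x0] := eqVneq x (0, 0); first by rewrite G0 mulr0 !mul0r.
  by rewrite line_D//; [exact: nn_neq0|have [] := unfold_line cD eD S2 x0].
have EK x : om x * b x * (m%:R ^+ 2 * Int setT (fun t => KE c (m%:R ^+ 2) E t x.1%:~R x.2%:~R)) =
   om x * b x * LamP c E m (nx x).
  have [->|x0] := eqVneq x (0, 0); first by rewrite b0 mulr0 !mul0r.
  by rewrite line_K//; [exact: nn_neq0|have [] := unfold_line cK eK S1 x0].
split; first by apply: eq_tsummable UD1 => x; rewrite ED.
rewrite -(eq_tsum ED) -UD2 -(eq_tsum EK).
under eq_tsum do rewrite mulrCA.
rewrite tsumZ; last exact: UK1.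
rewrite -UK2 S3 mulrA; congr (_ * _).
by field; rewrite !gt_eqF// rho_gt0.
Qed.

(** On the left the limit may be taken inside: [LamP] is O((1 + |n|)^-2) uniformly in m, which is
    summable over the cone. The right-hand kernel has no such bound. *)
Lemma core_limit :
  pi / (2 * rho * c%:R ^+ 2) * tsum (fun x => om x * Gh c b x * kd (4 * pi ^+ 2 / (m.+1%:R ^+ 2 * c%:R ^+ 2)) (nx x))
    @[m --> \oo] --> tsum (fun x => om x * b x * Llim (nx x)).
Proof.
under eq_cvg => m do rewrite -(core_identity (ltn0Sn m)).2.
have M0 : 0 <= M := le_trans (normr_ge0 _) (bM (0, 0)).
have CL0 : 0 <= CL c C0 by rewrite /CL; nonneg.
apply: (tannery (f_ := fun m x => om x * b x * LamP c E m.+1 (nx x)) (f := fun x => om x * b x * Llim (nx x)) (g := fun x : int * int => M * CL c C0 * 160 ^+ 2 * ((1 + (x.1%:~R : R) ^+ 2)^-1 * (1 + x.2%:~R ^+ 2)^-1)) _ _ _).2.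
- exact/tsummableZ/tsummable_inv_sqr2.
- move=> m x; have [->|x0] := eqVneq x (0, 0).
    rewrite b0 mulr0 mul0r normr0; apply: mulr_ge0; first by nonneg.
    by rewrite /= expr0n addr0 invr1 mulr1.
  have [->|o0] := eqVneq (om x : R) 0.
    rewrite !mul0r normr0 mulr_ge0//; first by nonneg.
    by rewrite mulr_ge0// invr_ge0; [have := sqr_ge0 (x.1%:~R : R)|have := sqr_ge0 (x.2%:~R : R)]; lra.
  have h : `|LamP c E m.+1 (nx x)| <= CL c C0 * (1 + `|nx x|) ^- 2.
    have := nn_ge x0; have [np|nm|/esym/eqP n0] := ltgtP 0 (nx x).
    - by rewrite gtr0_norm// => h; exact: (LamP_pos_le c0 cE bE).
    - rewrite ltr0_norm// => h; rewrite -{1}[nx x]opprK.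
      exact: (LamP_neg_le c0 cE bE (ltn0Sn m) h).2.
    - by move: n0; rewrite (negPf (nn_neq0 x0)).
  rewrite [leLHS]normrM [X in X * _]normrM (ger0_norm (om_ge0 x)) -2!mulrA.
  apply: le_trans (_ : 1 * (M * (CL c C0 * (1 + `|nx x|) ^- 2)) <= _).
    apply: ler_pM; [exact: om_ge0|by apply: mulr_ge0|exact: om_le1|].
    exact: ler_pM.
  rewrite mul1r -[leRHS]mulrA; apply: ler_wpM2l; first exact: M0.
  by apply: ler_wpM2l; [exact: CL0|exact: cone_le].
- move=> x; have [->|x0] := eqVneq x (0, 0).
    by rewrite b0 mulr0 mul0r; under eq_cvg do rewrite mul0r; exact: cvg_cst.
  apply: cvgM; first exact: cvg_cst.
  rewrite /Llim; have := nn_ge x0; have [np|nm|/esym/eqP n0] := ltgtP 0 (nx x).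
  - by move=> _; exact: (LamP_pos_cvg c0 cE bE).
  - rewrite ltr0_norm// => h; rewrite -[nx x]opprK; exact: (LamP_neg_cvg c0 cE bE).
  - by move: n0; rewrite (negPf (nn_neq0 x0)).
Qed.

End core_limit.

(** * Complex exponentials through real parts *)

Section exponential_functional.
Context {R : realType}.
Local Open Scope complex_scope.
Implicit Types (s u v : R[i]) (y z w : R).

(* [cR s u y] is the real part of [u * exp (- s y)]; letting u vary makes all the calculus real. *)
Definition cR s u (y : R) : R :=
  expR (- (complex.Re s * y)) * (complex.Re u * cos (complex.Im s * y) + complex.Im u * sin (complex.Im s * y)).

Definition nu u : R := `|complex.Re u| + `|complex.Im u|.

Lemma nu_ge0 u : 0 <= nu u.
Proof. by rewrite addr_ge0. Qed.

Lemma cReM u v : complex.Re (u * v) = complex.Re u * complex.Re v - complex.Im u * complex.Im v.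
Proof. by case: u v => [a b] [c d]. Qed.
Lemma cImM u v : complex.Im (u * v) = complex.Re u * complex.Im v + complex.Im u * complex.Re v.
Proof. by case: u v => [a b] [c d]. Qed.

(** Differentiation multiplies the parameter u by - s, so that complex linear equations can be
    stated for real functions. *)
Lemma d_cR s u (y : R) : is_derive y 1 (cR s u) (- cR s (s * u) y).
Proof.
rewrite /cR cReM cImM; eapply dE; [dtac|cbv beta].
by move: (expR _) (cos _) (sin _) => e c t; ring.
Qed.

Lemma cc_cR s u : continuous (cR s u).
Proof. exact: derive_continuous (d_cR s u). Qed.

Lemma cR_le s u y : `|cR s u y| <= nu u * expR (- (complex.Re s * y)).
Proof.
rewrite /cR normrM (ger0_norm (expR_ge0 _)) mulrC ler_wpM2r ?expR_ge0//.
apply: le_trans (ler_normD _ _) _; rewrite !normrM; apply: lerD.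
  by rewrite -[leRHS]mulr1 ler_wpM2l// cos_max.
by rewrite -[leRHS]mulr1 ler_wpM2l// sin_max.
Qed.

Lemma cR0 s u : cR s u 0 = complex.Re u.
Proof. by rewrite /cR !mulr0 oppr0 expR0 cos0 sin0 mulr0 addr0 mulr1 mul1r. Qed.

Lemma cRD s u v y : cR s (u + v) y = cR s u y + cR s v y.
Proof. by rewrite /cR !raddfD /=; ring. Qed.

Lemma cRZ s (r : R) u y : cR s (r%:C * u) y = r * cR s u y.
Proof. by rewrite /cR cReM cImM /=; ring. Qed.

End exponential_functional.
#[global] Hint Resolve cc_cR : cont.

Section ftc_in.
Context {R : realType}.
Lemma Int_FTC_in (f F : R -> R) a b : a <= b -> continuous f ->
  (forall x : R, a <= x <= b -> is_derive x 1 F (f x)) -> Int `[a, b] f = F b - F a.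
Proof.
rewrite le_eqVlt => /predU1P[<- _ _|ab cf dF].
  by rewrite subrr set_itv1 /Int Rintegral_set1.
have ha : a <= a <= b by rewrite lexx ltW.
have hb : a <= b <= b by rewrite lexx ltW.
rewrite /Int /Rintegral (@continuous_FTC2 _ f F)//.
- exact: continuous_subspaceT.
- split.
  + by move=> x; rewrite in_itv /= => /andP[h1 h2]; have [] := dF x; rewrite ?ltW.
  + by apply: cvg_at_right_filter; exact: (derive_continuous_at (dF a ha)).
  + by apply: cvg_at_left_filter; exact: (derive_continuous_at (dF b hb)).
- move=> x; rewrite in_itv /= => /andP[h1 h2]; rewrite derive1E.
  have h : a <= x <= b by rewrite !ltW.
  by have [_ ->] := dF x h.
Qed.
End ftc_in.

(** * Dawson's function with complex parameter and its derivative *)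

Section dawson.
Context {R : realType}.
Local Open Scope complex_scope.
Variable s : R[i].
Hypothesis s0 : 0 < complex.Re s.
Implicit Types (u v : R[i]) (z w : R).

(** For k = 0, x times the value at z = x^2 is the real part of u exp(- s x^2) times the integral of
    exp(s y^2) over [0, x], which is Dawson's function; higher k arise from z-derivatives. *)
Definition Mk (k : nat) u z : R := Int `[0, 1] (fun w => (1 - w ^+ 2) ^+ k * cR s u (z * (1 - w ^+ 2))).

Lemma cc_Mk_int k u z : continuous (fun w : R => (1 - w ^+ 2) ^+ k * cR s u (z * (1 - w ^+ 2))).
Proof. by ctac. Qed.

Lemma itv01 (w : R) : `[0, 1]%classic w -> 0 <= 1 - w ^+ 2 <= 1.
Proof. by rewrite /= in_itv /= => /andP[h0 h1]; apply/andP; split; nra. Qed.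

Lemma eq_Mk_lin k u v z (r : R) : Mk k (r%:C * u + v) z = r * Mk k u z + Mk k v z.
Proof.
rewrite /Mk -IntZ//; last exact/intg_itv/cc_Mk_int.
rewrite -IntD//; [|apply: intgZ => //; exact/intg_itv/cc_Mk_int|exact/intg_itv/cc_Mk_int].
by apply: eq_Int => w _; rewrite cRD cRZ; ring.
Qed.

Lemma d_Mk k u (z : R) : is_derive z 1 (Mk k u) (- Mk k.+1 (s * u) z).
Proof.
have E : - Mk k.+1 (s * u) z = Int `[0, 1] (fun w => - ((1 - w ^+ 2) ^+ k.+1 * cR s (s * u) (z * (1 - w ^+ 2)))).
  by rewrite IntN//; exact/intg_itv/cc_Mk_int.
rewrite E; clear E.
have key (x w : R) : is_derive x 1 (fun z => (1 - w ^+ 2) ^+ k * cR s u (z * (1 - w ^+ 2)))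
    (- ((1 - w ^+ 2) ^+ k.+1 * cR s (s * u) (x * (1 - w ^+ 2)))).
  eapply dE; [eapply dM; [exact: dcst|]|].
    eapply (dcomp (f := fun x => x * (1 - w ^+ 2)) (g := cR s u)); [dtac|exact: d_cR].
  by cbv beta; rewrite (exprS _ k); ring.
pose BB := nu (s * u) * expR (complex.Re s * (`|z| + 1)).
apply: (@derive_param R `[0, 1] (fun z w => (1 - w ^+ 2) ^+ k * cR s u (z * (1 - w ^+ 2)))
  (fun z w => - ((1 - w ^+ 2) ^+ k.+1 * cR s (s * u) (z * (1 - w ^+ 2)))) (fun=> BB) (z - 1) (z + 1) z) => //.
- by apply/andP; split; lra.
- by move=> x _; exact/intg_itv/cc_Mk_int.
- exact/intg_itv/cc_cst.
- move=> x w /andP[x1 x2] /itv01/andP[t0 t1]; rewrite normrN normrM -[leRHS]mul1r; apply: ler_pM => //.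
    by rewrite ger0_norm ?exprn_ge0// exprn_ile1.
  apply: le_trans (cR_le _ _ _) _; apply: ler_wpM2l; first exact: nu_ge0.
  rewrite ler_expR -mulrN; apply: ler_wpM2l; first exact: ltW.
  have := ler_norm (- x); rewrite normrN => h; have h2 : `|x| <= `|z| + 1.
    by have := ler_norm z; have := ler_norm (- z); rewrite normrN ler_norml => ? ?; apply/andP; split; lra.
  apply: le_trans (_ : `|x| * (1 - w ^+ 2) <= _); first by rewrite -mulNr; apply: ler_wpM2r.
  by apply: le_trans h2; rewrite -[leRHS]mulr1; apply: ler_wpM2l.
Qed.

Lemma cc_Mk k u : continuous (Mk k u).
Proof. exact: derive_continuous (d_Mk k u). Qed.

(* integration of d/dw [w cR s u (z (1 - w^2))] over [0, 1] *)
Lemma Mk_parts u z : complex.Re u = Mk 0 u z + 2 * z * Mk 0 (s * u) z - 2 * z * Mk 1 (s * u) z.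
Proof.
have c1 := @cc_Mk_int 0 u z; have c2 := @cc_Mk_int 0 (s * u) z; have c3 := @cc_Mk_int 1 (s * u) z.
pose f w := cR s u (z * (1 - w ^+ 2)) + 2 * z * cR s (s * u) (z * (1 - w ^+ 2)) - 2 * z * ((1 - w ^+ 2) * cR s (s * u) (z * (1 - w ^+ 2))).
have E1 : Int `[0, 1] f = 1 * cR s u (z * (1 - 1 ^+ 2)) - 0 * cR s u (z * (1 - 0 ^+ 2)).
  apply: (Int_FTC (@ler01 R) _ (F := fun w => w * cR s u (z * (1 - w ^+ 2)))); first by rewrite /f; ctac.
  move=> w; eapply dE; [eapply dM; [dtac|]|].
    eapply (dcomp (f := fun w => z * (1 - w ^+ 2)) (g := cR s u)); [dtac|exact: d_cR].
  by rewrite /f /=; ring.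
rewrite mul0r subr0 mul1r expr1n subrr mulr0 cR0 in E1; rewrite -E1.
have i1 := intg_itv 0 1 c1; have i2 := intg_itv 0 1 c2; have i3 := intg_itv 0 1 c3.
rewrite /Mk -!IntZ// -IntD//; last exact: intgZ.
rewrite -IntB//; [|by apply: intgD => //; exact: intgZ|exact: intgZ].
by apply: eq_Int => w _; rewrite /f expr0 expr1 !mul1r.
Qed.

(** At z = x^2 this is the x-derivative of Dawson's function, hence the future cosine transform. *)
Definition Delta u z : R := complex.Re u - 2 * z * Mk 0 (s * u) z.

Lemma DeltaE u z : Delta u z = Mk 0 u z - 2 * z * Mk 1 (s * u) z.
Proof. by rewrite /Delta (Mk_parts u z); ring. Qed.

Lemma d_Delta u (z : R) : is_derive z 1 (Delta u) (- 3 * Mk 1 (s * u) z + 2 * z * Mk 2 (s * (s * u)) z).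
Proof.
have -> : Delta u = fun z => Mk 0 u z - 2 * z * Mk 1 (s * u) z by apply/funext => x; exact: DeltaE.
eapply dE; [eapply dD; [exact: d_Mk|eapply dN; eapply dM; [dtac|exact: d_Mk]]|].
by cbv beta; ring.
Qed.

Definition Fd u (x : R) : R := x * Mk 0 u (x ^+ 2).

Lemma d_Fd u (x : R) : is_derive x 1 (Fd u) (Delta u (x ^+ 2)).
Proof.
rewrite DeltaE; eapply dE; [eapply dM; [dtac|]|].
  eapply (dcomp (f := fun x => x ^+ 2) (g := Mk 0 u)); [eapply dX; exact: did|exact: d_Mk].
by cbv beta; rewrite /= expr1; ring.
Qed.

(** Adds the bound 1, from the integrand, to the bound 1/(a z), from the primitive. *)
Lemma exp_int (a z : R) : 0 < a -> 0 <= z ->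
  Int `[0, 1] (fun w => expR (- (a * z * (1 - w)))) <= (1 + a^-1) / (1 + z).
Proof.
move=> a0 z0; have ca : continuous (fun w : R => expR (- (a * z * (1 - w)))) by ctac.
rewrite ler_pdivlMr; last by lra.
rewrite mulrDr mulr1; apply: lerD.
  have : Int `[0, 1] (fun w => expR (- (a * z * (1 - w)))) <= Int `[0, 1] (fun _ : R => 1).
    apply: le_Int => //; [exact: intg_itv|exact/intg_itv/cc_cst|].
    move=> w /=; rewrite in_itv /= => /andP[w0 w1].
    by rewrite -[leRHS]expR0 ler_expR oppr_le0 mulr_ge0 ?subr_ge0// mulr_ge0// ltW.
  suff -> : Int `[0, 1] (fun _ : R => 1) = 1 by [].
  have -> : Int `[0, 1] (fun _ : R => 1) = 1 - 0 :> R; last by rewrite subr0.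
  by apply: (Int_FTC (@ler01 R) (@cc_cst R 1) (F := fun w => w)) => w; exact: did.
have E : Int `[0, 1] (fun w => a * z * expR (- (a * z * (1 - w)))) = expR (- (a * z * (1 - 1))) - expR (- (a * z * (1 - 0))).
  apply: (Int_FTC (@ler01 R) _ (F := fun w => expR (- (a * z * (1 - w))))); first by ctac.
  by move=> w; dring.
rewrite IntZ in E; [|by []|exact: intg_itv].
set I := Int _ _ in E *.
rewrite -(ler_pM2l a0) divff ?gt_eqF// (_ : a * (I * z) = a * z * I); last by ring.
rewrite E subrr mulr0 oppr0 expR0.
by rewrite lerBlDr lerDl expR_ge0.
Qed.

Lemma pow_exp_le (a z t : R) (k : nat) : 0 < a -> 0 <= z -> 0 <= t ->
  z ^+ k * t ^+ k * expR (- (a * (z * t))) <= (k.+1%:R * 2 / a) ^+ k * expR (- (a / 2 * (z * t))).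
Proof.
move=> a0 z0 t0; rewrite -exprMn; set y := z * t; have y0 : 0 <= y by rewrite mulr_ge0.
have -> : - (a * y) = - (a / 2 * y) - a / 2 * y by field.
rewrite expRD mulrCA [leRHS]mulrC; apply: ler_wpM2l; first exact: expR_ge0.
have k0 : 0 < k.+1%:R :> R by rewrite ltr0n.
have h : y <= k.+1%:R * 2 / a * expR (a / 2 * y / k.+1%:R).
  apply: le_trans (_ : k.+1%:R * 2 / a * (a / 2 * y / k.+1%:R) <= _).
    by rewrite le_eqVlt; apply/orP; left; apply/eqP; field; rewrite !gt_eqF.
  apply: ler_wpM2l; first by rewrite divr_ge0 ?mulr_ge0// ltW.
  by apply: le_trans (expR_ge1Dx _); rewrite lerDr.
have h2 : y ^+ k <= (k.+1%:R * 2 / a) ^+ k * expR (a / 2 * y).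
  apply: le_trans (_ : (k.+1%:R * 2 / a * expR (a / 2 * y / k.+1%:R)) ^+ k <= _).
    by case: k k0 h => [|k] k0 h; [rewrite !expr0|rewrite ler_pXn2r ?nnegrE// (le_trans y0)].
  rewrite exprMn; apply: ler_wpM2l; first by rewrite exprn_ge0// divr_ge0 ?mulr_ge0// ltW.
  rewrite -expRM_natl ler_expR; set q := _ / k.+1%:R.
  have -> : a / 2 * y = k.+1%:R * q by rewrite /q; field; rewrite gt_eqF.
  apply: ler_wpM2r; last by rewrite ler_nat.
  by rewrite divr_ge0// mulr_ge0// divr_ge0// ltW.
rewrite mulrC; apply: le_trans (ler_wpM2l (expR_ge0 _) h2) _.
by rewrite mulrCA -expRD addNr expR0 mulr1.
Qed.

(** Each power of z is paid for by one factor 1 - w^2 and half of the exponential; then 1 - w^2 >= 1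
    - w reduces to [exp_int]. The condition j <= k provides the factors. *)
Lemma Mk_decay (k j : nat) u : (j <= k)%N ->
  exists2 C : R, 0 <= C & forall z, 0 <= z -> z ^+ j * `|Mk k u z| <= C / (1 + z).
Proof.
move=> jk; set a := complex.Re s; have a2 : 0 < a / 2 by rewrite divr_gt0.
exists (nu u * (j.+1%:R * 2 / a) ^+ j * (1 + (a / 2)^-1)) => [|z z0].
  rewrite !mulr_ge0 ?nu_ge0// ?exprn_ge0// ?divr_ge0 ?mulr_ge0 ?(ltW s0)//.
  by rewrite addr_ge0// invr_ge0 ltW.
rewrite -[X in X * `|_|]ger0_norm ?exprn_ge0// -normrM.
apply: le_trans (_ : nu u * (j.+1%:R * 2 / a) ^+ j * Int `[0, 1] (fun w => expR (- (a / 2 * z * (1 - w)))) <= _); last first.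
  rewrite -[leRHS]mulrA; apply: ler_wpM2l; last exact: exp_int.
  by rewrite mulr_ge0 ?nu_ge0// exprn_ge0// divr_ge0 ?mulr_ge0 ?(ltW s0).
have iM : intg `[0, 1] (fun w => (1 - w ^+ 2) ^+ k * cR s u (z * (1 - w ^+ 2))) := intg_itv 0 1 (@cc_Mk_int k u z).
have -> : z ^+ j * Mk k u z = Int `[0, 1] (fun w => z ^+ j * ((1 - w ^+ 2) ^+ k * cR s u (z * (1 - w ^+ 2)))).
  by rewrite /Mk IntZ.
rewrite -IntZ//; last by apply: intg_itv; ctac.
apply: norm_Int_le2 => //; [by apply: cont_meas => //; ctac|by apply: intg_itv; ctac|].
have key (w : R) : 0 <= w -> w <= 1 -> `|z ^+ j * ((1 - w ^+ 2) ^+ k * cR s u (z * (1 - w ^+ 2)))| <= nu u * (j.+1%:R * 2 / a) ^+ j * expR (- (a / 2 * z * (1 - w))).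
  move=> w0 w1; have t0 : 0 <= 1 - w ^+ 2 by nra.
  have t1 : 1 - w ^+ 2 <= 1 by nra.
  have tw : 1 - w <= 1 - w ^+ 2 by nra.
  set t := 1 - w ^+ 2 in t0 t1 tw *.
  rewrite normrM normrM (ger0_norm (exprn_ge0 _ z0)) (ger0_norm (exprn_ge0 _ t0)).
  have h1 := cR_le s u (z * t); rewrite -/a in h1.
  have h2 : t ^+ k <= t ^+ j by rewrite ler_wiXn2l.
  have h3 := pow_exp_le j s0 z0 t0; rewrite -/a in h3.
  apply: le_trans (_ : z ^+ j * (t ^+ j * (nu u * expR (- (a * (z * t))))) <= _).
    apply: ler_wpM2l; first exact: exprn_ge0.
    by apply: ler_pM => //; exact: exprn_ge0.
  rewrite (_ : z ^+ j * _ = nu u * (z ^+ j * t ^+ j * expR (- (a * (z * t))))); last by ring.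
  rewrite -[leRHS]mulrA; apply: ler_wpM2l; first exact: nu_ge0.
  apply: le_trans h3 _; apply: ler_wpM2l; first by rewrite exprn_ge0// divr_ge0 ?mulr_ge0 ?(ltW s0).
  rewrite ler_expR lerN2 -!mulrA; apply: ler_wpM2l; first exact: ltW.
  by apply: ler_wpM2l; [rewrite invr_ge0|apply: ler_wpM2l].
by move=> w /=; rewrite in_itv /= => /andP[w0 w1]; exact: key.
Qed.

Lemma Delta_bounds u : exists2 C : R, 0 <= C & forall z, 0 <= z ->
  [/\ `|Mk 0 u z| <= C / (1 + z), `|Delta u z| <= C / (1 + z) &
      `|- 3 * Mk 1 (s * u) z + 2 * z * Mk 2 (s * (s * u)) z| <= C / (1 + z) ^+ 2].
Proof.
have [C1 C10 H1] := Mk_decay u (leqnn 0).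
have [C2 C20 H2] := Mk_decay (s * u) (leqnn 1).
have [C3 C30 H3] := Mk_decay (s * u) (leq0n 1).
have [C4 C40 H4] := Mk_decay (s * (s * u)) (leqnn 2).
have [C5 C50 H5] := Mk_decay (s * (s * u)) (isT : (1 <= 2)%N).
exists (C1 + 3 * C2 + 3 * C3 + 2 * C4 + 2 * C5) => [|z z0]; first by lra.
have := H1 z z0; have := H2 z z0; have := H3 z z0; have := H4 z z0; have := H5 z z0.
rewrite !expr0 !expr1 !mul1r.
have z1 : 0 < 1 + z by lra.
rewrite !ler_pdivlMr ?exprn_gt0//.
rewrite DeltaE; move: (Mk 0 u z) (Mk 1 (s * u) z) (Mk 2 (s * (s * u)) z) => m0 m1 m2 h5 h4 h3 h2 h1.
have n2 : `|2 * z * m1| = 2 * (z * `|m1|) by rewrite !normrM ger0_norm// (ger0_norm z0) mulrA.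
have n3 : `|- 3 * m1| = 3 * `|m1| by rewrite mulNr normrN normrM ger0_norm.
have n4 : `|2 * z * m2| = 2 * (z * `|m2|) by rewrite !normrM ger0_norm// (ger0_norm z0) mulrA.
split.
- by lra.
- apply: le_trans (_ : (`|m0| + `|2 * z * m1|) * (1 + z) <= _); first by rewrite ler_pM2r// ler_normB.
  by rewrite n2; lra.
- apply: le_trans (_ : (`|- 3 * m1| + `|2 * z * m2|) * (1 + z) ^+ 2 <= _).
    by rewrite ler_pM2r ?exprn_gt0// ler_normD.
  rewrite n3 n4; move: h5 h4 h3 h2 h1 (normr_ge0 m1) (normr_ge0 m2); move: `|m0| `|m1| `|m2| => a b c h5 h4 h3 h2 h1 b0 c0.
  by rewrite (_ : (3 * b + 2 * (z * c)) * (1 + z) ^+ 2 = 3 * (b * (1 + z)) + 3 * (z * b * (1 + z)) + 2 * (z * c * (1 + z)) + 2 * (z ^+ 2 * c * (1 + z))); [lra|ring].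
Qed.

(* C/(1+z) +- Delta are nonincreasing, which dominates the variation of Delta *)
Lemma Delta_dom u : exists2 C : R, 0 <= C &
  (forall z, 0 <= z -> `|Delta u z| <= C / (1 + z)) /\
  (forall z z', 0 <= z -> z <= z' -> `|Delta u z - Delta u z'| <= C / (1 + z) - C / (1 + z')).
Proof.
have [C C0 H] := Delta_bounds u; exists C => //; split=> [z z0|z z' z0 zz']; first by have [] := H z z0.
set d := fun z => - 3 * Mk 1 (s * u) z + 2 * z * Mk 2 (s * (s * u)) z.
have cd : continuous d by rewrite /d; have ? := @cc_Mk 1 (s * u); have ? := @cc_Mk 2 (s * (s * u)); ctac.
have E1 := Int_FTC zz' cd (d_Delta u).
rewrite distrC -E1.
have ex (x : R) : 0 <= x -> is_derive x 1 (fun x => - (C / (1 + x))) (C / (1 + x) ^+ 2).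
  move=> x0; have x1 : 1 + x != 0 by rewrite gt_eqF//; lra.
  have dv : is_derive x 1 (fun x : R => (1 + x)^-1) (- (1 + x) ^- 2 *: (0 + 1)).
    by apply: is_deriveV.
  by eapply dE; [eapply dN; eapply dM; [exact: dcst|exact: dv]|rewrite /GRing.scale /=; move: ((1 + x) ^- 2) => y; ring].
have ci : continuous (fun x : R => C / (1 + `|x|) ^+ 2).
  apply: cc_M; first exact: cc_cst.
  by apply: cc_inv; [ctac|move=> x; rewrite expf_neq0// gt_eqF//; have := normr_ge0 x; lra].
have h : `|Int `[z, z'] d| <= Int `[z, z'] (fun x => C / (1 + `|x|) ^+ 2).
  apply: norm_Int_le2 => //; [exact: cont_meas|exact: intg_itv|].
  move=> x /=; rewrite in_itv /= => /andP[zx _]; have x0 := le_trans z0 zx.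
  by rewrite (ger0_norm x0); have [] := H x x0.
apply: le_trans h _; rewrite le_eqVlt; apply/orP; left; apply/eqP.
have -> : Int `[z, z'] (fun x => C / (1 + `|x|) ^+ 2) = - (C / (1 + z')) - - (C / (1 + z)).
  apply: (@Int_FTC_in R _ (fun x => - (C / (1 + x))) z z' zz' ci) => x /andP[zx _].
  by have x0 := le_trans z0 zx; rewrite (ger0_norm x0); exact: ex.
by rewrite opprK addrC.
Qed.

End dawson.

Section nat_inv.
Context {R : realType}.
Lemma cvg_nat_inv : n%:R^-1 @[n --> \oo] --> (0 : R).
Proof.
by rewrite -(cvg_shiftS (fun n : nat => n%:R^-1 : R)); exact: cvg_harmonic.
Qed.
End nat_inv.

(** * The cosine transform of |q| exp(- l q^2) *)

Section fourier.
Context {R : realType}.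
Local Open Scope complex_scope.
Variables (l s : R[i]).
Hypotheses (l0 : 0 < complex.Re l) (s0 : 0 < complex.Re s) (ls : l * s = (pi ^+ 2)%:C).
Implicit Types (u v : R[i]) (q x : R).

Definition Eu u (q : R) : R := `|q| * cR l u (q ^+ 2).

Lemma cc_Eu u : continuous (Eu u).
Proof. by rewrite /Eu; ctac. Qed.

Lemma EuN u q : Eu u (- q) = Eu u q.
Proof. by rewrite /Eu normrN sqrrN. Qed.

Lemma Eu_bound u : exists C0 : R, forall q, `|Eu u q| <= C0 / (1 + q ^+ 2) ^+ 2.
Proof.
set a := complex.Re l; pose K := 1 + 3 / a.
have K0 : 0 <= K by rewrite /K addr_ge0// divr_ge0// ltW.
exists (nu u * K ^+ 3) => q; have q0 := sqr_ge0 q.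
rewrite ler_pdivlMr; last by rewrite exprn_gt0//; lra.
rewrite /Eu normrM normr_id.
have h1 : `|q| <= 1 + q ^+ 2 by rewrite -(real_normK (num_real q)); have := normr_ge0 q; nra.
have h2 : 1 + q ^+ 2 <= K * expR (a * q ^+ 2 / 3).
  apply: le_trans (_ : K * (1 + a * q ^+ 2 / 3) <= _); last by apply: ler_wpM2l => //; exact: expR_ge1Dx.
  have an : a != 0 by rewrite gt_eqF.
  rewrite (_ : K * _ = 1 + q ^+ 2 + (3 / a + a * q ^+ 2 / 3)); last by rewrite /K; field.
  rewrite lerDl; apply: addr_ge0; first by rewrite divr_ge0// ltW.
  by rewrite divr_ge0// mulr_ge0// ltW.
have h3 : (1 + q ^+ 2) ^+ 3 <= (K * expR (a * q ^+ 2 / 3)) ^+ 3.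
  by rewrite ler_pXn2r ?nnegrE// ?mulr_ge0 ?expR_ge0//; lra.
rewrite exprMn -expRM_natl (_ : 3%:R * (a * q ^+ 2 / 3) = a * q ^+ 2) in h3; last by field.
have h4 := cR_le l u (q ^+ 2); rewrite -/a in h4.
apply: le_trans (_ : (1 + q ^+ 2) * (nu u * expR (- (a * q ^+ 2))) * (1 + q ^+ 2) ^+ 2 <= _).
  by apply: ler_wpM2r; [exact: sqr_ge0|apply: ler_pM].
rewrite (_ : _ * (1 + q ^+ 2) ^+ 2 = nu u * (expR (- (a * q ^+ 2)) * (1 + q ^+ 2) ^+ 3)); last by ring.
apply: ler_wpM2l; first exact: nu_ge0.
apply: le_trans (ler_wpM2l (expR_ge0 _) h3) _.
by rewrite mulrCA -expRD addNr expR0 mulr1.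
Qed.

(* The half-line sine transform of exp (- l q^2); it solves the ODE of Dawson's function. *)
Definition Su u (x : R) : R := Int `[0, +oo[ (fun q => cR l u (q ^+ 2) * sin (2 * pi * q * x)).
Definition Au u (x : R) : R := Int `[0, +oo[ (fun q => 2 * q * cR l u (q ^+ 2) * cos (2 * pi * q * x)).

Let a : R := complex.Re l.
Let K2 : R := 1 + 2 / a.

Lemma qgauss q : (1 + `|q|) * expR (- (a * q ^+ 2)) <= 2 * K2 * expR (- (a / 2 * q ^+ 2)).
Proof.
have an : a != 0 by rewrite gt_eqF.
have K20 : 0 <= K2 by rewrite /K2 addr_ge0// divr_ge0// ltW.
have h1 : 1 + `|q| <= 2 * (1 + q ^+ 2) by rewrite -(real_normK (num_real q)); have := normr_ge0 q; nra.
have h2 : 1 + q ^+ 2 <= K2 * expR (a / 2 * q ^+ 2).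
  apply: le_trans (_ : K2 * (1 + a / 2 * q ^+ 2) <= _); last by apply: ler_wpM2l => //; exact: expR_ge1Dx.
  rewrite (_ : K2 * _ = 1 + q ^+ 2 + (2 / a + a / 2 * q ^+ 2)); last by rewrite /K2; field.
  rewrite lerDl; apply: addr_ge0; first by rewrite divr_ge0// ltW.
  by rewrite mulr_ge0 ?sqr_ge0// divr_ge0// ltW.
have -> : - (a * q ^+ 2) = - (a / 2 * q ^+ 2) - a / 2 * q ^+ 2 by field.
rewrite expRD mulrCA [leRHS]mulrC; apply: ler_wpM2l; first exact: expR_ge0.
apply: le_trans (_ : 2 * (K2 * expR (a / 2 * q ^+ 2)) * expR (- (a / 2 * q ^+ 2)) <= _).
  by apply: ler_wpM2r; [exact: expR_ge0|lra].
by rewrite -!mulrA -expRD subrr expR0 mulr1.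
Qed.

Lemma intg_qg : intg `[0, +oo[ (fun q => 2 * K2 * expR (- (a / 2 * q ^+ 2))).
Proof.
have a2 : 0 < a / 2 by rewrite divr_gt0.
by apply: intgS (intgZ (2 * K2) _ (gauss_int a2).1).
Qed.

Lemma intg_dom (f : R -> R) (C : R) : continuous f ->
  (forall q, `|f q| <= C * ((1 + `|q|) * expR (- (a * q ^+ 2)))) -> intg `[0, +oo[ f.
Proof.
move=> cf fC; have C0 : 0 <= C.
  by have := fC 0; rewrite normr0 expr0n mulr0 oppr0 expR0 addr0 !mulr1; exact: le_trans.
apply: (intg_le _ _ (intgZ C _ intg_qg)) => //; first exact: cont_meas.
by move=> q _; apply: le_trans (fC q) _; apply: ler_wpM2l => //; exact: qgauss.
Qed.

Lemma dom_cR u q : `|cR l u (q ^+ 2)| <= nu u * ((1 + `|q|) * expR (- (a * q ^+ 2))).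
Proof.
apply: le_trans (cR_le _ _ _) _; apply: ler_wpM2l; first exact: nu_ge0.
by rewrite ler_peMl ?expR_ge0// lerDl.
Qed.

Lemma dom_qcR u q : `|q * cR l u (q ^+ 2)| <= nu u * ((1 + `|q|) * expR (- (a * q ^+ 2))).
Proof.
rewrite normrM; apply: le_trans (ler_wpM2l (normr_ge0 _) (cR_le _ _ _)) _.
rewrite mulrCA; apply: ler_wpM2l; first exact: nu_ge0.
by apply: ler_wpM2r; [exact: expR_ge0|rewrite lerDr].
Qed.

Lemma norm_mul_trig (z t C : R) : `|z| <= C -> `|t| <= 1 -> `|z * t| <= C.
Proof.
move=> zC t1; rewrite normrM; apply: le_trans zC; rewrite -[leRHS]mulr1; exact: ler_wpM2l.
Qed.

Lemma intg_S u x : intg `[0, +oo[ (fun q => cR l u (q ^+ 2) * sin (2 * pi * q * x)).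
Proof.
apply: (intg_dom (C := nu u)); first by ctac.
by move=> q; apply: norm_mul_trig; [exact: dom_cR|exact: sin_max].
Qed.

Lemma intg_A u x : intg `[0, +oo[ (fun q => 2 * q * cR l u (q ^+ 2) * cos (2 * pi * q * x)).
Proof.
apply: (intg_dom (C := 2 * nu u)); first by ctac.
move=> q; apply: norm_mul_trig; last exact: cos_max.
rewrite -mulrA normrM ger0_norm// -[leRHS]mulrA; apply: ler_wpM2l => //; exact: dom_qcR.
Qed.

Lemma d_Su u (x : R) : is_derive x 1 (Su u) (pi * Au u x).
Proof.
have -> : pi * Au u x = Int `[0, +oo[ (fun q => cR l u (q ^+ 2) * (2 * pi * q * cos (2 * pi * q * x))).
  by rewrite /Au -IntZ//; [apply: eq_Int => q _; rewrite -mulrA; move: (cR _ _ _) (cos _) => A B; ring|exact: intg_A].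
have key (z q : R) : is_derive z 1 (fun z => cR l u (q ^+ 2) * sin (2 * pi * q * z)) (cR l u (q ^+ 2) * (2 * pi * q * cos (2 * pi * q * z))) by dring.
apply: (@derive_param R `[0, +oo[ (fun x q => cR l u (q ^+ 2) * sin (2 * pi * q * x))
  (fun x q => cR l u (q ^+ 2) * (2 * pi * q * cos (2 * pi * q * x)))
  (fun q => 2 * pi * nu u * (2 * K2 * expR (- (a / 2 * q ^+ 2)))) (x - 1) (x + 1) x) => //.
- by apply/andP; split; lra.
- by move=> z _; exact: intg_S.
- exact: intgZ intg_qg.
- have key2 (z q : R) : `|cR l u (q ^+ 2) * (2 * pi * q * cos (2 * pi * q * z))| <= 2 * pi * nu u * (2 * K2 * expR (- (a / 2 * q ^+ 2))).
    rewrite mulrA; apply: norm_mul_trig; last exact: cos_max.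
    rewrite (_ : cR l u (q ^+ 2) * (2 * pi * q) = 2 * pi * (q * cR l u (q ^+ 2))); last by ring.
    rewrite normrM ger0_norm; last by rewrite mulr_ge0 ?pi_ge0.
    rewrite -mulrA; apply: ler_wpM2l; first by rewrite mulr_ge0 ?pi_ge0.
    apply: le_trans (dom_qcR _ _) _; apply: ler_wpM2l; [exact: nu_ge0|exact: qgauss].
  by move=> z q _ _; exact: key2.
Qed.

Lemma Int_half_lim (f : R -> R) : intg `[0, +oo[ f -> Int `[0, n%:R] f @[n --> \oo] --> Int `[0, +oo[ f.
Proof.
move=> hf; apply: Int_exhaust => //.
- by move=> n x /=; rewrite !in_itv /= andbT => /andP[].
- move=> x /=; rewrite in_itv /= andbT => x0; near=> n; rewrite /= in_itv /= x0 /=.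
  by near: n; exact: nbhs_infty_ger.
Unshelve. all: by end_near. Qed.

(** Integration by parts: the primitive - [cR l u (q ^+ 2)] cos(2 pi q x) contributes its value at q
    = 0, and the boundary term at infinity vanishes. *)
Lemma A_parts u x : Au (l * u) x = complex.Re u - 2 * pi * x * Su u x.
Proof.
pose g q := 2 * q * cR l (l * u) (q ^+ 2) * cos (2 * pi * q * x) + 2 * pi * x * (cR l u (q ^+ 2) * sin (2 * pi * q * x)).
have cg : continuous g by rewrite /g; ctac.
have ig : intg `[0, +oo[ g by apply: intgD => //; [exact: intg_A|apply: intgZ => //; exact: intg_S].
have dG (q : R) : is_derive q 1 (fun q => - (cR l u (q ^+ 2) * cos (2 * pi * q * x))) (g q).
  eapply dE; [eapply dN; eapply dM; [eapply (dcomp (f := fun q => q ^+ 2) (g := cR l u)); [eapply dX; exact: did|exact: d_cR]|dtac]|].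
  by cbv beta; rewrite /g /= expr1; move: (cR _ _ _) (cR _ _ _) (sin _) (cos _) => A B C D; ring.
have E n : Int `[0, n%:R] g = complex.Re u - cR l u (n%:R ^+ 2) * cos (2 * pi * n%:R * x).
  rewrite (_ : _ - _ = - (cR l u (n%:R ^+ 2) * cos (2 * pi * n%:R * x)) - - (cR l u (0 ^+ 2) * cos (2 * pi * 0 * x))).
    exact: (Int_FTC (ler0n R n) cg dG).
  by rewrite expr0n cR0 mulr0 mul0r cos0 mulr1 opprK addrC.
have lim0 : cR l u (n%:R ^+ 2) * cos (2 * pi * n%:R * x) @[n --> \oo] --> (0 : R).
  apply/norm_cvg0P.
  apply: (squeeze_cvgr (f := fun _ => 0) (h := fun n : nat => nu u / a * n%:R^-1)).
  - near=> n; rewrite normr_ge0 /=; apply: norm_mul_trig; last exact: cos_max.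
    have n0 : 0 < n%:R :> R by rewrite ltr0n; near: n; exact: nbhs_infty_gt.
    apply: le_trans (cR_le _ _ _) _; rewrite -mulrA; apply: ler_wpM2l; first exact: nu_ge0.
    rewrite -invfM expRN lef_pV2 ?posrE ?expR_gt0 ?mulr_gt0//.
    apply: le_trans (_ : a * n%:R ^+ 2 <= _); last by apply: le_trans (expR_ge1Dx _); rewrite lerDr.
    apply: ler_wpM2l; first exact: ltW.
    by rewrite expr2 ler_peMr ?(ltW n0)// ler1n -(ltr0n R).
  - exact: cvg_cst.
  - rewrite -(mulr0 (nu u / a)); apply: cvgM; first exact: cvg_cst.
    exact: cvg_nat_inv.
have c1 := Int_half_lim ig.
have c2 : Int `[0, n%:R] g @[n --> \oo] --> complex.Re u - 0.
  under eq_cvg do rewrite E.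
  by apply: cvgB; [exact: cvg_cst|exact: lim0].
have -> : Au (l * u) x = Int `[0, +oo[ g - 2 * pi * x * Su u x.
  rewrite /g IntD//; [|exact: intg_A|apply: intgZ => //; exact: intg_S].
  by rewrite IntZ ?addrK//; exact: intg_S.
congr (_ - _); rewrite -[RHS]subr0 -(cvg_lim _ c2)//; symmetry; exact/cvg_lim.
Unshelve. all: by end_near. Qed.

Lemma Su_lin (r : R) u v x : Su (r%:C * u + v) x = r * Su u x + Su v x.
Proof.
rewrite /Su -IntZ//; last exact: intg_S.
rewrite -IntD//; [|by apply: intgZ => //; exact: intg_S|exact: intg_S].
by apply: eq_Int => q _; rewrite cRD cRZ; move: (cR _ _ _) (cR _ _ _) (sin _) => A B C; ring.
Qed.

(** The difference of the sine transform and Dawson's function; the relation l s = pi^2 lets it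
    satisfy a homogeneous equation. *)
Definition Dif u (x : R) : R := pi^-1 * Su (l * u) x - Fd s u x.

Lemma Dif_lin (r : R) u v x : Dif (r%:C * u + v) x = r * Dif u x + Dif v x.
Proof.
rewrite /Dif (_ : l * (r%:C * u + v) = r%:C * (l * u) + l * v); last by rewrite mulrDr mulrCA.
by rewrite Su_lin /Fd eq_Mk_lin//; ring.
Qed.

Lemma d_Dif u (x : R) : is_derive x 1 (Dif u) (- 2 * x * Dif (s * u) x).
Proof.
have pn : pi != 0 :> R by rewrite gt_eqF// pi_gt0.
eapply dE; [eapply dD; [eapply dM; [exact: dcst|exact: d_Su]|eapply dN; exact: d_Fd]|].
cbv beta; rewrite mul0r add0r mulKf// A_parts /Delta /Dif /Fd.
have -> : l * (s * u) = (pi ^+ 2)%:C * u + 0 by rewrite mulrA ls addr0.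
have Su0 : Su 0 x = 0.
  rewrite /Su (eq_Int (g := fun=> 0)) /Int ?Rintegral_cst ?mul0r// => q _.
  by rewrite /cR /= !mul0r addr0 mulr0 mul0r.
rewrite Su_lin Su0; move: pn (Su u x) (Mk _ _ _ _); move: (pi : R) => p pn A B.
by field.
Qed.

(** The squared modulus Q of the difference satisfies Q' = - 4 Re(s) x Q with Q(0) = 0. Since Q >=
    0, integrating gives Q <= 0. The values at u = 1 and u = i determine all others by real
    linearity. *)
Lemma Dif_eq0 u (x : R) : 0 <= x -> Dif u x = 0.
Proof.
move=> x0; pose Q (x : R) := Dif 1 x ^+ 2 + Dif 'i%C x ^+ 2.
pose s1 := complex.Re s; pose s2 := complex.Im s.
have es1 y : Dif (s * 1) y = s1 * Dif 1 y + s2 * Dif 'i%C y.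
  rewrite (_ : s * 1 = s1%:C * 1 + (s2%:C * 'i%C + 0)).
    by rewrite !Dif_lin; have := Dif_lin 1 0 0 y; rewrite mulr0 addr0 mul1r => h; lra.
  by rewrite mulr1 addr0 mulr1 /s1 /s2 [LHS]complexE mulrC.
have es2 y : Dif (s * 'i%C) y = s1 * Dif 'i%C y - s2 * Dif 1 y.
  rewrite (_ : s * 'i%C = s1%:C * 'i%C + ((- s2)%:C * 1 + 0)).
    by rewrite !Dif_lin; have := Dif_lin 1 0 0 y; rewrite mulr0 addr0 mul1r => h; lra.
  by apply/eqP; rewrite eq_complex; apply/andP; split; apply/eqP; rewrite !(raddfD, cReM, cImM) /= /s1 /s2; ring.
have dQ (y : R) : is_derive y 1 Q (- 4 * s1 * y * Q y).
  eapply dE; [eapply dD; [eapply dX; exact: d_Dif|eapply dX; exact: d_Dif]|].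
  by cbv beta; rewrite es1 es2 /Q /=; ring.
have cQ : continuous (fun y : R => - 4 * s1 * y * Q y) by have ? := derive_continuous dQ; ctac.
have Q0 : Q 0 = 0.
  have D0 v : Dif v 0 = 0.
    rewrite /Dif /Fd mul0r subr0 /Su (eq_Int (g := fun=> 0)) /Int ?Rintegral_cst ?mul0r ?mulr0// => q _.
    by rewrite mulr0 sin0 mulr0.
  by rewrite /Q !D0 expr0n addr0.
have := Int_FTC x0 cQ dQ; rewrite Q0 subr0 => EQ.
have Qle : Q x <= 0.
  rewrite -EQ -oppr_ge0 -IntN//; last exact: intg_itv.
  apply: Int_ge0 => y /=; rewrite in_itv /= => /andP[y0 _].
  rewrite -mulNr -!mulNr opprK; apply: mulr_ge0; last by rewrite addr_ge0 ?sqr_ge0.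
  by rewrite mulr_ge0// mulr_ge0// ltW.
have [d1 d2] : Dif 1 x = 0 /\ Dif 'i%C x = 0.
  move: Qle; rewrite /Q; have := sqr_ge0 (Dif 1 x); have := sqr_ge0 (Dif 'i%C x) => h1 h2 h3.
  have e1 : Dif 1 x ^+ 2 = 0 by lra.
  have e2 : Dif 'i%C x ^+ 2 = 0 by lra.
  by split; apply/eqP; rewrite -sqrf_eq0 ?e1 ?e2 eqxx.
rewrite (_ : u = (complex.Re u)%:C * 1 + ((complex.Im u)%:C * 'i%C + 0)).
  by rewrite !Dif_lin d1 d2; have := Dif_lin 1 0 0 x; rewrite mulr0 addr0 mul1r => h; lra.
by rewrite mulr1 addr0 [LHS]complexE mulrC.
Qed.

Lemma Int_even_half (f : R -> R) : continuous f -> (forall q, f (- q) = f q) -> intg setT f ->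
  Int setT f = 2 * Int `[0, +oo[ f.
Proof.
move=> cf ef hf; have h2 : intg `[0, +oo[ f by apply: intgS hf.
have c1 := IntT_lim hf.
have c2 : Int `[- n%:R, n%:R] f @[n --> \oo] --> 2 * Int `[0, +oo[ f.
  have := Int_half_lim h2 => /(cvgM (cvg_cst (2 : R))); apply: cvg_trans; apply: near_eq_cvg; apply: nearW => n /=.
  rewrite (@Int_cat _ f (- n%:R) 0 n%:R) ?oppr_le0//; last exact: intg_itv.
  have := @Int_opp_itv _ f 0 n%:R (ler0n _ _) cf; rewrite oppr0 => <-.
  by rewrite mulr2n mulrDl !mul1r; congr (_ + _); apply: eq_Int => q _; rewrite ef.
by rewrite -(cvg_lim _ c1)// -(cvg_lim _ c2).
Qed.

Lemma Ehat_Eu u x : intg setT (Eu (l * u)) -> Ehat (Eu (l * u)) x = Delta s u (x ^+ 2).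
Proof.
move=> iE.
wlog x0 : x / 0 <= x.
  move=> H; have [x0|x0] := leP 0 x; first exact: H.
  rewrite -(sqrrN x) -H; last by rewrite oppr_ge0 ltW.
  by apply: eq_Int => q _; rewrite mulrN cosN.
have cf : continuous (fun q => Eu (l * u) q * cos (2 * pi * q * x)) by have ? := @cc_Eu (l * u); ctac.
rewrite /Ehat Int_even_half//; last first.
- apply: (intg_le _ _ (intg_norm _ iE)) => //; first exact: cont_meas.
  by move=> q _; rewrite normrM -[leRHS]mulr1 ler_wpM2l// cos_max.
- by move=> q; rewrite EuN mulrN mulNr cosN.
transitivity (Au (l * u) x).
  rewrite /Au -IntZ//; last first.
    have h := intg_A (l * u) x; apply: (intg_le _ _ (intg_norm _ h)) => //; first exact: cont_meas.
    move=> q _; rewrite /Eu; move: (cR _ _ _) (cos _) => A B.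
    rewrite !normrM normr_id (ger0_norm (x := 2))//.
    by have := mulr_ge0 (mulr_ge0 (normr_ge0 q) (normr_ge0 A)) (normr_ge0 B); lra.
  apply: eq_Int => q /=; rewrite in_itv /= andbT => q0; rewrite /Eu ger0_norm//.
  by move: (cR _ _ _) (cos _) => A B; ring.
have pn : pi != 0 :> R by rewrite gt_eqF// pi_gt0.
rewrite A_parts /Delta; congr (_ - _).
have := Dif_eq0 (s * u) x0; rewrite /Dif /Fd => /eqP; rewrite subr_eq0 => /eqP h.
rewrite expr2 -!mulrA -h.
have -> : l * (s * u) = (pi ^+ 2)%:C * u + 0 by rewrite mulrA ls addr0.
have Su0 : Su 0 x = 0.
  rewrite /Su (eq_Int (g := fun=> 0)) /Int ?Rintegral_cst ?mul0r// => q _.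
  by rewrite /cR /= !mul0r addr0 mulr0 mul0r.
rewrite Su_lin Su0; move: pn (Su u x); move: (pi : R) => p pn A.
by field.
Qed.

End fourier.

(** * Functions dominated in size and variation *)

Section domination.
Context {R : realType}.
Implicit Types (f g K w : R -> R).

(** Equivalently, K + f and K - f are nonnegative and nonincreasing on the positive half-line. This
    form is stable under products with decreasing weights and under integration in a parameter. *)
Definition dom f K := (forall n, 0 < n -> `|f n| <= K n) /\
  (forall n n', 0 < n -> n <= n' -> `|f n - f n'| <= K n - K n').

Lemma dom_prod f K w : dom f K -> (forall n, 0 < n -> 0 <= w n) ->
  (forall n n', 0 < n -> n <= n' -> w n' <= w n) ->
  dom (fun n => f n * w n) (fun n => K n * w n).
Proof.
move=> [f1 f2] w0 wd; split=> [n n0|n n' n0 nn'].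
  by rewrite normrM (ger0_norm (w0 n n0)); apply: ler_wpM2r; [exact: w0|exact: f1].
have n'0 := lt_le_trans n0 nn'.
have -> : f n * w n - f n' * w n' = (f n - f n') * w n + f n' * (w n - w n') by ring.
apply: le_trans (ler_normD _ _) _; rewrite !normrM (ger0_norm (w0 n n0)).
have h3 : 0 <= w n - w n' by rewrite subr_ge0 wd.
rewrite (ger0_norm h3).
have -> : K n * w n - K n' * w n' = (K n - K n') * w n + K n' * (w n - w n') by ring.
by apply: lerD; apply: ler_wpM2r => //; [exact: w0|exact: f2|exact: f1].
Qed.

Lemma dom_scale f K r : dom f K -> dom (fun n => r * f n) (fun n => `|r| * K n).
Proof.
move=> [f1 f2]; split=> [n n0|n n' n0 nn']; first by rewrite normrM; apply: ler_wpM2l => //; exact: f1.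
by rewrite -!mulrBr normrM; apply: ler_wpM2l => //; exact: f2.
Qed.

Lemma dom_trunc f K (T : R) : dom f K ->
  dom (fun n => f n * (n <= T)%R%:R) (fun n => K n * (n <= T)%R%:R).
Proof.
move=> h; apply: dom_prod => // n n' n0 nn'; rewrite ler_nat.
by have [h1|//] := leP n' T; rewrite (le_trans nn' h1).
Qed.

Lemma dom_Int (f K : R -> R -> R) :
  (forall t, dom (fun n => f n t) (fun n => K n t)) ->
  (forall n, 0 < n -> continuous (f n)) -> (forall n, 0 < n -> intg setT (K n)) ->
  dom (fun n => Int setT (f n)) (fun n => Int setT (K n)).
Proof.
move=> d cf iK.
have iF n : 0 < n -> intg setT (f n).
  move=> n0; apply: (intg_le _ _ (iK n n0)) => //; first exact: cont_meas (cf n n0).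
  by move=> t _; exact: (d t).1.
split=> [n n0|n n' n0 nn'].
  by apply: norm_Int_le2 => //; [exact: cont_meas (cf n n0)|exact: iK|move=> t _; exact: (d t).1].
have n'0 := lt_le_trans n0 nn'.
rewrite -!IntB//; [|exact: iK|exact: iK|exact: iF|exact: iF].
apply: norm_Int_le2 => //.
- by apply: cont_meas => //; apply: cc_D; [exact: cf|apply: cc_N; exact: cf].
- by apply: intgB => //; exact: iK.
- by move=> t _; exact: (d t).2.
Qed.

(** Kernels dominated on each half-line by a majorant of size C/|n|. The same C for all members of a
    family is what makes the row estimates uniform. *)
Definition cls (C : R) (k : R -> R) := exists K1 K2, [/\ dom k K1, dom (fun n => k (- n)) K2,
  forall n, 0 < n -> K1 n <= C / n & forall n, 0 < n -> K2 n <= C / n].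

Lemma cls_le C k n : cls C k -> n != 0 -> `|k n| <= C / `|n|.
Proof.
move=> [K1 [K2 [[d1 _] [d2 _] b1 b2]]]; move=> nz; have [n0|n0|/eqP n0] := ltgtP n 0; last by rewrite (negPf nz) in n0.
  have h : 0 < - n by rewrite oppr_gt0.
  by have := le_trans (d2 _ h) (b2 _ h); rewrite opprK (ltr0_norm n0).
by rewrite (gtr0_norm n0); exact: le_trans (d1 _ n0) (b1 _ n0).
Qed.

(** A cut-off is a decreasing weight with values 0 and 1, so truncation costs nothing in the
    constant. *)
Lemma cls_trunc C k T : 0 <= C -> cls C k -> cls C (fun n => k n * (`|n| <= T)%R%:R).
Proof.
move=> C0 [K1 [K2 [d1 d2 b1 b2]]].
have Cn n : 0 < n -> 0 <= C / n by move=> n0; rewrite divr_ge0// ltW.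
have trb K n : K n <= C / n -> 0 < n -> K n * (n <= T)%R%:R <= C / n.
  by move=> h n0; case: (n <= T); rewrite ?mulr1 ?mulr0// Cn.
exists (fun n => K1 n * (n <= T)%R%:R), (fun n => K2 n * (n <= T)%R%:R); split.
- have [h1 h2] := dom_trunc T d1; split=> [n n0|n n' n0 nn']; first by rewrite (gtr0_norm n0); exact: h1.
  by rewrite (gtr0_norm n0) (gtr0_norm (lt_le_trans n0 nn')); exact: h2.
- have [h1 h2] := dom_trunc T d2; split=> [n n0|n n' n0 nn']; first by rewrite normrN (gtr0_norm n0); exact: h1.
  by rewrite !normrN (gtr0_norm n0) (gtr0_norm (lt_le_trans n0 nn')); exact: h2.
- by move=> n n0; apply: trb => //; exact: b1.
- by move=> n n0; apply: trb => //; exact: b2.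
Qed.

End domination.

(** * Summation by parts against bounded partial sums *)

Section abel.
Context {R : realType}.

Lemma periodic_sum_bound (g : nat -> R) (N : nat) (M : R) : (0 < N)%N ->
  (forall i, g (i + N)%N = g i) -> \sum_(i < N) g i = 0 -> (forall i, `|g i| <= M) ->
  forall m, `|\sum_(i < m) g i| <= N%:R * M.
Proof.
move=> N0 gp g0 gM; have M0 : 0 <= M := le_trans (normr_ge0 _) (gM 0%N).
elim/ltn_ind => m ih; have [Nm|mN] := leqP N m.
  have E : \sum_(i < m) g i = \sum_(i < m - N) g i.
    rewrite -[in LHS](subnKC Nm) -!(big_mkord xpredT g) (big_cat_nat _ (n := N))//=; last exact: leq_addr.
    rewrite big_mkord g0 add0r -{1}[N]add0n big_addn !addKn.
    by apply: eq_bigr => i _; exact: gp.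
  by rewrite E; apply: ih; rewrite ltn_subrL N0 (leq_trans N0 Nm).
apply: le_trans (ler_norm_sum _ _ _) _.
apply: le_trans (_ : \sum_(i < m) M <= _); first by apply: ler_sum.
rewrite big_const_ord iter_addr_0 -[M *+ m]mulr_natl; apply: ler_wpM2r => //.
by rewrite ler_nat ltnW.
Qed.

(** The majorant A replaces the total variation: its decrements bound those of a, and the final
    boundary term is bounded by what is left of A. *)
Lemma abel_bound (g a A : nat -> R) (B : R) :
  (forall m, `|\sum_(i < m) g i| <= B) -> (forall i, `|a i| <= A i) ->
  (forall i, `|a i - a i.+1| <= A i - A i.+1) -> forall m, `|\sum_(i < m) g i * a i| <= B * A 0%N.
Proof.
move=> gB aA dA m.
have B0 : 0 <= B := le_trans (normr_ge0 _) (gB 0%N).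
have key : `|\sum_(i < m) g i * a i - (\sum_(i < m) g i) * a m| <= B * (A 0%N - A m).
  elim: m => [|m ih]; first by rewrite !big_ord0 mul0r subrr normr0 subrr mulr0.
  have -> : \sum_(i < m.+1) g i * a i - (\sum_(i < m.+1) g i) * a m.+1 =
    (\sum_(i < m) g i * a i - (\sum_(i < m) g i) * a m) + (\sum_(i < m.+1) g i) * (a m - a m.+1).
    by rewrite !big_ord_recr /=; ring.
  apply: le_trans (ler_normD _ _) _.
  have -> : B * (A 0%N - A m.+1) = B * (A 0%N - A m) + B * (A m - A m.+1) by ring.
  apply: lerD => //; rewrite normrM; apply: ler_pM => //.
have -> : \sum_(i < m) g i * a i = (\sum_(i < m) g i * a i - (\sum_(i < m) g i) * a m) + (\sum_(i < m) g i) * a m by ring.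
apply: le_trans (ler_normD _ _) _.
have -> : B * A 0%N = B * (A 0%N - A m) + B * A m by ring.
by apply: lerD => //; rewrite normrM; apply: ler_pM.
Qed.

End abel.

(** * Conditional convergence by rows *)

Section rows.
Context {R : realType}.
Local Notation nx x := (nn (x.1%:~R : R) x.2%:~R).
Variables (N : nat) (M : R) (G : int * int -> R).
Hypotheses (N0 : (0 < N)%N) (GM : forall x, `|G x| <= M) (G0 : G (0, 0) = 0).
Hypothesis Gp : forall X Y, G (X + N%:Z, Y) = G (X, Y).
Hypothesis Gm : forall X Y, \sum_(i < N) G (X + i%:Z, Y) = 0.
Let M0 : 0 <= M. Proof. exact: le_trans (normr_ge0 _) (GM (0, 0)). Qed.

Lemma row_partial (e p Y : int) : (e == 1) || (e == -1) -> forall m, `|\sum_(i < m) G (p + e * i%:Z, Y)| <= N%:R * M.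
Proof.
move=> e1; apply: (periodic_sum_bound (g := fun i => G (p + e * i%:Z, Y))) => //.
- move=> i; case/orP: e1 => /eqP ->.
    by rewrite !mul1r PoszD addrA Gp.
  by rewrite !mulN1r PoszD opprD addrA -[in RHS](subrK N%:Z (p - i%:Z)) Gp.
- case/orP: e1 => /eqP ->; first by under eq_bigr do rewrite mul1r; exact: Gm.
  rewrite (reindex_inj rev_ord_inj) /=; transitivity (\sum_(i < N) G (p - (N.-1)%:Z + i%:Z, Y)); last exact: Gm.
  apply: eq_bigr => i _; congr (G (_, _)); rewrite mulN1r.
  by have := ltn_ord i; lia.
Qed.

(** Along a row the weight is 1 for |X| < 2|Y|, 0 between 2|Y| and 3|Y|, and 1 beyond; being locally
    constant, it does not disturb the cancellation. The two walls are treated as single terms. *)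
Lemma om_one (x : int * int) : x.1 ^+ 2 < 4 * x.2 ^+ 2 -> om x = 1 :> R.
Proof.
move=> h; rewrite omE ifF; last by apply/negbTE; rewrite -leNgt /qf; have := sqr_ge0 x.2; lia.
have h' : ((x.1%:~R : R) + 2 * x.2%:~R) * (x.1%:~R - 2 * x.2%:~R) < 0.
  have -> : ((x.1%:~R : R) + 2 * x.2%:~R) * (x.1%:~R - 2 * x.2%:~R) = (x.1 ^+ 2 - 4 * x.2 ^+ 2)%:~R by rewrite !(rmorphB, rmorphM, rmorphXn) /=; ring.
  by rewrite ltrz0; lia.
by rewrite -sgrM (ltr0_sg h'); lra.
Qed.

Lemma om_zero (x : int * int) : 4 * x.2 ^+ 2 < x.1 ^+ 2 -> x.1 ^+ 2 < 9 * x.2 ^+ 2 -> om x = 0 :> R.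
Proof.
move=> h1 h2; rewrite omE; case: ifP => _.
  have h' : ((x.1%:~R : R) + 3 * x.2%:~R) * (x.1%:~R - 3 * x.2%:~R) < 0.
    have -> : ((x.1%:~R : R) + 3 * x.2%:~R) * (x.1%:~R - 3 * x.2%:~R) = (x.1 ^+ 2 - 9 * x.2 ^+ 2)%:~R by rewrite !(rmorphB, rmorphM, rmorphXn) /=; ring.
    by rewrite ltrz0; lia.
  by rewrite -sgrM (ltr0_sg h'); lra.
have h' : 0 < ((x.1%:~R : R) + 2 * x.2%:~R) * (x.1%:~R - 2 * x.2%:~R).
  have -> : ((x.1%:~R : R) + 2 * x.2%:~R) * (x.1%:~R - 2 * x.2%:~R) = (x.1 ^+ 2 - 4 * x.2 ^+ 2)%:~R by rewrite !(rmorphB, rmorphM, rmorphXn) /=; ring.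
  by rewrite ltr0z; lia.
by rewrite -sgrM (gtr0_sg h'); lra.
Qed.

Lemma om_one' (x : int * int) : 9 * x.2 ^+ 2 < x.1 ^+ 2 -> om x = 1 :> R.
Proof.
move=> h; rewrite omE ifT; last by rewrite /qf; have := sqr_ge0 x.2; lia.
have h' : 0 < ((x.1%:~R : R) + 3 * x.2%:~R) * (x.1%:~R - 3 * x.2%:~R).
  have -> : ((x.1%:~R : R) + 3 * x.2%:~R) * (x.1%:~R - 3 * x.2%:~R) = (x.1 ^+ 2 - 9 * x.2 ^+ 2)%:~R by rewrite !(rmorphB, rmorphM, rmorphXn) /=; ring.
  by rewrite ltr0z; lia.
by rewrite -sgrM (gtr0_sg h'); lra.
Qed.

Variables (C : R).
Hypothesis C0 : 0 <= C.
Definition rterm (k : R -> R) (x : int * int) : R := om x * G x * k (nx x).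

Lemma nn_low (Y X : int) (D : R) : (1 + (Y%:~R : R) ^+ 2) <= 48 * D -> 0 < D -> C / D <= 48 * C / (1 + Y%:~R ^+ 2).
Proof.
move=> h D0; have y1 : 0 < 1 + (Y%:~R : R) ^+ 2 by have := sqr_ge0 (Y%:~R : R); lra.
rewrite ler_pdivlMr// mulrAC ler_pdivrMr// [48 * C]mulrC -mulrA; exact: ler_wpM2l.
Qed.

(* half row e X = 1, 2, ..., m at height Y, cut at |X| = 2|Y| and |X| = 3|Y| *)
Lemma half_row (k : R -> R) (e Y : int) (m : nat) : cls C k -> (e == 1) || (e == -1) ->
  `|\sum_(1 <= i < m) rterm k (e * i%:Z, Y)| <= (2 * N%:R + 2) * M * (48 * C) / (1 + Y%:~R ^+ 2).
Proof.
move=> [K1 [K2 [d1 d2 b1 b2]]] e1; have e2 : e ^+ 2 = 1 by case/orP: e1 => /eqP ->.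
pose y := absz Y; have yY : Y ^+ 2 = (y%:Z) ^+ 2 by rewrite /y; have := abszE Y => ->; rewrite real_normK ?num_real.
have yR : (Y%:~R : R) ^+ 2 = y%:R ^+ 2.
  by rewrite -rmorphXn /= yY rmorphXn /= -pmulrn.
set Bd := 48 * C / (1 + Y%:~R ^+ 2).
have y1 : 0 < 1 + (Y%:~R : R) ^+ 2 by have := sqr_ge0 (Y%:~R : R); lra.
have Bd0 : 0 <= Bd by rewrite /Bd divr_ge0 ?(ltW y1)// mulr_ge0.
have nE (i : nat) : nx (e * i%:Z, Y) = (i%:R ^+ 2 - 6 * y%:R ^+ 2) / 48.
  rewrite /nn /= yR rmorphM exprMn -rmorphXn /= e2 mul1r -pmulrn.
  by [].
have kp (i : nat) : (3 * y <= i)%N -> (0 < i)%N -> 0 < nx (e * i%:Z, Y) /\ C / nx (e * i%:Z, Y) <= Bd.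
  move=> h i0; rewrite nE; have h' : (3 * y%:R : R) <= i%:R by rewrite -natrM ler_nat.
  have i1 : 1 <= i%:R :> R by rewrite ler1n.
  have y0 : 0 <= y%:R :> R by [].
  have q : 1 + (y%:R : R) ^+ 2 <= i%:R ^+ 2 - 6 * y%:R ^+ 2.
    have [yz|yn] := eqVneq y 0%N; first by rewrite yz expr0n /= mulr0 subr0 addr0 exprn_ege1.
    have yp : 1 <= y%:R :> R by rewrite ler1n lt0n.
    by nra.
  have y2 := sqr_ge0 (y%:R : R).
  by split; [lra|apply: (@nn_low Y 0); rewrite ?yR; lra].
have kn (i : nat) : (i <= 2 * y)%N -> (0 < y)%N -> 0 < - nx (e * i%:Z, Y) /\ C / - nx (e * i%:Z, Y) <= Bd.
  move=> h y0; rewrite nE; have h' : (i%:R : R) <= 2 * y%:R by rewrite -natrM ler_nat.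
  have yp : 1 <= y%:R :> R by rewrite ler1n.
  have i0 : 0 <= i%:R :> R by [].
  have q : 1 + (y%:R : R) ^+ 2 <= 6 * y%:R ^+ 2 - i%:R ^+ 2 by nra.
  have y2 := sqr_ge0 (y%:R : R).
  by split; [lra|apply: (@nn_low Y 0); rewrite ?yR; lra].
have kle (i : nat) : (0 < i)%N -> (i <= 2 * y)%N || (3 * y <= i)%N -> `|k (nx (e * i%:Z, Y))| <= Bd.
  move=> i0 /orP[h|h].
    have y0 : (0 < y)%N by lia.
    have [h1 h2] := kn i h y0; apply: le_trans h2; have := le_trans (d2.1 _ h1) (b2 _ h1).
    by rewrite opprK.
  by have [h1 h2] := kp i h i0; apply: le_trans h2; exact: le_trans (d1.1 _ h1) (b1 _ h1).
have single (i : nat) : (0 < i)%N -> `|rterm k (e * i%:Z, Y)| <= M * Bd.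
  move=> i0; rewrite /rterm.
  have [z0|z0] := eqVneq (om (e * i%:Z, Y)) (0 : R); first by rewrite z0 !mul0r normr0 mulr_ge0.
  have hi : (i <= 2 * y)%N || (3 * y <= i)%N.
    rewrite -[_ || _]negbK; apply/negP; rewrite negb_or -!ltnNge => /andP[h1 h2].
    by case/eqP: z0; apply: om_zero; rewrite /= exprMn e2 mul1r yY; nia.
  rewrite [leLHS]normrM [X in X * _]normrM (ger0_norm (om_ge0 _)).
  apply: ler_pM => //; [by rewrite mulr_ge0// om_ge0| |exact: kle].
  by rewrite -[leRHS]mul1r; apply: ler_pM => //; [exact: om_ge0|exact: om_le1].
have NM0 : 0 <= N%:R * M by rewrite mulr_ge0.
have far (m' : nat) : `|\sum_(3 * y + 1 <= i < m') rterm k (e * i%:Z, Y)| <= N%:R * M * Bd.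
  rewrite -[X in index_iota X m']add0n big_addn big_mkord.
  pose g i := G ((e * (3 * y + 1)%N%:Z) + e * i%:Z, Y).
  pose a (i : nat) := k (nx (e * (3 * y + 1 + i)%N%:Z, Y)); pose A (i : nat) := K1 (nx (e * (3 * y + 1 + i)%N%:Z, Y)).
  have pos i : 0 < nx (e * (3 * y + 1 + i)%N%:Z, Y) by apply: (kp _ _ _).1; lia.
  have E (i : nat) : rterm k (e * (i + (3 * y + 1))%N%:Z, Y) = g i * a i.
    rewrite /rterm /g /a [(i + _)%N]addnC om_one'.
      by rewrite mul1r PoszD mulrDr.
    by rewrite /= exprMn e2 mul1r yY; nia.
  under eq_bigr do rewrite E.
  apply: le_trans (abel_bound (B := N%:R * M) (A := A) _ _ _ _) _.
  - exact: row_partial.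
  - by move=> i; exact: d1.1.
  - move=> i; apply: d1.2 => //; rewrite !nE; rewrite ler_pM2r ?invr_gt0// lerD2r ler_pXn2r ?nnegrE// ler_nat.
    by lia.
  apply: ler_wpM2l => //; rewrite /A addn0; have [h1 h2] := @kp (3 * y + 1)%N ltac:(lia) ltac:(lia).
  by apply: le_trans h2; exact: b1.
(* the near range i < 2y, read backwards so that |n| increases *)
have near (m' : nat) : (m' <= 2 * y)%N -> `|\sum_(1 <= i < m') rterm k (e * i%:Z, Y)| <= N%:R * M * Bd.
  move=> m'y; have [m1|m1] := leqP m' 1; first by rewrite big_geq// normr0 mulr_ge0.
  have y0 : (0 < y)%N by lia.
  rewrite big_nat_rev /= -{1}[1%N]add0n big_addn big_mkord.
  pose g i := G ((e * (m' - 1)%N%:Z) + (- e) * i%:Z, Y).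
  pose a (i : nat) := k (nx (e * (m' - 1 - i)%N%:Z, Y)); pose A (i : nat) := K2 (- nx (e * (m' - 1 - i)%N%:Z, Y)).
  have pos i : 0 < - nx (e * (m' - 1 - i)%N%:Z, Y) by apply: (kn _ _ _).1; lia.
  have E (i : 'I_(m' - 1)) : rterm k (e * (1 + m' - (i + 1).+1)%N%:Z, Y) = g i * a i.
    have hi := ltn_ord i; rewrite /rterm /g /a (_ : (1 + m' - (i + 1).+1)%N = (m' - 1 - i)%N); last by lia.
    rewrite om_one; first by rewrite mul1r mulNr -mulrBr subzn//; lia.
    by rewrite /= exprMn e2 mul1r yY; nia.
  under eq_bigr do rewrite E.
  apply: le_trans (abel_bound (B := N%:R * M) (A := A) _ _ _ _) _.
  - by apply: row_partial; case/orP: e1 => /eqP ->; rewrite ?opprK.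
  - by move=> i; have := d2.1 _ (pos i); rewrite opprK.
  - move=> i; have := d2.2 _ _ (pos i) _; rewrite /= /a /A.
    move=> /(_ (- nx (e * (m' - 1 - i.+1)%N%:Z, Y))); rewrite !opprK; apply.
    rewrite lerN2 !nE ler_pM2r ?invr_gt0// lerD2r ler_pXn2r ?nnegrE// ler_nat.
    by lia.
  apply: ler_wpM2l => //; rewrite /A subn0; have [h1 h2] := @kn (m' - 1)%N ltac:(lia) y0.
  by apply: le_trans h2; exact: b2.
have tot : `|\sum_(1 <= i < m) rterm k (e * i%:Z, Y)| <= N%:R * M * Bd + M * Bd + M * Bd + N%:R * M * Bd.
  have MB : 0 <= M * Bd by rewrite mulr_ge0.
  have NB : 0 <= N%:R * M * Bd by rewrite mulr_ge0.
  have [h|h] := leqP m (2 * y); first by have := near m h; lra.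
  have mid (p : nat) : (p <= 3 * y)%N -> \sum_((2 * y).+1 <= i < p) rterm k (e * i%:Z, Y) = 0.
    move=> hp; rewrite big_nat big1// => i /andP[i1 i2]; rewrite /rterm om_zero ?mul0r//= exprMn e2 mul1r yY; nia.
  have s1 : `|\sum_(1 <= i < (2 * y).+1) rterm k (e * i%:Z, Y)| <= N%:R * M * Bd + M * Bd.
    have [y0|y0] := posnP y; first by rewrite y0 muln0 big_geq// normr0; lra.
    rewrite big_nat_recr /=; last by lia.
    apply: le_trans (ler_normD _ _) _; apply: lerD; first by apply: near.
    by apply: single; lia.
  have c1 : (1 <= (2 * y).+1)%N by [].
  rewrite (big_cat_nat _ (n := (2 * y).+1))//=.
  have [h3|h3] := leqP m (3 * y).
    by rewrite mid// addr0; lra.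
  have [y0|y0] := posnP y.
    have fm := far m; rewrite y0 muln0 add0n in fm; rewrite {1}y0 muln0 big_geq// add0r.
    by rewrite y0 muln0; lra.
  rewrite (big_cat_nat _ (m := (2 * y).+1) (n := 3 * y)) /=; [|lia|lia].
  rewrite mid// add0r (big_ltn h3).
  have fm := far m; rewrite addn1 in fm.
  have sg : `|rterm k (e * (3 * y)%N%:Z, Y)| <= M * Bd by apply: single; lia.
  apply: le_trans (ler_normD _ _) _; have := ler_normD (rterm k (e * (3 * y)%N%:Z, Y)) (\sum_((3 * y).+1 <= i < m) rterm k (e * i%:Z, Y)).
  by lra.
apply: le_trans tot _; rewrite [leRHS](_ : _ = (2 * N%:R + 2) * M * Bd); last by rewrite /Bd !mulrA.
rewrite le_eqVlt; apply/orP; left; apply/eqP; ring.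
Qed.

(** 320 is twice 160: |n| >= (X^2 + Y^2)/160 on the support of the weight, and X^2 + Y^2 >= 1 off
    the origin. *)
Lemma rterm_le k x : cls C k -> `|rterm k x| <= 320 * C * M * (1 + (x.1%:~R ^+ 2 + x.2%:~R ^+ 2))^-1.
Proof.
move=> kC; have a0 := sqr_ge0 (x.1%:~R : R); have b0 := sqr_ge0 (x.2%:~R : R).
have CM0 : 0 <= 320 * C * M * (1 + ((x.1%:~R : R) ^+ 2 + x.2%:~R ^+ 2))^-1.
  by apply: mulr_ge0; [exact: mulr_ge0 (mulr_ge0 (ler0n _ _) C0) M0|rewrite invr_ge0; lra].
have [->|x0] := eqVneq x (0, 0); first by rewrite /rterm G0 mulr0 mul0r normr0 /= expr0n addr0 addr0 invr1 mulr1; exact: mulr_ge0 (mulr_ge0 (ler0n _ _) C0) M0.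
rewrite /rterm; have [z0|z0] := eqVneq (om x) (0 : R); first by rewrite z0 !mul0r normr0.
have h1 := @om_cone R x z0; have h2 := @nn_ge R x x0.
have n1 : 0 < `|nx x| by apply: lt_le_trans h2; rewrite invr_gt0.
rewrite [leLHS]normrM [X in X * _]normrM (ger0_norm (om_ge0 _)).
apply: le_trans (_ : 1 * M * (C / `|nx x|) <= _).
  apply: ler_pM => //; [by rewrite mulr_ge0// om_ge0| |by apply: cls_le => //; rewrite -normr_gt0].
  by apply: ler_pM => //; [exact: om_ge0|exact: om_le1].
have -> : 320 * C * M * (1 + ((x.1%:~R : R) ^+ 2 + x.2%:~R ^+ 2))^-1 = M * (C * (320 * (1 + (x.1%:~R ^+ 2 + x.2%:~R ^+ 2))^-1)) by ring.
rewrite mul1r; apply: ler_wpM2l => //; apply: ler_wpM2l => //.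
rewrite -[320]invrK -invfM lef_pV2 ?posrE//; last by rewrite mulr_gt0// ?invr_gt0//; lra.
have : 1 <= (x.1%:~R : R) ^+ 2 + x.2%:~R ^+ 2.
  have z : (1 <= x.1 ^+ 2 + x.2 ^+ 2)%R.
    case: x x0 {h1 h2 n1 z0 a0 b0 CM0} => x1 x2 /=; rewrite -pair_eqE /pair_eq /= negb_and => h.
    have := sqr_ge0 x1; have := sqr_ge0 x2; case/orP: h => h; rewrite -sqrf_eq0 in h; lia.
  by rewrite -!rmorphXn /= -rmorphD /= ler1z.
by lra.
Qed.

Definition CR : R := 2 * ((2 * N%:R + 2) * M * (48 * C)) + 320 * C * M.

Lemma row_summable k Y : cls C k -> tsummable (fun X => rterm k (X, Y)).
Proof.
move=> kC; apply: (tsummable_le (g := fun X : int => 320 * C * M * (1 + (X%:~R : R) ^+ 2)^-1)); last first.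
  exact/tsummableZ/tsummable_inv_sqr.
move=> X; apply: le_trans (rterm_le (X, Y) kC) _; have a0 := sqr_ge0 (X%:~R : R); have b0 := sqr_ge0 (Y%:~R : R).
by apply: ler_wpM2l; [exact: mulr_ge0 (mulr_ge0 (ler0n _ _) C0) M0|rewrite lef_pV2 ?posrE /=; lra].
Qed.

Lemma row_bound k Y : cls C k -> `|tsum (fun X => rterm k (X, Y))| <= CR * (1 + Y%:~R ^+ 2)^-1.
Proof.
move=> kC; have b0 := sqr_ge0 (Y%:~R : R).
pose s (m : nat) : seq int := 0 :: [seq 1 * i%:Z | i <- index_iota 1 m] ++ [seq -1 * i%:Z | i <- index_iota 1 m].
have us m : uniq (s m).
  rewrite /s /= mem_cat negb_or cat_uniq !map_inj_uniq ?iota_uniq /=.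
  - rewrite andbT; apply/andP; split; last first.
      by apply/hasP => -[z /mapP[i hi ->] /mapP[i' hi' h]]; move: hi hi' h; rewrite !mem_index_iota; lia.
    by apply/andP; split; apply/mapP => -[i0 hi h]; move: hi h; rewrite mem_index_iota; lia.
  - by move=> i i' h; lia.
  - by move=> i i' h; lia.
have es X : \forall m \near \oo, X \in s m.
  near=> m; have h : (absz X < m)%N by near: m; exact: nbhs_infty_gt.
  rewrite /s in_cons mem_cat; have [-> //|X0] := eqVneq X 0; apply/orP; right; apply/orP.
  have [Xp|Xn] := ltP 0 X; [left|right]; apply/mapP; exists (absz X); rewrite ?mem_index_iota; lia.
have cv := tsum_approx (row_summable Y kC) us es.
apply: (ler_cvg_to (cvg_norm cv) (cvg_cst (CR * (1 + Y%:~R ^+ 2)^-1))); near=> m.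
rewrite /s big_cons big_cat /= !big_map.
have h1 := @half_row k 1 Y m kC isT; have h2 := @half_row k (-1) Y m kC isT.
have h0 := rterm_le (0, Y) kC; rewrite /= expr0n /= add0r in h0.
apply: le_trans (ler_normD _ _) _; have := ler_normD (\sum_(1 <= j < m) rterm k (1 * j%:Z, Y)) (\sum_(1 <= j < m) rterm k (-1 * j%:Z, Y)).
have -> : CR * (1 + Y%:~R ^+ 2)^-1 = 320 * C * M * (1 + Y%:~R ^+ 2)^-1 + 2 * ((2 * N%:R + 2) * M * (48 * C) / (1 + Y%:~R ^+ 2)).
  by rewrite /CR; ring.
by lra.
Unshelve. all: by end_near. Qed.

Lemma tsum_rows k : tsummable (rterm k) -> tsum (rterm k) = tsum (fun Y => tsum (fun X => rterm k (X, Y))).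
Proof.
move=> sk; have [_ ->] := tsum_pair sk; apply: (tsum_swap (f := fun X Y => rterm k (X, Y))).
by apply: eq_tsummable sk => -[].
Qed.

(** Tannery's theorem twice: within a row the terms are O(1/(1 + X^2)), and the row sums are O(1/(1
    + Y^2)) by cancellation. The double series itself need not converge absolutely for the limit
    kernel, so the limit is written as an iterated sum. *)
Lemma rows_cvg (kj : nat -> R -> R) (k : R -> R) : (forall j, cls C (kj j)) ->
  (forall n, n != 0 -> kj j n @[j --> \oo] --> k n) -> (forall j, tsummable (rterm (kj j))) ->
  tsum (rterm (kj j)) @[j --> \oo] --> tsum (fun Y => tsum (fun X => rterm k (X, Y))).
Proof.
move=> kC kc sk; under eq_cvg do rewrite tsum_rows//.
apply: (tannery (f_ := fun j Y => tsum (fun X => rterm (kj j) (X, Y))) (f := fun Y => tsum (fun X => rterm k (X, Y)))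
   (g := fun Y : int => CR * (1 + (Y%:~R : R) ^+ 2)^-1) _ _ _).2.
- exact/tsummableZ/tsummable_inv_sqr.
- by move=> j Y; exact: row_bound.
move=> Y; apply: (tannery (f_ := fun j X => rterm (kj j) (X, Y)) (f := fun X => rterm k (X, Y))
   (g := fun X : int => 320 * C * M * (1 + (X%:~R : R) ^+ 2)^-1) _ _ _).2.
- exact/tsummableZ/tsummable_inv_sqr.
- move=> j X; apply: le_trans (rterm_le (X, Y) (kC j)) _; have a0 := sqr_ge0 (X%:~R : R); have b0 := sqr_ge0 (Y%:~R : R).
  by apply: ler_wpM2l; [exact: mulr_ge0 (mulr_ge0 (ler0n _ _) C0) M0|rewrite lef_pV2 ?posrE /=; lra].
move=> X; have [[-> ->]|x0] := eqVneq (X, Y) (0, 0).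
  by rewrite /rterm G0 mulr0 mul0r; under eq_cvg do rewrite mul0r; exact: cvg_cst.
by apply: cvgM; [exact: cvg_cst|apply: kc; exact: nn_neq0 x0].
Qed.

Lemma trunc_summable k T : cls C k -> 0 <= T -> tsummable (rterm (fun n => k n * (`|n| <= T)%R%:R)).
Proof.
move=> kC T0; pose c1 := M * (48 * C * (1 + T) ^+ 2) * 160 ^+ 2.
have c0 : 0 <= M * (48 * C * (1 + T) ^+ 2).
  by apply: mulr_ge0 => //; apply: mulr_ge0; [apply: mulr_ge0|exact: sqr_ge0].
apply: (tsummable_le (g := fun x : int * int => c1 * ((1 + (x.1%:~R : R) ^+ 2)^-1 * (1 + x.2%:~R ^+ 2)^-1))); last first.
  exact/tsummableZ/tsummable_inv_sqr2.
move=> x; have g0 : 0 <= c1 * ((1 + (x.1%:~R : R) ^+ 2)^-1 * (1 + x.2%:~R ^+ 2)^-1).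
  have := sqr_ge0 (x.1%:~R : R); have := sqr_ge0 (x.2%:~R : R) => h1 h2.
  by rewrite /c1 mulr_ge0//; [rewrite mulr_ge0|rewrite mulr_ge0// invr_ge0; lra].
rewrite /rterm; have [->|x0] := eqVneq x (0, 0); first by rewrite G0 mulr0 mul0r normr0 /c1 /= expr0n /= addr0 invr1 !mulr1 mulr_ge0.
have [z0|z0] := eqVneq (om x) (0 : R); first by rewrite z0 !mul0r normr0.
have h2 := @nn_ge R x x0; have h3 := @cone_le R x z0.
have n1 : 0 < `|nx x| by apply: lt_le_trans h2; rewrite invr_gt0.
case: (leP `|nx x| T) => nT; last by rewrite mulr0 mulr0 normr0.
rewrite mulr1 [leLHS]normrM [X in X * _]normrM (ger0_norm (om_ge0 _)).
apply: le_trans (_ : 1 * M * (C / `|nx x|) <= _).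
  apply: ler_pM => //; [by rewrite mulr_ge0// om_ge0| |by apply: cls_le => //; rewrite -normr_gt0].
  by apply: ler_pM => //; [exact: om_ge0|exact: om_le1].
rewrite mul1r /c1 -[leRHS]mulrA; apply: le_trans (ler_wpM2l c0 h3).
rewrite -[leRHS]mulrA; apply: ler_wpM2l => //; rewrite -mulrA.
apply: le_trans (_ : 48 * C * 1 <= _).
  rewrite mulr1 mulrC; apply: ler_wpM2r => //.
  by rewrite -[leRHS]invrK lef_pV2 ?posrE// invr_gt0.
rewrite [leRHS](_ : _ = 48 * C * ((1 + T) ^+ 2 / (1 + `|nx x|) ^+ 2)); last by rewrite !mulrA.
apply: ler_wpM2l; first by rewrite mulr_ge0.
rewrite ler_pdivlMr ?mul1r; last by rewrite exprn_gt0//; lra.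
by rewrite ler_pXn2r ?nnegrE//; lra.
Qed.

(** The truncated kernels form a family of the same class tending pointwise to k, so the symmetric
    truncation has the iterated row sum as its limit. *)
Lemma rows_star k : cls C k ->
  tsum (rterm (fun n => k n * (`|n| <= T)%R%:R)) @[T --> +oo%R] --> tsum (fun Y => tsum (fun X => rterm k (X, Y))).
Proof.
move=> kC; apply/cvg_pinftyP => v vo.
have vo' : `|v j| @[j --> \oo] --> +oo.
  apply/cvgryPge => A; have /cvgryPge /(_ A) h := vo.
  by near do (apply: le_trans (ler_norm _)); exact: h.
suff h : tsum (rterm (fun n => k n * (`|n| <= `|v j|)%R%:R)) @[j --> \oo] --> tsum (fun Y => tsum (fun X => rterm k (X, Y))).
  apply: cvg_trans h; apply: near_eq_cvg; have /cvgryPge /(_ 0) := vo; apply: filterS => j /= v0.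
  by rewrite (ger0_norm v0).
apply: rows_cvg.
- by move=> j; exact: cls_trunc.
- move=> n _; apply: cvg_near_cst; have /cvgryPge /(_ `|n|) := vo'; apply: filterS => j /= ->.
  by rewrite mulr1.
- by move=> j; exact: trunc_summable.
Unshelve. all: by end_near. Qed.

End rows.

(** * Convergence with a rate and Cauchy majorants *)

Section rates.
Context {R : realType}.

Lemma cvg_rate (f : nat -> R) (l K : R) : (forall m, (0 < m)%N -> `|f m - l| <= K / m%:R) ->
  f m @[m --> \oo] --> l.
Proof.
move=> h.
have z : K / m%:R @[m --> \oo] --> (0 : R).
  by rewrite -[X in _ --> X](mulr0 K); apply: cvgM; [exact: cvg_cst|exact: cvg_nat_inv].
apply: (@squeeze_cvgr _ _ _ _ (fun m => l - K / m%:R) (fun m => l + K / m%:R)).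
- near=> m; have m0 : (0 < m)%N by near: m; exact: nbhs_infty_gt.
  by have := h m m0; rewrite ler_norml => /andP[h1 h2]; apply/andP; split; lra.
- by rewrite -[X in _ --> X](subr0 l); apply: cvgB => //; exact: cvg_cst.
- by rewrite -[X in _ --> X](addr0 l); apply: cvgD => //; exact: cvg_cst.
Unshelve. all: by end_near. Qed.

Lemma cauchy_gt0 (t : R) : 0 < 1 + t ^+ 2.
Proof. by have := sqr_ge0 t; lra. Qed.

Lemma cc_cauchy : continuous (fun t : R => (1 + t ^+ 2)^-1).
Proof. by apply: cc_inv; [ctac|move=> t; rewrite gt_eqF// cauchy_gt0]. Qed.

Lemma ch2_ge (t : R) : 1 + t ^+ 2 <= ch t ^+ 2.
Proof. by rewrite ch2_sh2 lerD2l sh2_ge. Qed.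

Lemma Int_cauchy_itv (n : nat) : Int `[- n%:R, n%:R] (fun t : R => (1 + t ^+ 2)^-1) <= pi.
Proof.
have -> : Int `[- n%:R, n%:R] (fun t : R => (1 + t ^+ 2)^-1) = atan n%:R - atan (- n%:R).
  have da (x : R) : is_derive x 1 (@atan R) ((1 + x ^+ 2)^-1) by exact: is_derive1_atan.
  exact: (Int_FTC (opp_nat_le n) cc_cauchy da).
by rewrite atanN opprK; have := atan_ltpi2 (n%:R : R); lra.
Qed.

Lemma intg_cauchy : intg setT (fun t : R => (1 + t ^+ 2)^-1).
Proof.
apply: (@intgT_bounded _ _ pi); first exact: cc_cauchy.
move=> n; under eq_Int do rewrite ger0_norm ?invr_ge0 ?(ltW (cauchy_gt0 _))//.
exact: Int_cauchy_itv.
Qed.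

Lemma Int_cauchy_le : Int setT (fun t : R => (1 + t ^+ 2)^-1) <= pi.
Proof.
apply: (ler_cvg_to (IntT_lim intg_cauchy) (cvg_cst pi)).
by near=> n; exact: Int_cauchy_itv.
Unshelve. all: by end_near. Qed.

Lemma ch_dom (n t : R) : 0 < n -> (1 + n * ch t ^+ 2)^-1 <= n^-1 * (1 + t ^+ 2)^-1.
Proof.
move=> n0; rewrite -invfM; have h := ch2_ge t; have c := cauchy_gt0 t.
have := ler_wpM2l (ltW n0) h; have := mulr_gt0 n0 c => h1 h2.
by rewrite lef_pV2 ?posrE//; lra.
Qed.

Lemma sh_dom (n t : R) : 0 < n -> (1 + n * sh t ^+ 2)^-1 <= (1 + n^-1) * (1 + t ^+ 2)^-1.
Proof.
move=> n0; have h := sh2_ge t; have c := cauchy_gt0 t; have t0 := sqr_ge0 t.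
have h1 := ler_wpM2l (ltW n0) h; have h2 := mulr_ge0 (ltW n0) t0.
rewrite ler_pdivlMr// mulrC ler_pdivrMr; last by lra.
have -> : (1 + n^-1) * (1 + n * sh t ^+ 2) = 1 + n * sh t ^+ 2 + n^-1 + sh t ^+ 2 by field; rewrite gt_eqF.
have : 0 < n^-1 by rewrite invr_gt0.
by lra.
Qed.

Lemma exp_cauchy (a t : R) : 0 < a -> 0 <= t -> expR (- (a * t)) <= (1 + 4 / a ^+ 2) * (1 + t ^+ 2)^-1.
Proof.
move=> a0 t0; have at0 : 0 <= a / 2 * t by rewrite !mulr_ge0// ltW.
have a2 : 0 < a ^+ 2 by rewrite exprn_gt0.
have -> : - (a * t) = - (a / 2 * t) + - (a / 2 * t) by field.
rewrite expRD; have h := expRN_le_inv at0.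
apply: le_trans (ler_pM (expR_ge0 _) (expR_ge0 _) h h) _.
rewrite -invfM ler_pdivlMr ?cauchy_gt0// mulrC ler_pdivrMr; last by rewrite mulr_gt0; lra.
have hw : 4 / a ^+ 2 * (a / 2 * t) ^+ 2 = t ^+ 2 by field; rewrite gt_eqF.
have w0 : 0 <= 4 / a ^+ 2 by rewrite divr_ge0// ltW.
move: (4 / a ^+ 2) (a / 2 * t) hw w0 at0 => w x <- w0 x0.
have := mulr_ge0 w0 x0; have := sqr_ge0 x => h1 h2.
have -> : (1 + w) * ((1 + x) * (1 + x)) = 1 + 2 * x + x ^+ 2 + w + 2 * (w * x) + w * x ^+ 2 by ring.
by lra.
Qed.

End rates.

(** * Differential equations for the line integrals *)

Section dawson_integrals.
Context {R : realType}.
Local Open Scope complex_scope.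
Variable s : R[i].
Hypothesis s0 : 0 < complex.Re s.
Implicit Types (u v : R[i]) (z n t : R).
Local Notation Delta := (Delta s).
Local Notation Mk := (Mk s).
Local Notation cR := (cR s).

(** The undamped kernel for positive norm n and, in [hm], for norm - n; there [sh] vanishes at t =
    0, so no decay comes from the integrand near that point. *)
Definition hp u n : R := Int setT (fun t => Delta u (n * ch t ^+ 2)).
Definition hm u n : R := Int setT (fun t => Delta u (n * sh t ^+ 2)).

Lemma cc_Delta u : continuous (Delta u).
Proof. by apply: derive_continuous => z; exact: d_Delta. Qed.
Hint Resolve cc_Delta : cont.

Lemma cc_Dch u n : continuous (fun t : R => Delta u (n * ch t ^+ 2)).
Proof. by apply: (@cc_comp _ (fun t : R => n * ch t ^+ 2)); [ctac|exact: cc_Delta]. Qed.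
Lemma cc_Dsh u n : continuous (fun t : R => Delta u (n * sh t ^+ 2)).
Proof. by apply: (@cc_comp _ (fun t : R => n * sh t ^+ 2)); [ctac|exact: cc_Delta]. Qed.

Lemma sqrM_ge0 n (x : R) : 0 < n -> 0 <= n * x ^+ 2.
Proof. by move=> n0; rewrite mulr_ge0 ?sqr_ge0// ltW. Qed.

Lemma hp_int u n : 0 < n -> intg setT (fun t => Delta u (n * ch t ^+ 2)).
Proof.
move=> n0; have [C C0 [H _]] := Delta_dom s0 u.
apply: (intg_le (g := fun t => C * n^-1 * (1 + t ^+ 2)^-1)) => //.
- by apply: cont_meas => //; exact: cc_Dch.
- by apply: intgZ => //; exact: intg_cauchy.
- move=> t _; apply: le_trans (H _ (sqrM_ge0 _ n0)) _; rewrite -mulrA; apply: ler_wpM2l => //.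
  exact: ch_dom.
Qed.

Lemma hm_bound u : exists2 C : R, 0 <= C & forall n t, 0 < n -> `|Delta u (n * sh t ^+ 2)| <= C * (1 + n^-1) * (1 + t ^+ 2)^-1.
Proof.
have [C C0 [H _]] := Delta_dom s0 u; exists C => // n t n0.
apply: le_trans (H _ (sqrM_ge0 _ n0)) _; rewrite -mulrA; apply: ler_wpM2l => //.
exact: sh_dom.
Qed.

Lemma hm_int u n : 0 < n -> intg setT (fun t => Delta u (n * sh t ^+ 2)).
Proof.
move=> n0; have [C C0 H] := hm_bound u.
apply: (intg_le (g := fun t => C * (1 + n^-1) * (1 + t ^+ 2)^-1)) => //.
- by apply: cont_meas => //; exact: cc_Dsh.
- by apply: intgZ => //; exact: intg_cauchy.
- by move=> t _; exact: H.
Qed.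

Lemma hm_le u : exists2 C : R, 0 <= C & forall n, 0 < n -> `|hm u n| <= C * (1 + n^-1).
Proof.
have [C C0 H] := hm_bound u; exists (C * pi); first by rewrite mulr_ge0// pi_ge0.
move=> n n0; apply: le_trans (_ : _ <= Int setT (fun t => C * (1 + n^-1) * (1 + t ^+ 2)^-1)) _.
  apply: norm_Int_le2 => //; first by apply: cont_meas => //; exact: cc_Dsh.
    by apply: intgZ => //; exact: intg_cauchy.
  by move=> t _; exact: H.
rewrite IntZ//; last exact: intg_cauchy.
rewrite -[C * pi * _]mulrAC; apply: ler_wpM2l; last exact: Int_cauchy_le.
by rewrite mulr_ge0// addr_ge0// invr_ge0 ltW.
Qed.

Lemma Delta_lin (r : R) u v z : Delta (r%:C * u + v) z = r * Delta u z + Delta v z.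
Proof.
rewrite /Delta (_ : s * (r%:C * u + v) = r%:C * (s * u) + s * v); last by ring.
by rewrite eq_Mk_lin raddfD /= cReM /=; ring.
Qed.

(** Real linearity in u reduces everything to u = 1 and u = i; this is how equations coupling u and
    s u are solved. *)
Lemma Delta_ri u z : Delta u z = complex.Re u * Delta 1 z + complex.Im u * Delta 'i z.
Proof.
have D0 : Delta 0 z = 0 by have := Delta_lin 1 0 0 z; rewrite mulr0 addr0; lra.
have {1}-> : u = (complex.Re u)%:C * 1 + ((complex.Im u)%:C * 'i + 0).
  by case: u => a b; apply/eqP; rewrite eq_complex /= !(mulr1, mulr0, mul0r, subr0, addr0, add0r) !eqxx.
by rewrite !Delta_lin D0 addr0.
Qed.

Lemma hp_ri u n : 0 < n -> hp u n = complex.Re u * hp 1 n + complex.Im u * hp 'i n.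
Proof.
move=> n0; rewrite /hp -!IntZ//; [|exact: hp_int|exact: hp_int].
rewrite -IntD//; [|by apply: intgZ => //; exact: hp_int|by apply: intgZ => //; exact: hp_int].
by apply: eq_Int => t _; rewrite Delta_ri.
Qed.

Lemma hm_ri u n : 0 < n -> hm u n = complex.Re u * hm 1 n + complex.Im u * hm 'i n.
Proof.
move=> n0; rewrite /hm -!IntZ//; [|exact: hm_int|exact: hm_int].
rewrite -IntD//; [|by apply: intgZ => //; exact: hm_int|by apply: intgZ => //; exact: hm_int].
by apply: eq_Int => t _; rewrite Delta_ri.
Qed.

Lemma d_Delta2 u (z : R) : is_derive z 1 (Delta u) (- Mk 0 (s * u) z - Delta (s * u) z).
Proof.
have -> : Delta u = fun z => complex.Re u - 2 * z * Mk 0 (s * u) z by [].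
eapply dE; [eapply dD; [exact: dcst|eapply dN; eapply dM; [dtac|exact: d_Mk]]|].
by cbv beta; rewrite DeltaE; ring.
Qed.

Lemma Delta_slope u : exists2 C : R, 0 <= C & forall z, 0 <= z ->
  `|- Mk 0 (s * u) z - Delta (s * u) z| <= C / (1 + z) ^+ 2.
Proof.
have [C C0 H] := Delta_bounds s0 u; exists C => // z z0; have [_ _] := H z z0.
by have [_ <-] := @d_Delta _ s s0 u z; have [_ <-] := d_Delta2 u z.
Qed.

Lemma zMk u z : 2 * z * Mk 0 (s * u) z = complex.Re u - Delta u z.
Proof. by rewrite /Delta; ring. Qed.

Lemma d_Mk0 u (z : R) : z != 0 -> is_derive z 1 (Mk 0 u) ((Delta u z - Mk 0 u z) / (2 * z)).
Proof.
move=> z0; eapply dE; [exact: d_Mk|].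
by rewrite DeltaE; field.
Qed.

(* the primitive sh ch Mk makes the n-derivative of the integrand exact up to Delta *)
Lemma d_shchp u n (t : R) : 0 < n ->
  is_derive t 1 (fun t => sh t * ch t * Mk 0 u (n * ch t ^+ 2)) (ch t ^+ 2 * Mk 0 u (n * ch t ^+ 2) + sh t ^+ 2 * Delta u (n * ch t ^+ 2)).
Proof.
move=> n0; have c0 := ch_gt0 t.
have z0 : n * ch t ^+ 2 != 0 by rewrite gt_eqF// mulr_gt0// exprn_gt0.
have d1 : is_derive t 1 (fun t : R => n * ch t ^+ 2) (n * (2 * ch t * sh t)).
  by eapply dE; [eapply dM; [exact: dcst|eapply dX; exact: d_ch]|cbv beta; rewrite /= expr1; ring].
have d2 := dcomp (f := fun t => n * ch t ^+ 2) (g := Mk 0 u) d1 (d_Mk0 u z0).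
eapply dE; [exact: (dM (dM (d_sh t) (d_ch t)) d2)|].
cbv beta; move: (Mk 0 u _) (Delta u _) => A B.
by field; rewrite !gt_eqF.
Qed.

Lemma d_shchm u n (t : R) : 0 < n ->
  is_derive t 1 (fun t => sh t * ch t * Mk 0 u (n * sh t ^+ 2)) (sh t ^+ 2 * Mk 0 u (n * sh t ^+ 2) + ch t ^+ 2 * Delta u (n * sh t ^+ 2)).
Proof.
move=> n0; have d1 : is_derive t 1 (fun t : R => n * sh t ^+ 2) (n * (2 * sh t * ch t)).
  by eapply dE; [eapply dM; [exact: dcst|eapply dX; exact: d_sh]|cbv beta; rewrite /= expr1; ring].
have d2 := dcomp (f := fun t => n * sh t ^+ 2) (g := Mk 0 u) d1 (@d_Mk _ s s0 0 u _).
eapply dE; [exact: (dM (dM (d_sh t) (d_ch t)) d2)|].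
cbv beta; rewrite DeltaE; move: (Mk 0 u _) (Mk 1 _ _) => A B.
by ring.
Qed.

Lemma exp_ch_sh t : ch t - sh t = expR (- t).
Proof. by rewrite /ch /sh; field. Qed.

Lemma expN_nat (m : nat) : (0 < m)%N -> expR (- m%:R) <= (m%:R : R)^-1.
Proof.
move=> m0; have mR : 0 < m%:R :> R by rewrite ltr0n.
apply: le_trans (expRN_le_inv (ltW mR)) _; rewrite lef_pV2 ?posrE//; lra.
Qed.

(** The limit comes from 2 z [Mk] = Re u - [Delta]: at z = n ch^2 the first part survives and the
    second decays. It is the source of the inhomogeneous term 1/n. *)
Lemma boundp u n : 0 < n ->
  2 * (sh m%:R * ch m%:R * Mk 0 (s * u) (n * ch m%:R ^+ 2)) @[m --> \oo] --> complex.Re u / n.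
Proof.
move=> n0; have [C C0 [H _]] := Delta_dom s0 u.
apply: (cvg_rate (K := (`|complex.Re u| + C * n^-1) / n)) => m m0.
set t := m%:R : R; have t1 : 1 <= t by rewrite ler1n.
have c1 := ch_ge1 t; have c0 : 0 < ch t by lra.
set D := Delta u (n * ch t ^+ 2).
have E : 2 * (sh t * ch t * Mk 0 (s * u) (n * ch t ^+ 2)) - complex.Re u / n =
  n^-1 * (- (expR (- t) / ch t) * complex.Re u - (sh t / ch t) * D).
  have -> : 2 * (sh t * ch t * Mk 0 (s * u) (n * ch t ^+ 2)) = sh t / (n * ch t) * (2 * (n * ch t ^+ 2) * Mk 0 (s * u) (n * ch t ^+ 2)).
    by move: (Mk 0 _ _) => A; field; rewrite !gt_eqF.
  by rewrite zMk -/D -exp_ch_sh; field; rewrite !gt_eqF.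
have tpos : 0 < t by lra.
rewrite E normrM (gtr0_norm (x := n^-1)) ?invr_gt0//.
have -> : (`|complex.Re u| + C * n^-1) / n / t = n^-1 * (`|complex.Re u| / t + C * n^-1 / t) by field; rewrite !gt_eqF.
apply: ler_wpM2l; first by rewrite invr_ge0 ltW.
apply: le_trans (ler_normB _ _) _; rewrite [X in X + _]normrM [X in _ + X]normrM normrN.
have ci : 0 < (ch t)^-1 by rewrite invr_gt0.
apply: lerD.
  rewrite mulrC; apply: ler_wpM2l => //.
  rewrite ger0_norm; last by rewrite divr_ge0 ?expR_ge0// ltW.
  apply: le_trans (_ : expR (- t) * 1 <= _); last by rewrite mulr1; exact: expN_nat.
  by apply: ler_wpM2l; [exact: expR_ge0|rewrite invf_le1].
have s1 : 0 <= sh t by have := sh_ge (ltW tpos); lra.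
have sc : sh t <= ch t by have := expR_ge0 (- t); have := exp_ch_sh t; lra.
rewrite (ger0_norm (_ : 0 <= sh t / ch t)); last by rewrite divr_ge0// ltW.
apply: le_trans (_ : 1 * `|D| <= _).
  by apply: ler_wpM2r => //; rewrite ler_pdivrMr// mul1r.
rewrite mul1r; apply: le_trans (H _ (sqrM_ge0 _ n0)) _; rewrite -mulrA; apply: ler_wpM2l => //.
apply: le_trans (ch_dom _ n0) _; apply: ler_wpM2l; first by rewrite invr_ge0 ltW.
by rewrite lef_pV2 ?posrE ?cauchy_gt0//; nra.
Qed.

Lemma boundm u n : 0 < n ->
  2 * (sh m%:R * ch m%:R * Mk 0 (s * u) (n * sh m%:R ^+ 2)) @[m --> \oo] --> complex.Re u / n.
Proof.
move=> n0; have [C C0 [H _]] := Delta_dom s0 u.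
apply: (cvg_rate (K := (`|complex.Re u| + 2 * C * n^-1) / n)) => m m0.
set t := m%:R : R; have t1 : 1 <= t by rewrite ler1n.
have tpos : 0 < t by lra.
have st : t <= sh t := sh_ge (ltW tpos); have sp : 0 < sh t by lra.
set D := Delta u (n * sh t ^+ 2).
have E : 2 * (sh t * ch t * Mk 0 (s * u) (n * sh t ^+ 2)) - complex.Re u / n =
  n^-1 * (expR (- t) / sh t * complex.Re u - (ch t / sh t) * D).
  have -> : 2 * (sh t * ch t * Mk 0 (s * u) (n * sh t ^+ 2)) = ch t / (n * sh t) * (2 * (n * sh t ^+ 2) * Mk 0 (s * u) (n * sh t ^+ 2)).
    by move: (Mk 0 _ _) => A; field; rewrite !gt_eqF.
  by rewrite zMk -/D -exp_ch_sh; field; rewrite !gt_eqF.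
rewrite E normrM (gtr0_norm (x := n^-1)) ?invr_gt0//.
have -> : (`|complex.Re u| + 2 * C * n^-1) / n / t = n^-1 * (`|complex.Re u| / t + 2 * (C * n^-1 / t)) by field; rewrite !gt_eqF.
apply: ler_wpM2l; first by rewrite invr_ge0 ltW.
apply: le_trans (ler_normB _ _) _; rewrite [X in X + _]normrM [X in _ + X]normrM.
have si : 0 < (sh t)^-1 by rewrite invr_gt0.
apply: lerD.
  rewrite mulrC; apply: ler_wpM2l => //.
  rewrite ger0_norm; last by rewrite divr_ge0 ?expR_ge0// ltW.
  apply: le_trans (_ : expR (- t) * 1 <= _); last by rewrite mulr1; exact: expN_nat.
  by apply: ler_wpM2l; [exact: expR_ge0|rewrite invf_le1//; lra].
have e1 : expR (- t) <= 1 by rewrite -[leRHS]expR0 ler_expR; lra.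
have sc : ch t <= 2 * sh t by have := exp_ch_sh t; lra.
rewrite (ger0_norm (_ : 0 <= ch t / sh t)); last by rewrite divr_ge0 ?ltW// ch_gt0.
apply: ler_pM => //; [by rewrite divr_ge0 ?ltW// ch_gt0|by rewrite ler_pdivrMr|].
apply: le_trans (H _ (sqrM_ge0 _ n0)) _; rewrite -mulrA; apply: ler_wpM2l => //.
rewrite -invfM lef_pV2 ?posrE.
- have : n * t <= n * sh t ^+ 2 by apply: ler_wpM2l; [exact: ltW|nra].
  by lra.
- by have := sqrM_ge0 (sh t) n0; lra.
- by rewrite mulr_gt0.
Qed.

(** The derivative under the integral plus the integrand for s u is an exact t-derivative, so only
    boundary terms at plus and minus infinity remain. *)
Lemma d_hp u (n : R) : 0 < n -> is_derive n 1 (hp u) (- hp (s * u) n - complex.Re u / n).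
Proof.
move=> n0; have [C C0 H] := Delta_slope u.
pose f' (x t : R) := ch t ^+ 2 * (- Mk 0 (s * u) (x * ch t ^+ 2) - Delta (s * u) (x * ch t ^+ 2)).
have cf' x : continuous (f' x).
  rewrite /f'; apply: cc_M; first by ctac.
  apply: cc_D; apply: cc_N; last exact: cc_Dch.
  by apply: (@cc_comp _ (fun t : R => x * ch t ^+ 2)); [ctac|exact: cc_Mk].
have bd (x t : R) : n / 2 < x < 2 * n -> `|f' x t| <= C * (4 / n ^+ 2) * (1 + t ^+ 2)^-1.
  move=> /andP[x1 _]; have x0 : 0 < x by lra.
  have c0 : 0 < ch t ^+ 2 by rewrite exprn_gt0// ch_gt0.
  rewrite /f' normrM (gtr0_norm c0).
  apply: le_trans (ler_wpM2l (ltW c0) (H _ (sqrM_ge0 _ x0))) _.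
  rewrite mulrCA -mulrA; apply: ler_wpM2l => //.
  apply: le_trans (_ : ch t ^+ 2 / (n / 2 * ch t ^+ 2) ^+ 2 <= _).
    apply: ler_wpM2l; first exact: ltW.
    have q : 0 < n / 2 * ch t ^+ 2 by rewrite mulr_gt0//; lra.
    have q' : n / 2 * ch t ^+ 2 <= x * ch t ^+ 2 by apply: ler_wpM2r; [exact: ltW|lra].
    by rewrite lef_pV2 ?posrE ?exprn_gt0// ?ler_pXn2r ?nnegrE//; lra.
  have -> : ch t ^+ 2 / (n / 2 * ch t ^+ 2) ^+ 2 = 4 / n ^+ 2 * (ch t ^+ 2)^-1.
    by move: (ch t ^+ 2) c0 => A A0; field; rewrite !gt_eqF.
  apply: ler_wpM2l; first by rewrite divr_ge0// sqr_ge0.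
  by rewrite lef_pV2 ?posrE ?cauchy_gt0// ch2_ge.
have ig : intg setT (fun t : R => C * (4 / n ^+ 2) * (1 + t ^+ 2)^-1) by apply: intgZ => //; exact: intg_cauchy.
have nn2 : n / 2 < n < 2 * n by apply/andP; split; lra.
apply: dE.
  apply: (derive_param (D := setT) (f := fun x t => Delta u (x * ch t ^+ 2)) (f' := f') measurableT nn2 _ ig).
  - by move=> x /andP[x1 _]; apply: hp_int; lra.
  - move=> x t _ _; rewrite /f'; apply: (dcomp (f := fun x : R => x * ch t ^+ 2) (g := Delta u)); last exact: d_Delta2.
    by eapply dE; [eapply dM; [exact: did|exact: dcst]|cbv beta; ring].
  - by move=> x t hx _; exact: bd.
have if' : intg setT (f' n) by apply: (intg_le _ _ ig) => //; [exact: cont_meas|move=> t _; exact: bd].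
have iD := hp_int (s * u) n0.
pose g t := f' n t + Delta (s * u) (n * ch t ^+ 2).
have ig' : intg setT g by exact: intgD.
have E (m : nat) : Int `[- m%:R, m%:R] g = - (2 * (sh m%:R * ch m%:R * Mk 0 (s * u) (n * ch m%:R ^+ 2))).
  pose g1 (t : R) := ch t ^+ 2 * Mk 0 (s * u) (n * ch t ^+ 2) + sh t ^+ 2 * Delta (s * u) (n * ch t ^+ 2).
  have cg1 : continuous g1.
    rewrite /g1; apply: cc_D; apply: cc_M; [by ctac| |by ctac|exact: cc_Dch].
    by apply: (@cc_comp _ (fun t : R => n * ch t ^+ 2)); [ctac|exact: cc_Mk].
  have e t : g t = - g1 t by rewrite /g /f' /g1 ch2_sh2; ring.
  rewrite (eq_Int (fun t _ => e t)) IntN//; last exact: intg_itv.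
  have -> : Int `[- m%:R, m%:R] g1 = sh m%:R * ch m%:R * Mk 0 (s * u) (n * ch m%:R ^+ 2) - sh (- m%:R) * ch (- m%:R) * Mk 0 (s * u) (n * ch (- m%:R) ^+ 2).
    by apply: (Int_FTC (F := fun t => sh t * ch t * Mk 0 (s * u) (n * ch t ^+ 2)) (opp_nat_le m) cg1) => t; exact: d_shchp.
  by rewrite shN chN; ring.
have L1 := IntT_lim ig'; have L2 := cvgN (@boundp u _ n0).
have L3 : Int `[- m%:R, m%:R] g @[m --> \oo] --> - (complex.Re u / n).
  by under eq_cvg do rewrite E; exact: L2.
have h : Int setT g = - (complex.Re u / n) by apply: (cvg_unique _ L1 L3).
by move: h; rewrite /g IntD// -/(hp (s * u) n); lra.
Qed.

(** The same equation as for [hp], read in the variable N = - n, which reverses the sign of the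
    linear term only. *)
Lemma d_hm u (n : R) : 0 < n -> is_derive n 1 (hm u) (hm (s * u) n - complex.Re u / n).
Proof.
move=> n0; have [C C0 H] := Delta_slope u.
pose f' (x t : R) := sh t ^+ 2 * (- Mk 0 (s * u) (x * sh t ^+ 2) - Delta (s * u) (x * sh t ^+ 2)).
have cf' x : continuous (f' x).
  rewrite /f'; apply: cc_M; first by ctac.
  apply: cc_D; apply: cc_N; last exact: cc_Dsh.
  by apply: (@cc_comp _ (fun t : R => x * sh t ^+ 2)); [ctac|exact: cc_Mk].
have h0 : 0 < n / 2 by lra.
have bd (x t : R) : n / 2 < x < 2 * n -> `|f' x t| <= C * ((n / 2)^-1 * (1 + (n / 2)^-1)) * (1 + t ^+ 2)^-1.
  move=> /andP[x1 _]; have x0 : 0 < x by lra.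
  have c0 := sqr_ge0 (sh t).
  rewrite /f' normrM (ger0_norm c0).
  apply: le_trans (ler_wpM2l c0 (H _ (sqrM_ge0 _ x0))) _.
  rewrite mulrCA -mulrA; apply: ler_wpM2l => //.
  have q : 0 <= n / 2 * sh t ^+ 2 by rewrite mulr_ge0// ltW.
  have q' : n / 2 * sh t ^+ 2 <= x * sh t ^+ 2 by apply: ler_wpM2r; [exact: c0|lra].
  apply: le_trans (_ : sh t ^+ 2 / (1 + n / 2 * sh t ^+ 2) ^+ 2 <= _).
    apply: ler_wpM2l => //.
    by rewrite lef_pV2 ?posrE ?exprn_gt0// ?ler_pXn2r ?nnegrE//; lra.
  apply: le_trans (_ : (n / 2)^-1 * (1 + n / 2 * sh t ^+ 2)^-1 <= _); last first.
    by rewrite -[leRHS]mulrA; apply: ler_wpM2l; [rewrite invr_ge0 ltW|exact: sh_dom].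
  rewrite ler_pdivrMr; last by rewrite exprn_gt0//; lra.
  have -> : (n / 2)^-1 * (1 + n / 2 * sh t ^+ 2)^-1 * (1 + n / 2 * sh t ^+ 2) ^+ 2 = (n / 2)^-1 + sh t ^+ 2.
    by field; rewrite !gt_eqF//; lra.
  by rewrite lerDr invr_ge0 ltW.
have ig : intg setT (fun t : R => C * ((n / 2)^-1 * (1 + (n / 2)^-1)) * (1 + t ^+ 2)^-1) by apply: intgZ => //; exact: intg_cauchy.
have nn2 : n / 2 < n < 2 * n by apply/andP; split; lra.
apply: dE.
  apply: (derive_param (D := setT) (f := fun x t => Delta u (x * sh t ^+ 2)) (f' := f') measurableT nn2 _ ig).
  - by move=> x /andP[x1 _]; apply: hm_int; lra.
  - move=> x t _ _; rewrite /f'; apply: (dcomp (f := fun x : R => x * sh t ^+ 2) (g := Delta u)); last exact: d_Delta2.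
    by eapply dE; [eapply dM; [exact: did|exact: dcst]|cbv beta; ring].
  - by move=> x t hx _; exact: bd.
have if' : intg setT (f' n) by apply: (intg_le _ _ ig) => //; [exact: cont_meas|move=> t _; exact: bd].
have iD := hm_int (s * u) n0.
pose g t := f' n t - Delta (s * u) (n * sh t ^+ 2).
have ig' : intg setT g by exact: intgB.
have E (m : nat) : Int `[- m%:R, m%:R] g = - (2 * (sh m%:R * ch m%:R * Mk 0 (s * u) (n * sh m%:R ^+ 2))).
  pose g1 (t : R) := sh t ^+ 2 * Mk 0 (s * u) (n * sh t ^+ 2) + ch t ^+ 2 * Delta (s * u) (n * sh t ^+ 2).
  have cg1 : continuous g1.
    rewrite /g1; apply: cc_D; apply: cc_M; [by ctac| |by ctac|exact: cc_Dsh].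
    by apply: (@cc_comp _ (fun t : R => n * sh t ^+ 2)); [ctac|exact: cc_Mk].
  have e t : g t = - g1 t by rewrite /g /f' /g1 ch2_sh2; ring.
  rewrite (eq_Int (fun t _ => e t)) IntN//; last exact: intg_itv.
  have -> : Int `[- m%:R, m%:R] g1 = sh m%:R * ch m%:R * Mk 0 (s * u) (n * sh m%:R ^+ 2) - sh (- m%:R) * ch (- m%:R) * Mk 0 (s * u) (n * sh (- m%:R) ^+ 2).
    by apply: (Int_FTC (F := fun t => sh t * ch t * Mk 0 (s * u) (n * sh t ^+ 2)) (opp_nat_le m) cg1) => t; exact: d_shchm.
  by rewrite shN chN sqrrN; ring.
have L1 := IntT_lim ig'; have L2 := cvgN (@boundm u _ n0).
have L3 : Int `[- m%:R, m%:R] g @[m --> \oo] --> - (complex.Re u / n).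
  by under eq_cvg do rewrite E; exact: L2.
have h : Int setT g = - (complex.Re u / n) by apply: (cvg_unique _ L1 L3).
by move: h; rewrite /g IntB// -/(hm (s * u) n); lra.
Qed.

End dawson_integrals.

(** * Identification with the principal value integral *)

Section principal_value.
Context {R : realType}.
Local Open Scope complex_scope.
Variable s : R[i].
Hypothesis s0 : 0 < complex.Re s.
Implicit Types (u v : R[i]) (n t : R).
Local Notation Delta := (Delta s).
Local Notation cR := (cR s).
Local Notation hp := (hp s).
Local Notation hm := (hm s).
Local Notation a := (complex.Re s).

(* ue u x is the complex number u * exp (- s x) *)
Definition ue u (x : R) : R[i] := (cR u x) +i* (cR (- 'i * u) x).

Lemma cR_ue u x y : cR (ue u x) y = cR u (x + y).
Proof.
have e1 : expR (- (a * (x + y))) = expR (- (a * x)) * expR (- (a * y)) by rewrite -expRD -opprD -mulrDr.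
by rewrite /ue /cR /= e1 (mulrDr (complex.Im s) x y) cosD sinD !(cReM, cImM) /=; ring.
Qed.

Lemma cR_sM u x : cR (s * u) x = complex.Re s * cR u x - complex.Im s * cR (- 'i * u) x.
Proof. by rewrite /cR !(cReM, cImM) /=; ring. Qed.

Lemma cR_sMi u x : cR (s * (- 'i * u)) x = complex.Re s * cR (- 'i * u) x + complex.Im s * cR u x.
Proof. by rewrite /cR !(cReM, cImM) /=; ring. Qed.

Lemma Re_iM u : complex.Re (- 'i * u) = complex.Im u.
Proof. by rewrite cReM /=; ring. Qed.

(** The real part of u exp(- s t) times the complex value of [hm] at N + t; the homogeneous part of
    the equation cancels, leaving - exp(- s t)/(N + t). [Gp] is the analogue with n - t. *)
Definition Gm u N (t : R) : R := cR u t * hm 1 (N + t) + cR (- 'i * u) t * hm 'i (N + t).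
Definition Gp u n (t : R) : R := cR u t * hp 1 (n - t) + cR (- 'i * u) t * hp 'i (n - t).

Lemma d_Gm u N (t : R) : 0 < N + t -> is_derive t 1 (Gm u N) (- (cR u t / (N + t))).
Proof.
move=> N0; have dx : is_derive t 1 (fun t => N + t) 1 by dring.
have d1 v := dcomp (f := fun t => N + t) (g := hm v) dx (d_hm s0 v N0).
eapply dE; [exact: (dD (dM (d_cR s u t) (d1 1)) (dM (d_cR s (- 'i * u) t) (d1 'i)))|].
cbv beta; rewrite cR_sM cR_sMi (hm_ri s0 (s * 1) N0) (hm_ri s0 (s * 'i) N0) !cReM !cImM /=.
set c1 := cR u t; set c2 := cR (- 'i * u) t; set h1 := hm 1 (N + t); set h2 := hm 'i (N + t); set x := (N + t).
have xi : x * x^-1 = 1 by rewrite divff// gt_eqF.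
move: (x^-1) (complex.Re s) (complex.Im s) c1 c2 h1 h2 xi => y p q c1 c2 h1 h2 xi.
by ring: xi.
Qed.

Lemma d_Gp u n (t : R) : t < n -> is_derive t 1 (Gp u n) (cR u t / (n - t)).
Proof.
move=> tn; have N0 : 0 < n - t by rewrite subr_gt0.
have dx : is_derive t 1 (fun t => n - t) (-1) by dring.
have d1 v := dcomp (f := fun t => n - t) (g := hp v) dx (d_hp s0 v N0).
eapply dE; [exact: (dD (dM (d_cR s u t) (d1 1)) (dM (d_cR s (- 'i * u) t) (d1 'i)))|].
cbv beta; rewrite cR_sM cR_sMi (hp_ri s0 (s * 1) N0) (hp_ri s0 (s * 'i) N0) !cReM !cImM /=.
set c1 := cR u t; set c2 := cR (- 'i * u) t; set h1 := hp 1 (n - t); set h2 := hp 'i (n - t); set x := (n - t).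
have xi : x * x^-1 = 1 by rewrite divff// gt_eqF.
move: (x^-1) (complex.Re s) (complex.Im s) c1 c2 h1 h2 xi => y p q c1 c2 h1 h2 xi.
by ring: xi.
Qed.

Lemma intg_exp (D : set (measurableTypeR R)) (f : R -> R) (K : R) : measurable D ->
  (forall t : R, D t -> 0 <= t) -> measurable_fun D f -> (forall t : R, D t -> `|f t| <= K * expR (- (a * t))) -> intg D f.
Proof.
move=> mD D0 mf fK; apply: (intg_le (g := fun t : R => `|K| * (1 + 4 / a ^+ 2) * (1 + t ^+ 2)^-1)) => //.
  by apply: intgZ => //; apply: (intgS _ _ _ intg_cauchy).
move=> t Dt; apply: le_trans (fK t Dt) _; rewrite -mulrA.
apply: le_trans (ler_wpM2r (expR_ge0 _) (ler_norm K)) _.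
by apply: ler_wpM2l => //; apply: exp_cauchy => //; exact: D0.
Qed.

(** [Gm] is a primitive of the negative of the integrand; it equals [hm u N] at 0 and vanishes at
    infinity, which fixes the solution of the equation. *)
Lemma hm_formula u N : 0 < N -> intg `[0, +oo[ (fun t => cR u t / (t + N)) /\
  Int `[0, +oo[ (fun t => cR u t / (t + N)) = hm u N.
Proof.
move=> N0; pose f (t : R) := cR u t * (`|t| + N)^-1.
have p (t : R) : 0 < `|t| + N by have := normr_ge0 t; lra.
have cf : continuous f.
  rewrite /f; apply: cc_M; first exact: cc_cR.
  by apply: cc_inv; [ctac|move=> t; rewrite gt_eqF].
have e (t : R) : `[0, +oo[%classic t -> f t = cR u t / (t + N).
  by rewrite /= in_itv /= andbT => t0; rewrite /f ger0_norm.
have i1 : intg `[0, +oo[ f.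
  apply: (@intg_exp _ _ (nu u * N^-1)) => //.
  - by move=> t /=; rewrite in_itv /= andbT.
  - exact: cont_meas.
  - move=> t _; rewrite /f normrM mulrAC; apply: ler_pM => //; first exact: cR_le.
    by rewrite gtr0_norm ?invr_gt0// lef_pV2 ?posrE//; have := normr_ge0 t; lra.
split; first exact: eq_intg e i1.
rewrite -(eq_Int e).
have E (m : nat) : Int `[0, m%:R] f = hm u N - Gm u N m%:R.
  have -> : Int `[0, m%:R] f = - Gm u N m%:R - - Gm u N 0.
    apply: (Int_FTC_in (F := fun t => - Gm u N t)); [exact: ler0n|exact: cf|move=> t /andP[t0 _]].
    have q : 0 < N + t by lra.
    by eapply dE; [exact: (dN (d_Gm u q))|rewrite opprK /f ger0_norm// addrC].
  rewrite opprK addrC; congr (_ - _).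
  by rewrite /Gm (@cR0 _ s u) (@cR0 _ s (- 'i * u)) Re_iM (addr0 N) (hm_ri s0 u N0).
have L1 := Int_half_lim i1.
have [C1 C10 H1] := hm_le s0 1; have [C2 C20 H2] := hm_le s0 'i.
have L2 : Int `[0, m%:R] f @[m --> \oo] --> hm u N.
  under eq_cvg do rewrite E.
  apply: (cvg_rate (K := (nu u * (C1 * (1 + N^-1)) + nu (- 'i * u) * (C2 * (1 + N^-1))) / a)) => m m0.
  have mR : 0 < m%:R :> R by rewrite ltr0n.
  rewrite addrAC subrr add0r normrN /Gm; apply: le_trans (ler_normD _ _) _.
  rewrite [X in X + _]normrM [X in _ + X]normrM.
  have ee : expR (- (a * m%:R)) <= (a * m%:R)^-1.
    apply: le_trans (expRN_le_inv (ltW (mulr_gt0 s0 mR))) _; have := mulr_gt0 s0 mR => h.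
    by rewrite lef_pV2 ?posrE//; lra.
  have hb (v : R[i]) (C : R) : 0 <= C -> (forall x, 0 < x -> `|hm v x| <= C * (1 + x^-1)) -> `|hm v (N + m%:R)| <= C * (1 + N^-1).
    move=> C0 H; apply: le_trans (H _ _) _; first by lra.
    by apply: ler_wpM2l => //; rewrite lerD2l lef_pV2 ?posrE//; lra.
  have key (v w : R[i]) (C : R) : 0 <= C -> `|hm v (N + m%:R)| <= C -> `|cR w m%:R| * `|hm v (N + m%:R)| <= nu w * C * (a * m%:R)^-1.
    move=> C0 h; rewrite mulrAC; apply: ler_pM => //.
    by apply: le_trans (cR_le s w m%:R) _; apply: ler_wpM2l; [exact: nu_ge0|].
  have N1 : 0 <= 1 + N^-1 by rewrite addr_ge0// invr_ge0 ltW.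
  have -> : (nu u * (C1 * (1 + N^-1)) + nu (- 'i * u) * (C2 * (1 + N^-1))) / a / m%:R =
    nu u * (C1 * (1 + N^-1)) * (a * m%:R)^-1 + nu (- 'i * u) * (C2 * (1 + N^-1)) * (a * m%:R)^-1.
    by rewrite invfM; ring.
  by apply: lerD; apply: key; rewrite ?mulr_ge0//; apply: hb.
exact: (cvg_unique _ L1 L2).
Qed.

(* continuous function equal to 1/x for |x| >= e *)
Definition qe (e x : R) : R := x * ((e ^+ 2 + x ^+ 2 + `|x ^+ 2 - e ^+ 2|) / 2)^-1.

Lemma cc_qe e : 0 < e -> continuous (qe e).
Proof.
move=> e0; rewrite /qe; apply: cc_M; first exact: cc_id.
apply: cc_inv; first by ctac.
move=> x; have := sqr_ge0 x; have : 0 < e ^+ 2 by rewrite exprn_gt0.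
by have := normr_ge0 (x ^+ 2 - e ^+ 2) => h1 h2 h3; rewrite gt_eqF//; lra.
Qed.

Lemma qeE e x : 0 < e -> e <= `|x| -> qe e x = x^-1.
Proof.
move=> e0 ex; have x0 : x != 0 by rewrite -normr_gt0 (lt_le_trans e0).
have h : e ^+ 2 <= x ^+ 2 by rewrite -[x ^+ 2]real_normK ?num_real// ler_pXn2r ?nnegrE// ltW.
rewrite /qe ger0_norm ?subr_ge0//.
have -> : (e ^+ 2 + x ^+ 2 + (x ^+ 2 - e ^+ 2)) / 2 = x ^+ 2 by field.
by field.
Qed.

Definition kern u n (t : R) : R := cR u t / (t - n).

Lemma pv_domainE n e : 0 < e -> pv_domain n e = `[0, +oo[ `&` (`]-oo, n - e] `|` `[n + e, +oo[).
Proof.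
move=> e0; apply/seteqP; split=> t /=; rewrite /pv_domain /= !in_itv /= !andbT.
  move=> [t0 et]; split=> //; have [h|h] := leP n t; [right|left].
    by move: et; rewrite ger0_norm ?subr_ge0//; lra.
  by move: et; rewrite ltr0_norm ?subr_lt0//; lra.
move=> [t0 [h|h]]; split=> //.
  by rewrite ler0_norm; lra.
by rewrite ger0_norm; lra.
Qed.

Lemma pv_meas n e : 0 < e -> measurable (pv_domain n e : set (measurableTypeR R)).
Proof.
by move=> e0; rewrite pv_domainE//; apply: measurableI; [|apply: measurableU]; exact: measurable_itv.
Qed.

Lemma pv_intg u n e : 0 < e -> intg (pv_domain n e) (kern u n).
Proof.
move=> e0; have mD := pv_meas n e0.
have e1 (t : R) : pv_domain n e t -> cR u t * qe e (t - n) = kern u n t by move=> [_ h]; rewrite qeE.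
apply: (eq_intg mD e1); apply: (@intg_exp _ _ (nu u * e^-1)) => //.
- by move=> t [].
- apply: cont_meas => //; apply: cc_M; first exact: cc_cR.
  by apply: (@cc_comp _ (fun t : R => t - n)); [ctac|exact: cc_qe].
- move=> t [t0 h]; rewrite qeE// normrM mulrAC normfV; apply: ler_pM => //; first exact: cR_le.
  by rewrite lef_pV2 ?posrE// (lt_le_trans e0).
Qed.

Lemma pv_neg u n e : 0 < e -> e <= - n -> Int (pv_domain n e) (kern u n) = hm u (- n).
Proof.
move=> e0 en; have n0 : 0 < - n by lra.
have -> : pv_domain n e = `[0, +oo[%classic.
  rewrite pv_domainE//; apply/seteqP; split=> t /=; rewrite !in_itv /= !andbT; first by move=> [].
  by move=> t0; split=> //; right; lra.
by have [_ <-] := hm_formula u n0.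
Qed.

Lemma cc_kern u n e : 0 < e -> continuous (fun t : R => cR u t * qe e (t - n)).
Proof.
move=> e0; apply: cc_M; first exact: cc_cR.
by apply: (@cc_comp _ (fun t : R => t - n)); [ctac|exact: cc_qe].
Qed.

Lemma pv_left u n e : 0 < e -> e < n -> Int `[0, n - e] (kern u n) = hp u n - Gp u n (n - e).
Proof.
move=> e0 en; have e1 (t : R) : `[0, n - e]%classic t -> kern u n t = cR u t * qe e (t - n).
  by rewrite /= in_itv /= => /andP[t0 t1]; rewrite qeE// ler0_norm; lra.
rewrite (eq_Int e1).
have -> : Int `[0, n - e] (fun t => cR u t * qe e (t - n)) = - Gp u n (n - e) - - Gp u n 0.
  apply: (Int_FTC_in (F := fun t => - Gp u n t)); [lra|exact: cc_kern|].
  move=> t /andP[t0 t1]; have tn : t < n by lra.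
  eapply dE; [exact: (dN (d_Gp u tn))|].
  rewrite qeE//; last by rewrite ler0_norm; lra.
  by rewrite -mulrN -invrN opprB.
have n0 : 0 < n by lra.
rewrite opprK addrC; congr (_ - _).
by rewrite /Gp (@cR0 _ s u) (@cR0 _ s (- 'i * u)) Re_iM (subr0 n) (hp_ri s0 u n0).
Qed.

Lemma Int_ray_lim (f : R -> R) (b : R) : intg `[b, +oo[ f -> Int `[b, m%:R + b] f @[m --> \oo] --> Int `[b, +oo[ f.
Proof.
move=> hf; apply: Int_exhaust => //.
- by move=> n x /=; rewrite !in_itv /= andbT => /andP[].
- move=> x /=; rewrite in_itv /= andbT => x0; near=> n; rewrite /= in_itv /= x0 /= -lerBlDr.
  by near: n; exact: nbhs_infty_ger.
Unshelve. all: by end_near. Qed.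

(** Translation by n + e turns this ray into the half-line integral of [hm_formula] with N = e and
    with u replaced by u exp(- s (n + e)). *)
Lemma pv_right u n e : 0 < e -> 0 < n -> Int `[n + e, +oo[ (kern u n) = hm (ue u (n + e)) e.
Proof.
move=> e0 n0; have e1 (t : R) : `[n + e, +oo[%classic t -> kern u n t = cR u t * qe e (t - n).
  by rewrite /= in_itv /= andbT => t0; rewrite qeE// ger0_norm; lra.
have [i1 E1] := hm_formula (ue u (n + e)) e0.
have i2 : intg `[n + e, +oo[ (kern u n).
  apply: (intgS (pv_meas n e0) _ _ (pv_intg u n e0)) => //.
  move=> t /=; rewrite in_itv /= andbT pv_domainE//= => t0; split; rewrite !in_itv /= !andbT; first by lra.
  by right.
have L1 := Int_ray_lim i2; have L2 := Int_half_lim i1; rewrite E1 in L2.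
apply: (cvg_unique _ L1 _) => //; apply: cvg_trans L2.
rewrite (_ : (fun m : nat => Int `[n + e, m%:R + (n + e)] (kern u n)) = (fun m : nat => Int `[0, m%:R] (fun t => cR (ue u (n + e)) t / (t + e))))//.
apply/funext => m; have m0 : 0 <= m%:R :> R by [].
rewrite (eq_Int (g := fun t => cR u t * qe e (t - n))); last first.
  by move=> t /=; rewrite in_itv /= => /andP[t0 t1]; apply: e1; rewrite /= in_itv /= t0.
have := Int_affine_itv (n + e) m0 ltr01 (@cc_kern u n e e0).
rewrite mulr0 add0r mul1r => <-; apply: eq_Int => t; rewrite /= in_itv /= => /andP[t0 t1].
rewrite !mul1r cR_ue [n + e + t]addrC; congr (_ * _).
have -> : t + (n + e) - n = t + e by ring.
by rewrite qeE// ger0_norm; lra.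
Qed.

Lemma pv_pos u n e : 0 < e -> e < n ->
  Int (pv_domain n e) (kern u n) = hp u n - Gp u n (n - e) + hm (ue u (n + e)) e.
Proof.
move=> e0 en; have n0 : 0 < n by lra.
have E : pv_domain n e = `[0, n - e]%classic `|` `[n + e, +oo[%classic.
  rewrite pv_domainE//; apply/seteqP; split=> t /=; rewrite !in_itv /= !andbT.
    by move=> [t0 [h|h]]; [left; rewrite t0|right].
  by move=> [/andP[t0 h]|h]; [split=> //; left|split; [lra|right]].
have := pv_intg u n e0; rewrite E => iU.
rewrite /Int Rintegral_setU//; first by rewrite -[X in X + _]/(Int _ _) -[X in _ + X]/(Int _ _) pv_left// pv_right.
apply/disj_set2P; rewrite -subset0 => t /=; rewrite !in_itv /= !andbT => -[/andP[_ h1] h2]; lra.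
Qed.

Lemma cR_lip u x y : 0 <= x -> x <= y -> `|cR u y - cR u x| <= nu (s * u) * (y - x).
Proof.
move=> x0 xy; have <- : Int `[x, y] (fun t => - cR (s * u) t) = cR u y - cR u x.
  apply: (Int_FTC (F := cR u) xy (cc_N (@cc_cR _ s (s * u)))) => t; exact: d_cR.
apply: Int_itv_le => //; first by apply: cc_N; exact: cc_cR.
move=> t /andP[xt _]; rewrite normrN; apply: le_trans (cR_le s _ t) _.
rewrite -[leRHS]mulr1; apply: ler_wpM2l; first exact: nu_ge0.
by rewrite -[leRHS]expR0 ler_expR oppr_le0 mulr_ge0 ?(ltW s0)//; lra.
Qed.

Lemma cvg0_bounded (f g : nat -> R) (K : R) : (forall k, `|f k| <= K) -> g k @[k --> \oo] --> (0 : R) ->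
  f k * g k @[k --> \oo] --> (0 : R).
Proof.
move=> fK g0; apply: norm_cvg0.
have g0' : K * `|g k| @[k --> \oo] --> (0 : R).
  rewrite -[X in _ --> X](mulr0 K); apply: cvgM; first exact: cvg_cst.
  by rewrite -[X in _ --> X](@normr0 _ R); exact: cvg_norm.
apply: (@squeeze_cvgr _ _ _ _ (fun=> 0) (fun k => K * `|g k|)) => //; last exact: cvg_cst.
by near=> k; rewrite normr_ge0 normrM ler_wpM2r.
Unshelve. all: by end_near. Qed.

Lemma Int_zero : Int setT (fun _ : R => 0) = 0 :> R.
Proof. by rewrite /Int Rintegral_cst// mul0r. Qed.

Section sequence.
Variable e : nat -> R.
Hypotheses (e0 : forall k, 0 < e k) (e1 : forall k, e k <= 1) (ec : e k @[k --> \oo] --> (0 : R)).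

(** Both terms are generally unbounded as e tends to 0. Their difference is dominated through the
    variation of [Delta] between e sh^2 and e ch^2, which lie only e apart, and the integrand tends
    to 0. This is the matching across n = 0. *)
Lemma gap_cvg v : hp v (e k) - hm v (e k) @[k --> \oo] --> (0 : R).
Proof.
have [C C0 [_ H]] := Delta_dom s0 v.
have E k : hp v (e k) - hm v (e k) = Int setT (fun t => Delta v (e k * ch t ^+ 2) - Delta v (e k * sh t ^+ 2)).
  by rewrite IntB//; [exact: hp_int|exact: hm_int].
rewrite (funext E) -[X in _ --> X]Int_zero.
apply: (dct (g := fun t => C * (1 + t ^+ 2)^-1) measurableT _ _ _ _).2.
- by move=> k; apply: cont_meas => //; apply: cc_D; [exact: cc_Dch|apply: cc_N; exact: cc_Dsh].
- by apply: intgZ => //; exact: intg_cauchy.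
- move=> k t _; have h := sqrM_ge0 (sh t) (e0 k).
  have h' : e k * sh t ^+ 2 <= e k * ch t ^+ 2.
    by apply: ler_wpM2l; [exact: ltW|rewrite ch2_sh2; have := sqr_ge0 (sh t); lra].
  rewrite distrC; apply: le_trans (H _ _ h h') _; rewrite -mulrBr; apply: ler_wpM2l => //.
  have p1 : 0 < 1 + e k * sh t ^+ 2 by lra.
  have p2 : 0 < 1 + e k * ch t ^+ 2 by lra.
  have -> : (1 + e k * sh t ^+ 2)^-1 - (1 + e k * ch t ^+ 2)^-1 = (1 + e k * sh t ^+ 2)^-1 * (e k * (1 + e k * ch t ^+ 2)^-1).
    move: p1 p2; rewrite ch2_sh2; move: (sh t ^+ 2) (e k) => x y p1 p2.
    by field; rewrite !gt_eqF.
  have q : e k * (1 + e k * ch t ^+ 2)^-1 <= (1 + t ^+ 2)^-1.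
    rewrite -[leRHS](mulVKf (x := e k)) ?gt_eqF//; apply: ler_wpM2l; first exact: ltW.
    exact: ch_dom.
  rewrite -[leRHS]mul1r; apply: ler_pM => //; [by rewrite invr_ge0 ltW| |by rewrite invf_le1//; lra].
  by rewrite mulr_ge0 ?invr_ge0 ?ltW.
- move=> t _; rewrite -[X in _ --> X](subrr (Delta v 0)).
  have cv (x : R) : Delta v (e k * x) @[k --> \oo] --> Delta v 0.
    apply: (cont_seq (x := 0)); first exact: cc_Delta.
    by rewrite -[X in _ --> X](mul0r x); apply: cvgM => //; exact: cvg_cst.
  by apply: cvgB; exact: cv.
Qed.

(** Shows that the growth of [hm] is o(1/e), enough against the Lipschitz difference of the
    exponentials at n - e and n + e. *)
Lemma small_cvg v : e k * hm v (e k) @[k --> \oo] --> (0 : R).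
Proof.
have [C C0 [H _]] := Delta_dom s0 v.
have E k : e k * hm v (e k) = Int setT (fun t => e k * Delta v (e k * sh t ^+ 2)).
  by rewrite IntZ//; exact: hm_int.
rewrite (funext E) -[X in _ --> X]Int_zero.
apply: (dct (g := fun t => C * (2 * (1 + t ^+ 2)^-1)) measurableT _ _ _ _).2.
- by move=> k; apply: cont_meas => //; apply: cc_M; [exact: cc_cst|exact: cc_Dsh].
- by apply: intgZ => //; apply: intgZ => //; exact: intg_cauchy.
- move=> k t _; rewrite normrM (gtr0_norm (e0 k)).
  apply: le_trans (ler_wpM2l (ltW (e0 k)) (H _ (sqrM_ge0 _ (e0 k)))) _.
  rewrite mulrCA; apply: ler_wpM2l => //.
  apply: le_trans (ler_wpM2l (ltW (e0 k)) (sh_dom t (e0 k))) _.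
  rewrite mulrA; apply: ler_wpM2r; first by rewrite invr_ge0 (ltW (cauchy_gt0 t)).
  by rewrite mulrDr mulr1 divff ?gt_eqF//; have := e1 k; lra.
- move=> t _; rewrite -[X in _ --> X](mul0r (Delta v 0)); apply: cvgM => //.
  apply: (cont_seq (x := 0)); first exact: cc_Delta.
  by rewrite -[X in _ --> X](mul0r (sh t ^+ 2)); apply: cvgM => //; exact: cvg_cst.
Qed.

Lemma pv_pos_seq u n : (forall k, e k < n) -> Int (pv_domain n (e k)) (kern u n) @[k --> \oo] --> hp u n.
Proof.
move=> en; have n0 k : 0 <= n - e k by rewrite subr_ge0 ltW.
have E k : Int (pv_domain n (e k)) (kern u n) = hp u n +
  (* The error is a bounded factor times the gap of [hp] and [hm] at e, plus a bounded difference
     quotient times e [hm]; both tend to 0. *)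
  (- (cR u (n - e k) * (hp 1 (e k) - hm 1 (e k)) + cR (- 'i * u) (n - e k) * (hp 'i (e k) - hm 'i (e k))) +
   ((cR u (n + e k) - cR u (n - e k)) / e k * (e k * hm 1 (e k)) +
    (cR (- 'i * u) (n + e k) - cR (- 'i * u) (n - e k)) / e k * (e k * hm 'i (e k)))).
  have w : n - (n - e k) = e k by ring.
  rewrite pv_pos// /Gp w (hm_ri s0 (ue _ _) (e0 k)) /=.
  move: (e k) (e0 k) (hp u n) (cR u (n - e k)) (cR (- 'i * u) (n - e k)) (cR u (n + e k)) (cR (- 'i * u) (n + e k)) (hp 1 (e k)) (hm 1 (e k)) (hp 'i (e k)) (hm 'i (e k)).
  by move=> x x0 h a1 a2 a3 a4 a5 a6 a7 a8; field; rewrite gt_eqF.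
rewrite (funext E).
have b1 v k : `|cR v (n - e k)| <= nu v.
  apply: le_trans (cR_le s _ _) _; rewrite -[leRHS]mulr1; apply: ler_wpM2l; first exact: nu_ge0.
  by rewrite -[leRHS]expR0 ler_expR oppr_le0 mulr_ge0// ltW.
have b2 v k : `|(cR v (n + e k) - cR v (n - e k)) / e k| <= nu (s * v) * 2.
  rewrite normrM normfV (gtr0_norm (e0 k)) ler_pdivrMr//.
  apply: le_trans (cR_lip v (n0 k) _) _; first by have := e0 k; lra.
  by rewrite -mulrA; apply: ler_wpM2l; [exact: nu_ge0|lra].
rewrite -[X in _ --> X]addr0; apply: cvgD; first exact: cvg_cst.
rewrite -[X in _ --> X](addr0 (0 : R)); apply: cvgD.
  rewrite -[X in _ --> X](oppr0 R) -[X in _ --> - X](addr0 (0 : R)); apply: cvgN; apply: cvgD.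
    by apply: cvg0_bounded (b1 u) _; exact: gap_cvg.
  by apply: cvg0_bounded (b1 (- 'i * u)) _; exact: gap_cvg.
rewrite -[X in _ --> X](addr0 (0 : R)); apply: cvgD.
  by apply: cvg0_bounded (b2 u) _; exact: small_cvg.
by apply: cvg0_bounded (b2 (- 'i * u)) _; exact: small_cvg.
Qed.

End sequence.

Definition k0 u n : R := if 0 < n then hp u n else hm u (- n).

Lemma pv_cvg u n : n != 0 -> Int (pv_domain n e) (kern u n) @[e --> 0^'+] --> k0 u n.
Proof.
move=> nz; rewrite /k0; case: ifPn => [n0|].
  apply/cvg_at_rightP => e [e0 ec].
  (* Capping the sequence by min(1, n/2) changes only finitely many terms and gives the bounds e <=
     1 and e < n everywhere. *)
  pose b := Num.min 1 (n / 2); have b0 : 0 < b by rewrite /b lt_min ltr01 divr_gt0.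
  pose e' k := Num.min (e k) b.
  have ne : \forall k \near \oo, e k = e' k.
    have /cvgrPdist_lt /(_ b b0) := ec; apply: filterS => k.
    by rewrite sub0r normrN (gtr0_norm (e0 k)) /e' => h; rewrite min_l// ltW.
  have c' : Int (pv_domain n (e' k)) (kern u n) @[k --> \oo] --> hp u n.
    apply: pv_pos_seq.
    - by move=> k; rewrite /e' lt_min e0.
    - by move=> k; rewrite /e' ge_min /b ge_min lexx orbT.
    - by apply: cvg_trans ec; apply: near_eq_cvg; apply: filterS ne => k ->.
    - by move=> k; rewrite /e' gt_min /b; apply/orP; right; rewrite gt_min; apply/orP; right; lra.
  by apply: cvg_trans c'; apply: near_eq_cvg; apply: filterS ne => k <-.
rewrite -leNgt => n0; have nn : 0 < - n by rewrite oppr_gt0 lt_neqAle nz.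
apply: cvg_near_cst; near=> e; apply: pv_neg.
  by near: e; exact: nbhs_right_gt.
by near: e; exact: nbhs_right_le.
Unshelve. all: by end_near. Qed.

End principal_value.

(** * The dual kernels belong to one uniform class *)

Section kernel_class.
Context {R : realType}.
Local Open Scope complex_scope.
Variables (l s u v : R[i]).
Hypotheses (l0 : 0 < complex.Re l) (s0 : 0 < complex.Re s) (ls : l * s = (pi ^+ 2)%:C) (sv : s * v = u).
Local Notation E := (Eu l (l * u)).
Local Notation Dl := (Delta s).
Implicit Types (d n N t : R).

Lemma intg_E : intg setT E.
Proof. have [C0 bE] := Eu_bound l0 (l * u); exact: (iE (@cc_Eu _ l (l * u)) bE). Qed.

(** The damping exp(- d (p^2 + r^2)) on the hyperbola of norm n or - n; for fixed t it decreases in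
    n. *)
Definition gd d n t : R := expR (- (d * (n * (ch t ^+ 2 + sh t ^+ 2)))).

Lemma cc_gd d n : continuous (gd d n).
Proof. by rewrite /gd; ctac. Qed.

Lemma gd_ge0 d n t : 0 <= gd d n t. Proof. exact: expR_ge0. Qed.

Lemma hsum_ge t : 1 + t ^+ 2 <= ch t ^+ 2 + sh t ^+ 2.
Proof. by have := ch2_ge t; have := sqr_ge0 (sh t); lra. Qed.

Lemma gd_dec d n n' t : 0 <= d -> n <= n' -> gd d n' t <= gd d n t.
Proof.
move=> d0 nn; rewrite /gd ler_expR lerN2; apply: ler_wpM2l => //; apply: ler_wpM2r => //.
by have := hsum_ge t; have := cauchy_gt0 t; lra.
Qed.

Lemma gd_le1 d n t : 0 <= d -> 0 <= n -> gd d n t <= 1.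
Proof.
move=> d0 n0; rewrite /gd -[leRHS]expR0 ler_expR oppr_le0 mulr_ge0// mulr_ge0//.
by have := hsum_ge t; have := cauchy_gt0 t; lra.
Qed.

Lemma gd_inv d n t : 0 <= d -> 0 < n -> d * gd d n t <= n^-1 * (1 + t ^+ 2)^-1.
Proof.
move=> d0 n0; have c0 := cauchy_gt0 t; have h := hsum_ge t.
have y0 : 0 <= d * (n * (ch t ^+ 2 + sh t ^+ 2)) by rewrite mulr_ge0// mulr_ge0 ?(ltW n0)//; lra.
have q : d * (n * (1 + t ^+ 2)) <= d * (n * (ch t ^+ 2 + sh t ^+ 2)) by do 2 apply: ler_wpM2l => //; exact: ltW.
apply: le_trans (ler_wpM2l d0 (expRN_le_inv y0)) _.
rewrite -invfM ler_pdivrMr; last by lra.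
rewrite -ler_pdivrMl ?invr_gt0 ?mulr_gt0// invrK.
by rewrite mulrC; lra.
Qed.

Lemma kdp d n : 0 < n -> kd E d n = Int setT (fun t => Dl u (n * ch t ^+ 2) * gd d n t).
Proof.
move=> n0; rewrite /kd /lineI n0; apply: eq_Int => t _.
by rewrite /Dk (Ehat_Eu l0 s0 ls)//; [rewrite !sqr_sqrt_mul ?(ltW n0)// /gd -mulrDr|exact: intg_E].
Qed.

Lemma kdm d N : 0 < N -> kd E d (- N) = Int setT (fun t => Dl u (N * sh t ^+ 2) * gd d N t).
Proof.
move=> n0; rewrite /kd /lineI ifF; last by apply/negbTE; rewrite -leNgt oppr_le0 ltW.
apply: eq_Int => t _; rewrite /Dk (Ehat_Eu l0 s0 ls)//; last exact: intg_E.
by rewrite opprK !sqr_sqrt_mul ?(ltW n0)// /gd -mulrDr [sh t ^+ 2 + _]addrC.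
Qed.

Lemma eq_dom (f f' K : R -> R) : (forall n, 0 < n -> f n = f' n) -> dom f' K -> dom f K.
Proof.
move=> e [h1 h2]; split=> [n n0|n n' n0 nn']; first by rewrite e//; exact: h1.
by rewrite !e ?(lt_le_trans n0 nn')//; exact: h2.
Qed.

(** For n > 0 the argument n ch^2 is at least n (1 + t^2), so the decay of [Delta] already gives
    C/n; the damping enters only as a decreasing weight. *)
Lemma kd_pos_dom : exists2 C : R, 0 <= C & forall d, 0 <= d ->
  exists2 K, dom (kd E d) K & forall n, 0 < n -> K n <= C / n.
Proof.
have [C C0 [H1 H2]] := Delta_dom s0 u; exists (C * pi); first by rewrite mulr_ge0// pi_ge0.
move=> d d0; pose K n t := C / (1 + n * ch t ^+ 2) * gd d n t.
have cK n : 0 < n -> continuous (K n).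
  move=> n0; rewrite /K; apply: cc_M; last exact: cc_gd.
  apply: cc_M; first exact: cc_cst.
  apply: cc_inv; first by ctac.
  by move=> t; rewrite gt_eqF//; have := sqrM_ge0 (ch t) n0; lra.
have ig n : intg setT (fun t : R => C * n^-1 * (1 + t ^+ 2)^-1) by apply: intgZ => //; exact: intg_cauchy.
have Kb n t : 0 < n -> 0 <= K n t <= C * n^-1 * (1 + t ^+ 2)^-1.
  move=> n0; have q := sqrM_ge0 (ch t) n0.
  have q0 : 0 <= C / (1 + n * ch t ^+ 2) by rewrite divr_ge0//; lra.
  rewrite /K mulr_ge0//=; last exact: gd_ge0.
  apply: le_trans (_ : C / (1 + n * ch t ^+ 2) * 1 <= _).
    by apply: ler_wpM2l => //; apply: gd_le1 => //; exact: ltW.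
  by rewrite mulr1 -[leRHS]mulrA; apply: ler_wpM2l => //; exact: ch_dom.
have iK n : 0 < n -> intg setT (K n).
  move=> n0; apply: (intg_le _ _ (ig n)) => //; first exact: cont_meas (cK n n0).
  by move=> t _; have /andP[h1 h2] := Kb n t n0; rewrite ger0_norm.
exists (fun n => Int setT (K n)).
  apply: (eq_dom (f' := fun n => Int setT (fun t => Dl u (n * ch t ^+ 2) * gd d n t))); first by move=> n n0; exact: kdp.
  apply: (dom_Int (f := fun n t => Dl u (n * ch t ^+ 2) * gd d n t) (K := K)) => //.
    move=> t; apply: (dom_prod (f := fun n => Dl u (n * ch t ^+ 2)) (K := fun n => C / (1 + n * ch t ^+ 2))).
    - split=> [n n0|n n' n0 nn']; first by apply: H1; exact: sqrM_ge0.
      by apply: H2; [exact: sqrM_ge0|apply: ler_wpM2r => //; exact: sqr_ge0].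
    - by move=> n _; exact: gd_ge0.
    - by move=> n n' n0 nn'; exact: gd_dec.
  by move=> n n0; apply: cc_M; [exact: cc_Dch|exact: cc_gd].
move=> n n0; apply: le_trans (le_Int measurableT (iK n n0) (ig n) _) _.
  by move=> t _; have /andP[] := Kb n t n0.
rewrite IntZ//; last exact: intg_cauchy.
rewrite mulrAC; apply: ler_wpM2r; first by rewrite invr_ge0 ltW.
by apply: ler_wpM2l => //; exact: Int_cauchy_le.
Qed.

(** The weight left by the integration by parts: 4 d comes from differentiating the damping and 1/(N
    ch^2) from the derivative of sh/ch. Since d times the damping is O(1/N), no bound depends on
    d. *)
Definition wt d N t : R := (4 * d + (N * ch t ^+ 2)^-1) * gd d N t.

Lemma wt_bound d N t : 0 <= d -> 0 < N -> 0 <= wt d N t <= 5 / N * (1 + t ^+ 2)^-1.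
Proof.
move=> d0 N0; have c0 : 0 < ch t ^+ 2 by rewrite exprn_gt0// ch_gt0.
have i0 : 0 < (N * ch t ^+ 2)^-1 by rewrite invr_gt0 mulr_gt0.
apply/andP; split; first by rewrite /wt mulr_ge0 ?gd_ge0//; lra.
have h1 := gd_inv t d0 N0.
have h2 : (N * ch t ^+ 2)^-1 * gd d N t <= N^-1 * (1 + t ^+ 2)^-1.
  apply: le_trans (_ : (N * ch t ^+ 2)^-1 * 1 <= _).
    by apply: ler_wpM2l; [exact: ltW|apply: gd_le1 => //; exact: ltW].
  rewrite mulr1 invfM; apply: ler_wpM2l; first by rewrite invr_ge0 ltW.
  by rewrite lef_pV2 ?posrE ?cauchy_gt0//; exact: ch2_ge.
rewrite /wt mulrDl -[4 * d * _]mulrA.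
have -> : 5 / N * (1 + t ^+ 2)^-1 = 4 * (N^-1 * (1 + t ^+ 2)^-1) + N^-1 * (1 + t ^+ 2)^-1 by ring.
by lra.
Qed.

Lemma wt_dec d N N' t : 0 <= d -> 0 < N -> N <= N' -> wt d N' t <= wt d N t.
Proof.
move=> d0 N0 NN; have N'0 := lt_le_trans N0 NN.
have c0 : 0 < ch t ^+ 2 by rewrite exprn_gt0// ch_gt0.
have i0 : 0 < (N' * ch t ^+ 2)^-1 by rewrite invr_gt0 mulr_gt0.
apply: ler_pM; [by lra|exact: gd_ge0| |exact: gd_dec].
have h : N * ch t ^+ 2 <= N' * ch t ^+ 2 by apply: ler_wpM2r => //; exact: ltW.
by rewrite lerD2l lef_pV2// posrE mulr_gt0.
Qed.

Lemma cc_wt d N : 0 < N -> continuous (wt d N).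
Proof.
move=> N0; rewrite /wt; apply: cc_M; last exact: cc_gd.
apply: cc_D; first exact: cc_cst.
apply: cc_inv; first by ctac.
by move=> t; rewrite gt_eqF// mulr_gt0// exprn_gt0// ch_gt0.
Qed.

Lemma intg_pos d N : 0 <= d -> 0 < N -> intg setT (fun t => Dl u (N * sh t ^+ 2) * gd d N t).
Proof.
move=> d0 N0; apply: (intg_le _ _ (intg_norm measurableT (hm_int s0 u N0))) => //.
  by apply: cont_meas => //; apply: cc_M; [exact: cc_Dsh|exact: cc_gd].
move=> t _; rewrite normrM -[leRHS]mulr1; apply: ler_wpM2l => //.
by rewrite ger0_norm ?gd_ge0//; apply: gd_le1 => //; exact: ltW.
Qed.

(** The constant |Re v| may be put into the majorant because its variation is zero; the decay in N
    is supplied by [wt]. *)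
Lemma half_bound : exists2 C : R, 0 <= C & (forall z, 0 <= z -> `|complex.Re v - Dl v z| <= `|complex.Re v| + C / (1 + z)) /\
  (forall z z', 0 <= z -> z <= z' -> `|(complex.Re v - Dl v z) - (complex.Re v - Dl v z')| <= (`|complex.Re v| + C / (1 + z)) - (`|complex.Re v| + C / (1 + z'))).
Proof.
have [C C0 [H1 H2]] := Delta_dom s0 v; exists C => //; split=> [z z0|z z' z0 zz'].
  by apply: le_trans (ler_normB _ _) _; rewrite lerD2l; exact: H1.
have -> : (complex.Re v - Dl v z) - (complex.Re v - Dl v z') = - (Dl v z - Dl v z') by ring.
by rewrite normrN; apply: le_trans (H2 _ _ z0 zz') _; lra.
Qed.

Lemma wt_int (C : R) d N (f : R -> R) : 0 <= d -> 0 < N -> continuous f -> 0 <= C -> (forall t, `|f t| <= C) ->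
  intg setT (fun t => f t * wt d N t).
Proof.
move=> d0 N0 cf C0 fC; apply: (intg_le (g := fun t : R => C * (5 / N) * (1 + t ^+ 2)^-1)) => //.
- by apply: cont_meas => //; apply: cc_M => //; exact: cc_wt.
- by apply: intgZ => //; exact: intg_cauchy.
- move=> t _; have /andP[h1 h2] := wt_bound t d0 N0.
  by rewrite normrM (ger0_norm h1) -mulrA; apply: ler_pM.
Qed.

(* integration by parts against (sh/ch) Mk gd, gaining a factor 1/N *)
Lemma kd_neg_parts d N : 0 <= d -> 0 < N ->
  kd E d (- N) = 2^-1 * Int setT (fun t => (complex.Re v - Dl v (N * sh t ^+ 2)) * wt d N t).
Proof.
move=> d0 N0; rewrite kdm//; have [C C0 [H1 H2]] := half_bound.
pose A t := Dl u (N * sh t ^+ 2) * gd d N t.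
pose B t := (complex.Re v - Dl v (N * sh t ^+ 2)) * wt d N t.
have cA : continuous A by apply: cc_M; [exact: cc_Dsh|exact: cc_gd].
have cB : continuous B.
  by apply: cc_M; [apply: cc_D; [exact: cc_cst|apply: cc_N; exact: cc_Dsh]|exact: cc_wt].
have iA : intg setT A by exact: intg_pos.
have iB : intg setT B.
  apply: (@wt_int (`|complex.Re v| + C)) => //.
  - by apply: cc_D; [exact: cc_cst|apply: cc_N; exact: cc_Dsh].
  - by rewrite addr_ge0.
  - move=> t; have q := sqrM_ge0 (sh t) N0; apply: le_trans (H1 _ q) _; rewrite lerD2l ler_pdivrMr; last by lra.
    by rewrite ler_peMr//; lra.
pose P t := sh t / ch t * Mk s 0 u (N * sh t ^+ 2) * gd d N t.
have dP (t : R) : is_derive t 1 P (A t - 2^-1 * B t).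
  have c0 := ch_gt0 t.
  have d1 : is_derive t 1 (fun t : R => N * sh t ^+ 2) (N * (2 * sh t * ch t)).
    by eapply dE; [eapply dM; [exact: dcst|eapply dX; exact: d_sh]|cbv beta; rewrite /= expr1; ring].
  have d2 := dcomp (f := fun t => N * sh t ^+ 2) (g := Mk s 0 u) d1 (@d_Mk _ s s0 0 u _).
  have d3 : is_derive t 1 (fun t : R => sh t / ch t) ((ch t ^+ 2)^-1).
    have dv : is_derive t 1 (fun t : R => (ch t)^-1) (- (sh t / ch t ^+ 2)).
      have h := @is_deriveV R ch t (sh t) 1 (lt0r_neq0 c0) (d_ch t).
      by apply: (dE h); rewrite /GRing.scale /= mulNr mulrC.
    eapply dE; [exact: (dM (d_sh t) dv)|]; cbv beta.
    have := ch2_sh2 t; move: (ch t) (sh t) c0 => x y x0 h.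
    have -> : x * x^-1 + y * - (y / x ^+ 2) = (x ^+ 2 - y ^+ 2) / x ^+ 2 by field; rewrite gt_eqF.
    by rewrite h addrK mul1r.
  have d4 : is_derive t 1 (gd d N) (- (4 * d * N * sh t * ch t) * gd d N t).
    rewrite /gd; eapply dE; [eapply dexp; eapply dN; eapply dM; [exact: dcst|eapply dM; [exact: dcst|eapply dD; [eapply dX; exact: d_ch|eapply dX; exact: d_sh]]]|].
    by cbv beta; rewrite /= !expr1; move: (expR _) => e; ring.
  eapply dE; [exact: (dM (dM d3 d2) d4)|]; cbv beta.
  rewrite /A /B /wt -(zMk s v) sv DeltaE.
  have := ch2_sh2 t; move: (ch t) (sh t) c0 (gd d N t) (Mk s 0 u (N * sh t ^+ 2)) (Mk s 1 (s * u) (N * sh t ^+ 2)) => x y x0 g m1 m2 h.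
  have -> : y ^+ 2 = x ^+ 2 - 1 by rewrite h; ring.
  have -> : N * (2 * y * x) = 2 * N * y * x by ring.
  have y2 : y * y = x ^+ 2 - 1 by rewrite -expr2 h; ring.
  transitivity (g * (m1 / x ^+ 2 - 2 * N * (y * y) * m2 - 4 * d * N * (y * y) * m1)).
    by field; rewrite gt_eqF.
  by rewrite y2; field; rewrite !gt_eqF.
have [CM CM0 HM] := Mk_decay s0 u (leqnn 0).
have L : Int `[- m%:R, m%:R] (fun t => A t - 2^-1 * B t) @[m --> \oo] --> (0 : R).
  have cAB : continuous (fun t => A t - 2^-1 * B t).
    by apply: cc_D => //; apply: cc_N; apply: cc_M => //; exact: cc_cst.
  apply: (cvg_rate (K := 2 * (CM / N))) => m m0; rewrite subr0.
  have -> : Int `[- m%:R, m%:R] (fun t => A t - 2^-1 * B t) = P m%:R - P (- m%:R).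
    by apply: (Int_FTC (opp_nat_le m) cAB).
  have -> : P m%:R - P (- m%:R) = 2 * P m%:R by rewrite /P /gd shN chN sqrrN; ring.
  rewrite normrM (ger0_norm (ler0n R 2)) -mulrA; apply: ler_wpM2l => //.
  set t := m%:R : R; have t1 : 1 <= t by rewrite ler1n.
  have st : t <= sh t by apply: sh_ge; lra.
  have c0 := ch_gt0 t; have sc : sh t <= ch t by have := expR_ge0 (- t); have := @exp_ch_sh R t; lra.
  have q := sqrM_ge0 (sh t) N0.
  rewrite /P normrM (ger0_norm (gd_ge0 _ _ _)).
  apply: le_trans (_ : `|sh t / ch t * Mk s 0 u (N * sh t ^+ 2)| * 1 <= _).
    by apply: ler_wpM2l => //; apply: gd_le1 => //; exact: ltW.
  rewrite mulr1 normrM (ger0_norm (_ : 0 <= sh t / ch t)); last by rewrite divr_ge0//; lra.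
  apply: le_trans (_ : 1 * `|Mk s 0 u (N * sh t ^+ 2)| <= _).
    by apply: ler_wpM2r => //; rewrite ler_pdivrMr// mul1r.
  have := HM _ q; rewrite expr0 => h; apply: le_trans h _.
  rewrite -mulrA; apply: ler_wpM2l => //; rewrite -invfM.
  have : N * t <= N * sh t ^+ 2 by apply: ler_wpM2l; [exact: ltW|nra].
  by move=> h; rewrite lef_pV2 ?posrE ?mulr_gt0//; lra.
have iAB : intg setT (fun t => A t - 2^-1 * B t) by apply: intgB => //; exact: intgZ.
have : Int setT (fun t => A t - 2^-1 * B t) = 0 by apply: (cvg_unique _ (IntT_lim iAB) L).
rewrite IntB//; last exact: intgZ.
by rewrite IntZ// => /eqP; rewrite subr_eq0 => /eqP.
Qed.

(** Near t = 0 the integrand has no decay in N, so a direct estimate misses C/N; the form after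
    integration by parts is a dominated function times a decreasing weight of size 1/N. *)
Lemma kd_neg_dom : exists2 C : R, 0 <= C & forall d, 0 <= d ->
  exists2 K, dom (fun N => kd E d (- N)) K & forall n, 0 < n -> K n <= C / n.
Proof.
have [C C0 [H1 H2]] := half_bound; pose Cv := `|complex.Re v| + C.
have Cv0 : 0 <= Cv by rewrite addr_ge0.
exists (2^-1 * (Cv * 5 * pi)); first by rewrite !mulr_ge0// pi_ge0.
move=> d d0; pose kz N t : R := `|complex.Re v| + C / (1 + N * sh t ^+ 2).
have ckz N : 0 < N -> continuous (kz N).
  move=> N0; apply: cc_D; first exact: cc_cst.
  apply: cc_M; first exact: cc_cst.
  apply: cc_inv; first by ctac.
  by move=> t; rewrite gt_eqF//; have := sqrM_ge0 (sh t) N0; lra.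
have bkz N t : 0 < N -> `|kz N t| <= Cv.
  move=> N0; have q := sqrM_ge0 (sh t) N0; rewrite ger0_norm; last by rewrite addr_ge0// divr_ge0//; lra.
  by rewrite /kz /Cv lerD2l ler_pdivrMr; [rewrite ler_peMr//; lra|lra].
have iK N : 0 < N -> intg setT (fun t => kz N t * wt d N t).
  by move=> N0; apply: (@wt_int Cv) => //; [exact: ckz|move=> t; exact: bkz].
exists (fun N => `|2^-1| * Int setT (fun t => kz N t * wt d N t)).
  apply: (eq_dom (f' := fun N => 2^-1 * Int setT (fun t => (complex.Re v - Dl v (N * sh t ^+ 2)) * wt d N t))).
    by move=> N N0; exact: kd_neg_parts.
  apply: dom_scale.
  apply: (dom_Int (f := fun N t => (complex.Re v - Dl v (N * sh t ^+ 2)) * wt d N t) (K := fun N t => kz N t * wt d N t)) => //.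
    move=> t; apply: (dom_prod (f := fun N => complex.Re v - Dl v (N * sh t ^+ 2)) (K := fun N => kz N t) (w := fun N => wt d N t)).
    - split=> [n n0|n n' n0 nn']; first by apply: H1; exact: sqrM_ge0.
      by apply: H2; [exact: sqrM_ge0|apply: ler_wpM2r => //; exact: sqr_ge0].
    - by move=> n n0; have /andP[] := wt_bound t d0 n0.
    - by move=> n n' n0 nn'; exact: wt_dec.
  by move=> N N0; apply: cc_M; [apply: cc_D; [exact: cc_cst|apply: cc_N; exact: cc_Dsh]|exact: cc_wt].
move=> N N0; rewrite ger0_norm// -[leRHS]mulrA; apply: ler_wpM2l => //.
have ig : intg setT (fun t : R => Cv * (5 / N) * (1 + t ^+ 2)^-1) by apply: intgZ => //; exact: intg_cauchy.
apply: le_trans (le_Int measurableT (iK N N0) ig _) _.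
  move=> t _; have /andP[h1 h2] := wt_bound t d0 N0.
  by rewrite -[leRHS]mulrA; apply: ler_pM => //; [have q := sqrM_ge0 (sh t) N0; rewrite /kz addr_ge0// divr_ge0//; lra|exact: le_trans (ler_norm _) (bkz N t N0)].
rewrite IntZ//; last exact: intg_cauchy.
have -> : Cv * 5 * pi / N = Cv * (5 / N) * pi by ring.
by apply: ler_wpM2l; [rewrite mulr_ge0// divr_ge0// ltW|exact: Int_cauchy_le].
Qed.

Lemma kd_cls : exists2 C : R, 0 <= C & forall d, 0 <= d -> cls C (kd E d).
Proof.
have [C1 C10 H1] := kd_pos_dom; have [C2 C20 H2] := kd_neg_dom.
exists (C1 + C2); first by rewrite addr_ge0.
move=> d d0; have [K1 d1 b1] := H1 d d0; have [K2 d2 b2] := H2 d d0.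
exists K1, K2; split=> // n n0.
  by apply: le_trans (b1 n n0) _; rewrite ler_pM2r ?invr_gt0//; lra.
by apply: le_trans (b2 n n0) _; rewrite ler_pM2r ?invr_gt0//; lra.
Qed.

Lemma kd0 n : n != 0 -> kd E 0 n = k0 s u n.
Proof.
have g1 N t : gd 0 N t = 1 by rewrite /gd mul0r oppr0 expR0.
move=> nz; rewrite /k0; case: ifPn => [n0|].
  by rewrite kdp//; apply: eq_Int => t _; rewrite g1 mulr1.
rewrite -leNgt => n0; have N0 : 0 < - n by rewrite oppr_gt0 lt_neqAle nz.
by rewrite -{1}[n]opprK kdm//; apply: eq_Int => t _; rewrite g1 mulr1.
Qed.

Lemma k0_cls : exists2 C : R, 0 <= C & cls C (k0 s u).
Proof.
have [C C0 H] := kd_cls; exists C => //; have [K1 [K2 [d1 d2 b1 b2]]] := H 0 (lexx 0).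
exists K1, K2; split=> //.
  by apply: eq_dom d1 => n n0; rewrite kd0// gt_eqF.
by apply: eq_dom d2 => n n0; rewrite kd0// oppr_eq0 gt_eqF.
Qed.

Lemma kd_cvg (d : nat -> R) n : (forall k, 0 <= d k) -> d k @[k --> \oo] --> (0 : R) -> n != 0 ->
  kd E (d k) n @[k --> \oo] --> k0 s u n.
Proof.
move=> d0 dc nz.
have gc N t : gd (d k) N t @[k --> \oo] --> (1 : R).
  have -> : 1 = gd 0 N t by rewrite /gd mul0r oppr0 expR0.
  by apply: (cont_seq (F := fun x => gd x N t)) => //; rewrite /gd; apply/cc_exp; ctac.
have main N (f : R -> R) : 0 < N -> continuous f -> intg setT f ->
   Int setT (fun t => f t * gd (d k) N t) @[k --> \oo] --> Int setT f.
  move=> N0 cf iff; apply: (dct (g := fun t => `|f t|) measurableT _ _ _ _).2.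
  - by move=> k; apply: cont_meas => //; apply: cc_M => //; exact: cc_gd.
  - exact: intg_norm.
  - move=> k t _; rewrite normrM -[leRHS]mulr1; apply: ler_wpM2l => //.
    by rewrite ger0_norm ?gd_ge0//; apply: gd_le1 => //; exact: ltW.
  - by move=> t _; rewrite -[X in _ --> X]mulr1; apply: cvgM => //; exact: cvg_cst.
rewrite /k0; case: ifPn => [n0|].
  under eq_cvg do rewrite kdp//.
  by apply: main => //; [exact: cc_Dch|exact: hp_int].
rewrite -leNgt => n0; have N0 : 0 < - n by rewrite oppr_gt0 lt_neqAle nz.
under eq_cvg do rewrite -{1}[n]opprK kdm//.
by apply: main => //; [exact: cc_Dsh|exact: hm_int].
Qed.

Local Notation rho := (Num.sqrt 6 : R).
Local Notation nx x := (nn (x.1%:~R : R) x.2%:~R).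

(** The limit of vanishing damping and the limit of the truncation both equal the iterated row sum;
    the first is known from the left side. *)
Lemma star_limit (c Nr : nat) (b : int * int -> R) (M : R) : (0 < c)%N -> (0 < Nr)%N ->
  periodic (24 * c)%N (4 * c)%N b -> (forall x, `|b x| <= M) ->
  (forall x, b (eps x) = b x) -> b (0, 0) = 0 ->
  (forall x, Gh c b (eps x) = Gh c b x :> R) -> Gh c b (0, 0) = 0 :> R ->
  (forall X Y, Gh c b (X + Nr%:Z, Y) = Gh c b (X, Y) :> R) ->
  (forall X Y, \sum_(i < Nr) Gh c b (X + i%:Z, Y) = 0 :> R) ->
  pi / (2 * rho * c%:R ^+ 2) * tsum (rterm (Gh c b) (fun n => k0 s u n * (`|n| <= T)%R%:R)) @[T --> +oo%R] -->
  tsum (fun x => om x * b x * Llim c E (nx x)).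
Proof.
move=> c0 Nr0 pb bM be b0 Ge G0 Gp Gm.
have cR0 : 0 < c%:R :> R by rewrite ltr0n.
have GM := fun x => @Gh_le R c b M x bM.
have [C C0 kC] := kd_cls; have [C' C'0 k0C] := k0_cls.
have [C1 bE] := Eu_bound l0 (l * u).
have cE := @cc_Eu _ l (l * u); have eE := @EuN _ l (l * u).
pose d (m : nat) : R := 4 * pi ^+ 2 / (m.+1%:R ^+ 2 * c%:R ^+ 2).
have d0 m : 0 <= d m by rewrite divr_ge0// mulr_ge0// sqr_ge0.
have dc : d m @[m --> \oo] --> (0 : R).
  have -> : d = fun m : nat => 4 * pi ^+ 2 / c%:R ^+ 2 * ((m.+1%:R^-1 * 1) * (m.+1%:R^-1 * 1)).
    apply/funext => m; rewrite /d; have : 0 < m.+1%:R :> R by rewrite ltr0n.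
    by move=> m0; move: (pi : R) => p; field; rewrite !gt_eqF.
  have z := @cvg_natV R 1.
  rewrite -[X in _ --> X](mulr0 (4 * pi ^+ 2 / c%:R ^+ 2)); apply: cvgM; first exact: cvg_cst.
  by rewrite -[X in _ --> X](mulr0 (0 : R)); apply: cvgM.
have L1 := core_limit c0 cE eE bE pb bM be b0 Ge G0.
have sK m : tsummable (rterm (Gh c b) (kd E (d m))).
  exact: (core_identity c0 cE eE bE pb bM be b0 Ge G0 (ltn0Sn m)).1.
have L2 := @rows_cvg R Nr _ (Gh c b) Nr0 GM G0 Gp Gm C C0 (fun m => kd E (d m)) (k0 s u) (fun m => kC _ (d0 m)) (fun n nz => kd_cvg d0 dc nz) sK.
have L3 := @rows_star R Nr _ (Gh c b) Nr0 GM G0 Gp Gm C' C'0 (k0 s u) k0C.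
have -> : tsum (fun x => om x * b x * Llim c E (nx x)) = pi / (2 * rho * c%:R ^+ 2) * tsum (fun Y => tsum (fun X => rterm (Gh c b) (k0 s u) (X, Y))).
  apply: (cvg_unique (@Rhausdorff R) L1).
  by apply: cvgM; [exact: cvg_cst|exact: L2].
by apply: cvgM; [exact: cvg_cst|exact: L3].
Qed.

End kernel_class.

(** * Reindexing periodic sums over residues *)

Section lattice_sums.
Variables (K : zmodType) (N1 N2 : nat).
Hypotheses (N10 : (0 < N1)%N) (N20 : (0 < N2)%N).

Definition lat (y : int * int) : int * int := (N1%:Z * y.1, N2%:Z * y.2).
Definition addp (x y : int * int) : int * int := (x.1 + y.1, x.2 + y.2).
Definition latperiodic (F : int * int -> K) := forall x y, F (addp x (lat y)) = F x.
Definition latmap (g : int * int -> int * int) := forall x y, exists z, g (addp x (lat y)) = addp (g x) (lat z).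

Lemma latred (x : int * int) : exists2 p : 'I_N1 * 'I_N2, True & exists y, x = addp ((p.1 : nat)%:Z, (p.2 : nat)%:Z) (lat y).
Proof.
have [i hi [k ek]] := modz_nat x.1 N10; have [j hj [m em]] := modz_nat x.2 N20.
exists (Ordinal hi, Ordinal hj) => //; exists (k, m).
by rewrite /addp /lat /= -ek -em; case: x {ek em}.
Qed.

Lemma latred_inj (p q : 'I_N1 * 'I_N2) y :
  ((p.1 : nat)%:Z, (p.2 : nat)%:Z) = addp ((q.1 : nat)%:Z, (q.2 : nat)%:Z) (lat y) -> p = q.
Proof.
case: p q y => [p1 p2] [q1 q2] [y1 y2]; rewrite /addp /lat /= => -[e1 e2].
have a1 := ltn_ord p1; have a2 := ltn_ord p2; have b1 := ltn_ord q1; have b2 := ltn_ord q2.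
have h (N : nat) (a b : nat) (y : int) : (a < N)%N -> (b < N)%N -> a%:Z = b%:Z + N%:Z * y -> a = b.
  move=> aN bN e; have y0 : y = 0 by nia.
  by move: e; rewrite y0 mulr0 addr0 => -[].
by congr (_, _); apply/val_inj => /=; [exact: (h _ _ _ _ a1 b1 e1)|exact: (h _ _ _ _ a2 b2 e2)].
Qed.

(** A map compatible with the lattice and invertible modulo it on the left is injective on the
    finite set of residues, hence permutes them. *)
Lemma lattice_reindex (F : int * int -> K) (g gi : int * int -> int * int) :
  latperiodic F -> latmap g -> latmap gi -> (forall x, exists z, gi (g x) = addp x (lat z)) ->
  \sum_(i < N1) \sum_(j < N2) F (g (i%:Z, j%:Z)) = \sum_(i < N1) \sum_(j < N2) F (i%:Z, j%:Z).
Proof.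
move=> Fp gl gil gk; rewrite !pair_big /=.
pose emb (p : 'I_N1 * 'I_N2) : int * int := ((p.1 : nat)%:Z, (p.2 : nat)%:Z).
have hex p : exists q : 'I_N1 * 'I_N2, exists y, g (emb p) = addp (emb q) (lat y).
  by have [q _ hq] := latred (g (emb p)); exists q.
pose h p := sval (cid (hex p)).
have hE p : exists y, g (emb p) = addp (emb (h p)) (lat y) by rewrite /h; case: cid.
have hinj : injective h.
  move=> p q hpq; have [y ey] := hE p; have [z ez] := hE q; rewrite hpq in ey.
  have e : g (emb p) = addp (g (emb q)) (lat (y.1 - z.1, y.2 - z.2)).
    by rewrite ey ez /addp /lat /=; congr (_, _); ring.
  have [w1 f1] := gk (emb p); have [w2 f2] := gk (emb q).
  have [w3 f3] := gil (g (emb q)) (y.1 - z.1, y.2 - z.2).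
  apply: (@latred_inj p q (w2.1 + w3.1 - w1.1, w2.2 + w3.2 - w1.2)).
  move: f1; rewrite e f3 f2 /addp /lat /emb /= => -[e1 e2].
  by congr (_, _); [move: e1|move: e2]; clear; lia.
rewrite [RHS](reindex_inj hinj) /=; apply: eq_bigr => p _.
by have [y ey] := hE p; rewrite -/(emb p) ey Fp.
Qed.

End lattice_sums.

Lemma signed_root (c : nat) : (0 < c)%N -> exists u : int, [/\ (u = 7 %[mod 24])%Z, exists k, u = 7 + 24 * k &
  exists m, u ^+ 2 = 1 + 48 * c%:Z * m].
Proof.
move=> c0; have [u u7 u2] := exists_square_root_one c0.
have e : (u ^ 2 %% (48 * c) = 1)%N by rewrite u2 modn_small//; lia.
exists u%:Z; split; first by lia.
  by exists ((u%:Z - 7) %/ 24)%Z; lia.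
exists (u ^ 2 %/ (48 * c))%N%:Z; have := divn_eq (u ^ 2) (48 * c); rewrite e.
move: (u ^ 2 %/ (48 * c))%N => q; rewrite -mulnn expr2 => h.
by rewrite -PoszM h PoszD !PoszM; ring.
Qed.

(** * Gauss sums and their symmetries *)

Section multiplier.
Context {R : realType}.
Local Open Scope complex_scope.
Local Notation nx x := (nn (x.1%:~R : R) x.2%:~R).

Definition ec (x : R) : R[i] := cos (2 * pi * x) +i* sin (2 * pi * x).

Lemma ecD x y : ec (x + y) = ec x * ec y.
Proof. by rewrite /ec mulrDr cosD sinD; apply/eqP; rewrite eq_complex /=; apply/andP; split; apply/eqP; ring. Qed.

Lemma ec_int (k : int) : ec k%:~R = 1.
Proof.
have := cosD2pi_int (0 : R) k; have := sinD2pi_int (0 : R) k; rewrite !add0r /ec => -> ->.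
by rewrite cos0 sin0.
Qed.

Lemma ecDint x (k : int) : ec (x + k%:~R) = ec x.
Proof. by rewrite ecD ec_int mulr1. Qed.

(** The pairing B in the coordinates X = 24 m1, Y = 4 m2. *)
Definition bx (x y : int * int) : R := x.1%:~R * y.1%:~R / 24 - x.2%:~R * y.2%:~R / 4.

Variables (c : nat) (a b d : int).
Hypotheses (c0 : (0 < c)%N) (det1 : a * d - b * c%:Z = 1).
Let cn0 : (c%:R : R) != 0. Proof. by rewrite pnatr_eq0 -lt0n. Qed.
Let N10 : (0 < 24 * c)%N. Proof. by rewrite muln_gt0. Qed.
Let N20 : (0 < 4 * c)%N. Proof. by rewrite muln_gt0. Qed.

Lemma ec_eq (t t' : R) (k : int) : t = t' + c%:R * k%:~R -> ec (t / c%:R) = ec (t' / c%:R).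
Proof. by move=> ->; rewrite mulrDl mulrAC divff// mul1r ecDint. Qed.

(** c times the phase of psi_M; [Ww] sums over residues modulo (24 c, 4 c), which combines the sums
    over mu and over m. *)
Definition ph (x v : int * int) : R := a%:~R * nx x - bx x v + d%:~R * nx v.
Definition Fw (j : nat) (v x : int * int) : R[i] := (fcl j x)%:~R * ec (ph x v / c%:R).
Definition Ww (j : nat) (v : int * int) : R[i] :=
  \sum_(i < 24 * c) \sum_(k < 4 * c) Fw j v (i%:Z, k%:Z).

Lemma fcl_lat j x y : fcl j (addp x (lat (24 * c) (4 * c) y)) = fcl j x.
Proof.
rewrite -(fclD j x (c%:Z * y.1, c%:Z * y.2)) /addp /lat /=; congr (fcl j (_, _)); rewrite PoszM; ring.
Qed.

Lemma Fw_per j v : latperiodic (24 * c) (4 * c) (Fw j v).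
Proof.
move=> x y; rewrite /Fw fcl_lat; congr (_ * _).
apply: (@ec_eq _ _ (a * (x.1 * y.1 + 12 * c%:Z * y.1 ^+ 2 - x.2 * y.2 - 2 * c%:Z * y.2 ^+ 2) - (y.1 * v.1 - y.2 * v.2))).
rewrite /ph /nn /bx /addp /lat /= !PoszM !(rmorphD, rmorphB, rmorphM, rmorphXn) /= -!pmulrn.
by field.
Qed.

Lemma latmap_add s : latmap (24 * c) (4 * c) (addp^~ s).
Proof. by move=> x y; exists y; rewrite /addp /=; congr (_, _); ring. Qed.

Lemma latmap_eps : latmap (24 * c) (4 * c) eps.
Proof.
by move=> x y; exists (5 * y.1 + 2 * y.2, 12 * y.1 + 5 * y.2); rewrite /addp /lat /eps /= !PoszM; congr (_, _); ring.
Qed.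

Lemma latmap_epsi : latmap (24 * c) (4 * c) epsi.
Proof.
by move=> x y; exists (5 * y.1 - 2 * y.2, - 12 * y.1 + 5 * y.2); rewrite /addp /lat /epsi /= !PoszM; congr (_, _); ring.
Qed.

Lemma latmap_scale (p q : int) : latmap (24 * c) (4 * c) (fun x => (p * x.1, q * x.2)).
Proof. by move=> x y; exists (p * y.1, q * y.2); rewrite /addp /lat /=; congr (_, _); ring. Qed.

(** Periodicity modulo (24, 4) rather than (24 c, 4 c) is where the determinant enters: the
    summation variable is moved by d times the change of v, and a d - 1 = b c makes the remaining
    phase integral. *)
Lemma Ww_per j v y : Ww j (v.1 + 24 * y.1, v.2 + 4 * y.2) = Ww j v.
Proof.
pose s : int * int := (24 * (d * y.1), 4 * (d * y.2)).
rewrite /Ww -[LHS](@lattice_reindex _ _ _ N10 N20 _ (addp^~ s) (addp^~ (- s.1, - s.2)));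
  [|exact: Fw_per|exact: latmap_add|exact: latmap_add|]; last first.
  by move=> x; exists (0, 0); rewrite /addp /lat /= !mulr0; congr (_, _); ring.
apply: eq_bigr => i _; apply: eq_bigr => k _; set x := (i%:Z, k%:Z).
rewrite /Fw; congr (_%:~R * _); first exact: (fclD j x (d * y.1, d * y.2)).
have bc : (b%:~R : R) = (a%:~R * d%:~R - 1) / c%:R.
  have := congr1 (fun z : int => z%:~R : R) det1; rewrite rmorphB !rmorphM /= -pmulrn mulr1z => h.
  by apply: (canRL (mulfK cn0)); lra.
apply: (@ec_eq _ _ (b * (x.1 * y.1 - x.2 * y.2 + d * (12 * y.1 ^+ 2 - 2 * y.2 ^+ 2)))).
rewrite /ph /nn /bx /addp /s /= !(rmorphD, rmorphB, rmorphM, rmorphXn) /= bc -?pmulrn.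
by field.
Qed.

(** [eps] preserves both Q and B, so applying it to the summation variable and to v leaves the phase
    unchanged. *)
Lemma Ww_eps j v : Ww j (eps v) = Ww j v.
Proof.
rewrite /Ww -[LHS](@lattice_reindex _ _ _ N10 N20 _ eps epsi);
  [|exact: Fw_per|exact: latmap_eps|exact: latmap_epsi|]; last first.
  by move=> x; exists (0, 0); rewrite epsK /addp /lat /= !mulr0 !addr0; case: x.
apply: eq_bigr => i _; apply: eq_bigr => k _; rewrite /Fw fcl_eps; congr (_ * ec (_ / _)).
by rewrite /ph /nn /bx /eps /= !(rmorphD, rmorphM) /=; field.
Qed.

Lemma Ww_scale j (p q : int) (s : int) v : p ^+ 2 = 1 -> q ^+ 2 = 1 ->
  (forall x, fcl j (p * x.1, q * x.2) = s * fcl j x) -> Ww j (p * v.1, q * v.2) = s%:~R * Ww j v.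
Proof.
move=> p2 q2 fs; have r2 (z : int) : z ^+ 2 = 1 -> (z%:~R : R) * z%:~R = 1 by move=> h; rewrite -expr2 -rmorphXn /= h.
rewrite /Ww -[LHS](@lattice_reindex _ _ _ N10 N20 _ (fun x => (p * x.1, q * x.2)) (fun x => (p * x.1, q * x.2)));
  [|exact: Fw_per|exact: latmap_scale|exact: latmap_scale|]; last first.
  by move=> x; exists (0, 0); rewrite /addp /lat /= !mulrA -!expr2 p2 q2 !mul1r !mulr0 !addr0; case: x.
rewrite mulr_sumr; apply: eq_bigr => i _; rewrite mulr_sumr; apply: eq_bigr => k _.
rewrite /Fw fs rmorphM /= mulrA; congr (_ * ec (_ / _)).
have := r2 p p2; have := r2 q q2; rewrite /ph /nn /bx /= !rmorphM /=.
by move: (p%:~R : R) (q%:~R : R) => P Q hQ hP; field: hP hQ.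
Qed.

(** Multiplication by 7 itself need not preserve the phase. It is replaced by a u congruent to 7
    modulo 24, using the periodicity in v; u^2 = 1 modulo 48 c then changes the phase by an integer
    only. *)
Lemma Ww_seven j v : Ww j (7 * v.1, v.2) = - Ww j v.
Proof.
have [u [u7z [k uk] [m um]]] := signed_root c0.
have -> : Ww j (7 * v.1, v.2) = Ww j (u * v.1, v.2).
  have -> : (u * v.1, v.2) = (7 * v.1 + 24 * (k * v.1), v.2 + 4 * 0) by rewrite uk; congr (_, _); ring.
  exact/esym/(Ww_per j (7 * v.1, v.2) (k * v.1, 0)).
rewrite /Ww -[LHS](@lattice_reindex _ _ _ N10 N20 _ (fun x => (u * x.1, 1 * x.2)) (fun x => (u * x.1, 1 * x.2)));
  [|exact: Fw_per|exact: latmap_scale|exact: latmap_scale|]; last first.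
  move=> x; exists (2 * m * x.1, 0); rewrite /addp /lat /= !mul1r mulr0 addr0 mulrA -expr2 um PoszM.
  by congr (_, _); ring.
rewrite -sumrN; apply: eq_bigr => i _; rewrite -sumrN; apply: eq_bigr => k' _; set x := (i%:Z, k'%:Z).
rewrite /Fw mul1r (@fcl_seven j u x u7z) rmorphN /= mulNr; congr (- (_ * _)).
have umR : (u%:~R : R) ^+ 2 = 1 + 48 * c%:R * m%:~R.
  by have := congr1 (fun z : int => z%:~R : R) um; rewrite !(rmorphD, rmorphM, rmorphXn) /= -!pmulrn.
apply: (@ec_eq _ _ (a * (m * x.1 ^+ 2) - 2 * m * x.1 * v.1 + d * (m * v.1 ^+ 2))).
rewrite /ph /nn /bx /= !(rmorphD, rmorphB, rmorphM, rmorphXn) /= -!pmulrn.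
by move: (u%:~R : R) umR => U hU; field: hU.
Qed.

Lemma Ww_basis j v : Ww j v = (fcl 0 v)%:~R * Ww j (7, 0) + (fcl 1 v)%:~R * Ww j (11, 0) + (fcl 2 v)%:~R * Ww j (10, 1).
Proof.
apply: (@fcl_basis R[i]).
- by move=> x y; exact: Ww_per.
- by move=> x; exact: Ww_eps.
- move=> x; have := @Ww_scale j (-1) 1 1 x erefl erefl; rewrite !mul1r mulN1r; apply.
  by move=> y; rewrite mulN1r !mul1r; exact: fcl_negX.
- move=> x; have := @Ww_scale j 1 (-1) 1 x erefl erefl; rewrite !mul1r mulN1r; apply.
  by move=> y; rewrite mulN1r !mul1r; exact: fcl_negY.
- exact: Ww_seven.
Qed.

(** The coefficient pattern f_l e(- d n/c) of I_l; [bc1] and [bc2] are the real and imaginary parts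
    of f_j e(a n/c). *)
Definition gl (l : nat) (v : int * int) : R[i] := (fcl l v)%:~R * ec (- (d%:~R * nx v) / c%:R).
Definition bc1 j x : R := (fcl j x)%:~R * complex.Re (ec (a%:~R * nx x / c%:R)).
Definition bc2 j x : R := (fcl j x)%:~R * complex.Im (ec (a%:~R * nx x / c%:R)).

Lemma Re_intM (k : int) (z : R[i]) : complex.Re (k%:~R * z) = k%:~R * complex.Re z.
Proof. by have -> : k%:~R = (k%:~R : R)%:C :> R[i]; [rewrite rmorph_int|rewrite cReM /=; ring]. Qed.
Lemma Im_intM (k : int) (z : R[i]) : complex.Im (k%:~R * z) = k%:~R * complex.Im z.
Proof. by have -> : k%:~R = (k%:~R : R)%:C :> R[i]; [rewrite rmorph_int|rewrite cImM /=; ring]. Qed.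

(** The Gauss sum is even in v. Averaging its expressions at v and - v turns the exponentials of the
    pairing into cosines, that is, into [Gh] of the two parts. *)
Lemma Gh_complex j v : (Gh c (bc1 j) v)%:C + 'i * (Gh c (bc2 j) v)%:C =
  ec (- (d%:~R * nx v) / c%:R) * Ww j v.
Proof.
pose A (x : int * int) : R[i] := (fcl j x)%:~R * ec (a%:~R * nx x / c%:R).
have E1 : ec (- (d%:~R * nx v) / c%:R) * Ww j v = \sum_(i < 24 * c) \sum_(k < 4 * c) A (i%:Z, k%:Z) * ec (- bx (i%:Z, k%:Z) v / c%:R).
  rewrite /Ww mulr_sumr; apply: eq_bigr => i _; rewrite mulr_sumr; apply: eq_bigr => k _.
  rewrite /Fw /A [LHS]mulrCA -[RHS]mulrA -!ecD -!mulrDl; congr (_ * ec (_ / _)).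
  by rewrite /ph; ring.
have E2 : ec (- (d%:~R * nx v) / c%:R) * Ww j v = \sum_(i < 24 * c) \sum_(k < 4 * c) A (i%:Z, k%:Z) * ec (bx (i%:Z, k%:Z) v / c%:R).
  have -> : Ww j v = Ww j (- 1 * v.1, - 1 * v.2).
    rewrite (@Ww_scale j (-1) (-1) 1 v erefl erefl) ?mul1r// => y; rewrite !mulN1r mul1r.
    by rewrite -[RHS]fcl_negX -[RHS]fcl_negY.
  rewrite /Ww mulr_sumr; apply: eq_bigr => i _; rewrite mulr_sumr; apply: eq_bigr => k _.
  rewrite /Fw /A [LHS]mulrCA -[RHS]mulrA -!ecD -!mulrDl; congr (_ * ec (_ / _)).
  by rewrite /ph /nn /bx /= !mulN1r !rmorphN /= !sqrrN; ring.
have two : 2 * ((Gh c (bc1 j) v)%:C + 'i * (Gh c (bc2 j) v)%:C) = 2 * (ec (- (d%:~R * nx v) / c%:R) * Ww j v).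
  rewrite [RHS](_ : _ = ec (- (d%:~R * nx v) / c%:R) * Ww j v + ec (- (d%:~R * nx v) / c%:R) * Ww j v); last by ring.
  rewrite {1}E1 E2 -big_split /= /Gh !rmorph_sum /= mulr_sumr -big_split mulr_sumr /=; apply: eq_bigr => i _.
  rewrite -big_split /= !rmorph_sum /= mulr_sumr -big_split mulr_sumr /=; apply: eq_bigr => k _.
  set x := (i%:Z, k%:Z); rewrite /bc1 /bc2 -/x /A.
  have -> : ang c i k v = 2 * pi * (bx x v / c%:R) by rewrite /ang /bx /x /= -!pmulrn; move: (pi : R) => p; field.
  have -> : - bx x v / c%:R = - (bx x v / c%:R) by rewrite mulNr.
  rewrite /ec mulrN cosN sinN; move: (cos _) (sin _) (cos _) (sin _) => C1 S1 C2 S2.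
  have -> : (fcl j x)%:~R = ((fcl j x)%:~R : R)%:C :> R[i] by rewrite rmorph_int.
  by move: ((fcl j x)%:~R : R) => f; apply/eqP; rewrite eq_complex /=; apply/andP; split; apply/eqP; ring.
by apply: (mulfI _ two); rewrite pnatr_eq0.
Qed.

(* multiplication of X by a square root of 1 congruent to 7 changes the sign of gl along a row *)
Lemma gl_row l X Y : \sum_(i < 48 * c) gl l (X + i%:Z, Y) = 0.
Proof.
have M0 : (0 < 48 * c)%N by rewrite muln_gt0.
have gp : latperiodic (48 * c) 1 (fun x => gl l (x.1, Y)).
  move=> x y; rewrite /gl; congr (_%:~R * _).
    rewrite -(fclD l (x.1, Y) (2 * c%:Z * y.1, 0)) /addp /lat /=; congr (fcl l (_, _)); rewrite ?PoszM; ring.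
  apply: (@ec_eq _ _ (- (d * (2 * x.1 * y.1 + 48 * c%:Z * y.1 ^+ 2)))).
  rewrite /nn /addp /lat /= PoszM !(rmorphN, rmorphD, rmorphB, rmorphM, rmorphXn) /= -!pmulrn.
  by field.
have la s : latmap (48 * c) 1 (addp^~ s) by move=> x y; exists y; rewrite /addp /=; congr (_, _); ring.
have ls (p : int) : latmap (48 * c) 1 (fun x => (p * x.1, x.2)).
  by move=> x y; exists (p * y.1, y.2); rewrite /addp /lat /=; congr (_, _); ring.
have S1 : \sum_(i < 48 * c) gl l (X + i%:Z, Y) = \sum_(i < 48 * c) gl l (i%:Z, Y).
  have := @lattice_reindex _ _ _ M0 (ltn0Sn 0) _ (addp^~ (X, 0)) (addp^~ (- X, 0)) gp (la _) (la _).
  move=> /(_ _) h; have {}h := h ltac:(by move=> x; exists (0, 0); rewrite /addp /lat /= !mulr0; congr (_, _); ring).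
  transitivity (\sum_(i < 48 * c) \sum_(j < 1) gl l ((addp (i%:Z, j%:Z) (X, 0)).1, Y)).
    by apply: eq_bigr => i _; rewrite big_ord1 /= addrC.
  by rewrite h; apply: eq_bigr => i _; rewrite big_ord1.
have [u [u7z _ [m um]]] := signed_root c0.
have umR : (u%:~R : R) ^+ 2 = 1 + 48 * c%:R * m%:~R.
  by have := congr1 (fun z : int => z%:~R : R) um; rewrite !(rmorphD, rmorphM, rmorphXn) /= -!pmulrn.
have S2 : \sum_(i < 48 * c) gl l (i%:Z, Y) = - \sum_(i < 48 * c) gl l (i%:Z, Y).
  have := @lattice_reindex _ _ _ M0 (ltn0Sn 0) _ (fun x => (u * x.1, x.2)) (fun x => (u * x.1, x.2)) gp (ls _) (ls _).
  move=> /(_ _) h; have {}h := h ltac:(by move=> x; exists (m * x.1, 0); rewrite /addp /lat /= mulr0 addr0 mulrA -expr2 um PoszM; congr (_, _); ring).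
  have e1 : \sum_(i < 48 * c) gl l (i%:Z, Y) = \sum_(i < 48 * c) \sum_(j < 1) gl l (i%:Z, Y) by apply: eq_bigr => i _; rewrite big_ord1.
  rewrite [LHS]e1 -[LHS]h -sumrN; apply: eq_bigr => i _; rewrite big_ord1 /gl /= (@fcl_seven l u (i%:Z, Y) u7z) rmorphN /= [LHS]mulNr; congr (- (_ * _)).
  apply: (@ec_eq _ _ (- (d * (m * i%:Z ^+ 2)))).
  rewrite /nn /= !(rmorphN, rmorphM, rmorphXn) /= -!pmulrn.
  by move: (u%:~R : R) umR => U hU; field: hU.
rewrite S1; have : (\sum_(i < 48 * c) gl l (i%:Z, Y)) *+ 2 = 0 by rewrite mulr2n {1}S2 addNr.
by move=> /eqP; rewrite mulrn_eq0 /= => /eqP.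
Qed.

Lemma gl_per l X Y : gl l (X + (48 * c)%N%:Z, Y) = gl l (X, Y).
Proof.
rewrite /gl; congr (_%:~R * _).
  rewrite -(fclD l (X, Y) (2 * c%:Z, 0)) /=; congr (fcl l (_, _)); rewrite ?PoszM; ring.
apply: (@ec_eq _ _ (- (d * (2 * X + 48 * c%:Z)))).
rewrite /nn /= PoszM !(rmorphN, rmorphD, rmorphB, rmorphM, rmorphXn) /= -!pmulrn.
by field.
Qed.

Lemma gl_eps l x : gl l (eps x) = gl l x.
Proof. by rewrite /gl fcl_eps nn_eps. Qed.

Lemma gl0 l : gl l (0, 0) = 0.
Proof. by rewrite /gl (_ : fcl l (0, 0) = 0) ?mul0r//; exact: (fcl_row0 l 0 0). Qed.

End multiplier.

(** * The coefficients d_j as finite lattice sums *)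

Section coefficients.
Context {R : realType}.
Local Open Scope complex_scope.
Local Notation nx x := (nn (x.1%:~R : R) x.2%:~R).

Definition plist (l : nat) : seq (nat * nat) :=
  match l with
  | 0 => [:: (7, 0); (17, 0); (11, 2); (13, 2)]
  | 1 => [:: (11, 0); (13, 0); (7, 2); (17, 2)]
  | _ => [:: (10, 1); (14, 1); (10, 3); (14, 3)] end%N.
Definition mlist (l : nat) : seq (nat * nat) :=
  match l with
  | 0 => [:: (1, 0); (23, 0); (5, 2); (19, 2)]
  | 1 => [:: (5, 0); (19, 0); (1, 2); (23, 2)]
  | _ => [:: (2, 1); (22, 1); (2, 3); (22, 3)] end%N.

Definition mup (p : nat * nat) : R * R := (p.1%:R / 24, p.2%:R / 4).
Definition phi (x : int * int) : R * R := (x.1%:~R / 24, x.2%:~R / 4).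

Lemma SplusE (l : 'I_3) : Splus R l = map mup (plist l).
Proof.
case: l => -[|[|[|l]]] hl //; rewrite /Splus /= /mup /=;
  congr [:: (_, _); (_, _); (_, _); (_, _)]; rewrite ?mul0r//; lra.
Qed.

Lemma SminusE (l : 'I_3) : Sminus R l = map mup (mlist l).
Proof.
case: l => -[|[|[|l]]] hl //; rewrite /Sminus /= /mup /=;
  congr [:: (_, _); (_, _); (_, _); (_, _)]; rewrite ?mul0r//; lra.
Qed.

Lemma phi_inj : injective phi.
Proof.
move=> [x1 x2] [y1 y2] [/= /(mulIf (_ : 24^-1 != 0)) e1 /(mulIf (_ : 4^-1 != 0)) e2].
have := e1 ltac:(by rewrite invr_eq0); have := e2 ltac:(by rewrite invr_eq0) => /intr_inj -> /intr_inj ->.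
by [].
Qed.

Lemma Q_phi x : Q (phi x) = nx x.
Proof. by rewrite /Q /phi /nn /=; field. Qed.

Definition res (x : int * int) : nat * nat := (absz (modz x.1 24), absz (modz x.2 4)).

Lemma coset_phi1 (N : nat) (X : int) (i : nat) : (0 < N)%N -> (i < N)%N ->
  Zcoset (i%:R / N%:R : R) (X%:~R / N%:R) <-> absz (modz X N) = i.
Proof.
move=> N0 iN; have Nn : (N%:R : R) != 0 by rewrite pnatr_eq0 -lt0n.
split=> [[k _ /= e]|e].
  have eR : (X%:~R : R) = (k * N%:Z + i%:Z)%:~R.
    rewrite rmorphD rmorphM /= -!pmulrn; apply: (mulIf (x := N%:R^-1)); first by rewrite invr_eq0.
    by rewrite -e mulrDl mulfK.
  have -> : X = k * N%:Z + i%:Z by exact: intr_inj eR.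
  by rewrite modzMDl modz_small// ltz_nat iN.
exists (divz X N) => //; have h := divz_eq X N.
have h2 : modz X N = i%:Z by rewrite -e gez0_abs// modz_ge0// -lt0n.
rewrite h2 in h; rewrite [in RHS]h rmorphD rmorphM /= -!pmulrn.
by field.
Qed.

Lemma coset_phi (x : int * int) (p : nat * nat) : (p.1 < 24)%N -> (p.2 < 4)%N ->
  Z2coset (mup p) (phi x) <-> res x = p.
Proof.
move=> p1 p2; rewrite /Z2coset /mup /phi /=.
have h1 := @coset_phi1 24 x.1 p.1 isT p1; have h2 := @coset_phi1 4 x.2 p.2 isT p2.
split=> [[/h1 e1 /h2 e2]|e].
  by rewrite /res e1 e2; case: p {p1 p2 h1 h2 e1 e2}.
by rewrite -e /res in h1 h2 *; split; [exact/h1|exact/h2].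
Qed.

Lemma phi_surj (p : nat * nat) (m : R * R) : Z2coset (mup p) m -> exists x, m = phi x.
Proof.
move=> [[k _ e1] [k' _ e2]]; exists (k * 24 + p.1%:Z, k' * 4 + p.2%:Z); rewrite /phi /=.
rewrite !(rmorphD, rmorphM) /= -!pmulrn; case: m e1 e2 => m1 m2 /= <- <-.
by rewrite /mup /=; congr (_, _); field.
Qed.

Definition box (K : nat) : seq (int * int) :=
  let s := [seq i%:Z - K%:Z | i <- iota 0 (2 * K).+1] in [seq (X, Y) | X <- s, Y <- s].

Lemma box_uniq K : uniq (box K).
Proof.
rewrite /box; apply: allpairs_uniq.
- by rewrite map_inj_uniq ?iota_uniq// => i j; lia.
- by rewrite map_inj_uniq ?iota_uniq// => i j; lia.
- by move=> [x1 x2] [y1 y2].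
Qed.

Lemma mem_box K x : (`|x.1| <= K%:Z)%R -> (`|x.2| <= K%:Z)%R -> x \in box K.
Proof.
have key (z : int) : (`|z| <= K%:Z)%R -> z \in [seq i%:Z - K%:Z | i <- iota 0 (2 * K).+1].
  rewrite ler_norml => /andP[h1 h2].
  have h0 : 0 <= z + K%:Z by rewrite -lerBlDr sub0r.
  have [i ei] : exists i : nat, z + K%:Z = i%:Z by exists (absz (z + K%:Z)); rewrite gez0_abs.
  apply/mapP; exists i; last by rewrite -ei addrK.
  rewrite mem_iota add0n ltnS /= -lez_nat -ei PoszM.
  by rewrite (_ : 2%:Z * K%:Z = K%:Z + K%:Z) ?lerD2r//; ring.
move=> h1 h2; rewrite /box; apply/allpairsP; exists x; split; [exact: key|exact: key|by case: x {h1 h2}].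
Qed.

(** Half-width of a box containing all points of nonzero weight with |n| <= T: there X^2 and Y^2 are
    at most 160 T, and an integer is at most its square. *)
Definition KT (T : R) : nat := (Num.truncn (160 * T)).+1.

Lemma box_cover (T : R) x : om x != 0 :> R -> `|nx x| <= T -> x \in box (KT T).
Proof.
move=> o0 nT; have h := om_cone o0.
have s1 := sqr_ge0 (x.1%:~R : R); have s2 := sqr_ge0 (x.2%:~R : R).
have K1 : 160 * T <= (KT T)%:R by rewrite /KT ltW// truncnS_gt.
have key (z : int) : (z%:~R : R) ^+ 2 <= 160 * T -> (`|z| <= (KT T)%:Z)%R.
  move=> hz; have : (z ^+ 2)%:~R <= ((KT T)%:Z%:~R : R) by rewrite rmorphXn /= -pmulrn; exact: le_trans hz K1.
  by rewrite ler_int; nia.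
by apply: mem_box; apply: key; lra.
Qed.

Definition wsum (l : nat) (K : nat) (n : R) : R := \sum_(x <- box K | nx x == n) om x * (fcl l x)%:~R.

(** The cone forms become 2 m1 + m2 = (X + 3 Y)/12 and 3 m1 + m2 = (X + 2 Y)/8, with the same signs
    as those in [om], which includes the factor 1/2. *)
Lemma a_muE (p : nat * nat) (n T : R) : (p.1 < 24)%N -> (p.2 < 4)%N -> `|n| <= T ->
  a_mu (mup p) n = \sum_(x <- box (KT T) | (nx x == n) && (res x == p)) om x.
Proof.
move=> p1 p2 nT.
pose P := Z2coset (mup p) `&` [set m | Q m = n].
have key (F : R * R -> R) : (forall x, nx x = n -> F (phi x) = 2 * om x) ->
   2^-1 * \sum_(m \in P) F m = \sum_(x <- box (KT T) | (nx x == n) && (res x == p)) om x.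
  move=> FE; pose r := [seq phi x | x <- box (KT T) & (nx x == n) && (res x == p)].
  rewrite (fsbigE r).
  - rewrite (_ : \sum_(i <- r | i \in P) F i = \sum_(i <- r) F i); last first.
      rewrite big_seq_cond [RHS]big_seq; apply: eq_bigl => m; apply: andb_idr => /mapP[x].
      rewrite mem_filter => /andP[/andP[/eqP hn /eqP hr] _] ->; rewrite inE; split; last by rewrite /= Q_phi.
      exact/coset_phi.
    rewrite big_map big_filter mulr_sumr; apply: eq_bigr => x /andP[/eqP hn _].
    by rewrite FE// mulKf.
  - by rewrite map_inj_uniq; [rewrite filter_uniq// box_uniq|exact: phi_inj].
  - move=> m /= /mapP[x]; rewrite mem_filter => /andP[/andP[/eqP hn /eqP hr] _] ->.
    by split; [exact/coset_phi|rewrite /= Q_phi].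
  - move=> m [mc mQ]; have [x ex] := phi_surj mc; move: mc mQ; rewrite ex /= Q_phi => mc mQ hr.
    rewrite FE//; have [z0|z0] := eqVneq (om x) (0 : R); first by rewrite z0 mulr0.
    case/negP: hr; apply/mapP; exists x => //; rewrite mem_filter mQ eqxx /=.
    by apply/andP; split; [apply/eqP; exact/coset_phi|apply: box_cover => //; rewrite mQ].
have sgE (k r : R) : 0 < k -> Num.sg (r / k) = Num.sg r by move=> k0; rewrite sgrM (gtr0_sg (_ : 0 < k^-1)) ?invr_gt0// mulr1.
rewrite /a_mu; case: ifPn => n0; apply: key => x hn; rewrite omE -(@qf_nn R) hn.
  rewrite n0 /phi /=; have -> : 2 * (x.1%:~R / 24) + x.2%:~R / 4 = (x.1%:~R + 3 * x.2%:~R) / 12 :> R by field.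
  have -> : 2 * (x.1%:~R / 24) - x.2%:~R / 4 = (x.1%:~R - 3 * x.2%:~R) / 12 :> R by field.
  by rewrite !sgE//; field.
rewrite (negPf n0) /phi /=; have -> : 3 * (x.1%:~R / 24) + x.2%:~R / 4 = (x.1%:~R + 2 * x.2%:~R) / 8 :> R by field.
have -> : 3 * (x.1%:~R / 24) - x.2%:~R / 4 = (x.1%:~R - 2 * x.2%:~R) / 8 :> R by field.
by rewrite !sgE//; field.
Qed.

Lemma plist_ok l p : p \in plist l -> (p.1 < 24)%N && (p.2 < 4)%N.
Proof. by case: l => [|[|l]]; rewrite !inE => /or4P[] /eqP ->. Qed.
Lemma mlist_ok l p : p \in mlist l -> (p.1 < 24)%N && (p.2 < 4)%N.
Proof. by case: l => [|[|l]]; rewrite !inE => /or4P[] /eqP ->. Qed.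

Lemma sum_mem (s : seq (nat * nat)) (q : nat * nat) (r : R) : uniq s ->
  \sum_(p <- s) (if q == p then r else 0) = (q \in s)%:R * r.
Proof.
move=> us; have [qs|qs] := boolP (q \in s); last first.
  by rewrite mul0r big1_seq// => p /andP[_ ps]; case: eqP => // e; move: qs; rewrite e ps.
rewrite (big_rem q)//= eqxx mul1r big1_seq ?addr0// => p /andP[_].
by rewrite mem_rem_uniq// inE => /andP[pq _]; rewrite eq_sym (negPf pq).
Qed.

Lemma fcl_lists (l : nat) x : (fcl l x)%:~R = (res x \in plist l)%:R - (res x \in mlist l)%:R :> R.
Proof. by rewrite /fcl /res; case: l => [|[|l]]; rewrite /fcl_nat rmorphB /= -!pmulrn. Qed.

Lemma dcoefE (l : 'I_3) (n T : R) : `|n| <= T -> dcoef l n = 2^-1 * wsum l (KT T) n.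
Proof.
move=> nT; rewrite /dcoef SplusE SminusE !big_map; congr (_ * _).
have part (s : seq (nat * nat)) : uniq s -> (forall p, p \in s -> (p.1 < 24)%N && (p.2 < 4)%N) ->
   \sum_(p <- s) a_mu (mup p) n = \sum_(x <- box (KT T) | nx x == n) (res x \in s)%:R * om x.
  move=> us hs; rewrite big_seq (eq_bigr (fun p => \sum_(x <- box (KT T) | nx x == n) (if res x == p then om x else 0))); last first.
    move=> p /hs /andP[h1 h2]; rewrite (@a_muE p n T h1 h2 nT) big_mkcondr.
    by [].
  rewrite -big_seq exchange_big /=; apply: eq_bigr => x _; exact: sum_mem.
rewrite !part ?uniq_plist//; [|by case: l => -[|[|[|l]]]|exact: mlist_ok|by case: l => -[|[|[|l]]]|exact: plist_ok].
rewrite -sumrB; apply: eq_bigr => x _; rewrite fcl_lists; ring.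
Qed.

(** 48 times beta_l: the residue modulo 48 of X^2 - 6 Y^2 on the support of f_l. *)
Definition qb (l : nat) : int := match l with 0 => 1 | 1 => 25 | _ => 46 end.

Lemma fcl_qf l x : fcl l x != 0 -> exists k : int, qf x = qb l + 48 * k.
Proof.
move: x; apply: fcl_case => [x y ih|i j hi hj].
  rewrite fclD => /ih [k e]; exists (k + x.1 * y.1 + 12 * y.1 ^+ 2 - x.2 * y.2 - 2 * y.2 ^+ 2).
  by move: e; rewrite /qf /= => e; rewrite !sqrrD; lia.
have key : all (fun i => all (fun j : nat => (fcl l (i%:Z, j%:Z) != 0) ==> ((qf (i%:Z, j%:Z) - qb l) %% 48 == 0)%Z) (iota 0 4)) (iota 0 24).
  by case: l => [|[|l]]; vm_compute.
have /allP /(_ i) := key; rewrite mem_iota hi => /(_ isT) /allP /(_ j); rewrite mem_iota hj => /(_ isT).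
move=> /implyP h /h /eqP e; exists ((qf (i%:Z, j%:Z) - qb l) %/ 48)%Z.
by have := divz_eq (qf (i%:Z, j%:Z) - qb l) 48; rewrite e; lia.
Qed.

Lemma nx_coset (l : 'I_3) x : fcl l x != 0 -> Zcoset (@beta R l) (nx x).
Proof.
move=> /fcl_qf [k e]; exists k => //; rewrite nnE e rmorphD rmorphM /=.
by case: l {e} => -[|[|[|l]]] hl //; rewrite /beta /=; field.
Qed.

Lemma coset_neq0 (l : 'I_3) (n : R) : Zcoset (beta R l) n -> n != 0.
Proof.
move=> [k _ <-]; apply/eqP => /(congr1 (fun r : R => r * 48)); rewrite mul0r mulrDl.
have -> : beta R l * 48 = (qb l)%:~R by case: l => -[|[|[|l]]] hl //; rewrite /beta /=; field.
by rewrite -[48]/(48%:~R) -rmorphM -rmorphD /= => /eqP; rewrite intr_eq0; case: l => -[|[|[|l]]] hl //=; lia.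
Qed.

(** Passes from the sum over exponents n to the sum over lattice points, grouped by norm; a single
    box serves all n because |n| <= T. *)
Lemma trunc_sumE (l : 'I_3) (S : set R) (h : R -> R[i]) (T : R) : S `<=` Zcoset (beta R l) ->
  trunc_sum S (fun n => (dcoef l n)%:C * h n) T =
  \sum_(x <- box (KT T)) (2^-1 * om x * (fcl l x)%:~R * (`[< S (nx x) >] && (`|nx x| <= T))%:R)%:C * h (nx x).
Proof.
move=> SZ; rewrite /trunc_sum; pose r := undup [seq nx x | x <- box (KT T) & `[< S (nx x) >] && (`|nx x| <= T)].
have memr n : n \in r -> S n /\ `|n| <= T.
  by rewrite mem_undup => /mapP[x]; rewrite mem_filter => /andP[/andP[/asboolP h1 h2] _] ->.
rewrite (fsbigE r).
- rewrite (_ : \sum_(i <- r | _) _ = \sum_(n <- r) (dcoef l n)%:C * h n); last first.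
    rewrite big_seq_cond [RHS]big_seq; apply: eq_bigl => n; apply: andb_idr => /memr[h1 h2].
    by rewrite inE.
  transitivity (\sum_(n <- r) \sum_(x <- box (KT T) | nx x == n) (2^-1 * om x * (fcl l x)%:~R)%:C * h (nx x)).
    rewrite big_seq [RHS]big_seq; apply: eq_bigr => n /memr[h1 h2].
    rewrite (dcoefE l h2) /wsum mulr_sumr rmorph_sum /= mulr_suml; apply: eq_bigr => x /eqP ->.
    by rewrite mulrA.
  rewrite (exchange_big_dep xpredT)//=; rewrite big_seq [RHS]big_seq; apply: eq_bigr => x xb.
  have [hx|hx] := boolP (`[< S (nx x) >] && (`|nx x| <= T)).
    rewrite mulr1 -big_filter (_ : [seq n <- r | nx x == n] = [:: nx x]) ?big_seq1//.
    have nr : nx x \in r by rewrite mem_undup; apply/mapP; exists x => //; rewrite mem_filter hx.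
    rewrite (eq_filter (a2 := pred1 (nx x))); last by move=> n /=; rewrite eq_sym.
    by rewrite filter_pred1_uniq// undup_uniq.
  rewrite mulr0 mul0r big1_seq// => n /andP[/eqP e /memr[h1 h2]].
  by case/negP: hx; rewrite e h2 andbT; apply/asboolP.
- exact: undup_uniq.
- by move=> n /= /memr[].
- move=> n [Sn nT] nr; rewrite (dcoefE l nT) /wsum big1_seq ?mulr0 ?mul0r// => x /andP[/eqP e xb].
  case/negP: nr; rewrite mem_undup; apply/mapP; exists x => //; rewrite mem_filter xb e.
  by rewrite (_ : `[< S n >]) ?nT//; apply/asboolP.
Qed.

End coefficients.

(** * Complex limits, the kernel of I_l, boxed complex sums *)

Section complex_limits.
Context {R : realType}.
Local Open Scope complex_scope.
Local Notation C := (R[i]^o).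

Lemma ccvg (T : Type) (F : set_system T) (FF : Filter F) (f1 f2 : T -> R) (l1 l2 : R) :
  f1 x @[x --> F] --> l1 -> f2 x @[x --> F] --> l2 ->
  ((f1 x +i* f2 x) : C) @[x --> F] --> ((l1 +i* l2) : C).
Proof.
move=> h1 h2; apply/cvgrPdist_lt => e e0.
have : 0 < e :> R[i] by []; rewrite ltcE /= => /andP[/eqP ei er].
have r2 : 0 < complex.Re e / 2 by rewrite divr_gt0.
have /cvgrPdist_lt /(_ _ r2) n1 := h1; have /cvgrPdist_lt /(_ _ r2) n2 := h2.
near=> x; have a1 : `|l1 - f1 x| < complex.Re e / 2 by near: x.
have a2 : `|l2 - f2 x| < complex.Re e / 2 by near: x.
rewrite normc_def /= ltcE /= -ei eqxx /=.
have q : 0 <= (l1 - f1 x) ^+ 2 + (l2 - f2 x) ^+ 2 by rewrite addr_ge0 ?sqr_ge0.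
rewrite -[X in _ < X]ger0_norm ?(ltW er)// -sqrtr_sqr ltr_sqrt ?exprn_gt0//.
move: a1 a2; rewrite !ltr_norml => /andP[b1 b2] /andP[b3 b4]; nra.
Unshelve. all: by end_near. Qed.

Lemma complexE2 (z : R[i]) : z = complex.Re z +i* complex.Im z.
Proof. by case: z. Qed.

Lemma cexpD (z w : R[i]) : cexp (z + w) = cexp z * cexp w.
Proof.
rewrite /cexp; case: z => z1 z2; case: w => w1 w2 /=; rewrite expRD cosD sinD.
by apply/eqP; rewrite eq_complex /=; apply/andP; split; apply/eqP; ring.
Qed.

Lemma e2pi_real (x : R) : e2pi x%:C = ec x.
Proof.
rewrite /e2pi /cexp /ec (_ : (2 * pi)%:C * 'i * x%:C = 0 +i* (2 * pi * x)); last first.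
  by apply/eqP; rewrite eq_complex /=; apply/andP; split; apply/eqP; ring.
by rewrite /= expR0 mul1r.
Qed.

Lemma Re_cexp (s u : R[i]) (y : R) : complex.Re (u * cexp (- (s * y%:C))) = cR s u y.
Proof.
case: s u => s1 s2 [u1 u2]; rewrite /cexp /cR /= !(mulr0, subr0, addr0, add0r) cosN sinN.
by ring.
Qed.

Lemma cexp_ri (s : R[i]) (y : R) : cexp (- (s * y%:C)) = (cR s 1 y) +i* (cR s (- 'i) y).
Proof.
rewrite -!Re_cexp mul1r; case: (cexp _) => z1 z2; apply/eqP; rewrite eq_complex /= eqxx /=.
by apply/eqP; ring.
Qed.

Lemma cscale (T : Type) (F : set_system T) (FF : Filter F) (f : T -> C) (z l : C) :
  f x @[x --> F] --> l -> ((z * f x) : C) @[x --> F] --> ((z * l) : C).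
Proof. by move=> h; have h2 : z \*: f @ F --> z *: l := cvgZl_tmp h; exact: h2. Qed.

Lemma pi2_div_gt0 (z : R[i]) : 0 < complex.Re z -> 0 < complex.Re ((pi ^+ 2)%:C / z).
Proof.
move=> z0; have zn : z != 0 by apply: contraTneq z0 => ->; rewrite ltxx.
have := divfK zn (pi ^+ 2)%:C; set y := _ / z => e.
have e1 := congr1 (@complex.Re R) e; have e2 := congr1 (@complex.Im R) e.
rewrite cReM /= in e1; rewrite cImM /= in e2.
have p2 : 0 < (pi : R) ^+ 2 by rewrite exprn_gt0// pi_gt0.
have h : complex.Re y * (complex.Re z ^+ 2 + complex.Im z ^+ 2) = complex.Re z * pi ^+ 2.
  by rewrite -e1; transitivity (complex.Re z * (complex.Re y * complex.Re z - complex.Im y * complex.Im z) + complex.Im z * (complex.Re y * complex.Im z + complex.Im y * complex.Re z)); [ring|rewrite e2 mulr0 addr0].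
have q : 0 < complex.Re z ^+ 2 + complex.Im z ^+ 2 by rewrite ltr_wpDr ?sqr_ge0// exprn_gt0.
by rewrite -(pmulr_lgt0 _ q) h mulr_gt0.
Qed.

Section kernel.
Variables (x : R) (tau : R[i]).
Hypothesis tau0 : 0 < complex.Im tau.
(** Chosen so that exp(2 pi i (tau - x) t) = exp(- sig t); its real part is 2 pi Im tau. *)
Definition sig : R[i] := - ((2 * pi)%:C * 'i%C * (tau - x%:C)).

Lemma sig_gt0 : 0 < complex.Re sig.
Proof.
rewrite /sig; case: tau tau0 => t1 t2 /= t0.
have -> : - ((2 * pi * 0 - 0 * 1) * (t1 - x) - (2 * pi * 1 + 0 * 0) * (t2 - 0)) = 2 * pi * t2 by ring.
by rewrite mulr_gt0// mulr_gt0// pi_gt0.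
Qed.

Lemma kernelE n t : I_kernel x tau n t = (kern sig 1 n t) +i* (kern sig (- 'i) n t).
Proof.
rewrite /I_kernel /e2pi (_ : (2 * pi)%:C * 'i%C * ((tau - x%:C) * t%:C) = - (sig * t%:C)); last by rewrite /sig; ring.
rewrite cexp_ri /kern -fmorphV /=.
by apply/eqP; rewrite eq_complex /=; apply/andP; split; apply/eqP; ring.
Qed.

(** The principal value as a complex number: u = 1 gives the real part and u = - i the imaginary
    part. *)
Definition AA (n : R) : R[i] := (k0 sig 1 n) +i* (k0 sig (- 'i) n).

Lemma cintegralE n e : cintegral (pv_domain n e) (I_kernel x tau n) =
  (Int (pv_domain n e) (kern sig 1 n)) +i* (Int (pv_domain n e) (kern sig (- 'i) n)).
Proof. by rewrite /cintegral /Int; congr (_ +i* _); apply: eq_Rintegral => t _; rewrite kernelE. Qed.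

Lemma pv_cvgC n : n != 0 -> (cintegral (pv_domain n e) (I_kernel x tau n) : C) @[e --> 0^'+] --> (AA n : C).
Proof.
move=> n0; rewrite (funext (cintegralE n)).
by apply: ccvg; exact: (pv_cvg sig_gt0).
Qed.

Lemma pv_int_AA n : n != 0 -> pv_int (I_kernel x tau n) n = AA n.
Proof. by move=> n0; apply: cvg_lim; [exact: norm_hausdorff|exact: pv_cvgC]. Qed.

Lemma pv_existsC n : n != 0 -> pv_exists (I_kernel x tau n) n.
Proof.
move=> n0; split=> [e e0|]; last by apply/cvg_ex; exists (AA n); exact: pv_cvgC.
have E1 : (fun t => (complex.Re (I_kernel x tau n t))%:E) = EFin \o kern sig 1 n by apply/funext => t; rewrite kernelE.
have E2 : (fun t => (complex.Im (I_kernel x tau n t))%:E) = EFin \o kern sig (- 'i) n by apply/funext => t; rewrite kernelE.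
by split; rewrite ?E1 ?E2; exact: (pv_intg sig_gt0).
Qed.

End kernel.

Local Notation nx x := (nn (x.1%:~R : R) x.2%:~R).

(** A truncated complex sum over a finite box; [CBE] splits it into four real sums [SR] to which the
    row estimates apply. *)
Definition CB (G : int * int -> R[i]) (A : R -> R[i]) (T : R) : R[i] :=
  \sum_(x <- box (KT T)) (om x * (`|nx x| <= T)%R%:R)%:C * (G x * A (nx x)).

Definition SR (g : int * int -> R) (k : R -> R) (T : R) : R := tsum (rterm g (fun n => k n * (`|n| <= T)%R%:R)).

Lemma SRE g k T : SR g k T = \sum_(x <- box (KT T)) om x * (`|nx x| <= T)%R%:R * (g x * k (nx x)).
Proof.
rewrite /SR (tsum_seq (s := box (KT T)) _ _).2 ?box_uniq//.
  by apply: eq_bigr => x _; rewrite /rterm; ring.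
move=> x xb; rewrite /rterm; have [z0|z0] := eqVneq (om x) (0 : R); first by rewrite z0 !mul0r.
case: (leP `|nx x| T) => nT; last by rewrite !mulr0.
by move: xb; rewrite (box_cover z0 nT).
Qed.

Lemma CBE G A T : CB G A T =
  (SR (fun x => complex.Re (G x)) (fun n => complex.Re (A n)) T - SR (fun x => complex.Im (G x)) (fun n => complex.Im (A n)) T) +i*
  (SR (fun x => complex.Re (G x)) (fun n => complex.Im (A n)) T + SR (fun x => complex.Im (G x)) (fun n => complex.Re (A n)) T).
Proof.
rewrite !SRE /CB -sumrB -big_split /=.
apply: (big_rec3 (fun (z : R[i]) (p q : R) => z = p +i* q)) => // x z p q _ ->.
by apply/eqP; rewrite eq_complex !raddfD /= !cReM !cImM /=; apply/andP; split; apply/eqP; ring.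
Qed.

Lemma CB_cvg G A (l1 l2 l3 l4 : R) :
  SR (fun x => complex.Re (G x)) (fun n => complex.Re (A n)) T @[T --> +oo%R] --> l1 ->
  SR (fun x => complex.Im (G x)) (fun n => complex.Im (A n)) T @[T --> +oo%R] --> l2 ->
  SR (fun x => complex.Re (G x)) (fun n => complex.Im (A n)) T @[T --> +oo%R] --> l3 ->
  SR (fun x => complex.Im (G x)) (fun n => complex.Re (A n)) T @[T --> +oo%R] --> l4 ->
  (CB G A T : C) @[T --> +oo%R] --> (((l1 - l2) +i* (l3 + l4)) : C).
Proof.
move=> h1 h2 h3 h4; rewrite (funext (CBE G A)); apply: ccvg; [exact: cvgB|exact: cvgD].
Qed.

(** The absolutely convergent case, for the left side: decay (1 + |n|)^-2 is summable over the
    cone. *)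
Lemma SR_abs_cvg (g : int * int -> R) (k : R -> R) (M D : R) : 0 <= D -> (forall x, `|g x| <= M) ->
  (forall x, x != (0, 0) -> `|k (nx x)| <= D * (1 + `|nx x|) ^- 2) -> g (0, 0) = 0 ->
  SR g k T @[T --> +oo%R] --> tsum (rterm g k).
Proof.
move=> D0 gM kD g0; have M0 : 0 <= M := le_trans (normr_ge0 _) (gM (0, 0)).
apply/cvg_pinftyP => v vo; rewrite /SR.
apply: (tannery (f_ := fun j x => rterm g (fun n => k n * (`|n| <= v j)%R%:R) x) (f := rterm g k)
  (g := fun x : int * int => M * D * 160 ^+ 2 * ((1 + (x.1%:~R : R) ^+ 2)^-1 * (1 + x.2%:~R ^+ 2)^-1)) _ _ _).2.
- exact/tsummableZ/tsummable_inv_sqr2.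
- move=> j x.
  have p0 : 0 <= M * D * 160 ^+ 2 * ((1 + (x.1%:~R : R) ^+ 2)^-1 * (1 + x.2%:~R ^+ 2)^-1).
    have := sqr_ge0 (x.1%:~R : R); have := sqr_ge0 (x.2%:~R : R) => h1 h2.
    by apply: mulr_ge0; [apply: mulr_ge0; [exact: mulr_ge0|exact: sqr_ge0]|apply: mulr_ge0; rewrite invr_ge0; lra].
  have [e|x0] := eqVneq x (0, 0); first by rewrite /rterm {2}e g0 mulr0 mul0r normr0.
  rewrite /rterm; have [z0|z0] := eqVneq (om x) (0 : R); first by rewrite z0 !mul0r normr0.
  rewrite [leLHS]normrM [X in X * _]normrM (ger0_norm (om_ge0 x)) [X in _ * X]normrM.
  have b1 (bb : bool) : `|bb%:R| <= 1 :> R by case: bb; rewrite ?normr1 ?normr0.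
  apply: le_trans (_ : 1 * M * (D * (1 + `|nx x|) ^- 2 * 1) <= _).
    apply: ler_pM; [by rewrite mulr_ge0// om_ge0|by rewrite mulr_ge0| |by apply: ler_pM => //; exact: kD].
    by apply: ler_pM => //; [exact: om_ge0|exact: om_le1].
  rewrite mul1r mulr1 -[leRHS]mulrA mulrA; apply: ler_wpM2l; first exact: mulr_ge0.
  exact: cone_le.
- move=> x; apply: cvgM; first exact: cvg_cst.
  apply: cvg_near_cst; have /cvgryPge /(_ `|nx x|) := vo; apply: filterS => j /= ->.
  by rewrite mulr1.
Qed.

End complex_limits.

(** * The multiplier Psi_M as a Gauss sum *)

Section psi_sums.
Context {R : realType}.
Local Open Scope complex_scope.
Local Notation rho := (Num.sqrt 6 : R).
Local Notation nx x := (nn (x.1%:~R : R) x.2%:~R).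

Lemma sum_residues (V : nmodType) (N c : nat) (F : nat -> V) :
  \sum_(i < N * c) F i = \sum_(i < N) \sum_(k < c) F (i + N * k)%N.
Proof.
rewrite exchange_big /=; elim: c => [|c ih]; first by rewrite muln0 !big_ord0.
rewrite big_ord_recr /= -ih -(big_mkord xpredT F) mulnS addnC (big_cat_nat _ (n := (N * c)%N))//=; last exact: leq_addr.
rewrite big_mkord; congr (_ + _).
by rewrite -{1}[(N * c)%N]add0n big_addn addKn big_mkord.
Qed.

Lemma sum_list (V : zmodType) (s : seq (nat * nat)) (H : nat -> nat -> V) : uniq s ->
  (forall p, p \in s -> (p.1 < 24)%N && (p.2 < 4)%N) ->
  \sum_(i < 24) \sum_(k < 4) (if ((i : nat), (k : nat)) \in s then H i k else 0) = \sum_(p <- s) H p.1 p.2.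
Proof.
elim: s => [|p s ih] /=; first by move=> _ _; rewrite big_nil big1// => i _; rewrite big1.
move=> /andP[ps us] hs; rewrite big_cons -ih//; last by move=> q qs; apply: hs; rewrite inE qs orbT.
have /andP[p1 p2] := hs p (mem_head _ _).
transitivity (\sum_(i < 24) \sum_(k < 4) ((if ((i : nat), (k : nat)) == p then H i k else 0) + (if ((i : nat), (k : nat)) \in s then H i k else 0))).
  apply: eq_bigr => i _; apply: eq_bigr => k _; rewrite inE.
  by case: eqP => [->|_] /=; [rewrite (negPf ps) addr0|rewrite add0r].
under eq_bigr do rewrite big_split /=.
rewrite big_split /=; congr (_ + _).
rewrite (bigD1 (Ordinal p1))//= (bigD1 (Ordinal p2))//= -surjective_pairing eqxx big1 ?addr0.
  rewrite big1 ?addr0// => i ip; rewrite big1// => k _; case: eqP => // e.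
  by case/eqP: ip; apply/val_inj; rewrite /= -e.
move=> k kp; case: eqP => // e; case/eqP: kp; apply/val_inj; by rewrite /= -e.
Qed.

Variables (M : 'M[int]_2) (c : nat).
Hypotheses (c0 : (0 < c)%N) (Mc : M 1 0 = c%:Z).
Local Notation a := (M 0 0).
Local Notation d := (M 1 1).

Lemma psiE (p q : nat * nat) : psi M (mup p) (mup q) =
  ((4 * rho * c%:R)^-1)%:C * \sum_(k1 < c) \sum_(k2 < c) ec (ph a d ((p.1 + 24 * k1)%N%:Z, (p.2 + 4 * k2)%N%:Z) (q.1%:Z, q.2%:Z) / c%:R) :> R[i].
Proof.
have cn0 : (c%:R : R) != 0 by rewrite pnatr_eq0 -lt0n.
rewrite /psi Mc /= -pmulrn ger0_norm//; congr (_ * _); apply: eq_bigr => k1 _; apply: eq_bigr => k2 _.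
rewrite e2pi_real; congr ec.
have e1 : ((p.1 + 24 * k1)%N%:Z)%:~R = p.1%:R + 24 * k1%:R :> R by rewrite -pmulrn natrD natrM.
have e2 : ((p.2 + 4 * k2)%N%:Z)%:~R = p.2%:R + 4 * k2%:R :> R by rewrite -pmulrn natrD natrM.
move: (p.1 + 24 * k1)%N%:Z (p.2 + 4 * k2)%N%:Z e1 e2 => X Y e1 e2.
rewrite /ph /Q /B /mup /nn /bx /= e1 e2 -!pmulrn.
by field.
Qed.

(** A residue modulo 24 c is a residue modulo 24 plus 24 times one modulo c, and likewise for Y; the
    sums over S_j^+ and S_j^- then combine into one sum weighted by f_j. *)
Lemma Psi_Ww (j : 'I_3) (q : nat * nat) : Psi M j (mup q) = ((4 * rho * c%:R)^-1)%:C * Ww c a d j (q.1%:Z, q.2%:Z) :> R[i].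
Proof.
rewrite /Psi SplusE SminusE !big_map.
pose H (i k : nat) : R[i] := \sum_(k1 < c) \sum_(k2 < c) ec (ph a d ((i + 24 * k1)%N%:Z, (k + 4 * k2)%N%:Z) (q.1%:Z, q.2%:Z) / c%:R).
under eq_bigr do rewrite psiE; under [X in _ - X]eq_bigr do rewrite psiE.
rewrite -!mulr_sumr -mulrBr; congr (_ * _).
have up : uniq (plist j) by case: (j) => -[|[|[|?]]].
have um : uniq (mlist j) by case: (j) => -[|[|[|?]]].
rewrite -(@sum_list _ (plist j) H up (@plist_ok j)) -(@sum_list _ (mlist j) H um (@mlist_ok j)) -sumrB.
rewrite /Ww (sum_residues 24 c (fun i => \sum_(k < 4 * c) Fw c a d j (q.1%:Z, q.2%:Z) (i%:Z, k%:Z))).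
apply: eq_bigr => i _; rewrite -sumrB.
under [RHS]eq_bigr do rewrite (sum_residues 4 c (fun k => Fw c a d j (q.1%:Z, q.2%:Z) ((i + 24 * _)%N%:Z, k%:Z))).
rewrite [RHS]exchange_big /=; apply: eq_bigr => k _.
have E (k1 k2 : nat) : fcl j ((i + 24 * k1)%N%:Z, (k + 4 * k2)%N%:Z) = fcl_nat j i k.
  rewrite -(@fclE j i k)// (PoszD i) (PoszD k) !PoszM; exact: (fclD j (i%:Z, k%:Z) (k1%:Z, k2%:Z)).
under [RHS]eq_bigr do under eq_bigr do rewrite /Fw E.
have -> : (fcl_nat j i k)%:~R = (((i : nat), (k : nat)) \in plist j)%:R - (((i : nat), (k : nat)) \in mlist j)%:R :> R[i].
  by case: j {up um E} => -[|[|[|?]]] hj //; rewrite /fcl_nat rmorphB /= -!pmulrn.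
under [RHS]eq_bigr do rewrite -mulr_sumr.
rewrite -mulr_sumr -/(H i k) mulrBl.
by congr (_ - _); case: (_ \in _); rewrite ?mul1r ?mul0r.
Qed.

End psi_sums.

(** * Rational identities with a symbol I of square -1 *)

Section field_identities.
Variable F : numFieldType.
Implicit Types (p C r I w n A D W Z : F).

(** With w = tau + d/c, the transformed point is a/c - 1/(c^2 w). *)
Lemma mobius_algebra A D C w : C != 0 -> w != 0 ->
  (A * (w - D / C) + (A * D - 1) / C) / (C * w) = A / C - (C ^+ 2 * w)^-1.
Proof. by move=> C0 w0; field; rewrite C0 w0. Qed.

(** Here p * p over - (2 p I w) is l; evaluating E at q = 2 sqrt n/c gives exactly the exponential
    of the transformed point. *)
Lemma exponent_algebra p C n I w : p != 0 -> C != 0 -> I != 0 -> I ^+ 2 = -1 -> w != 0 ->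
  2 * p * I * - (n / (C * C * w)) = - (p * p / - (2 * p * I * w) * (4 * n / C ^+ 2)).
Proof.
move=> p0 C0 I0 I2 w0.
have Ii : I^-1 = - I by apply: (mulfI I0); rewrite divff// mulrN -expr2 I2 opprK.
have -> : - (p * p / - (2 * p * I * w) * (4 * n / C ^+ 2)) = p * 2 * n / (C ^+ 2 * w) * I^-1.
  by field; rewrite C0 w0 I0 p0.
by rewrite Ii; field; rewrite C0 w0.
Qed.

(** Collects the constants of the unfolding, of psi_M, of I_l and the halves in d_l, and leaves the
    weight factor c w = c tau + d. *)
Lemma final_algebra p C r I w W0 W1 W2 Z0 Z1 Z2 : p != 0 -> C != 0 -> r != 0 -> I != 0 -> I ^+ 2 = -1 -> w != 0 ->
  (8 * p / (C * C) * (p * p / - (2 * p * I * w)))^-1 * (p / (2 * r * (C * C)) * (W0 * Z0 + W1 * Z1 + W2 * Z2)) =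
  C * w * ((4 * r * C)^-1 * W0 * ((p * I)^-1 * (2^-1 * Z0)) + ((4 * r * C)^-1 * W1 * ((p * I)^-1 * (2^-1 * Z1)) +
    (4 * r * C)^-1 * W2 * ((p * I)^-1 * (2^-1 * Z2)))).
Proof.
move=> p0 C0 r0 I0 I2 w0.
have Ii : I^-1 = - I by apply: (mulfI I0); rewrite divff// mulrN -expr2 I2 opprK.
transitivity (- I * (w / (8 * r * p) * (W0 * Z0 + W1 * Z1 + W2 * Z2))).
  by field; rewrite p0 r0 w0 C0 I0.
rewrite -Ii; by field; rewrite p0 r0 C0 I0.
Qed.

End field_identities.

(** * The transformation formula for fixed entries a, b, c, d *)

Section transformation.
Context {R : realType}.
Local Open Scope complex_scope.
Local Notation C := (R[i]^o).
Local Notation rho := (Num.sqrt 6 : R).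
Local Notation nx x := (nn (x.1%:~R : R) x.2%:~R).
Variables (c : nat) (a b d : int) (tau : R[i]) (j : 'I_3).
Hypotheses (c0 : (0 < c)%N) (det1 : a * d - b * c%:Z = 1) (tau0 : 0 < complex.Im tau).
Let x0 : R := - (d%:~R / c%:R).
Let s : R[i] := sig x0 tau.
Let l : R[i] := (pi ^+ 2)%:C / s.
Let cp : 0 < c%:R :> R. Proof. by rewrite ltr0n. Qed.
Let cn0 : (c%:R : R) != 0. Proof. by rewrite gt_eqF. Qed.
Let s0 : 0 < complex.Re s. Proof. exact: sig_gt0. Qed.
Let sn0 : s != 0. Proof. by apply: contraTneq s0 => ->; rewrite ltxx. Qed.
Let ls : l * s = (pi ^+ 2)%:C. Proof. by rewrite /l divfK. Qed.
Let l0 : 0 < complex.Re l. Proof. exact: pi2_div_gt0. Qed.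
Let ln0 : l != 0. Proof. by apply: contraTneq l0 => ->; rewrite ltxx. Qed.
Let sv (u : R[i]) : s * (u / s) = u. Proof. by rewrite mulrC divfK. Qed.

Lemma fcl_norm k x : `|(fcl k x)%:~R| <= 2 :> R.
Proof.
rewrite fcl_lists; apply: le_trans (ler_normB _ _) _.
by case: (_ \in _); case: (_ \in _); rewrite /= ?normr1 ?normr0; lra.
Qed.

Lemma Re_ec_le (t : R) : `|complex.Re (ec t)| <= 1.
Proof. by rewrite /ec /= ler_norml cos_geN1 cos_le1. Qed.
Lemma Im_ec_le (t : R) : `|complex.Im (ec t)| <= 1.
Proof. by rewrite /ec /= ler_norml sin_geN1 sin_le1. Qed.

Lemma fcl_mul_le k x (r : R) : `|r| <= 1 -> `|(fcl k x)%:~R * r| <= 2.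
Proof. by move=> h; rewrite normrM -[leRHS]mulr1; apply: ler_pM => //; exact: fcl_norm. Qed.

Local Notation b1 := (bc1 c a j : int * int -> R).
Local Notation b2 := (bc2 c a j : int * int -> R).
Definition kap (u : R[i]) (n : R) : R := Llim c (Eu l (l * u)) n.

(** The factor |q| of E, taken at 2 sqrt n/c, cancels the 1/sqrt n of the hyperbola integral. *)
Lemma kapE u n : 0 < n -> kap u n = 4 * pi / c%:R ^+ 2 * cR l (l * u) (4 * n / c%:R ^+ 2).
Proof.
move=> n0; rewrite /kap /Llim n0 /Eu; have q : 0 < Num.sqrt n by rewrite sqrtr_gt0.
have q2 : Num.sqrt n ^+ 2 = n by rewrite sqr_sqrtr// ltW.
have -> : (2 * Num.sqrt n / c%:R) ^+ 2 = 4 * n / c%:R ^+ 2 by rewrite -[in RHS]q2; field.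
rewrite ger0_norm; last by rewrite divr_ge0 ?mulr_ge0// ltW.
by move: (cR _ _ _) (pi : R) => z p; field; rewrite cn0 gt_eqF.
Qed.

Lemma kap_bound u : exists2 D : R, 0 <= D & forall x, x != (0, 0) -> `|kap u (nx x)| <= D * (1 + `|nx x|) ^- 2.
Proof.
pose mu := complex.Re l * 4 / c%:R ^+ 2.
have mu0 : 0 < mu by rewrite divr_gt0 ?mulr_gt0// exprn_gt0.
pose D := 4 * pi / c%:R ^+ 2 * nu (l * u) * (1 + 2 / mu) ^+ 2.
have D0 : 0 <= 4 * pi / c%:R ^+ 2 * nu (l * u) by rewrite mulr_ge0 ?nu_ge0// divr_ge0 ?sqr_ge0// mulr_ge0// pi_ge0.
have DD : 0 <= D by rewrite mulr_ge0// sqr_ge0.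
exists D => // x _; have r0 : 0 <= D * (1 + `|nx x|) ^- 2 by rewrite mulr_ge0// invr_ge0 sqr_ge0.
have [n0|n0] := ltP 0 (nx x); last by rewrite /kap /Llim ltNge n0 /= normr0.
rewrite kapE// (gtr0_norm n0); move: (nx x) n0 => n n0.
rewrite normrM ger0_norm; last by rewrite divr_ge0 ?sqr_ge0// mulr_ge0// pi_ge0.
have := cR_le l (l * u) (4 * n / c%:R ^+ 2).
have -> : complex.Re l * (4 * n / c%:R ^+ 2) = mu / 2 * n + mu / 2 * n by rewrite /mu; field.
rewrite opprD expRD => h.
have y0 : 0 <= mu / 2 * n by rewrite !mulr_ge0// ltW.
have e := expRN_le_inv y0; have ee := ler_pM (expR_ge0 _) (expR_ge0 _) e e.
have i1 : 0 < 2 / mu by rewrite divr_gt0.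
have key : (1 + mu / 2 * n)^-1 * (1 + mu / 2 * n)^-1 <= (1 + 2 / mu) ^+ 2 * (1 + n) ^- 2.
  rewrite -expr2 exprVn -ler_pdivrMl ?exprn_gt0//; last by lra.
  rewrite -invfM -exprMn lef_pV2 ?posrE ?exprn_gt0 ?mulr_gt0//; [|lra|lra|lra].
  have q1 : 0 <= 1 + n by lra.
  have q2 : 0 <= (1 + 2 / mu) * (1 + mu / 2 * n) by rewrite mulr_ge0//; lra.
  rewrite ler_pXn2r ?nnegrE//.
  have -> : (1 + 2 / mu) * (1 + mu / 2 * n) = 1 + mu / 2 * n + 2 / mu + n by field; rewrite gt_eqF.
  by lra.
apply: le_trans (_ : 4 * pi / c%:R ^+ 2 * (nu (l * u) * ((1 + 2 / mu) ^+ 2 * (1 + n) ^- 2)) <= _).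
  apply: ler_wpM2l; first by rewrite divr_ge0 ?sqr_ge0// mulr_ge0// pi_ge0.
  apply: le_trans h _; apply: ler_wpM2l; first exact: nu_ge0.
  exact: le_trans ee key.
by rewrite /D !mulrA.
Qed.

Lemma b_bound x : `|b1 x| <= 2 /\ `|b2 x| <= 2.
Proof. by split; apply: fcl_mul_le; [exact: Re_ec_le|exact: Im_ec_le]. Qed.

Lemma ec_nx_per x y : ec (a%:~R * nx (x.1 + (24 * c)%N%:Z * y.1, x.2 + (4 * c)%N%:Z * y.2) / c%:R) = ec (a%:~R * nx x / c%:R) :> R[i].
Proof.
apply: (ec_eq c0 (k := a * (x.1 * y.1 + 12 * c%:Z * y.1 ^+ 2 - x.2 * y.2 - 2 * c%:Z * y.2 ^+ 2))).
rewrite /nn /= !PoszM !(rmorphD, rmorphB, rmorphM, rmorphXn) /= -!pmulrn.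
by field.
Qed.

Lemma b_per : periodic (24 * c)%N (4 * c)%N b1 /\ periodic (24 * c)%N (4 * c)%N b2.
Proof. by split=> x y; rewrite /bc1 /bc2 ec_nx_per; congr (_%:~R * _); exact: fcl_lat. Qed.

Lemma b_eps x : b1 (eps x) = b1 x /\ b2 (eps x) = b2 x.
Proof. by rewrite /bc1 /bc2 fcl_eps nn_eps. Qed.

Lemma b_zero : b1 (0, 0) = 0 /\ b2 (0, 0) = 0.
Proof. by rewrite /bc1 /bc2 (_ : fcl j (0, 0) = 0) ?mul0r//; exact: (fcl_row0 j 0 0). Qed.

Definition W (k : nat) : R[i] := Ww c a d j (nth (0, 0) [:: (7, 0); (11, 0); (10, 1)] k).
Definition Gtot (v : int * int) : R[i] := (Gh c b1 v) +i* (Gh c b2 v).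
Local Notation g := (gl c d : nat -> int * int -> R[i]).

Lemma GtotE v : Gtot v = g 0 v * W 0 + g 1 v * W 1 + g 2 v * W 2.
Proof.
have -> : Gtot v = (Gh c b1 v)%:C + 'i * (Gh c b2 v)%:C.
  by apply/eqP; rewrite eq_complex /=; apply/andP; split; apply/eqP; ring.
rewrite (Gh_complex a d c0 j v) (Ww_basis c0 det1 j v) /W /gl /=.
by move: (Ww _ _ _ _ _) (Ww _ _ _ _ (11, 0)) (Ww _ _ _ _ (10, 1)) => w1 w2 w3; ring.
Qed.

Lemma Gtot_facts : [/\ forall v, Gtot (eps v) = Gtot v, Gtot (0, 0) = 0,
  forall X Y, Gtot (X + (48 * c)%N%:Z, Y) = Gtot (X, Y) & forall X Y, \sum_(i < 48 * c) Gtot (X + i%:Z, Y) = 0].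
Proof.
split=> [v||X Y|X Y]; rewrite ?GtotE.
- by rewrite !gl_eps.
- by rewrite !gl0 !mul0r !addr0.
- by rewrite !(gl_per d c0).
- under eq_bigr do rewrite GtotE.
  by rewrite !big_split /= -!mulr_suml !(gl_row d c0) !mul0r !addr0.
Qed.

Lemma Gh_facts (r : R[i] -> R) (B : int * int -> R) : (forall v, r (Gtot v) = Gh c B v) -> {morph r : x y / x + y} -> r 0 = 0 ->
  [/\ forall v, Gh c B (eps v) = Gh c B v, Gh c B (0, 0) = 0,
  forall X Y, Gh c B (X + (48 * c)%N%:Z, Y) = Gh c B (X, Y) & forall X Y, \sum_(i < 48 * c) Gh c B (X + i%:Z, Y) = 0].
Proof.
move=> rE rD r0; have [h1 h2 h3 h4] := Gtot_facts.
split=> [v||X Y|X Y]; rewrite -?rE ?h1 ?h2 ?h3//.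
under eq_bigr do rewrite -rE.
by rewrite -(big_morph r rD r0) h4.
Qed.

Let N0 : (0 < 48 * c)%N. Proof. by rewrite muln_gt0. Qed.
Definition cst : R := pi / (2 * rho * c%:R ^+ 2).
Let cst0 : 0 < cst. Proof. by rewrite divr_gt0 ?pi_gt0// !mulr_gt0 ?exprn_gt0// rho_gt0. Qed.

Lemma SR_Gh (B : int * int -> R) (r : R[i] -> R) (u : R[i]) : periodic (24 * c)%N (4 * c)%N B -> (forall x, `|B x| <= 2) ->
  (forall x, B (eps x) = B x) -> B (0, 0) = 0 ->
  (forall v, r (Gtot v) = Gh c B v) -> {morph r : x y / x + y} -> r 0 = 0 ->
  SR (Gh c B) (k0 s u) T @[T --> +oo%R] --> cst^-1 * tsum (rterm B (kap u)).
Proof.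
move=> pB bB eB zB rE rD r0; have [h1 h2 h3 h4] := Gh_facts rE rD r0.
have L := star_limit l0 s0 ls (sv u) c0 N0 pB bB eB zB h1 h2 h3 h4.
have L2 : cst^-1 * (cst * SR (Gh c B) (k0 s u) T) @[T --> +oo%R] --> cst^-1 * tsum (rterm B (kap u)).
  by apply: cvgM; [exact: cvg_cst|exact: L].
apply: cvg_trans L2; rewrite (_ : (fun T => cst^-1 * (cst * SR (Gh c B) (k0 s u) T)) = SR (Gh c B) (k0 s u))//.
by apply/funext => T; rewrite mulKf// gt_eqF.
Qed.

Local Notation t1 u := (tsum (rterm b1 (kap u))).
Local Notation t2 u := (tsum (rterm b2 (kap u))).
(** The common limit of both sides, assembled from four real sums as in the product of f_j e(a n/c)
    with the complex kernel. *)
Definition Lam : R[i] := (t1 1 - t2 (- 'i)) +i* (t1 (- 'i) + t2 1).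

Lemma CB_tot : (CB Gtot (AA x0 tau) T : C) @[T --> +oo%R] --> (((cst^-1)%:C * Lam) : C).
Proof.
have ReD : {morph @complex.Re R : x y / x + y} by move=> [? ?] [? ?].
have ImD : {morph @complex.Im R : x y / x + y} by move=> [? ?] [? ?].
have H1 u := @SR_Gh b1 (@complex.Re R) u b_per.1 (fun x => (b_bound x).1) (fun x => (b_eps x).1) b_zero.1 (fun v => erefl) ReD erefl.
have H2 u := @SR_Gh b2 (@complex.Im R) u b_per.2 (fun x => (b_bound x).2) (fun x => (b_eps x).2) b_zero.2 (fun v => erefl) ImD erefl.
have -> : (cst^-1)%:C * Lam = (cst^-1 * t1 1 - cst^-1 * t2 (- 'i)) +i* (cst^-1 * t1 (- 'i) + cst^-1 * t2 1).
  by apply/eqP; rewrite eq_complex /=; apply/andP; split; apply/eqP; ring.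
by apply: CB_cvg; [exact: H1|exact: H2|exact: H1|exact: H2].
Qed.

Definition bcC (x : int * int) : R[i] := (b1 x) +i* (b2 x).
Definition kapC (n : R) : R[i] := (kap 1 n) +i* (kap (- 'i) n).

Lemma CB_left : (CB bcC kapC T : C) @[T --> +oo%R] --> (Lam : C).
Proof.
have H (B : int * int -> R) u : (forall x, `|B x| <= 2) -> B (0, 0) = 0 -> SR B (kap u) T @[T --> +oo%R] --> tsum (rterm B (kap u)).
  by move=> bB zB; have [D D0 HD] := kap_bound u; exact: (SR_abs_cvg D0 bB HD zB).
have B1 u := H b1 u (fun x => (b_bound x).1) b_zero.1; have B2 u := H b2 u (fun x => (b_bound x).2) b_zero.2.
by apply: CB_cvg; [exact: B1|exact: B2|exact: B1|exact: B2].
Qed.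

(** [star_limit] concerns only the combination over the three patterns. Separate convergence of each
    I_l follows from the row estimates, because each [gl] sums to zero along rows by itself. *)
Lemma CB_gl k : exists Z : C, (CB (g k) (AA x0 tau) T : C) @[T --> +oo%R] --> Z.
Proof.
have ReS (f : 'I_(48 * c) -> R[i]) : complex.Re (\sum_i f i) = \sum_i complex.Re (f i).
  by apply: (big_morph (@complex.Re R)) => // -[? ?] [? ?].
have ImS (f : 'I_(48 * c) -> R[i]) : complex.Im (\sum_i f i) = \sum_i complex.Im (f i).
  by apply: (big_morph (@complex.Im R)) => // -[? ?] [? ?].
have rb x : `|complex.Re (g k x)| <= 2 by rewrite /gl Re_intM; exact: (fcl_mul_le k x (Re_ec_le _)).
have ib x : `|complex.Im (g k x)| <= 2 by rewrite /gl Im_intM; exact: (fcl_mul_le k x (Im_ec_le _)).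
have H (r : R[i] -> R) u : (forall x, `|r (g k x)| <= 2) -> r 0 = 0 -> (forall f : 'I_(48 * c) -> R[i], r (\sum_i f i) = \sum_i r (f i)) ->
   exists L : R, SR (fun x => r (g k x)) (k0 s u) T @[T --> +oo%R] --> L.
  move=> rb' r0 rS; have [C1 C10 k0C] := k0_cls l0 s0 ls (sv u).
  eexists; apply: (@rows_star R (48 * c) 2 (fun x => r (g k x)) N0 rb' _ _ _ C1 C10 (k0 s u) k0C).
  - by rewrite gl0.
  - by move=> X Y; rewrite (gl_per d c0).
  - by move=> X Y; rewrite -rS (gl_row d c0) r0.
have [L1 h1] := H (@complex.Re R) 1 rb erefl ReS; have [L2 h2] := H (@complex.Im R) (- 'i) ib erefl ImS.
have [L3 h3] := H (@complex.Re R) (- 'i) rb erefl ReS; have [L4 h4] := H (@complex.Im R) 1 ib erefl ImS.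
by exists ((L1 - L2) +i* (L3 + L4)); apply: CB_cvg; [exact: h1|exact: h2|exact: h3|exact: h4].
Qed.

Lemma CB_lin T : CB Gtot (AA x0 tau) T = W 0 * CB (g 0) (AA x0 tau) T + W 1 * CB (g 1) (AA x0 tau) T + W 2 * CB (g 2) (AA x0 tau) T.
Proof.
rewrite /CB !mulr_sumr -!big_split /=; apply: eq_bigr => x _; rewrite GtotE.
by move: (g 0 x) (g 1 x) (g 2 x) (W 0) (W 1) (W 2) (AA _ _ _) (_%:C) => *; ring.
Qed.

Lemma trunc_I (k : 'I_3) T : trunc_sum (Zcoset (beta R k)) (I_term k x0 tau) T = (2^-1)%:C * CB (g k) (AA x0 tau) T.
Proof.
have -> : I_term k x0 tau = fun n => (dcoef k n)%:C * (e2pi ((x0 * n)%:C) * pv_int (I_kernel x0 tau n) n).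
  by apply/funext => n; rewrite /I_term -mulrA.
rewrite trunc_sumE// /CB mulr_sumr; apply: eq_bigr => x _.
have [f0|f0] := eqVneq (fcl k x) 0; first by rewrite /gl f0 mulr0z !(mulr0, mul0r).
have hc := @nx_coset R k x f0; have n0 := coset_neq0 hc.
rewrite (asboolT hc) /= (pv_int_AA _ tau0 n0) e2pi_real /gl.
have -> : x0 * nx x = - (d%:~R * nx x) / c%:R by rewrite /x0; move: (nx x) => n; field.
have -> : (fcl k x)%:~R = ((fcl k x)%:~R : R)%:C :> R[i] by rewrite rmorph_int.
move: (om x) => o; rewrite !rmorphM /=; move: (ec _) (AA _ _ _) => *; ring.
Qed.

Variable Mtau : R[i].
Hypothesis MtE : Mtau = (a%:~R / c%:R)%:C - ((c%:R ^+ 2)%:C * (tau - x0%:C))^-1.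
Let wn0 : tau - x0%:C != 0.
Proof. by apply: contraNneq sn0 => e; rewrite /s /sig e mulr0 oppr0. Qed.

(** The constant is 2 * (4 pi/c^2) * l: 4 pi/c^2 comes from the limit kernel, l from the argument l
    u of E, and 2 offsets the half in d_j. *)
Lemma e2pi_Mtau n : 0 < n -> (8 * pi / c%:R ^+ 2)%:C * l * e2pi (n%:C * Mtau) = 2%:C * (ec (a%:~R * n / c%:R) * kapC n).
Proof.
move=> n0.
have E : e2pi (n%:C * Mtau) = ec (a%:~R * n / c%:R) * cexp (- (l * (4 * n / c%:R ^+ 2)%:C)).
  have -> : n%:C * Mtau = (a%:~R * n / c%:R)%:C - n%:C * ((c%:R ^+ 2)%:C * (tau - x0%:C))^-1.
    by rewrite MtE mulrBr; congr (_ - _); rewrite -rmorphM /=; congr (_%:C); ring.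
  rewrite /e2pi mulrDr cexpD -/(e2pi _) e2pi_real; congr (_ * cexp _).
  rewrite /l /s /sig !rmorphM !fmorphV /= !rmorphXn /=.
  have i2 : ('i%C : R[i]) ^+ 2 = -1 by exact: sqr_i.
  have pn : (pi%:C : R[i]) != 0 by rewrite fmorph_eq0 gt_eqF// pi_gt0.
  have cn : (c%:R%:C : R[i]) != 0 by rewrite fmorph_eq0.
  have in0 : ('i%C : R[i]) != 0 by rewrite -sqrf_eq0 i2 oppr_eq0 oner_eq0.
  have e2 : (2%:C : R[i]) = 2 by rewrite rmorph_nat.
  have e4 : (4%:C : R[i]) = 4 by rewrite rmorph_nat.
  rewrite e2 e4; move: wn0; move: (tau - x0%:C) (pi%:C : R[i]) (c%:R%:C : R[i]) (n%:C : R[i]) ('i%C : R[i]) pn cn in0 i2 => w p C n' I pn cn In i2 w0.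
  exact: exponent_algebra.
rewrite E /kapC !kapE// mulr1 -!Re_cexp.
have -> : complex.Re (l * - 'i * cexp (- (l * (4 * n / c%:R ^+ 2)%:C))) = complex.Im (l * cexp (- (l * (4 * n / c%:R ^+ 2)%:C))).
  by rewrite !(cReM, cImM) /=; ring.
set z := l * cexp _.
have -> : (4 * pi / c%:R ^+ 2 * complex.Re z) +i* (4 * pi / c%:R ^+ 2 * complex.Im z) = (4 * pi / c%:R ^+ 2)%:C * z.
  by case: (z) => z1 z2; apply/eqP; rewrite eq_complex /=; apply/andP; split; apply/eqP; ring.
have -> : (8 * pi / c%:R ^+ 2 : R)%:C = 2%:C * (4 * pi / c%:R ^+ 2)%:C.
  by apply/eqP; rewrite eq_complex /=; apply/andP; split; apply/eqP; ring.
by rewrite /z; move: (ec _) (cexp _) (_%:C) (_%:C) => *; ring.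
Qed.

Lemma trunc_u T : (8 * pi / c%:R ^+ 2)%:C * l * trunc_sum (pos_index j) (u_term j Mtau) T = CB bcC kapC T.
Proof.
have -> : u_term j Mtau = fun n => (dcoef j n)%:C * e2pi (n%:C * Mtau) by [].
rewrite trunc_sumE; last by move=> n [].
rewrite /CB mulr_sumr; apply: eq_bigr => x _.
have [n0|n0] := ltP 0 (nx x); last first.
  have -> : kapC (nx x) = 0 by rewrite /kapC /kap /Llim ltNge n0.
  rewrite (asboolF (_ : ~ pos_index j (nx x))) /= ?(mulr0, mul0r)//.
  by move=> [_ /=]; rewrite ltNge n0.
rewrite mulrCA e2pi_Mtau//.
have -> : bcC x = (fcl j x)%:~R * ec (a%:~R * nx x / c%:R).
  by rewrite [RHS]complexE2 Re_intM Im_intM.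
have [f0|f0] := eqVneq (fcl j x) 0; first by rewrite f0 mulr0z !(mulr0, mul0r).
rewrite (asboolT (_ : pos_index j (nx x))); last by split=> //; exact: nx_coset.
have -> : (fcl j x)%:~R = ((fcl j x)%:~R : R)%:C :> R[i] by rewrite rmorph_int.
move: (om x) => o; rewrite /= !rmorphM /=.
have h2 : (2^-1)%:C * 2%:C = 1 :> R[i] by rewrite -rmorphM /= mulVf.
move: (ec _) (kapC _) ((_ <= _)%R%:R%:C) ((fcl j x)%:~R%:C) (o%:C) ((2^-1)%:C) (2%:C) h2 => e k p f o' h t h2.
by ring: h2.
Qed.

Let K0 : R[i] := (8 * pi / c%:R ^+ 2)%:C * l.
Let K0n : K0 != 0.
Proof. by rewrite mulf_neq0// fmorph_eq0 gt_eqF// divr_gt0 ?exprn_gt0// mulr_gt0// pi_gt0. Qed.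

Lemma u_cvg : (trunc_sum (pos_index j) (u_term j Mtau) T : C) @[T --> +oo%R] --> ((K0^-1 * Lam) : C).
Proof.
have h : ((K0^-1 * CB bcC kapC T) : C) @[T --> +oo%R] --> ((K0^-1 * Lam) : C) by apply: cscale; exact: CB_left.
apply: cvg_trans h.
rewrite (_ : (fun T => (K0^-1 * CB bcC kapC T : C)) = (fun T => (trunc_sum (pos_index j) (u_term j Mtau) T : C)))//.
by apply/funext => T; rewrite -trunc_u -/K0 mulKf.
Qed.

Lemma transformation_formula : [/\ u_converges j Mtau, forall k, calI_converges k x0 tau &
  u j Mtau = (c%:R%:C * (tau - x0%:C)) * \sum_(k < 3) ((4 * rho * c%:R)^-1)%:C * W k * calI k x0 tau].
Proof.
have Ic (k : 'I_3) : exists Z : C, (CB (g k) (AA x0 tau) T : C) @[T --> +oo%R] --> Z /\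
   (trunc_sum (Zcoset (beta R k)) (I_term k x0 tau) T : C) @[T --> +oo%R] --> (((2^-1)%:C * Z) : C).
  have [Z hZ] := CB_gl k; exists Z; split; first exact: hZ.
  by rewrite (funext (trunc_I k)); exact: cscale.
split.
- by apply/cvg_ex; exists (K0^-1 * Lam); exact: u_cvg.
- move=> k; split=> [n hn|]; first by apply: pv_existsC => //; exact: coset_neq0 hn.
  by have [Z [_ hZ]] := Ic k; apply/cvg_ex; exists ((2^-1)%:C * Z).
have -> : u j Mtau = K0^-1 * Lam by apply: cvg_lim; [exact: norm_hausdorff|exact: u_cvg].
have [Z0 [z0 i0]] := Ic ord0; have [Z1 [z1 i1]] := Ic (lift ord0 ord0); have [Z2 [z2 i2]] := Ic (lift ord0 (lift ord0 ord0)).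
have cI (k : 'I_3) Z : (trunc_sum (Zcoset (beta R k)) (I_term k x0 tau) T : C) @[T --> +oo%R] --> (((2^-1)%:C * Z) : C) ->
   calI k x0 tau = (pi%:C * 'i%C)^-1 * ((2^-1)%:C * Z).
  by move=> h; rewrite /calI; congr (_ * _); apply: cvg_lim; [exact: norm_hausdorff|exact: h].
(* Uniqueness of limits: the truncated total sum is, term by term, the combination of the three
   separate ones. *)
have tot : (cst^-1)%:C * Lam = W 0 * Z0 + W 1 * Z1 + W 2 * Z2.
  have L1 := CB_tot; rewrite (funext CB_lin) in L1.
  apply: (cvg_unique (@norm_hausdorff _ C) L1).
  by apply: cvgD; [apply: cvgD; apply: cscale|apply: cscale]; [exact: z0|exact: z1|exact: z2].
rewrite !big_ord_recl big_ord0 addr0 (cI _ _ i0) (cI _ _ i1) (cI _ _ i2) /=.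
have LE : Lam = cst%:C * (W 0 * Z0 + W 1 * Z1 + W 2 * Z2).
  by rewrite -tot mulrA -rmorphM /= divff ?gt_eqF// mul1r.
rewrite LE /K0 /l /s /sig /cst /bump /=.
have rn : (rho%:C : R[i]) != 0 by rewrite fmorph_eq0 gt_eqF// rho_gt0.
have iq : ('i%C : R[i]) ^+ 2 = -1 by exact: sqr_i.
have pn : (pi%:C : R[i]) != 0 by rewrite fmorph_eq0 gt_eqF// pi_gt0.
have cn : (c%:R%:C : R[i]) != 0 by rewrite fmorph_eq0.
have in0 : ('i%C : R[i]) != 0 by rewrite -sqrf_eq0 iq oppr_eq0 oner_eq0.
have e2 : (2%:C : R[i]) = 2 by rewrite rmorph_nat.
have e4 : (4%:C : R[i]) = 4 by rewrite rmorph_nat.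
have e8 : (8%:C : R[i]) = 8 by rewrite rmorph_nat.
rewrite !(rmorphM, fmorphV, rmorphXn) /= e2 e4 e8.
move: wn0; move: (tau - x0%:C) (pi%:C : R[i]) (c%:R%:C : R[i]) (rho%:C : R[i]) ('i%C : R[i]) (W 0) (W 1) (W 2) pn cn rn in0 iq.
move=> w p C r I w0' w1' w2' pn cn rn In iq wn.
exact: final_algebra.
Qed.

End transformation.

(** The values of f_0, f_1, f_2 at any point of S_k^+ form the k-th unit vector, so the Gauss sum
    there does not depend on the point; this justifies an arbitrary nu. *)
Lemma fcl_plist (k k' : nat) (q : nat * nat) : (k < 3)%N -> (k' < 3)%N -> q \in plist k ->
  fcl k' (q.1%:Z, q.2%:Z) = (k' == k)%:Z.
Proof.
move=> hk hk' qk; have /andP[q1 q2] := plist_ok qk; rewrite fclE//; move: qk {q1 q2}.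
by case: k hk => [|[|[|k]]]//; case: k' hk' => [|[|[|k']]]// _ _; rewrite !inE => /or4P[] /eqP ->.
Qed.

Lemma det22 (M : 'M[int]_2) : \det M = M 0 0 * M 1 1 - M 0 1 * M 1 0.
Proof.
have e1 : lift 0 0 = 1 :> 'I_2 by apply/val_inj.
have e2 : lift 1 0 = 0 :> 'I_2 by apply/val_inj.
by rewrite (expand_det_row _ 0) big_ord_recl big_ord1 /cofactor !det_mx11 !mxE !e1 !e2 /= !expr0 ?expr1; ring.
Qed.

Local Open Scope complex_scope.

Theorem theorem4p9 (R : realType) (M : 'M[int]_2) (tau : R[i]) (j : 'I_3)
    (nu : 'I_3 -> R * R) :
  \det M = 1 -> 0 < M 1 0 -> 0 < complex.Im tau ->
  (forall l, nu l \in Splus R l) ->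
  let a : R := (M 0 0)%:~R in
  let b : R := (M 0 1)%:~R in
  let c : R := (M 1 0)%:~R in
  let d : R := (M 1 1)%:~R in
  let Mtau : R[i] := (a%:C * tau + b%:C) / (c%:C * tau + d%:C) in
  [/\ u_converges j Mtau,
      forall l, calI_converges l (- (d / c)) tau &
      u j Mtau = (c%:C * tau + d%:C) *
                 \sum_(l < 3) Psi M j (nu l) * calI l (- (d / c)) tau].
Proof.
move=> dM Mc tau0 hnu; pose c := absz (M 1 0).
have Mn : M 1 0 = c%:Z by rewrite /c gez0_abs// ltW.
have c0 : (0 < c)%N by rewrite -ltz_nat -Mn.
have det1 : M 0 0 * M 1 1 - M 0 1 * c%:Z = 1 by rewrite -Mn -det22.
rewrite /= Mn -pmulrn.
have cn0 : (c%:R : R) != 0 by rewrite pnatr_eq0 -lt0n.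
set a := M 0 0 in det1 *; set b := M 0 1 in det1 *; set d := M 1 1 in det1 *.
have cE : (c%:R : R)%:C * tau + (d%:~R)%:C = (c%:R)%:C * (tau - (- (d%:~R / c%:R))%:C).
  by rewrite rmorphN opprK mulrDr -[_ * (d%:~R / c%:R)%:C]rmorphM /= mulrCA divff// mulr1.
have wn : tau - (- (d%:~R / c%:R : R))%:C != 0.
  by apply: contraTneq tau0 => /(congr1 (@complex.Im R)); case: (tau) => t1 t2 /=; rewrite subr0 => ->; rewrite ltxx.
have Mt : ((a%:~R)%:C * tau + (b%:~R)%:C) / ((c%:R : R)%:C * tau + (d%:~R)%:C) =
   (a%:~R / c%:R)%:C - ((c%:R ^+ 2)%:C * (tau - (- (d%:~R / c%:R))%:C))^-1.
  rewrite cE; have bE : (b%:~R : R) = (a%:~R * d%:~R - 1) / c%:R.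
    have := congr1 (fun z : int => z%:~R : R) det1; rewrite rmorphB !rmorphM /= -pmulrn mulr1z => h.
    by apply: (canRL (mulfK cn0)); lra.
  have cn : (c%:R%:C : R[i]) != 0 by rewrite fmorph_eq0.
  have tE : tau = (tau - (- (d%:~R / c%:R))%:C) - (d%:~R)%:C / (c%:R)%:C.
    by rewrite rmorphN rmorphM fmorphV /=; ring.
  rewrite {1}tE bE; move: wn; move: (tau - _) => w wn.
  by rewrite !(rmorphB, rmorphM, fmorphV, rmorphXn, rmorph1) /=; exact: mobius_algebra.
have [u1 u2 u3] := transformation_formula j c0 det1 tau0 Mt.
split=> //; rewrite u3 cE; congr (_ * _); apply: eq_bigr => k _; congr (_ * _).
have := hnu k; rewrite SplusE => /mapP[p pk ->]; rewrite (Psi_Ww c0 Mn); congr (_ * _).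
(* The Gauss sum at the chosen representative of S_k^+ is expanded in the three base values; only
   the k-th one survives. *)
rewrite /W [RHS](Ww_basis c0 det1).
rewrite !(fcl_plist _ _ pk)//.
by case: k {pk} => -[|[|[|k]]] hk //=; rewrite !(mulr1z, mulr0z, mul1r, mul0r, addr0, add0r).
Qed.
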